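(* Let $n\ge1$, let $\Pi=I_{\mathbb R^n}\otimes\Pi_1$ be the Szegő projector on $L^2(\mathbb R^n\times S^1)$, and let $Q$ be a pseudodifferential operator on $\mathbb R^n\times S^1$ of the form described in the context, with Fourier modes $Q_k$, $k\in\mathbb Z$. Then $Q$ commutes with $\Pi$ if and only if, for every integer $k>0$, there exist $S^1$-invariant classical polyhomogeneous pseudodifferential operators $Q^\#_k$ and $Q^\#_{-k}$ on $\mathbb R^n\times S^1$ such that $$Q_k=Q^\#_k\left(\frac1{\sqrt{-1}}\frac{d}{d\theta}\,e^{i\theta}\right)^k,\qquad Q_{-k}=Q^\#_{-k}\left(e^{-i\theta}\frac1{\sqrt{-1}}\frac{d}{d\theta}\right)^k .$$
   Context: $\Pi_1$ is the orthogonal projection of $L^2(S^1)$ onto the closed span of $\{e^{im\theta}:m\ge0\}$, and $\Pi$ is the bounded extension of $I\otimes\Pi_1$ to $L^2(\mathbb R^n\times S^1)$. In the displayed formulas $e^{\pm i\theta}$ denotes a multiplication operator and the products are compositions. Pseudodifferential operators considered are those of the form $$Qf(x,\theta)=\sum_{m\in\mathbb Z}e^{im\theta}\int q(x,\xi,\theta,m)e^{ix\cdot\xi}\hat f(\xi,m)\,d\xi,\quad \hat f(\xi,m)=\left(\tfrac1{2\pi}\right)^{n+1}\int e^{-ix\cdot\xi-im\theta}f(x,\theta)\,dx\,d\theta,$$ where $q(x,\xi,\theta,s)$, $(x,\xi,\theta,s)\in\mathbb R^n\times\mathbb R^n\times S^1\times\mathbb R$, is a classical polyhomogeneous symbol in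 $(\xi,s)$, compactly supported in $x$. Write $q=\sum_k e^{ik\theta}q_k(x,\xi,s)$ with $q_k(x,\xi,s)=\frac1{2\pi}\int q(x,\xi,\theta,s)e^{-ik\theta}d\theta$; $Q_k$ is the operator with symbol $e^{ik\theta}q_k(x,\xi,s)$, so $Q=\sum_kQ_k$. $S^1$ acts on $\mathbb R^n\times S^1$ by rotating the second factor. *)

(* Defs.v *)
From HB Require Import structures.
From mathcomp Require Import all_boot all_order all_algebra.
From mathcomp Require Import complex.
From mathcomp Require Import all_classical all_reals all_analysis.

Set Implicit Arguments.
Unset Strict Implicit.
Unset Printing Implicit Defensive.

Import Order.TTheory GRing.Theory Num.Theory.
Import numFieldNormedType.Exports.

Local Open Scope classical_set_scope.
Local Open Scope ring_scope.
Local Open Scope complex_scope.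

Section measurable_rV.
Context {R : realType}.
Variable n : nat.

Let coors : 'I_n -> 'rV[R]_n -> R := fun i x => x ord0 i.

Let rV_set0 : g_sigma_preimage coors set0.
Proof. exact: sigma_algebra0. Qed.

Let rV_setC A : g_sigma_preimage coors A -> g_sigma_preimage coors (~` A).
Proof. exact: sigma_algebraC. Qed.

Let rV_bigcup (F : (set 'rV[R]_n)^nat) :
  (forall i, g_sigma_preimage coors (F i)) ->
  g_sigma_preimage coors (\bigcup_i (F i)).
Proof. exact: sigma_algebra_bigcup. Qed.

(* The Borel sigma-algebra of R^n, generated by the coordinate functions. *)
HB.instance Definition _ := @isMeasurable.Build default_measure_display
  'rV[R]_n (g_sigma_preimage coors) rV_set0 rV_setC rV_bigcup.

End measurable_rV.

Section lebesgue_rV.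
Context {R : realType}.

Lemma measurable_coord n (i : 'I_n) :
  measurable_fun [set: 'rV[R]_n] (fun x : 'rV[R]_n => x ord0 i).
Proof.
move=> _ Y mY; rewrite setTI; apply: sub_sigma_algebra => /=.
rewrite -bigcup_seq/=; exists i => /=; first by rewrite mem_index_enum.
by exists Y => //; rewrite setTI.
Qed.

Lemma measurable_fun_rVP d (T : measurableType d) n (f : T -> 'rV[R]_n) :
  (forall i, measurable_fun [set: T] (fun t => f t ord0 i)) ->
  measurable_fun [set: T] f.
Proof.
move=> mf.
suff prefS : g_sigma_preimage (fun i => (fun x : 'rV[R]_n => x ord0 i) \o f)
    `<=` measurable.
  move=> _ A mA; apply: prefS.
  by rewrite g_sigma_preimage_comp; exists A.
apply: smallest_sub; first exact: sigma_algebra_measurable.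
case: n => [|n] in f mf *; first by rewrite big_ord0.
rewrite -bigcup_mkord_ord; apply: bigcup_sub => i Ii.
by move=> A [B mB <-]; exact: mf.
Qed.

Definition rV_cons n (p : R * 'rV[R]_n) : 'rV[R]_n.+1 :=
  \row_i oapp (p.2 ord0) p.1 (unlift ord0 i).

Definition rV_uncons n (x : 'rV[R]_n.+1) : R * 'rV[R]_n :=
  (x ord0 ord0, \row_i x ord0 (lift ord0 i)).

Lemma rV_consK n : cancel (@rV_cons n) (@rV_uncons n).
Proof.
move=> [t y]; rewrite /rV_uncons /rV_cons !mxE unlift_none /=; congr pair.
by apply/rowP => i; rewrite !mxE liftK.
Qed.

Lemma measurable_rV_cons n :
  measurable_fun [set: R * 'rV[R]_n] (@rV_cons n).
Proof.
apply: measurable_fun_rVP => i.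
under eq_fun do rewrite mxE.
case: unliftP => [j _|_] /=; last exact: measurable_fst.
exact: (measurableT_comp (measurable_coord j) measurable_snd).
Qed.

Lemma measurable_rV_uncons n :
  measurable_fun [set: 'rV[R]_n.+1] (@rV_uncons n).
Proof.
apply: measurable_fun_pair; first exact: measurable_coord.
apply: measurable_fun_rVP => i.
under eq_fun do rewrite mxE.
exact: measurable_coord.
Qed.

Section step.
Variables (n : nat) (mu : {sigma_finite_measure set 'rV[R]_n -> \bar R}).

Definition lebesgue_cons : set 'rV[R]_n.+1 -> \bar R :=
  pushforward (@lebesgue_measure R \x mu)%E (@rV_cons n).

Let mcons (A : set 'rV[R]_n.+1) :
  measurable A -> measurable (@rV_cons n @^-1` A).
Proof.
by move=> mA; rewrite -[X in measurable X]setTI; exact: measurable_rV_cons.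
Qed.

Let lebesgue_cons0 : lebesgue_cons set0 = 0%E.
Proof. by rewrite /lebesgue_cons /pushforward preimage_set0 measure0. Qed.

Let lebesgue_cons_ge0 A : (0 <= lebesgue_cons A)%E.
Proof. exact: (measure_ge0 (@lebesgue_measure R \x mu)%E). Qed.

Let lebesgue_cons_sigma_additive : semi_sigma_additive lebesgue_cons.
Proof.
move=> F mF tF mUF; rewrite /lebesgue_cons /pushforward preimage_bigcup.
apply: measure_semi_sigma_additive.
- by move=> i; exact: mcons.
- apply/trivIsetP => i j _ _ ij; rewrite -preimage_setI.
  by move/trivIsetP : tF => /(_ _ _ _ _ ij) ->//; rewrite preimage_set0.
- by rewrite -preimage_bigcup; exact: mcons.
Qed.

HB.instance Definition _ := isMeasure.Build _ _ _ lebesgue_cons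
  lebesgue_cons0 lebesgue_cons_ge0 lebesgue_cons_sigma_additive.

Let lebesgue_cons_sigma_finite : sigma_finite setT lebesgue_cons.
Proof.
have /sigma_finiteP[F [FT ndF Foo]] := sigma_finiteT (@lebesgue_measure R).
have /sigma_finiteP[G [GT ndG Goo]] := sigma_finiteT mu.
exists (fun i => @rV_uncons n @^-1` (F i `*` G i)).
  rewrite -preimage_bigcup (_ : \bigcup_i _ = setT) ?preimage_setT//.
  rewrite -subTset => -[t y] _.
  have [i _ Fit] : (\bigcup_i F i) t by rewrite -FT.
  have [j _ Gjy] : (\bigcup_i G i) y by rewrite -GT.
  exists (maxn i j) => //; split => /=.
  - by move: t Fit; exact/subsetPset/ndF/leq_maxl.
  - by move: y Gjy; exact/subsetPset/ndG/leq_maxr.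
move=> i; have [mFi Fi_oo] := Foo i; have [mGi Gi_oo] := Goo i.
split.
  rewrite -[X in measurable X]setTI.
  by apply: measurable_rV_uncons => //; exact: measurableX.
rewrite /lebesgue_cons /pushforward -comp_preimage.
rewrite (_ : _ \o _ = id) ?preimage_id; last first.
  by apply/funext => p; exact: rV_consK.
by rewrite product_measure1E// lte_mul_pinfty// ge0_fin_numE.
Qed.

HB.instance Definition _ := Measure_isSigmaFinite.Build _ _ _ lebesgue_cons
  lebesgue_cons_sigma_finite.

End step.

(* Lebesgue measure on R^n, as an iterated product of the one on R. *)
Fixpoint lebesgue_rV n : {sigma_finite_measure set 'rV[R]_n -> \bar R} :=
  if n is m.+1 return {sigma_finite_measure set 'rV[R]_n -> \bar R}
  then lebesgue_cons (lebesgue_rV m) else \d_(0 : 'rV[R]_0).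

End lebesgue_rV.
Arguments lebesgue_rV {R} n.

Notation RnS1 R n := ('rV[R]_n * R)%type.

Section complex_valued.
Context {R : realType}.
Local Notation C := R[i].

Definition expi (t : R) : C := cos t +i* sin t.

Definition cintegral d (T : measurableType d) (mu : {measure set T -> \bar R})
    (D : set T) (f : T -> C) : C :=
  (\int[mu]_(x in D) complex.Re (f x)) +i* (\int[mu]_(x in D) complex.Im (f x)).

(* Symmetric summation; it only gets applied to absolutely convergent series. *)
Definition csumZ (F : int -> C) : C :=
  let S N := \sum_(i < N.*2.+1) F (i%:Z - N%:Z) in
  limn (fun N => complex.Re (S N)) +i* limn (fun N => complex.Im (S N)).

Definition cderive (V : normedModType R) (v : V) (f : V -> C) : V -> C :=
  fun p => 'D_v (fun x => complex.Re (f x)) p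
           +i* 'D_v (fun x => complex.Im (f x)) p.

Definition cderives (V : normedModType R) (vs : seq V) (f : V -> C) : V -> C :=
  foldr (@cderive V) f vs.

(* In finite dimension, f is C^oo on the open set U iff all its iterated
   directional derivatives exist and are continuous on U. *)
Definition smooth_on (V : normedModType R) (U : set V) (f : V -> C) : Prop :=
  forall (vs : seq V) (p : V), U p ->
    [/\ {for p, continuous (fun x => complex.Re (cderives vs f x))},
        {for p, continuous (fun x => complex.Im (cderives vs f x))},
        forall v, derivable (fun x => complex.Re (cderives vs f x)) p v &
        forall v, derivable (fun x => complex.Im (cderives vs f x)) p v].

Definition sqnorm2 d (T : measurableType d) (mu : {measure set T -> \bar R})
    (D : set T) (f : T -> C) : \bar R :=
  (\int[mu]_(x in D) (ComplexField.Normc.normc (f x) ^+ 2)%:E)%E.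

Definition L2 d (T : measurableType d) (mu : {measure set T -> \bar R})
    (D : set T) (f : T -> C) : Prop :=
  [/\ measurable_fun D (fun x => complex.Re (f x)),
      measurable_fun D (fun x => complex.Im (f x)) &
      (sqnorm2 mu D f < +oo)%E].

End complex_valued.

(* S^1 = R / 2 pi Z: functions on S^1 are 2 pi-periodic functions on R, which
   are integrated over the fundamental domain [0, 2 pi]. *)
Section circle.
Context {R : realType}.
Local Notation C := R[i].

Definition dom_S1 : set R := `[0, 2 * pi]%classic.

Definition L2_S1 (v : R -> C) : Prop :=
  (forall t, v (t + 2 * pi) = v t) /\ L2 lebesgue_measure dom_S1 v.

Definition inner_S1 (v w : R -> C) : C :=
  cintegral lebesgue_measure dom_S1 (fun t => v t * conjc (w t)).

(* The closed span of the exponentials e^{i m t}, m >= 0, in L^2(S^1). *)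
Definition hardy_S1 (v : R -> C) : Prop :=
  L2_S1 v /\
  forall e : R, 0 < e -> exists (N : nat) (c : nat -> C),
    (sqnorm2 lebesgue_measure dom_S1
       (fun t : R => v t - \sum_(m < N) c m * expi (m%:R * t))%R < e%:E)%E.

(* P1 is the orthogonal projection of L^2(S^1) onto hardy_S1. *)
Definition is_szego_S1 (P1 : (R -> C) -> (R -> C)) : Prop :=
  forall v, L2_S1 v ->
    hardy_S1 (P1 v) /\
    forall h, hardy_S1 h -> inner_S1 (fun t => v t - P1 v t) h = 0.

End circle.

Section RnS1.
Context {R : realType} {n : nat}.
Local Notation C := R[i].
Local Notation M := (RnS1 R n).
Implicit Types (f : M -> C) (q : M * M -> C).

Definition mu_RnS1 := (lebesgue_rV n \x @lebesgue_measure R)%E.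

Definition dom_RnS1 : set M := setT `*` dom_S1.

Definition periodic f : Prop := forall x t, f (x, t + 2 * pi) = f (x, t).

Definition L2_RnS1 f : Prop := periodic f /\ L2 mu_RnS1 dom_RnS1 f.

Definition eq_RnS1 f g : Prop := f = g %[ae mu_RnS1 in dom_RnS1].

(* P is the bounded extension of I (x) P1 to L^2(R^n x S^1). It acts on
   representatives, so identities in L^2 hold almost everywhere. *)
Definition is_szego (P1 : (R -> C) -> (R -> C)) (P : (M -> C) -> (M -> C)) :
    Prop :=
  [/\ forall f, L2_RnS1 f -> L2_RnS1 (P f),
      forall (a : C) f g, L2_RnS1 f -> L2_RnS1 g ->
        eq_RnS1 (P (fun z => a * f z + g z)) (fun z => a * P f z + P g z),
      exists B : R, forall f, L2_RnS1 f ->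
        (sqnorm2 mu_RnS1 dom_RnS1 (P f)
         <= B%:E * sqnorm2 mu_RnS1 dom_RnS1 f)%E &
      forall (u : 'rV[R]_n -> C) (v : R -> C),
        L2 (lebesgue_rV n) setT u -> L2_S1 v ->
        eq_RnS1 (P (fun z => u z.1 * v z.2)) (fun z => u z.1 * P1 v z.2)].

(* C_c^oo(R^n x S^1) *)
Definition test_function f : Prop :=
  [/\ smooth_on setT f, periodic f &
      exists2 K : set 'rV[R]_n, compact K & forall x t, ~ K x -> f (x, t) = 0].

(* Symbols are functions of ((x, theta), (xi, s)): the directions vs act on
   (x, theta) and the directions ws on (xi, s). The norm on R^n x R is the
   maximum norm, which only affects the constants. *)
Definition symbol_remainder_bound (d : R) (r : M * M -> C) : Prop :=
  forall vs ws : seq M, exists c : R, forall p : M * M, 1 <= `|p.2| ->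
    ComplexField.Normc.normc
      (cderives ([seq (v, 0) | v <- vs] ++ [seq (0, w) | w <- ws]) r p)
    <= c * `|p.2| `^ (d - (size ws)%:R).

Definition homogeneous (d : R) q : Prop :=
  forall (z zeta : M) (r : R), zeta != 0 -> 0 < r ->
    q (z, r *: zeta) = (r `^ d)%:C * q (z, zeta).

Definition periodic_symbol q : Prop :=
  forall zeta, periodic (fun z => q (z, zeta)).

(* q ~ \sum_j a_j with a_j homogeneous of degree d - j in (xi, s). The
   remainders are estimated on |(xi, s)| >= 1 in place of cutting off the a_j
   near (xi, s) = 0. *)
Definition classical_symbol (d : R) q : Prop :=
  [/\ smooth_on setT q, periodic_symbol q,
      exists2 K : set 'rV[R]_n, compact K &
        forall x t zeta, ~ K x -> q ((x, t), zeta) = 0 &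
      exists a : nat -> M * M -> C,
        (forall j, [/\ smooth_on [set p | p.2 != 0] (a j),
                       periodic_symbol (a j) &
                       homogeneous (d - j%:R) (a j)]) /\
        forall N, symbol_remainder_bound (d - N%:R)
                    (fun p => q p - \sum_(j < N) a j p)].

Definition polyhomogeneous q : Prop := exists d : R, classical_symbol d q.

Definition dotp (x y : 'rV[R]_n) : R := \sum_(i < n) x ord0 i * y ord0 i.

Definition fourier f (xi : 'rV[R]_n) (m : int) : C :=
  (((2 * pi)^-1) ^+ n.+1)%:C *
  cintegral mu_RnS1 dom_RnS1
    (fun z => expi (- dotp z.1 xi - m%:~R * z.2) * f z).

Definition Op q f : M -> C := fun z =>
  csumZ (fun m => expi (m%:~R * z.2) *
    cintegral (lebesgue_rV n) setT
      (fun xi => q (z, (xi, m%:~R)) * expi (dotp z.1 xi) * fourier f xi m)).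

Definition is_psido (P : (M -> C) -> (M -> C)) : Prop :=
  exists2 q, polyhomogeneous q & forall f, test_function f -> P f = Op q f.

Definition fourier_mode q (k : int) (x xi : 'rV[R]_n) (s : R) : C :=
  ((2 * pi)^-1)%:C *
  cintegral lebesgue_measure dom_S1
    (fun t => q ((x, t), (xi, s)) * expi (- (k%:~R * t))).

Definition mode_symbol q (k : int) : M * M -> C := fun p =>
  expi (k%:~R * p.1.2) * fourier_mode q k p.1.1 p.2.1 p.2.2.

Definition rotate (a : R) f : M -> C := fun z => f (z.1, z.2 + a).

Definition S1_invariant (P : (M -> C) -> (M -> C)) : Prop :=
  forall a f, test_function f -> P (rotate a f) = rotate a (P f).

(* (1 / i) d/dtheta *)
Definition Dtheta f : M -> C := fun z => (0 +i* 1)^-1 * cderive ((0, 1) : M) f z.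

Definition mul_expi (k : int) f : M -> C := fun z => expi (k%:~R * z.2) * f z.

End RnS1.

(* Main.v *)
Require Import Defs.
From HB Require Import structures.
From mathcomp Require Import all_boot all_order all_algebra.
From mathcomp Require Import complex.
From mathcomp Require Import all_classical all_reals all_analysis.
From mathcomp Require Import measurable_realfun ring lra zify.

Set Implicit Arguments.
Unset Strict Implicit.
Unset Printing Implicit Defensive.

Import Order.TTheory GRing.Theory Num.Theory.
Import numFieldNormedType.Exports.

Local Open Scope classical_set_scope.
Local Open Scope ring_scope.
Local Open Scope complex_scope.


(** Write [z = (x, theta)] and let m be a frequency in theta. The k-th mode
    [Q_k] of Q sends the frequency m to the frequency [m + k], with the symbol
    [q_k (x, xi, m)], while [Pi] keeps the frequencies [m >= 0] and kills the
    others. Hence Q commutes with [Pi] exactly when, for each k, the mode [Q_k]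
    does nothing to the frequencies m for which m and [m + k] lie on different
    sides of 0 ([mismatch]): those in [-k, .., -1] when k is positive, and those
    in [0, .., |k| - 1] when k is negative. On the other hand, the operator
    [((1/i) d/dtheta e^{i theta})^k] multiplies the frequency m by
    [(m + 1) .. (m + k)] and moves it to [m + k]; this product vanishes exactly
    for m in [-k, .., -1]. The lowering operator behaves symmetrically.

    If all the factorizations hold, the mismatched modes therefore vanish
    ([factor_vanish]), and the projector may be applied to the double series
    over k and m term by term ([commute_of_vanish]). This uses rapid decay in k
    and m, Fourier series, and the fact that the projector is only known on
    products [u(x) v(theta)] and through an L^2 bound ([szego_product],
    [szego_csumZ]).

    Conversely, test the commutation relation on [e^{i m theta} A(x)] with a
    product A of one-variable bumps. Comparing Fourier coefficients in theta
    shows that [int q_k (x, xi, m) e^{i x.xi} A^ (xi) dxi = 0] for mismatched m.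
    Transforms of such products separate continuous functions of polynomial
    growth ([annihilated_rV_eq0]), so [q_k (x, xi, m) = 0] at the k mismatched
    integers m ([commuting_symbol_vanish]). The remaining point is that this
    vanishing allows division inside the class of classical symbols: if q
    vanishes on [s = c], then [q / (s - c)] is again classical, by Hadamard's
    formula near [s = c], by homogeneity for the terms of the expansion, and by
    Taylor expansion for the translation in s ([symbol_division_seq],
    [symbol_shift]). The quotient does not depend on theta, so its operator
    commutes with rotations; translated by k in s, it is the symbol of the
    invariant factor ([mode_factor]). *)

(** * Smooth real functions and their iterated derivatives *)

Section Smooth.
Context {R : realType}.

Lemma derive_affine (V W X : normedModType R) (g : V -> X) (k : W -> V)
    (a w : W) (w' : V) :
  (forall h : R, k (h *: w + a) = h *: w' + k a) ->
  ('D_w (g \o k) a = 'D_w' g (k a)) /\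
  (derivable g (k a) w' -> derivable (g \o k) a w).
Proof.
move=> ka; rewrite /derive /derivable.
suff -> : (fun h : R => h^-1 *: (((g \o k) \o shift a) (h *: w) - (g \o k) a)) =
  (fun h : R => h^-1 *: ((g \o shift (k a)) (h *: w') - g (k a))) by split.
by apply/funext => h /=; rewrite ka.
Qed.

Lemma cts_dist (T : topologicalType) (g : T -> R) (p : T) :
  {for p, continuous g} <->
  forall e : R, 0 < e -> \forall x \near p, `|g p - g x| < e.
Proof. by split=> [/cvgrPdist_lt|H]; [|exact/cvgrPdist_lt]. Qed.

Definition rders (V : normedModType R) (vs : seq V) (g : V -> R) : V -> R :=
  foldr (fun v h => fun p => 'D_v h p) g vs.

Definition rsmooth (V : normedModType R) (U : set V) (g : V -> R) : Prop :=
  forall vs p, U p ->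
    {for p, continuous (rders vs g)} /\ forall v, derivable (rders vs g) p v.

Lemma Re_cderives (V : normedModType R) (vs : seq V) (f : V -> R[i]) :
  (fun x => complex.Re (cderives vs f x)) = rders vs (fun x => complex.Re (f x)).
Proof. by elim: vs => //= v vs <-. Qed.

Lemma Im_cderives (V : normedModType R) (vs : seq V) (f : V -> R[i]) :
  (fun x => complex.Im (cderives vs f x)) = rders vs (fun x => complex.Im (f x)).
Proof. by elim: vs => //= v vs <-. Qed.

Lemma smooth_onE (V : normedModType R) (U : set V) (f : V -> R[i]) :
  smooth_on U f <-> rsmooth U (fun x => complex.Re (f x)) /\
                    rsmooth U (fun x => complex.Im (f x)).
Proof.
split=> [sf|[sR sI] vs p Up].
  by split=> vs p Up; have := sf vs p Up; rewrite Re_cderives Im_cderives => -[].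
by rewrite Re_cderives Im_cderives; have [? ?] := sR vs p Up;
  have [? ?] := sI vs p Up.
Qed.

Section OneSpace.
Context {V : normedModType R}.
Implicit Types (U : set V) (g h : V -> R) (v w p : V).

Lemma rders_cat vs ws g : rders (vs ++ ws) g = rders vs (rders ws g).
Proof. by rewrite /rders foldr_cat. Qed.

Lemma rsmooth_derive U g v : rsmooth U g -> rsmooth U (fun p => 'D_v g p).
Proof.
move=> sg vs p Up.
by have := sg (vs ++ [:: v]) p Up; rewrite rders_cat.
Qed.

Lemma rsmooth_rders U g vs : rsmooth U g -> rsmooth U (rders vs g).
Proof. move=> sg; elim: vs => [|v vs IH]; [exact: sg|exact: (rsmooth_derive v IH)]. Qed.

Lemma rsmooth_cts U g p : rsmooth U g -> U p -> {for p, continuous g}.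
Proof. by move=> sg Up; have [] := sg [::] p Up. Qed.

Lemma rsmooth_derivable U g p v : rsmooth U g -> U p -> derivable g p v.
Proof. by move=> sg Up; have [_] := sg [::] p Up. Qed.

Lemma rsmooth_sub U U' g : U' `<=` U -> rsmooth U g -> rsmooth U' g.
Proof. by move=> UU sg vs p /UU; exact: sg. Qed.

Lemma rders_eq U g h vs : open U -> (forall p, U p -> g p = h p) ->
  forall p, U p -> rders vs g p = rders vs h p.
Proof.
move=> oU gh; elim: vs => //= v vs IH p Up.
apply: near_eq_derive; near=> x; apply: IH.
by near: x; exact: open_nbhs_nbhs.
Unshelve. all: by end_near. Qed.

Lemma rsmooth_coind U (P : (V -> R) -> Prop) : open U ->
  (forall g, P g ->
     (forall p, U p -> {for p, continuous g} /\ forall v, derivable g p v) /\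
     forall v, exists2 g', P g' & forall p, U p -> 'D_v g p = g' p) ->
  forall g, P g -> rsmooth U g.
Proof.
move=> oU HP g Pg vs.
have [g' Pg' gg'] : exists2 g', P g' & forall p, U p -> rders vs g p = g' p.
  elim: vs => [|v vs [g1 Pg1 E]]; first by exists g.
  have [_ /(_ v)[g2 Pg2 E2]] := HP _ Pg1.
  exists g2 => // p Up; rewrite -E2//=.
  apply: near_eq_derive; near=> x; apply: E.
  by near: x; exact: open_nbhs_nbhs.
move=> p Up; have [/(_ p Up)[cg' dg'] _] := HP _ Pg'.
have nr : \forall x \near p, g' x = rders vs g x.
  by near=> x; rewrite gg'//; near: x; exact: open_nbhs_nbhs.
split; last first.
  by move=> v; apply: near_eq_derivable (dg' v).
rewrite /prop_for /continuous_at gg'//.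
apply: cvg_trans cg'; apply: near_eq_cvg; exact: nr.
Unshelve. all: by end_near. Qed.

Inductive ratalg U (B : (V -> R) -> Prop) : (V -> R) -> Prop :=
| ratalg_base g : B g -> ratalg U B g
| ratalg_cst c : ratalg U B (fun=> c)
| ratalg_add g h : ratalg U B g -> ratalg U B h -> ratalg U B (fun p => g p + h p)
| ratalg_mul g h : ratalg U B g -> ratalg U B h -> ratalg U B (fun p => g p * h p)
| ratalg_inv g : ratalg U B g -> (forall p, U p -> g p != 0) ->
    ratalg U B (fun p => (g p)^-1).

Lemma rsmooth_ratalg U (B : (V -> R) -> Prop) : open U ->
  (forall g, B g ->
     (forall p, U p -> {for p, continuous g} /\ forall v, derivable g p v) /\
     forall v, exists2 g', ratalg U B g' & forall p, U p -> 'D_v g p = g' p) ->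
  forall g, ratalg U B g -> rsmooth U g.
Proof.
move=> oU HB; apply: rsmooth_coind => // g; elim.
- by move=> {}g /HB.
- move=> c; split=> [p Up|v]; first by split=> [|v]; [exact: cvg_cst|].
  by exists (fun=> 0) => [|p Up]; [exact: ratalg_cst|rewrite (derive_cst c)].
- move=> {}g h Ag [dg Dg] Ah [dh Dh]; split=> [p Up|v].
    have [cg d1] := dg p Up; have [ch d2] := dh p Up.
    by split=> [|v]; [exact: continuousD|exact: derivableD].
  have [g' Ag' Eg] := Dg v; have [h' Ah' Eh] := Dh v.
  exists (fun p => g' p + h' p); first exact: ratalg_add.
  move=> p Up; have [_ /(_ v) d1] := dg p Up; have [_ /(_ v) d2] := dh p Up.
  by rewrite -Eg// -Eh//; exact: (deriveD d1 d2).
- move=> {}g h Ag [dg Dg] Ah [dh Dh]; split=> [p Up|v].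
    have [cg d1] := dg p Up; have [ch d2] := dh p Up.
    by split=> [|v]; [exact: continuousM|exact: derivableM].
  have [g' Ag' Eg] := Dg v; have [h' Ah' Eh] := Dh v.
  exists (fun p => g p * h' p + h p * g' p).
    by apply: ratalg_add; apply: ratalg_mul.
  move=> p Up; have [_ /(_ v) d1] := dg p Up; have [_ /(_ v) d2] := dh p Up.
  by rewrite -Eg// -Eh//; exact: (deriveM d1 d2).
- move=> {}g Ag [dg Dg] g0; split=> [p Up|v].
    have [cg d1] := dg p Up.
    by split=> [|v]; [apply: cvgV => //; exact: g0|apply: derivableV; auto].
  have [g' Ag' Eg] := Dg v.
  exists (fun p => ((-1) * ((g p)^-1 * (g p)^-1)) * g' p).
    apply: ratalg_mul => //; apply: ratalg_mul; first exact: ratalg_cst.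
    by apply: ratalg_mul; apply: ratalg_inv.
  move=> p Up; have [_ /(_ v) d1] := dg p Up.
  rewrite -Eg// (deriveV (g0 p Up) d1) /GRing.scale/= expr2 invfM.
  by rewrite mulN1r.
Qed.

Let rsmooth_closed U B g : open U -> (forall h, B h -> rsmooth U h) ->
  (forall h v, B h -> B (fun p => 'D_v h p)) -> ratalg U B g -> rsmooth U g.
Proof.
move=> oU sB DB; apply: rsmooth_ratalg => // h Bh.
split=> [p Up|v]; first by have [] := sB h Bh [::] p Up.
by exists (fun p => 'D_v h p) => //; apply/ratalg_base/DB.
Qed.

Lemma ratalg_rsmooth U g : open U -> ratalg U (rsmooth U) g -> rsmooth U g.
Proof. move=> oU; apply: (rsmooth_closed oU) => [h sh|h v sh]; first exact: sh.
exact: (rsmooth_derive v sh). Qed.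

Lemma rsmooth_cst U (c : R) : open U -> rsmooth U (fun=> c).
Proof. by move=> oU; apply: ratalg_rsmooth => //; exact: ratalg_cst. Qed.

Lemma rsmoothD U g h : open U -> rsmooth U g -> rsmooth U h ->
  rsmooth U (fun p => g p + h p).
Proof.
by move=> oU sg sh; apply: ratalg_rsmooth => //; apply: ratalg_add;
  exact: ratalg_base.
Qed.

Lemma rsmoothM U g h : open U -> rsmooth U g -> rsmooth U h ->
  rsmooth U (fun p => g p * h p).
Proof.
by move=> oU sg sh; apply: ratalg_rsmooth => //; apply: ratalg_mul;
  exact: ratalg_base.
Qed.

Lemma rsmoothZ U g (c : R) : open U -> rsmooth U g -> rsmooth U (fun p => c * g p).
Proof. by move=> oU sg; apply: rsmoothM => //; exact: rsmooth_cst. Qed.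

Lemma rsmoothN U g : open U -> rsmooth U g -> rsmooth U (fun p => - g p).
Proof.
move=> oU /(@rsmoothZ _ _ (-1) oU); under eq_fun do rewrite mulN1r; exact.
Qed.

Lemma rsmoothV U g : open U -> rsmooth U g -> (forall p, U p -> g p != 0) ->
  rsmooth U (fun p => (g p)^-1).
Proof.
by move=> oU sg g0; apply: ratalg_rsmooth => //; apply: ratalg_inv => //;
  exact: ratalg_base.
Qed.

Lemma rsmooth_sum (I : Type) (s : seq I) U (F : I -> V -> R) : open U ->
  (forall i, rsmooth U (F i)) -> rsmooth U (fun p => \sum_(i <- s) F i p).
Proof.
move=> oU sF; elim: s => [|i s IH].
  by under eq_fun do rewrite big_nil; exact: rsmooth_cst.
by under eq_fun do rewrite big_cons; exact: rsmoothD.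
Qed.

Lemma rsmooth_eq U g h : open U -> (forall p, U p -> g p = h p) ->
  rsmooth U g -> rsmooth U h.
Proof.
move=> oU gh sg; apply: (@rsmooth_coind U
  (fun f => exists2 f', rsmooth U f' & forall p, U p -> f' p = f p)) => //;
  last by exists g.
move=> f [f' sf' E].
have nr p : U p -> \forall x \near p, f' x = f x.
  by move=> Up; near=> x; apply: E; near: x; exact: open_nbhs_nbhs.
split=> [p Up|v].
  split=> [|v]; last first.
    by apply: (near_eq_derivable (nr p Up)); exact: rsmooth_derivable Up.
  rewrite /prop_for /continuous_at -E//.
  by apply: cvg_trans (rsmooth_cts sf' Up); apply: near_eq_cvg; exact: nr.
exists (fun p => 'D_v f p) => //.
exists (fun p => 'D_v f' p); first exact: rsmooth_derive.
by move=> p Up; apply: near_eq_derive; exact: nr.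
Unshelve. all: by end_near. Qed.

Lemma rsmooth_union (I : Type) (U : I -> set V) g :
  (forall i, rsmooth (U i) g) -> rsmooth (\bigcup_i U i) g.
Proof. by move=> sg vs p [i _ Uip]; exact: sg Uip. Qed.

Lemma line_derive g p v t :
  'D_1 (fun s : R => g (p + s *: v)) t = 'D_v g (p + t *: v) /\
  (derivable g (p + t *: v) v -> derivable (fun s : R => g (p + s *: v)) t 1).
Proof.
apply: (@derive_affine _ _ _ g (fun s : R => p + s *: v)) => h.
by rewrite scalerDl [h *: 1]mulr1 addrA addrAC addrC addrA addrC.
Qed.

Lemma line_mvt g p v (h : R) :
  (forall t, `|t| <= `|h| -> derivable g (p + t *: v) v) ->
  exists2 c, `|c| <= `|h| & g (p + h *: v) - g p = h * 'D_v g (p + c *: v).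
Proof.
move=> dg; pose phi s := g (p + s *: v).
have dphi (t : R) : `|t| <= `|h| -> is_derive t 1 phi ('D_v g (p + t *: v)).
  move=> th; have [<- H] := line_derive g p v t.
  by apply: derivableP; apply: H; exact: dg.
have cphi (t : R) : `|t| <= `|h| -> {for t, continuous phi}.
  by move=> th; apply: differentiable_continuous; apply/derivable1_diffP;
    have [] := dphi t th.
have cw (I : set R) : (forall t, I t -> `|t| <= `|h|) -> {within I, continuous phi}.
  move=> hI; apply: continuous_in_subspaceT => t /set_mem It.
  by apply: cphi; exact: hI.
have E0 : phi 0 = g p by rewrite /phi scale0r addr0.
have [h0|h0|->] := ltgtP h 0.
- have H t : t \in `[h, 0] -> `|t| <= `|h|.
    by rewrite in_itv/= => /andP[? ?]; rewrite !ler0_norm ?lerN2 // ltW.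
  have [||c cI] := @MVT _ phi (fun t => 'D_v g (p + t *: v)) _ _ h0.
  - move=> x; rewrite in_itv/= => /andP[? ?]; apply: dphi; apply: H.
    by rewrite in_itv/= !ltW.
  - by apply: cw => t /= tI; exact: H.
  rewrite E0 sub0r mulrN => /eqP E.
  exists c; first by apply: H; move: cI; rewrite !in_itv/= => /andP[? ?]; rewrite !ltW.
  apply/eqP; rewrite -subr_eq0 -[X in X - _]opprK opprB -/(phi h).
  by rewrite (eqP E) opprK mulrC subrr.
- have H t : t \in `[0, h] -> `|t| <= `|h|.
    by rewrite in_itv/= => /andP[? ?]; rewrite !ger0_norm // ltW.
  have [||c cI] := @MVT _ phi (fun t => 'D_v g (p + t *: v)) _ _ h0.
  - move=> x; rewrite in_itv/= => /andP[? ?]; apply: dphi; apply: H.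
    by rewrite in_itv/= !ltW.
  - by apply: cw => t /= tI; exact: H.
  rewrite E0 subr0 mulrC => E.
  exists c => //.
  by apply: H; move: cI; rewrite !in_itv/= => /andP[? ?]; rewrite !ltW.
- by exists 0; rewrite ?normr0 // scale0r addr0 mul0r subrr.
Qed.

(* A ball inside an open set stays inside after short steps in fixed directions. *)
Let near_step U p (v w : V) (a : R) : open U -> U p ->
  \forall h \near (0 : R), forall t s : R, `|t| <= `|h| * (1 + `|a|) -> `|s| <= `|h| ->
    U (p + s *: w + t *: v).
Proof.
move=> oU Up.
have /nbhs_ballP[e /= e0 He] : nbhs p U by exact: open_nbhs_nbhs.
pose k := (1 + `|a|) * `|v| + `|w| + 1.
have k0 : 0 < k.
  by rewrite /k ltr_wpDl// addr_ge0// mulr_ge0// addr_ge0.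
near=> h => t s th sh; apply: He; rewrite -ball_normE /ball_/=.
rewrite -addrA opprD addNKr normrN.
apply: le_lt_trans (ler_normD _ _) _; rewrite !normrZ.
apply: (@le_lt_trans _ _ (`|h| * k)).
  rewrite /k 2!mulrDr mulr1 mulrA -[leLHS]addr0 [X in X + _ <= _]addrC.
  by rewrite !lerD// ler_wpM2r.
rewrite -ltr_pdivlMr//; near: h.
apply/nbhs_ballP; exists (e / k) => /=; first by rewrite divr_gt0.
by move=> x; rewrite -ball_normE /= sub0r normrN.
Unshelve. all: by end_near. Qed.

(** The difference quotient along $a v + w$ is split into a step along $w$
    followed by a step along $v$, and each step is evaluated by the mean value
    theorem. *)
Lemma derive_lin U g p (a : R) v w : open U -> rsmooth U g -> U p ->
  'D_(a *: v + w) g p = a * 'D_v g p + 'D_w g p.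
Proof.
move=> oU sg Up.
apply: cvg_lim => //; apply/cvgrPdist_lt => e e0.
have cv := rsmooth_cts (rsmooth_derive v sg) Up.
have cw := rsmooth_cts (rsmooth_derive w sg) Up.
have a0 : 0 < 1 + `|a| by rewrite ltr_pwDl.
pose d := e / 2 / (1 + `|a|).
have d0 : 0 < d by rewrite !divr_gt0.
pose Uv := [set x | `|'D_v g p - 'D_v g x| < d] `&` [set x | `|'D_w g p - 'D_w g x| < d].
have nU : nbhs p (interior (U `&` Uv)).
  apply: nbhs_interior; apply: filterI; first exact: open_nbhs_nbhs.
  by apply: filterI; [move/cts_dist : cv; exact|move/cts_dist : cw; exact].
have := @near_step _ p v w a (@open_interior _ _) (nbhs_singleton nU).
move=> /(@nbhs_dnbhs _ (0:R)) Hs.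
near=> h.
have h0 : h != 0 by near: h; exact: nbhs_dnbhs_neq.
have Hi : forall t s : R, `|t| <= `|h| * (1 + `|a|) -> `|s| <= `|h| ->
    (interior (U `&` Uv)) (p + s *: w + t *: v) by near: h.
have Hs' (t s : R) : `|t| <= `|h| * (1 + `|a|) -> `|s| <= `|h| ->
    (U `&` Uv) (p + s *: w + t *: v).
  by move=> th sh; apply: interior_subset; exact: Hi.
have hh : `|h| <= `|h| by [].
have [|c1 hc1 E1] := @line_mvt g p w h.
  move=> t th; have [] := Hs' 0 t _ th.
    by rewrite normr0 mulr_ge0// ltW.
  by rewrite scale0r addr0 => Ut _; exact: rsmooth_derivable Ut.
have ha (t : R) : `|t| <= `|h * a| -> `|t| <= `|h| * (1 + `|a|).
  by move=> /le_trans; apply; rewrite normrM mulrDr mulr1 lerDr.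
have [|c2 /ha hc2 E2] := @line_mvt g (p + h *: w) v (h * a).
  by move=> t /ha th; have [Ut _] := Hs' t h th hh; exact: rsmooth_derivable Ut.
have [_ [Hv _]] := Hs' _ _ hc2 hh.
have [|_ [_ Hw]] := Hs' 0 c1 _ hc1; first by rewrite normr0 mulr_ge0// ltW.
rewrite scale0r addr0 /= in Hw.
have -> : h^-1 *: ((g \o shift p) (h *: (a *: v + w)) - g p) =
    a * 'D_v g (p + h *: w + c2 *: v) + 'D_w g (p + c1 *: w).
  have -> : (g \o shift p) (h *: (a *: v + w)) = g (p + h *: w + (h * a) *: v).
    by rewrite /= scalerDr scalerA addrC addrA addrAC.
  rewrite -(subrK (g (p + h *: w)) (g (_ + _))) -addrA E1 E2.
  by rewrite -mulrA -mulrDr /GRing.scale/= mulKf.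
rewrite opprD addrACA -mulrBr.
apply: le_lt_trans (ler_normD _ _) _; rewrite normrM.
apply: (@lt_le_trans _ _ (`|a| * d + d)).
  by rewrite ler_ltD// ler_wpM2l// ltW.
have -> : `|a| * d + d = e / 2.
  by rewrite -[X in _ + X]mul1r -mulrDl addrC /d mulrC divfK// gt_eqF.
by rewrite ler_pdivrMr// mulrDr mulr1 lerDl ltW.
Unshelve. all: by end_near. Qed.

Let second_difference U g p v w (h : R) : rsmooth U g ->
  (forall t s : R, `|t| <= `|h| -> `|s| <= `|h| -> U (p + t *: v + s *: w)) ->
  exists c c' : R, [/\ `|c| <= `|h|, `|c'| <= `|h| &
    g (p + h *: v + h *: w) - g (p + h *: v) - (g (p + h *: w) - g p) =
    h * (h * 'D_w (fun x => 'D_v g x) (p + c *: v + c' *: w))].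
Proof.
move=> sg HU.
pose phi x := g (x + h *: w) - g x.
have hh : `|h| <= `|h| by [].
have n0 : `|0 : R| <= `|h| by rewrite normr0.
have sh x : 'D_v (fun x => g (x + h *: w)) x = 'D_v g (x + h *: w) /\
    (derivable g (x + h *: w) v -> derivable (fun x => g (x + h *: w)) x v).
  apply: (@derive_affine _ _ _ g (fun x : V => x + h *: w)) => k.
  by rewrite addrA.
have dphi (t : R) : `|t| <= `|h| ->
    is_derive (p + t *: v) v phi ('D_v g (p + t *: v + h *: w) - 'D_v g (p + t *: v)).
  move=> th; have [<- d1] := sh (p + t *: v).
  have {}d1 := d1 (rsmooth_derivable sg (HU _ _ th hh)).
  have U2 : U (p + t *: v) by have := HU t 0 th n0; rewrite scale0r addr0.
  have d2 := rsmooth_derivable sg U2.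
  by apply: (@is_deriveB _ _ _ (fun x => g (x + h *: w)) g); exact: derivableP.
have [|c hc] := @line_mvt phi p v h; first by move=> t /dphi [].
rewrite {1 2}/phi (@derive_val _ _ _ _ _ _ _ (dphi _ hc)) => E.
have [|c' hc' E'] := @line_mvt (fun x => 'D_v g x) (p + c *: v) w h.
  move=> s hs; apply: rsmooth_derivable (HU _ _ hc hs).
  exact: (rsmooth_derive v sg).
exists c, c'; split => //.
by rewrite -E' -E.
Qed.

(** Schwarz's theorem: both mixed derivatives are limits of the same second
    difference quotient. *)
Lemma derive_comm U g p v w : open U -> rsmooth U g -> U p ->
  'D_v (fun x => 'D_w g x) p = 'D_w (fun x => 'D_v g x) p.
Proof.
move=> oU sg Up.
have cvw := rsmooth_cts (rsmooth_derive v (rsmooth_derive w sg)) Up.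
have cwv := rsmooth_cts (rsmooth_derive w (rsmooth_derive v sg)) Up.
apply/eqP; rewrite -subr_eq0 -normr_le0; apply/ler_addgt0Pl => e e0.
rewrite addr0; have e20 : 0 < e / 2 by rewrite divr_gt0.
pose Uv := [set x | `|'D_v (fun x => 'D_w g x) p - 'D_v (fun x => 'D_w g x) x| < e / 2] `&`
           [set x | `|'D_w (fun x => 'D_v g x) p - 'D_w (fun x => 'D_v g x) x| < e / 2].
have nU : nbhs p (interior (U `&` Uv)).
  apply: nbhs_interior; apply: filterI; first exact: open_nbhs_nbhs.
  by apply: filterI; [move/cts_dist : cvw; exact|move/cts_dist : cwv; exact].
have := @near_step _ p v w 0 (@open_interior _ _) (nbhs_singleton nU).
move=> /(@nbhs_dnbhs _ (0:R)) Hs.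
near (0 : R)^' => h.
have h0 : h != 0 by near: h; exact: nbhs_dnbhs_neq.
have Hi : forall t s : R, `|t| <= `|h| * (1 + `|0 : R|) -> `|s| <= `|h| ->
    (interior (U `&` Uv)) (p + s *: w + t *: v) by near: h.
have H (t s : R) : `|t| <= `|h| -> `|s| <= `|h| -> (U `&` Uv) (p + t *: v + s *: w).
  move=> th sh; apply: interior_subset; rewrite addrAC; apply: Hi => //.
  by rewrite normr0 addr0 mulr1.
have [|c [c' [hc hc' E]]] := @second_difference U g p v w h sg.
  by move=> t s th sh; have [] := H t s th sh.
have [|d [d' [hd hd' E']]] := @second_difference U g p w v h sg.
  by move=> t s th sh; rewrite addrAC; have [] := H s t sh th.
have := E'; rewrite [p + h *: w + h *: v]addrAC => E2.
have EE : g (p + h *: v + h *: w) - g (p + h *: v) - (g (p + h *: w) - g p) =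
  g (p + h *: v + h *: w) - g (p + h *: w) - (g (p + h *: v) - g p) by ring.
move: E; rewrite EE E2 => /(mulfI h0)/(mulfI h0) E3.
have [_ [_ Hw]] := H _ _ hc hc'.
have [_ [Hv _]] := H _ _ hd' hd.
rewrite /= in Hw; rewrite /= [p + _ + _]addrAC E3 in Hv.
apply: le_trans (ler_distD _ _ _) _; last first.
  by rewrite (splitr e); apply: lerD; [exact: ltW Hv|rewrite distrC; exact: ltW Hw].
Unshelve. all: by end_near. Qed.

End OneSpace.
End Smooth.

(** * Differentiation under an integral over an interval *)

Section IntervalIntegral.
Context {R : realType}.
Local Notation mu := (@lebesgue_measure R).
Implicit Types (f g w : R -> R) (a b c : R).

Definition cts_in a b f := {within `[a, b], continuous f}.

Lemma cts_in_integrable a b f : cts_in a b f ->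
  mu.-integrable `[a, b] (EFin \o f).
Proof.
move=> cf; apply: continuous_compact_integrable => //; exact: segment_compact.
Qed.

Lemma cts_cts_in a b f : (forall t, a <= t <= b -> {for t, continuous f}) ->
  cts_in a b f.
Proof.
move=> cf; apply: continuous_in_subspaceT => t /set_mem/=.
by rewrite in_itv/= => /cf.
Qed.

Lemma Rintegral_itv_le a b f c : a <= b -> cts_in a b f ->
  (forall t, a <= t <= b -> `|f t| <= c) ->
  `|\int[mu]_(t in `[a, b]) f t| <= c * (b - a).
Proof.
move=> ab cf fc; have fi := cts_in_integrable cf.
apply: le_trans (le_normr_Rintegral _ fi) _ => //.
have -> : c * (b - a) = \int[mu]_(t in `[a, b]) (fun=> c) t.
  rewrite Rintegral_cst//=; congr (_ * _).
  by rewrite lebesgue_measure_itv/= lte_fin; case: ltgtP ab => // -> _; rewrite subrr.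
apply: le_Rintegral => //.
- by apply: (integrable_norm fi).
- by apply: cts_in_integrable; apply: cts_cts_in => t _; exact: cvg_cst.
Qed.

Lemma cts_pair (X Y Z : topologicalType) (f : X -> Y) (g : X -> Z) (x : X) :
  {for x, continuous f} -> {for x, continuous g} ->
  {for x, continuous (fun y => (f y, g y))}.
Proof. by move=> cf cg; rewrite /prop_for /continuous_at; apply: cvg_pair. Qed.

Section Parametric.
Context {V : normedModType R}.
Variables (a b : R) (U : set V).
Hypotheses (ab : a <= b) (oU : open U).

Definition jointly_cts (F : V -> R -> R) := forall p t, U p -> a <= t <= b ->
  {for (p, t), continuous (fun z : V * R => F z.1 z.2)}.

Lemma jointly_cts_in F p : jointly_cts F -> U p -> cts_in a b (F p).
Proof.
move=> cF Up; apply: cts_cts_in => t /(cF p t Up) ct.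
exact: (@continuous2_cvg _ _ _ _ (nbhs t) _ (fun=> p) id F p t ct (cvg_cst _) cvg_id).
Qed.

Lemma jointly_cts_near F p : jointly_cts F -> U p ->
  forall e : R, 0 < e ->
  \forall x \near p, forall t, a <= t <= b -> `|F p t - F x t| < e.
Proof.
move=> cF Up e e0.
have nc : near_covering `[a, b]%classic.
  by apply/compact_near_coveringP; exact: segment_compact.
suff : \forall x \near p, `[a, b] `<=` (fun t => `|F p t - F x t| < e).
  by apply: filterS => x H t ht; apply: H; rewrite /= in_itv.
apply: nc => t /=; rewrite in_itv/= => /(cF p t Up) /cts_dist/(_ _ (divr_gt0 e0 (ltr0n _ 2)))/=.
move=> [[A B] /= [pA tB] AB].
exists (B, A); first by split.
move=> [t' x] /= [Bt' Ax].
have H1 := AB (x, t') (conj Ax Bt').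
have H2 := AB (p, t') (conj (nbhs_singleton pA) Bt').
rewrite /= in H1 H2; rewrite (splitr e) -(subrK (F p t) (F p t')) -addrA.
by rewrite (le_lt_trans (ler_normD _ _))// ltrD// distrC.
Qed.

Lemma cts_inB f g : cts_in a b f -> cts_in a b g ->
  cts_in a b (fun t => f t - g t).
Proof. by move=> cf cg t; apply: continuousB; [exact: cf|exact: cg]. Qed.

Lemma cts_inZ c f : cts_in a b f -> cts_in a b (fun t => c * f t).
Proof. by move=> cf t; apply: continuousM; [exact: cvg_cst|exact: cf]. Qed.

(* The factor b - a + 1 instead of b - a spares the case a = b. *)
Let small (e : R) : 0 < e -> 0 < e / (b - a + 1).
Proof. by move=> e0; rewrite divr_gt0// ltr_wpDl// subr_ge0. Qed.

Let small_lt (e : R) : 0 < e -> e / (b - a + 1) * (b - a) < e.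
Proof.
move=> e0; rewrite mulrAC ltr_pdivrMr ?ltr_wpDl ?subr_ge0//.
by rewrite ltr_pM2l// ltrDl.
Qed.

Lemma cts_Rintegral F p : jointly_cts F -> U p ->
  {for p, continuous (fun x => \int[mu]_(t in `[a, b]) F x t)}.
Proof.
move=> cF Up; apply/cts_dist => e e0.
near=> x.
have Ux : U x by near: x; exact: open_nbhs_nbhs.
rewrite -RintegralB//; [|exact/cts_in_integrable/jointly_cts_in..].
apply: le_lt_trans (small_lt e0); apply: Rintegral_itv_le => //.
  by apply: cts_inB; exact: jointly_cts_in.
move=> t /[dup] tab; move: t tab.
have H : forall t, a <= t <= b -> `|F p t - F x t| < e / (b - a + 1).
  by near: x; apply: jointly_cts_near => //; exact: small.
by move=> t tab _; exact/ltW/H.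
Unshelve. all: by end_near. Qed.

Lemma is_derive_Rintegral F DF v p : jointly_cts F -> jointly_cts DF -> U p ->
  (forall x t, U x -> a <= t <= b -> is_derive x v (fun y => F y t) (DF x t)) ->
  is_derive p v (fun x => \int[mu]_(t in `[a, b]) F x t)
                (\int[mu]_(t in `[a, b]) DF p t).
Proof.
move=> cF cDF Up dF.
set I := fun x => _.
suff cvI : h^-1 *: ((I \o shift p) (h *: v) - I p) @[h --> (0:R)^'] -->
    \int[mu]_(t in `[a, b]) DF p t.
  by apply: DeriveDef; [apply/cvg_ex; exists (\int[mu]_(t in `[a, b]) DF p t)|
    exact: cvg_lim].
apply/cvgrPdist_lt => e e0.
have near_U : \forall x \near p, U x /\
    forall t, a <= t <= b -> `|DF p t - DF x t| < e / (b - a + 1).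
  by apply: filterI; [exact: open_nbhs_nbhs|apply: jointly_cts_near => //; exact: small].
have near_line : \forall h \near (0 : R), forall c : R, `|c| <= `|h| -> U (p + c *: v) /\
    forall t, a <= t <= b -> `|DF p t - DF (p + c *: v) t| < e / (b - a + 1).
  have /nbhs_ballP[r /= r0 Hr] := near_U.
  apply/nbhs_ballP; exists (r / (`|v| + 1)) => /=; first by rewrite divr_gt0// ltr_wpDl.
  move=> h; rewrite -ball_normE /= sub0r normrN ltr_pdivlMr ?ltr_wpDl// => hr c ch.
  apply: Hr; rewrite -ball_normE /= opprD addNKr normrN normrZ.
  apply: le_lt_trans hr; apply: ler_pM => //; by rewrite lerDl.
near=> h.
have h0 : h != 0 by near: h; exact: nbhs_dnbhs_neq.
have H : forall c : R, `|c| <= `|h| -> U (p + c *: v) /\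
    forall t, a <= t <= b -> `|DF p t - DF (p + c *: v) t| < e / (b - a + 1).
  by near: h; exact: nbhs_dnbhs.
have [Uh _] := H h (lexx _).
have -> : h^-1 *: ((I \o shift p) (h *: v) - I p) = h^-1 * (I (p + h *: v) - I p).
  by rewrite /= [h *: v + p]addrC.
rewrite /I.
rewrite -RintegralB//; [|exact/cts_in_integrable/jointly_cts_in..].
have cq : cts_in a b (fun t => h^-1 * (F (p + h *: v) t - F p t)).
  by apply: cts_inZ; apply: cts_inB; exact: jointly_cts_in.
rewrite -RintegralZl//; last first.
  by apply/cts_in_integrable/cts_inB; exact: jointly_cts_in.
rewrite -RintegralB//; [|exact/cts_in_integrable/jointly_cts_in|exact/cts_in_integrable].
apply: le_lt_trans (small_lt e0); apply: Rintegral_itv_le => //.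
  by apply: cts_inB => //; exact: jointly_cts_in.
move=> t tab.
have [|c /H[Uc Hc] ->] := @line_mvt _ _ (fun y => F y t) p v h.
  by move=> s /H[Us _]; have [] := dF _ _ Us tab.
rewrite mulKf// (@derive_val _ _ _ _ _ _ _ (dF _ _ Uc tab)).
exact/ltW/Hc.
Unshelve. all: by end_near. Qed.

End Parametric.

Lemma cts_mul_id w : continuous w -> continuous (fun t => w t * t).
Proof. by move=> cw t; apply: (@continuousM _ _ w id); [exact: cw|exact: cvg_id]. Qed.

Section Average.
Context {V : normedModType R}.
Variables (a b : R) (U U' : set V) (L : R -> V -> V) (N E : V -> V).
Hypotheses (ab : a <= b) (oU : open U) (oU' : open U').
Hypothesis LU : forall p t, U p -> a <= t <= b -> U' (L t p).
Hypothesis cL : forall p t, U p -> a <= t <= b ->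
  {for (p, t), continuous (fun z : V * R => L z.2 z.1)}.
Hypothesis aL : forall t (h : R) v p,
  L t (h *: v + p) = h *: (t *: E v + N v) + L t p.

Definition average w (g : V -> R) (p : V) : R :=
  \int[mu]_(t in `[a, b]) (w t * g (L t p)).

Let average_cts w (g : V -> R) : continuous w -> rsmooth U' g ->
  jointly_cts a b U (fun p t => w t * g (L t p)).
Proof.
move=> cw sg p t Up tab; apply: continuousM.
  apply: (@continuous_comp _ _ _ (@snd V R) w); last exact: cw.
  exact: cvg_snd.
apply: (@continuous_comp _ _ _ (fun z : V * R => L z.2 z.1) g); first exact: cL.
exact: (rsmooth_cts sg (LU Up tab)).
Qed.

Lemma average_in w (g : V -> R) p : continuous w -> rsmooth U' g -> U p ->
  cts_in a b (fun t => w t * g (L t p)).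
Proof. by move=> cw sg Up; exact: (jointly_cts_in (average_cts cw sg) Up). Qed.

(** Differentiating under the integral sign keeps the class of averages: the
    direction of differentiation depends affinely on the integration variable,
    and that variable can be absorbed in the weight. *)
Lemma is_derive_average w (g : V -> R) p v : continuous w -> rsmooth U' g -> U p ->
  is_derive p v (average w g)
    (average (fun t => w t * t) (fun x => 'D_(E v) g x) p +
     average w (fun x => 'D_(N v) g x) p).
Proof.
move=> cw sg Up.
have cwt := cts_mul_id cw.
have sE := rsmooth_derive (E v) sg; have sN := rsmooth_derive (N v) sg.
rewrite /average -RintegralD//;
  [|exact: (cts_in_integrable (average_in cwt sE Up))|
    exact: (cts_in_integrable (average_in cw sN Up))].
apply: (@is_derive_Rintegral _ _ _ _ ab oU (fun p t => w t * g (L t p))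
  (fun p t => w t * t * 'D_(E v) g (L t p) + w t * 'D_(N v) g (L t p))) => //.
- exact: average_cts.
- by move=> x t Ux tab; apply: continuousD; [exact: (average_cts cwt sE)|exact: (average_cts cw sN)].
- move=> x t Ux tab.
  have [Dv dv] := @derive_affine _ _ _ _ g (L t) x v (t *: E v + N v) (fun h => aL t h v x).
  have -> : w t * t * 'D_(E v) g (L t x) + w t * 'D_(N v) g (L t x) =
      w t *: 'D_v (g \o L t) x.
    by rewrite Dv (derive_lin _ _ _ oU' sg (LU Ux tab)) /GRing.scale/= mulrDr mulrA.
  apply: is_deriveZ; apply: derivableP; apply: dv.
  exact: (rsmooth_derivable sg (LU Ux tab)).
Qed.

Lemma rsmooth_average w (g : V -> R) : continuous w -> rsmooth U' g -> rsmooth U (average w g).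
Proof.
move=> cw sg.
pose B (f : V -> R) := exists (w' : R -> R) (g' : V -> R),
  [/\ continuous w', rsmooth U' g' & f = average w' g'].
apply: (@rsmooth_ratalg R V U B oU); last by apply: ratalg_base; exists w, g.
move=> f [w' [g' [cw' sg' ->]]]; split=> [p Up|v].
  split=> [|v]; first exact: (cts_Rintegral ab oU (average_cts cw' sg') Up).
  by have [] := @is_derive_average w' g' p v cw' sg' Up.
exists (fun p => average (fun t => w' t * t) (fun x => 'D_(E v) g' x) p +
     average w' (fun x => 'D_(N v) g' x) p).
  apply: ratalg_add; apply: ratalg_base.
    exists (fun t => w' t * t), (fun x => 'D_(E v) g' x).
    by split; [exact: cts_mul_id|exact: (rsmooth_derive (E v) sg')|].
  exists w', (fun x => 'D_(N v) g' x).
  by split; [exact: cw'|exact: (rsmooth_derive (N v) sg')|].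
by move=> p Up; have [_] := @is_derive_average w' g' p v cw' sg' Up.
Qed.

Lemma derive_average w (g : V -> R) p v : continuous w -> rsmooth U' g -> U p ->
  'D_v (average w g) p = average (fun t => w t * t) (fun x => 'D_(E v) g x) p +
     average w (fun x => 'D_(N v) g x) p.
Proof. by move=> cw sg Up; have [] := @is_derive_average w g p v cw sg Up. Qed.

Lemma average_le w (g : V -> R) p (W c : R) : continuous w -> rsmooth U' g -> U p -> 0 <= c ->
  (forall t, a <= t <= b -> `|w t| <= W) ->
  (forall t, a <= t <= b -> `|g (L t p)| <= c) ->
  `|average w g p| <= W * c * (b - a).
Proof.
move=> cw sg Up c0 wW gc; apply: Rintegral_itv_le => //; first exact: (average_in cw sg Up).
by move=> t tab; rewrite normrM ler_pM//; [exact: wW|exact: gc].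
Qed.

End Average.
End IntervalIntegral.

(** * Taylor's inequality for iterated derivatives *)

Section IteratedDerivatives.
Context {R : realType} {V : normedModType R}.
Implicit Types (U : set V) (g h : V -> R).

Lemma rders_lin U vs (c : R) g h p : open U -> rsmooth U g -> rsmooth U h -> U p ->
  rders vs (fun x => c * g x + h x) p = c * rders vs g p + rders vs h p.
Proof.
move=> oU sg sh; elim: vs p => [//|v vs IH] p Up /=.
rewrite (@near_eq_derive _ _ _ _ (fun x => c * rders vs g x + rders vs h x)).
  have d1 := rsmooth_derivable (v := v) (rsmooth_rders vs sg) Up.
  have d2 := rsmooth_derivable (v := v) (rsmooth_rders vs sh) Up.
  have := deriveD (@derivableZ _ _ _ _ c _ _ d1) d2.
  by rewrite deriveZ.
by near=> x; apply: IH; near: x; exact: open_nbhs_nbhs.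
Unshelve. all: by end_near. Qed.

Lemma rdersD U vs g h p : open U -> rsmooth U g -> rsmooth U h -> U p ->
  rders vs (fun x => g x + h x) p = rders vs g p + rders vs h p.
Proof.
move=> oU sg sh Up; rewrite -[X in X + _]mul1r -(rders_lin vs 1 oU sg sh Up).
by congr (rders vs _ p); apply/funext => x; rewrite mul1r.
Qed.

Lemma rders_cst (vs : seq V) (c : R) (p : V) : rders vs (fun=> c) p = if vs is [::] then c else 0.
Proof.
elim: vs p => [//|v vs IH] p /=; case: vs IH => [|v' vs] IH.
  exact: (@derive_cst _ _ R).
have -> : rders (v' :: vs) (fun=> c) = (fun=> 0) by apply/funext => x; rewrite IH.
exact: (@derive_cst _ _ R).
Qed.

Lemma rdersZ U vs (c : R) g p : open U -> rsmooth U g -> U p ->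
  rders vs (fun x => c * g x) p = c * rders vs g p.
Proof.
move=> oU sg Up; have := rders_lin vs c oU sg (rsmooth_cst 0 oU) Up.
rewrite rders_cst (_ : (if vs is [::] then 0 else 0) = 0 :> R) ?addr0; last by case: vs.
by move=> <-; congr (rders vs _ p); apply/funext => x; rewrite addr0.
Qed.

Lemma rders_sum (I : Type) (s : seq I) U vs (F : I -> V -> R) p : open U ->
  (forall i, rsmooth U (F i)) -> U p ->
  rders vs (fun x => \sum_(i <- s) F i x) p = \sum_(i <- s) rders vs (F i) p.
Proof.
move=> oU sF Up; elim: s => [|i s IH].
  rewrite big_nil (_ : (fun x => _) = (fun=> 0)); last by apply/funext => x; rewrite big_nil.
  by rewrite rders_cst; case: vs.
rewrite big_cons -IH -(rdersD vs oU (sF i) (rsmooth_sum s oU sF) Up).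
by congr (rders vs _ p); apply/funext => x; rewrite big_cons.
Qed.

(** Since derivatives commute, the innermost one may be moved outside. *)
Lemma rders_derive_comm U vs v g p : open U -> rsmooth U g -> U p ->
  rders vs (fun x => 'D_v g x) p = 'D_v (rders vs g) p.
Proof.
move=> oU sg; elim: vs p => [//|w vs IH] p Up /=.
rewrite -(derive_comm w v oU (rsmooth_rders vs sg) Up).
apply: near_eq_derive; near=> x; apply: IH; near: x; exact: open_nbhs_nbhs.
Unshelve. all: by end_near. Qed.

Lemma rders_comm U vs ws g p : open U -> rsmooth U g -> U p ->
  rders vs (rders ws g) p = rders ws (rders vs g) p.
Proof.
move=> oU sg; elim: vs p => [//|v vs IH] p Up /=.
rewrite (rders_derive_comm _ _ oU (rsmooth_rders vs sg) Up).
by apply: near_eq_derive; near=> x; apply: IH; near: x; exact: open_nbhs_nbhs.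
Unshelve. all: by end_near. Qed.

Lemma rders_affine (W : normedModType R) vs (g : W -> R) (k : V -> W) (L : V -> W) :
  (forall v a (h : R), k (h *: v + a) = h *: L v + k a) ->
  forall p, rders vs (g \o k) p = rders (map L vs) g (k p).
Proof.
move=> ka; elim: vs => [//|v vs IH] p /=.
have -> : rders vs (g \o k) = rders (map L vs) g \o k by apply/funext => x; rewrite IH.
by have [-> _] := @derive_affine _ _ _ _ (rders (map L vs) g) k p v (L v) (ka v p).
Qed.

Lemma rsmooth_affine (W : normedModType R) (U' : set W) (g : W -> R) (k : V -> W) (L : V -> W) :
  (forall v a (h : R), k (h *: v + a) = h *: L v + k a) -> continuous k ->
  rsmooth U' g -> rsmooth (k @^-1` U') (g \o k).
Proof.
move=> ka ck sg vs p Up.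
have -> : rders vs (g \o k) = rders (map L vs) g \o k.
  by apply/funext => x; rewrite (rders_affine vs g ka).
split=> [|v].
  apply: continuous_comp; [exact: ck|exact: (rsmooth_cts (rsmooth_rders (map L vs) sg) Up)].
have [_] := @derive_affine _ _ _ _ (rders (map L vs) g) k p v (L v) (ka v p).
by apply; exact: (rsmooth_derivable (rsmooth_rders (map L vs) sg) Up).
Qed.

Lemma rsmooth_sum_ord N U (a : nat -> V -> R) : open U -> (forall j, rsmooth U (a j)) ->
  rsmooth U (fun p => \sum_(j < N) a j p).
Proof.
by move=> oU sa; apply: (@rsmooth_sum _ _ _ _ _ (fun (j : 'I_N) p => a j p)).
Qed.

Lemma rsmoothB U g h : open U -> rsmooth U g -> rsmooth U h ->
  rsmooth U (fun p => g p - h p).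
Proof. by move=> oU sg sh; apply: (rsmoothD oU sg); exact: (rsmoothN oU sh). Qed.

End IteratedDerivatives.

(* Unification must not unfold smoothness when the functions do not match. *)
Global Opaque rsmooth.

Lemma is_derive_bigsum (R : realType) (V : normedModType R) (I : Type) (s : seq I)
    (F : I -> V -> R) (F' : I -> R) (x v : V) :
  (forall i, is_derive x v (F i) (F' i)) ->
  is_derive x v (fun x => \sum_(i <- s) F i x) (\sum_(i <- s) F' i).
Proof.
move=> dF; elim: s => [|i s IH].
  rewrite big_nil; under eq_fun do rewrite big_nil.
  exact: is_derive_cst.
rewrite big_cons; under eq_fun do rewrite big_cons.
exact: is_deriveD.
Qed.

(** Taylor's inequality along a line, by induction on the order: the derivative
    in [c] of the remainder of [g] is the remainder of its derivative. *)
Lemma taylor_line (R : realType) (V : normedModType R) N (g : V -> R) (v p : V) (c B : R) :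
  rsmooth setT g ->
  (forall t : R, `|t| <= `|c| -> `|rders (nseq N v) g (p + t *: v)| <= B) ->
  `|g (p + c *: v) - \sum_(i < N) c ^+ i / i`!%:R * rders (nseq i v) g p|
    <= `|c| ^+ N * B.
Proof.
elim: N g c => [|N IH] g c sg HB.
  by rewrite big_ord0 subr0 expr0 mul1r; exact: HB.
pose f (u : R) := g (p + u *: v) - \sum_(i < N.+1) u ^+ i / i`!%:R * rders (nseq i v) g p.
pose f' (u : R) := 'D_v g (p + u *: v) -
  \sum_(i < N) u ^+ i / i`!%:R * rders (nseq i v) (fun x => 'D_v g x) p.
have df (u : R) : is_derive u (1 : R) f (f' u).
  have [E H] := line_derive g p v u.
  have d1 : is_derive u (1 : R) (fun s : R => g (p + s *: v)) ('D_v g (p + u *: v)).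
    by rewrite -E; apply: derivableP; apply: H; exact: (rsmooth_derivable sg).
  have d2 : is_derive u (1 : R)
    (fun u : R => \sum_(i < N.+1) u ^+ i / i`!%:R * rders (nseq i v) g p)
    (\sum_(i < N.+1) i%:R * u ^+ i.-1 / i`!%:R * rders (nseq i v) g p).
    apply: is_derive_bigsum => i.
    under eq_fun do rewrite -mulrA mulrC.
    rewrite -[X in is_derive _ _ _ X]mulrA [X in is_derive _ _ _ X]mulrC; apply: is_deriveZ.
    apply: is_derive_eq (derivableP (@exprn_derivable _ i u 1)) _.
    by rewrite exp_derive /GRing.scale/= mulr1.
  have -> : f' u = 'D_v g (p + u *: v) -
      \sum_(i < N.+1) i%:R * u ^+ i.-1 / i`!%:R * rders (nseq i v) g p.
    rewrite /f' big_ord_recl mul0r !mul0r add0r; congr (_ - _); apply: eq_bigr => i _.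
    rewrite (rders_derive_comm (nseq i v) v openT sg I) lift0.
    congr (_ * _); rewrite factS natrM invfM.
    by rewrite -!mulrA mulrCA mulVKf// pnatr_eq0.
  exact: is_deriveB.
have f0 : f 0 = 0.
  rewrite /f big_ord_recl scale0r addr0 expr0 fact0 divr1 mul1r big1 ?addr0 ?subrr//.
  by move=> i _; rewrite expr0n/= !mul0r.
have f'B (u : R) : `|u| <= `|c| -> `|f' u| <= `|c| ^+ N * B.
  move=> uc; apply: le_trans (IH (fun x => 'D_v g x) u (rsmooth_derive v sg) _) _.
    move=> t tu; have := HB t (le_trans tu uc).
    by rewrite (rders_derive_comm (nseq N v) v openT sg I).
  have B0 : 0 <= B.
    by apply: le_trans (HB 0 _); rewrite ?normr0.
  by rewrite ler_wpM2r// lerXn2r ?nnegrE.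
have [|u uc] := @line_mvt R R^o f 0 1 c.
  by move=> t _; have [] := df (0 + t *: 1).
rewrite f0 subr0 add0r [c *: 1]mulr1 add0r [u *: 1]mulr1 -/(f c) => ->.
rewrite (@derive_val _ _ _ _ _ _ _ (df u)) normrM exprS -mulrA.
by rewrite ler_wpM2l// f'B.
Qed.

(** * Symbol estimates *)

Section SymbolBounds.
Context {R : realType} {n : nat}.
Local Notation M := (RnS1 R n).
Local Notation P := ((M * M)%type : normedModType R).
Implicit Types (e d c : R) (g h : M * M -> R) (U Reg : set (M * M)).

Definition dirs (vs ws : seq M) : seq (M * M) :=
  [seq (v, 0) | v <- vs] ++ [seq (0, w) | w <- ws].

Definition symbol_bound Reg e g : Prop := forall vs ws : seq M, exists c, forall p,
  Reg p -> `|rders (dirs vs ws) g p| <= c * `|p.2| `^ (e - (size ws)%:R).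

Lemma symbol_bound_eq U Reg e g h : @open P U -> Reg `<=` U ->
  (forall p, U p -> g p = h p) -> symbol_bound Reg e g -> symbol_bound Reg e h.
Proof.
move=> oU RU gh bg vs ws; have [c Hc] := bg vs ws; exists c => p Rp.
by rewrite -(rders_eq (dirs vs ws) oU gh (RU _ Rp)); exact: Hc.
Qed.

Lemma symbol_bound_lin U Reg e a g h : @open P U -> Reg `<=` U ->
  rsmooth U g -> rsmooth U h -> symbol_bound Reg e g -> symbol_bound Reg e h ->
  symbol_bound Reg e (fun p => a * g p + h p).
Proof.
move=> oU RU sg sh bg bh vs ws; have [c Hc] := bg vs ws; have [c' Hc'] := bh vs ws.
exists (`|a| * c + c') => p Rp; rewrite (rders_lin _ _ oU sg sh (RU _ Rp)).
apply: le_trans (ler_normD _ _) _; rewrite normrM mulrDl -mulrA.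
by rewrite lerD ?ler_wpM2l// ?Hc// Hc'.
Qed.

Lemma symbol_bound0 Reg e : symbol_bound Reg e (fun=> 0).
Proof.
move=> vs ws; exists 0 => p _; rewrite rders_cst mul0r.
by case: (dirs vs ws) => [|? ?]; rewrite normr0.
Qed.

Lemma symbol_boundZ U Reg e a g : @open P U -> Reg `<=` U ->
  rsmooth U g -> symbol_bound Reg e g -> symbol_bound Reg e (fun p => a * g p).
Proof.
move=> oU RU sg bg.
have := symbol_bound_lin a oU RU sg (rsmooth_cst 0 oU) bg (symbol_bound0 _ _).
by under eq_fun do rewrite addr0.
Qed.

Lemma symbol_boundD U Reg e g h : @open P U -> Reg `<=` U ->
  rsmooth U g -> rsmooth U h -> symbol_bound Reg e g -> symbol_bound Reg e h ->
  symbol_bound Reg e (fun p => g p + h p).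
Proof.
move=> oU RU sg sh bg bh.
have := symbol_bound_lin 1 oU RU sg sh bg bh.
by under eq_fun do rewrite mul1r.
Qed.

Lemma symbol_bound_sum (I : Type) (s : seq I) U Reg e (F : I -> M * M -> R) :
  @open P U -> Reg `<=` U -> (forall i, rsmooth U (F i)) ->
  (forall i, symbol_bound Reg e (F i)) ->
  symbol_bound Reg e (fun p => \sum_(i <- s) F i p).
Proof.
move=> oU RU sF bF; elim: s => [|i s IH].
  by under eq_fun do rewrite big_nil; exact: symbol_bound0.
under eq_fun do rewrite big_cons.
by apply: (symbol_boundD oU RU (sF i) _ (bF i) IH); exact: rsmooth_sum.
Qed.

Lemma symbol_bound_derive_zeta U Reg e g w : @open P U -> Reg `<=` U -> rsmooth U g ->
  symbol_bound Reg e g -> symbol_bound Reg (e - 1) (fun p => 'D_(0, w) g p).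
Proof.
move=> oU RU sg bg vs ws; have [c Hc] := bg vs (rcons ws w); exists c => p Rp.
have E : e - (size (rcons ws w))%:R = e - 1 - (size ws)%:R.
  by rewrite size_rcons -natr1 opprD addrA addrAC.
have := Hc p Rp; rewrite E.
by rewrite /dirs map_rcons -cats1 catA rders_cat.
Qed.

Lemma symbol_bound_derive_z U Reg e g v : @open P U -> Reg `<=` U -> rsmooth U g ->
  symbol_bound Reg e g -> symbol_bound Reg e (fun p => 'D_(v, 0) g p).
Proof.
move=> oU RU sg bg vs ws; have [c Hc] := bg (v :: vs) ws; exists c => p Rp.
by rewrite (rders_derive_comm _ _ oU sg (RU _ Rp)); exact: Hc.
Qed.

Lemma symbol_bound_subset Reg Reg' e g : Reg' `<=` Reg ->
  symbol_bound Reg e g -> symbol_bound Reg' e g.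
Proof. by move=> RR bg vs ws; have [c Hc] := bg vs ws; exists c => p /RR; exact: Hc. Qed.

Inductive graded_span (B : R -> (M * M -> R) -> Prop) : R -> (M * M -> R) -> Prop :=
| graded_base e g : B e g -> graded_span B e g
| graded_add e g h : graded_span B e g -> graded_span B e h ->
    graded_span B e (fun p => g p + h p)
| graded_scale e a g : graded_span B e g -> graded_span B e (fun p => a * g p).

(** The pointwise bounds for a family that is stable under differentiation,
    with the gradation shifted by derivatives in the fibre, give all the symbol
    estimates. *)
Lemma symbol_bound_span U Reg (B : R -> (M * M -> R) -> Prop) : @open P U -> Reg `<=` U ->
  (forall e g, B e g -> [/\ rsmooth U g,
    exists c, forall p, Reg p -> `|g p| <= c * `|p.2| `^ e,
    forall v, exists2 g', graded_span B e g' & forall p, U p -> 'D_(v, 0) g p = g' p &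
    forall w, exists2 g', graded_span B (e - 1) g' & forall p, U p -> 'D_(0, w) g p = g' p]) ->
  forall e g, graded_span B e g -> symbol_bound Reg e g.
Proof.
move=> oU RU HB.
have {}HB e g : graded_span B e g -> [/\ rsmooth U g,
    exists c, forall p, Reg p -> `|g p| <= c * `|p.2| `^ e,
    forall v, exists2 g', graded_span B e g' & forall p, U p -> 'D_(v, 0) g p = g' p &
    forall w, exists2 g', graded_span B (e - 1) g' & forall p, U p -> 'D_(0, w) g p = g' p].
  elim=> {e g} [e g /HB//|e g h Sg [sg [c Hc] xg zg] Sh [sh [c' Hc'] xh zh]|
                e a g Sg [sg [c Hc] xg zg]].
    split; first exact: rsmoothD.
    - exists (c + c') => p Rp; rewrite mulrDl (le_trans (ler_normD _ _))//.
      by rewrite lerD ?Hc ?Hc'.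
    - move=> v; have [g' Sg' Eg] := xg v; have [h' Sh' Eh] := xh v.
      exists (fun p => g' p + h' p); first exact: graded_add.
      move=> p Up; rewrite -Eg// -Eh//.
      exact: (deriveD (rsmooth_derivable sg Up) (rsmooth_derivable sh Up)).
    - move=> v; have [g' Sg' Eg] := zg v; have [h' Sh' Eh] := zh v.
      exists (fun p => g' p + h' p); first exact: graded_add.
      move=> p Up; rewrite -Eg// -Eh//.
      exact: (deriveD (rsmooth_derivable sg Up) (rsmooth_derivable sh Up)).
  split; first exact: rsmoothZ.
  - exists (`|a| * c) => p Rp.
    by rewrite normrM -mulrA ler_wpM2l// Hc.
  - move=> v; have [g' Sg' Eg] := xg v.
    exists (fun p => a * g' p); first exact: graded_scale.
    by move=> p Up; rewrite -Eg//; exact: (deriveZ a (rsmooth_derivable sg Up)).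
  - move=> v; have [g' Sg' Eg] := zg v.
    exists (fun p => a * g' p); first exact: graded_scale.
    by move=> p Up; rewrite -Eg//; exact: (deriveZ a (rsmooth_derivable sg Up)).
move=> e g Sg vs ws.
have [g1 Sg1 E1] : exists2 g', graded_span B (e - (size ws)%:R) g' &
    forall p, U p -> rders (dirs [::] ws) g p = g' p.
  elim: ws => [|w ws [g1 Sg1 E1]]; first by exists g; rewrite ?subr0.
  have [_ _ _ /(_ w)[g2 Sg2 E2]] := HB _ _ Sg1.
  exists g2; first by rewrite /= -natr1 opprD addrA.
  move=> p Up; rewrite -E2//=; apply: near_eq_derive; near=> x; apply: E1.
  by near: x; exact: open_nbhs_nbhs.
have [g2 Sg2 E2] : exists2 g', graded_span B (e - (size ws)%:R) g' &
    forall p, U p -> rders (dirs vs ws) g p = g' p.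
  elim: vs => [|v vs [g2 Sg2 E2]]; first by exists g1.
  have [_ _ /(_ v)[g3 Sg3 E3] _] := HB _ _ Sg2.
  exists g3 => // p Up; rewrite -E3//=; apply: near_eq_derive; near=> x; apply: E2.
  by near: x; exact: open_nbhs_nbhs.
have [_ [c Hc] _ _] := HB _ _ Sg2.
by exists c => p Rp; rewrite E2; [exact: Hc|exact: RU].
Unshelve. all: by end_near. Qed.

Lemma symbol_bound0P Reg e g : symbol_bound Reg e g ->
  exists c, forall p, Reg p -> `|g p| <= c * `|p.2| `^ e.
Proof. by move=> /(_ [::] [::]) [c] /=; rewrite subr0; exists c. Qed.

Lemma symbol_boundM U Reg e1 e2 g h : @open P U -> Reg `<=` U ->
  (forall p, Reg p -> p.2 != 0) ->
  rsmooth U g -> rsmooth U h -> symbol_bound Reg e1 g -> symbol_bound Reg e2 h ->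
  symbol_bound Reg (e1 + e2) (fun p => g p * h p).
Proof.
move=> oU RU R0 sg sh bg bh.
pose B e f := exists e1 e2 g h, [/\ e = e1 + e2, rsmooth U g, rsmooth U h,
  symbol_bound Reg e1 g /\ symbol_bound Reg e2 h & f = (fun p => g p * h p)].
apply: (@symbol_bound_span U Reg B oU RU); last first.
  by apply: graded_base; exists e1, e2, g, h.
move=> {e1 e2 g h sg sh bg bh} e f [e1 [e2 [g [h [-> sg sh [bg bh] ->]]]]].
have DM v p : U p -> 'D_v (fun p => g p * h p) p = g p * 'D_v h p + 'D_v g p * h p.
  move=> Up; rewrite [X in _ + X]mulrC.
  exact: (deriveM (rsmooth_derivable sg Up) (rsmooth_derivable sh Up)).
split; first exact: rsmoothM.
- have [c Hc] := symbol_bound0P bg; have [c' Hc'] := symbol_bound0P bh.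
  exists (c * c') => p Rp; rewrite powRD; last first.
    by rewrite normr_eq0 R0 ?implybT.
  by rewrite normrM mulrACA ler_pM ?Hc ?Hc'.
- move=> v; exists (fun p => g p * 'D_(v, 0) h p + 'D_(v, 0) g p * h p); last first.
    by move=> p Up; rewrite DM.
  apply: graded_add; apply: graded_base.
    exists e1, e2, g, (fun p => 'D_(v, 0) h p).
    split; [by []|exact: sg|exact: (rsmooth_derive (v, 0) sh)| |by []].
    by split=> //; exact: (symbol_bound_derive_z _ oU RU sh bh).
  exists e1, e2, (fun p => 'D_(v, 0) g p), h.
  split; [by []|exact: (rsmooth_derive (v, 0) sg)|exact: sh| |by []].
  by split=> //; exact: (symbol_bound_derive_z _ oU RU sg bg).
- move=> w; exists (fun p => g p * 'D_(0, w) h p + 'D_(0, w) g p * h p); last first.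
    by move=> p Up; rewrite DM.
  apply: graded_add; apply: graded_base.
    exists e1, (e2 - 1), g, (fun p => 'D_(0, w) h p).
    split; [by rewrite addrA|exact: sg|exact: (rsmooth_derive (0, w) sh)| |by []].
    by split=> //; exact: (symbol_bound_derive_zeta _ oU RU sh bh).
  exists (e1 - 1), e2, (fun p => 'D_(0, w) g p), h.
  split; [by rewrite addrAC|exact: (rsmooth_derive (0, w) sg)|exact: sh| |by []].
  by split=> //; exact: (symbol_bound_derive_zeta _ oU RU sg bg).
Qed.

Definition s_var (p : M * M) : R := p.2.2.

Definition e_s : M * M := (0, (0, 1)).

Lemma continuous_s_var : continuous s_var.
Proof.
move=> p; apply: (@continuous_comp _ _ _ (@snd M M) (@snd 'rV[R]_n R)); exact: cvg_snd.
Qed.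

Lemma is_derive_s_var p v : is_derive p v s_var v.2.2.
Proof.
have E : (fun h : R => h^-1 *: ((s_var \o shift p) (h *: v) - s_var p)) @ (0:R)^' --> v.2.2.
  apply: (@cvg_trans _ ((fun=> v.2.2) @ (0:R)^')); last exact: cvg_cst.
  apply: near_eq_cvg; near=> h.
  have h0 : h != 0 by near: h; exact: nbhs_dnbhs_neq.
  by rewrite /s_var/= addrK scalerA mulVf// scale1r.
apply: DeriveDef; [by apply/cvg_ex; exists v.2.2|exact: cvg_lim].
Unshelve. all: by end_near. Qed.

Lemma rsmooth_s_var U : @open P U -> rsmooth U s_var.
Proof.
move=> oU; apply: (@rsmooth_ratalg _ _ _ (fun f => f = s_var) oU); last exact: ratalg_base.
move=> f ->; split=> [p Up|v].
  by split=> [|v]; [exact: continuous_s_var|have [] := is_derive_s_var p v].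
exists (fun=> v.2.2); first exact: ratalg_cst.
by move=> p _; have [_] := is_derive_s_var p v.
Qed.

Lemma open_s_neq0 :
  @open P [set p : M * M | p.2.2 != 0].
Proof.
rewrite -[X in open X]/(s_var @^-1` [set s : R | s != 0]).
by apply: open_comp; [move=> p _; exact: continuous_s_var|exact: open_neq].
Qed.

(** Negative powers of $s$ satisfy symbol estimates in a cone around the $s$-axis. *)
Lemma symbol_bound_sV Reg m : Reg `<=` [set p | p.2.2 != 0] ->
  (forall p, Reg p -> `|p.2.2| = `|p.2|) ->
  symbol_bound Reg (- m%:R) (fun p => (s_var p)^-1 ^+ m).
Proof.
move=> R0 RE; pose U := [set p : M * M | p.2.2 != 0].
have oU : @open P U := open_s_neq0.
have sm k : rsmooth U (fun p => (s_var p)^-1 ^+ k).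
  have sV : rsmooth U (fun p => (s_var p)^-1).
    by apply: (rsmoothV oU (rsmooth_s_var oU)).
  elim: k => [|k IH]; first by under eq_fun do rewrite expr0; exact: rsmooth_cst.
  by under eq_fun do rewrite exprS; exact: rsmoothM.
pose B e f := exists k : nat, e = - k%:R /\ f = (fun p : M * M => (s_var p)^-1 ^+ k).
apply: (@symbol_bound_span U Reg B oU R0); last by apply: graded_base; exists m.
have Ds k v p : U p ->
    'D_v (fun p => (s_var p)^-1 ^+ k) p = (- k%:R * v.2.2) * (s_var p)^-1 ^+ k.+1.
  move=> Up; have Us : s_var p != 0 by [].
  have [dp Ep] := is_derive_s_var p v.
  have d1 : is_derive p v (fun p => (s_var p)^-1) (- (s_var p) ^- 2 * v.2.2).
    by apply: DeriveDef; [exact: derivableV|rewrite (deriveV Us dp) Ep].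
  elim: k => [|k IH].
    rewrite mulr0n oppr0 !mul0r (_ : (fun p => _) = cst 1) ?derive_cst//.
  under eq_fun do rewrite exprS.
  have dk := rsmooth_derivable (v := v) (sm k) Up.
  have [d1a d1b] := d1.
  rewrite (deriveM d1a dk) d1b IH /GRing.scale/= -natr1 !exprS.
  by rewrite expr0 mulr1 invfM; ring.
move=> e f [k [-> ->]]; split.
- exact: sm.
- exists 1 => p Rp; have p0 : 0 < `|p.2| by rewrite -RE// normr_gt0; exact: R0.
  by rewrite mul1r normrX normfV /s_var RE// powRN powR_mulrn// exprVn.
- move=> v; exists (fun=> 0).
    have -> : (fun=> 0) = (fun p : M * M => 0 * (s_var p)^-1 ^+ k).
      by apply/funext => p; rewrite mul0r.
    by apply/graded_scale/graded_base; exists k.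
  by move=> p Up; rewrite Ds// mulr0 mul0r.
- move=> w; exists (fun p => (- k%:R * w.2) * (s_var p)^-1 ^+ k.+1).
    by apply/graded_scale/graded_base; exists k.+1; rewrite -natr1 opprD.
  by move=> p Up; rewrite Ds.
Qed.

End SymbolBounds.

(** * Classical symbols through real and imaginary parts *)

Section ClassicalSymbols.
Context {R : realType} {n : nat}.
Local Notation M := (RnS1 R n).
Local Notation P := ((M * M)%type : normedModType R).
Implicit Types (e d c : R) (g h q : M * M -> R) (U Reg : set (M * M)).

Lemma cts_bounded_itv (w : R -> R) (a b : R) : a <= b -> continuous w ->
  exists W, forall t, a <= t <= b -> `|w t| <= W.
Proof.
move=> ab cw.
have cn : {within `[a, b], continuous (fun t => `|w t|)}.
  apply: cts_cts_in => t _; apply: continuous_comp; [exact: cw|exact: norm_continuous].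
have [c _ Hc] := EVT_max ab cn.
by exists `|w c| => t tab; apply: Hc; rewrite in_itv.
Qed.

Lemma symbol_bound_average (a b : R) U U' (L : R -> M * M -> M * M)
    (N E : M * M -> M * M) Reg Reg' (w : R -> R) e g :
  a <= b -> @open P U -> @open P U' ->
  (forall p t, U p -> a <= t <= b -> U' (L t p)) ->
  (forall p t, U p -> a <= t <= b ->
    {for (p, t), continuous (fun z : (M * M) * R => L z.2 z.1)}) ->
  (forall t (h : R) v p, L t (h *: v + p) = h *: (t *: E v + N v) + L t p) ->
  (forall v, exists v' v'', N (v, 0) = (v', 0) /\ E (v, 0) = (v'', 0)) ->
  (forall w, exists w' w'', N (0, w) = (0, w') /\ E (0, w) = (0, w'')) ->
  Reg `<=` U -> Reg' `<=` U' ->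
  (forall p t, Reg p -> a <= t <= b -> Reg' (L t p) /\ `|(L t p).2| = `|p.2|) ->
  continuous w -> rsmooth U' g -> symbol_bound Reg' e g ->
  symbol_bound Reg e (average a b L w g).
Proof.
move=> ab oU oU' LU cL aL NEx NEz RU RU' LR cw sg bg.
pose B e f := exists (w : R -> R) g, [/\ continuous w, rsmooth U' g,
  symbol_bound Reg' e g & f = average a b L w g].
apply: (@symbol_bound_span R n U Reg B oU RU); last first.
  by apply: graded_base; exists w, g.
move=> {e g w cw sg bg} e f [w [g [cw sg bg ->]]]; split.
- exact: (rsmooth_average ab oU oU' LU cL aL cw sg).
- have [c Hc] := symbol_bound0P bg; have [W HW] := cts_bounded_itv ab cw.
  exists (W * `|c| * (b - a)) => p Rp; rewrite mulrAC -(mulrA W).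
  apply: (average_le ab LU cL cw sg (RU _ Rp)) => //.
  move=> t tab; have [R'L <-] := LR p t Rp tab.
  by apply: le_trans (Hc _ R'L) _; rewrite ler_wpM2r ?powR_ge0// ler_norm.
- move=> v; have [v' [v'' [EN EE]]] := NEx v.
  exists (fun p => average a b L (fun t => w t * t) (fun x => 'D_(v'', 0) g x) p +
       average a b L w (fun x => 'D_(v', 0) g x) p); last first.
    by move=> p Up; rewrite (derive_average ab oU oU' LU cL aL (v, 0) cw sg Up) EN EE.
  apply: graded_add; apply: graded_base.
    exists (fun t => w t * t), (fun x => 'D_(v'', 0) g x).
    split; [exact: cts_mul_id|exact: (rsmooth_derive (v'', 0) sg)| |by []].
    exact: (symbol_bound_derive_z _ oU' RU' sg bg).
  exists w, (fun x => 'D_(v', 0) g x).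
  split; [exact: cw|exact: (rsmooth_derive (v', 0) sg)| |by []].
  exact: (symbol_bound_derive_z _ oU' RU' sg bg).
- move=> v; have [v' [v'' [EN EE]]] := NEz v.
  exists (fun p => average a b L (fun t => w t * t) (fun x => 'D_(0, v'') g x) p +
       average a b L w (fun x => 'D_(0, v') g x) p); last first.
    by move=> p Up; rewrite (derive_average ab oU oU' LU cL aL (0, v) cw sg Up) EN EE.
  apply: graded_add; apply: graded_base.
    exists (fun t => w t * t), (fun x => 'D_(0, v'') g x).
    split; [exact: cts_mul_id|exact: (rsmooth_derive (0, v'') sg)| |by []].
    exact: (symbol_bound_derive_zeta _ oU' RU' sg bg).
  exists w, (fun x => 'D_(0, v') g x).
  split; [exact: cw|exact: (rsmooth_derive (0, v') sg)| |by []].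
  exact: (symbol_bound_derive_zeta _ oU' RU' sg bg).
Qed.

Definition off_zero : set (M * M) := [set p | p.2 != 0].

Definition far : set (M * M) := [set p | 1 <= `|p.2|].

Lemma far_off_zero : far `<=` off_zero.
Proof.
move=> p; rewrite /far /off_zero/= => p1; apply/eqP => E.
by move: p1; rewrite E normr0 ler10.
Qed.

Lemma open_off_zero : @open P off_zero.
Proof.
rewrite -[X in X off_zero]/open.
rewrite (_ : off_zero = (fun p : M * M => `|p.2|) @^-1` [set s : R | s != 0]).
  apply: open_comp; last exact: open_neq.
  move=> p _; apply: continuous_comp; [exact: cvg_snd|exact: norm_continuous].
by apply/seteqP; split=> p /=; rewrite /off_zero/= normr_eq0.
Qed.

Definition rperiodic q := forall x t zeta, q ((x, t + 2 * pi), zeta) = q ((x, t), zeta).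

Definition rhomogeneous d q := forall (z zeta : M) (r : R), zeta != 0 -> 0 < r ->
  q (z, r *: zeta) = r `^ d * q (z, zeta).

Definition rexpansion d q (a : nat -> M * M -> R) : Prop :=
  (forall j, [/\ rsmooth off_zero (a j), rperiodic (a j) & rhomogeneous (d - j%:R) (a j)]) /\
  forall N, symbol_bound far (d - N%:R) (fun p => q p - \sum_(j < N) a j p).

Definition x_compact q : Prop := exists2 K : set 'rV[R]_n, compact K &
  forall x t zeta, ~ K x -> q ((x, t), zeta) = 0.

Definition rclassical d q : Prop :=
  [/\ rsmooth setT q, rperiodic q, x_compact q & exists a, rexpansion d q a].

Lemma Re_sum (I : Type) (s : seq I) (F : I -> R[i]) :
  complex.Re (\sum_(i <- s) F i) = \sum_(i <- s) complex.Re (F i).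
Proof.
by elim/big_rec2 : _ => //= i x y _ <-; case: (F i) => ? ?; case: y.
Qed.

Lemma Im_sum (I : Type) (s : seq I) (F : I -> R[i]) :
  complex.Im (\sum_(i <- s) F i) = \sum_(i <- s) complex.Im (F i).
Proof.
by elim/big_rec2 : _ => //= i x y _ <-; case: (F i) => ? ?; case: y.
Qed.

Lemma ReB (z w : R[i]) : complex.Re (z - w) = complex.Re z - complex.Re w.
Proof. by case: z w => ? ? []. Qed.

Lemma ImB (z w : R[i]) : complex.Im (z - w) = complex.Im z - complex.Im w.
Proof. by case: z w => ? ? []. Qed.

Lemma ReZ (a : R) (z : R[i]) : complex.Re (a%:C * z) = a * complex.Re z.
Proof. by case: z => x y /=; rewrite mul0r subr0. Qed.

Lemma ImZ (a : R) (z : R[i]) : complex.Im (a%:C * z) = a * complex.Im z.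
Proof. by case: z => x y /=; rewrite mul0r addr0. Qed.

Lemma complex_eqP (z w : R[i]) :
  z = w <-> complex.Re z = complex.Re w /\ complex.Im z = complex.Im w.
Proof. by split=> [->//|]; case: z w => ? ? [? ?] /= [-> ->]. Qed.

Local Notation normc := ComplexField.Normc.normc.

Lemma Re_le_normc (z : R[i]) : `|complex.Re z| <= normc z.
Proof.
by case: z => x y /=; rewrite -sqrtr_sqr ler_wsqrtr// lerDl sqr_ge0.
Qed.

Lemma Im_le_normc (z : R[i]) : `|complex.Im z| <= normc z.
Proof.
by case: z => x y /=; rewrite -sqrtr_sqr ler_wsqrtr// lerDr sqr_ge0.
Qed.

Lemma normc_le_ReIm (z : R[i]) : normc z <= `|complex.Re z| + `|complex.Im z|.
Proof.
case: z => x y /=; rewrite -(@ler_pXn2r _ 2) ?nnegrE ?sqrtr_ge0 ?addr_ge0//.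
rewrite sqr_sqrtr ?addr_ge0 ?sqr_ge0// sqrrD !real_normK ?num_real//.
by rewrite lerD2r lerDl mulrn_wge0// mulr_ge0.
Qed.

Lemma symbol_remainder_boundE d (r : M * M -> R[i]) :
  symbol_remainder_bound d r <->
  symbol_bound far d (fun p => complex.Re (r p)) /\
  symbol_bound far d (fun p => complex.Im (r p)).
Proof.
have RE vs ws p : complex.Re (cderives (dirs vs ws) r p) =
    rders (dirs vs ws) (fun p => complex.Re (r p)) p by rewrite -Re_cderives.
have IE vs ws p : complex.Im (cderives (dirs vs ws) r p) =
    rders (dirs vs ws) (fun p => complex.Im (r p)) p by rewrite -Im_cderives.
split=> [br|[bR bI] vs ws].
  split=> vs ws; have [c Hc] := br vs ws; exists c => p /Hc; apply: le_trans.
    by rewrite -RE; exact: Re_le_normc.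
  by rewrite -IE; exact: Im_le_normc.
have [c Hc] := bR vs ws; have [c' Hc'] := bI vs ws; exists (c + c') => p p1.
apply: le_trans (normc_le_ReIm _) _; rewrite RE IE mulrDl.
by rewrite lerD// ?Hc ?Hc'.
Qed.

Lemma classical_symbolE d (q : M * M -> R[i]) :
  classical_symbol d q <-> rclassical d (fun p => complex.Re (q p)) /\
                           rclassical d (fun p => complex.Im (q p)).
Proof.
split=> [[sq pq [K cK Kq] [a [aP aN]]]|[[sR pR [K cK KR] [aR [aRP aRN]]]
                                        [sI pI [K' cK' KI] [aI [aIP aIN]]]]].
  move/smooth_onE : sq => [sR sI]; split; split=> //.
  - by move=> x t zeta; rewrite pq.
  - by exists K => // x t zeta /Kq->.
  - exists (fun j p => complex.Re (a j p)); split=> [j|N].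
      have [/smooth_onE[sa _] pa ha] := aP j; split=> //.
        by move=> x t zeta; rewrite pa.
      by move=> z zeta r z0 r0; rewrite ha// ReZ.
    have /symbol_remainder_boundE[+ _] := aN N.
    by under eq_fun do rewrite ReB Re_sum.
  - by move=> x t zeta; rewrite pq.
  - by exists K => // x t zeta /Kq->.
  - exists (fun j p => complex.Im (a j p)); split=> [j|N].
      have [/smooth_onE[_ sa] pa ha] := aP j; split=> //.
        by move=> x t zeta; rewrite pa.
      by move=> z zeta r z0 r0; rewrite ha// ImZ.
    have /symbol_remainder_boundE[_ +] := aN N.
    by under eq_fun do rewrite ImB Im_sum.
split.
- by apply/smooth_onE.
- by move=> zeta x t; apply/complex_eqP; split; [exact: pR|exact: pI].
- exists (K `|` K'); first exact: compactU.
  move=> x t zeta /not_orP[xK xK']; apply/complex_eqP.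
  by split; [exact: KR|exact: KI].
- exists (fun j p => aR j p +i* aI j p); split=> [j|N].
    have [sa pa ha] := aRP j; have [sb pb hb] := aIP j; split.
    + by apply/smooth_onE.
    + by move=> zeta x t; rewrite pa pb.
    + by move=> z zeta r z0 r0; apply/complex_eqP; rewrite ReZ ImZ/= ha// hb.
  apply/symbol_remainder_boundE; split.
    by under eq_fun do rewrite ReB Re_sum; exact: aRN.
  by under eq_fun do rewrite ImB Im_sum; exact: aIN.
Qed.

Lemma rclassical_lin d c q q' : rclassical d q -> rclassical d q' ->
  rclassical d (fun p => c * q p + q' p).
Proof.
move=> [sq pq [K cK Kq] [a [aP aN]]] [sq' pq' [K' cK' Kq'] [a' [aP' aN']]].
split.
- exact: (rsmoothD openT (rsmoothZ c openT sq) sq').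
- by move=> x t zeta; rewrite pq pq'.
- exists (K `|` K'); first exact: compactU.
  by move=> x t zeta /not_orP[xK xK']; rewrite Kq// Kq'// mulr0 addr0.
exists (fun j p => c * a j p + a' j p); split=> [j|N].
  have [sa pa ha] := aP j; have [sb pb hb] := aP' j; split.
  - exact: (rsmoothD open_off_zero (rsmoothZ c open_off_zero sa) sb).
  - by move=> x t zeta; rewrite pa pb.
  - by move=> z zeta r z0 r0; rewrite ha// hb// mulrDr mulrCA.
have sr k : rsmooth off_zero (fun p => q p - \sum_(j < k) a j p).
  apply: (rsmoothB open_off_zero (rsmooth_sub (@subsetT _ _) sq)).
  by apply: (rsmooth_sum_ord k open_off_zero) => j; have [] := aP j.
have sr' k : rsmooth off_zero (fun p => q' p - \sum_(j < k) a' j p).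
  apply: (rsmoothB open_off_zero (rsmooth_sub (@subsetT _ _) sq')).
  by apply: (rsmooth_sum_ord k open_off_zero) => j; have [] := aP' j.
have := symbol_bound_lin c open_off_zero far_off_zero (sr N) (sr' N) (aN N) (aN' N).
congr symbol_bound; apply/funext => p.
by rewrite big_split/= -mulr_sumr mulrBr opprD addrACA.
Qed.

End ClassicalSymbols.

(** * Averages in the circle variable *)

Section ThetaAverage.
Context {R : realType} {n : nat}.
Local Notation M := (RnS1 R n).
Implicit Types (e d c : R) (g h q : M * M -> R).

Lemma Rintegral_eq0 (disp : measure_display) (T : measurableType disp)
    (mu : {measure set T -> \bar R}) (D : set T) (f : T -> R) :
  measurable D -> (forall x, D x -> f x = 0) -> \int[mu]_(x in D) f x = 0.
Proof.
move=> mD f0; transitivity (\int[mu]_(x in D) (fun=> 0) x).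
  by apply: eq_Rintegral => x /set_mem /f0.
by rewrite Rintegral_cst// mul0r.
Qed.

Lemma average_lin (V : normedModType R) (a b : R) (L : R -> V -> V) (w : R -> R)
    (c : R) (g h : V -> R) p :
  cts_in a b (fun t => w t * g (L t p)) -> cts_in a b (fun t => w t * h (L t p)) ->
  average a b L w (fun x => c * g x + h x) p =
  c * average a b L w g p + average a b L w h p.
Proof.
move=> cg ch; rewrite /average -RintegralZl//; last exact: cts_in_integrable.
rewrite -RintegralD//; last 2 first.
- exact/cts_in_integrable/cts_inZ.
- exact: cts_in_integrable.
by apply: eq_Rintegral => t _; rewrite mulrDr mulrCA.
Qed.

Lemma average0 (V : normedModType R) (a b : R) (L : R -> V -> V) (w : R -> R) p :
  average a b L w (fun=> 0) p = 0.
Proof.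
by apply: Rintegral_eq0 => // t _; rewrite mulr0.
Qed.

Lemma cts_in_sum (I : Type) (s : seq I) (a b : R) (F : I -> R -> R) :
  (forall i, cts_in a b (F i)) -> cts_in a b (fun t => \sum_(i <- s) F i t).
Proof.
move=> cF; elim: s => [|i s IH].
  by under eq_fun do rewrite big_nil; apply: cts_cts_in => t _; exact: cvg_cst.
under eq_fun do rewrite big_cons.
by move=> t; apply: continuousD; [exact: cF|exact: IH].
Qed.

Lemma average_sum (V : normedModType R) (a b : R) (L : R -> V -> V) (w : R -> R)
    (I : Type) (s : seq I) (F : I -> V -> R) p :
  (forall i, cts_in a b (fun t => w t * F i (L t p))) ->
  average a b L w (fun x => \sum_(i <- s) F i x) p = \sum_(i <- s) average a b L w (F i) p.
Proof.
move=> cF; elim: s => [|i s IH].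
  rewrite big_nil -[RHS](average0 a b L w p); congr (average a b L w _ p).
  by apply/funext => x; rewrite big_nil.
rewrite big_cons -IH -[X in _ = X + _]mul1r -average_lin//; last first.
  have := @cts_in_sum _ s _ _ _ cF; congr (cts_in a b _); apply/funext => t.
  by rewrite mulr_sumr.
by congr (average a b L w _ p); apply/funext => x; rewrite big_cons mul1r.
Qed.

Definition set_theta (t : R) (p : M * M) : M * M := ((p.1.1, t), p.2).

Definition theta_average (w : R -> R) g := average 0 (2 * pi) set_theta w g.

Let Nth (v : M * M) : M * M := ((v.1.1, 0), v.2).
Let Eth (v : M * M) : M * M := 0.

Let pi2 : 0 <= 2 * pi :> R. Proof. by rewrite mulr_ge0// pi_ge0. Qed.

Let cL U (p : M * M) (t : R) : U p -> 0 <= t <= 2 * pi ->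
  {for (p, t), continuous (fun z : (M * M) * R => set_theta z.2 z.1)}.
Proof.
move=> _ _; apply: cts_pair; first apply: cts_pair.
- apply: (@continuous_comp _ _ _ (fun z : (M * M) * R => z.1.1) fst); last exact: cvg_fst.
  by apply: (@continuous_comp _ _ _ fst fst); exact: cvg_fst.
- exact: cvg_snd.
- by apply: (@continuous_comp _ _ _ fst snd); [exact: cvg_fst|exact: cvg_snd].
Qed.

Let aL t (h : R) v p : set_theta t (h *: v + p) = h *: (t *: Eth v + Nth v) + set_theta t p.
Proof. by rewrite /Eth scaler0 add0r /set_theta /Nth; congr (_, _, _) => /=; rewrite scaler0 add0r. Qed.

Let LU (U : set (M * M)) : (forall p t, U p -> U (set_theta t p)) ->
  forall p t, U p -> 0 <= t <= 2 * pi -> U (set_theta t p).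
Proof. by move=> HU p t Up _; exact: HU. Qed.

Let offU (p : M * M) t : off_zero p -> off_zero (set_theta t p). Proof. by []. Qed.

Lemma theta_average_smooth (w : R -> R) g : continuous w -> rsmooth setT g ->
  rsmooth setT (theta_average w g).
Proof.
by move=> cw sg; apply: (rsmooth_average pi2 openT openT _ (@cL setT) aL cw sg).
Qed.

Lemma theta_average_in U (w : R -> R) g p : (forall p t, U p -> U (set_theta t p)) ->
  continuous w -> rsmooth U g -> U p ->
  cts_in 0 (2 * pi) (fun t => w t * g (set_theta t p)).
Proof. by move=> HU cw sg Up; exact: (average_in (LU HU) (@cL U) cw sg Up). Qed.

Lemma rclassical_theta_average d q (w : R -> R) : continuous w -> rclassical d q ->
  rclassical d (theta_average w q).
Proof.
move=> cw [sq pq [K cK Kq] [a [aP aN]]]; split.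
- exact: theta_average_smooth.
- by [].
- exists K => // x t zeta xK; apply: Rintegral_eq0 => // s _.
  by rewrite Kq// mulr0.
have sa j : rsmooth off_zero (a j) by have [] := aP j.
have soff : rsmooth off_zero q := rsmooth_sub (@subsetT _ _) sq.
exists (fun j => theta_average w (a j)); split=> [j|N].
  have [_ pa ha] := aP j; split.
  - exact: (rsmooth_average pi2 open_off_zero open_off_zero (LU offU) (@cL off_zero) aL cw (sa j)).
  - by [].
  - move=> z zeta r z0 r0; rewrite /theta_average /average -RintegralZl//.
      by apply: eq_Rintegral => t _; rewrite ha// mulrCA.
    exact/cts_in_integrable/(theta_average_in offU cw (sa j)).
have sR : rsmooth off_zero (fun p => q p - \sum_(j < N) a j p).
  exact: (rsmoothB open_off_zero soff (rsmooth_sum_ord N open_off_zero sa)).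
have ct g p : rsmooth off_zero g -> off_zero p ->
    cts_in 0 (2 * pi) (fun t => w t * g (set_theta t p)).
  by move=> sg p0; exact: (theta_average_in offU cw sg p0).
apply: (@symbol_bound_eq _ _ off_zero far _ (theta_average w (fun p => q p - \sum_(j < N) a j p))
  _ open_off_zero far_off_zero).
  move=> p p0; rewrite -(average_sum _ (fun j : 'I_N => ct _ _ (sa j) p0)).
  rewrite [RHS]addrC -mulN1r -average_lin; last 2 first.
  - exact: ct (rsmooth_sum_ord N open_off_zero sa) p0.
  - exact: ct.
  by congr (average _ _ _ w _ p); apply/funext => x; rewrite mulN1r addrC.
apply: (@symbol_bound_average _ _ 0 (2 * pi) off_zero off_zero set_theta Nth Eth
  far far w _ _ pi2 open_off_zero open_off_zero (LU offU) (@cL off_zero) aL _ _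
  far_off_zero far_off_zero _ cw sR (aN N)) => //.
- by move=> v; exists (v.1, 0), 0.
- by move=> v; exists v, 0.
Qed.

Lemma periodic_reduce (T : Type) (f : R -> T) : (forall t, f (t + 2 * pi) = f t) ->
  forall t, exists2 t', 0 <= t' <= 2 * pi & f t' = f t.
Proof.
move=> pf t.
have p0 : 0 < 2 * pi :> R by rewrite mulr_gt0// pi_gt0.
have pn (k : nat) s : f (s + k%:R * (2 * pi)) = f s.
  elim: k s => [|k IH] s; first by rewrite mul0r addr0.
  by rewrite -natr1 mulrDl mul1r addrA pf IH.
have pz (k : int) s : f (s + k%:~R * (2 * pi)) = f s.
  case: k => k; first exact: pn.
  by rewrite -(pn k.+1) NegzE mulrNz mulNr subrK.
pose k := Num.floor (t / (2 * pi)).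
exists (t + (- k)%:~R * (2 * pi)); last exact: pz.
have /andP[k1 k2] := floor_itv (t / (2 * pi)).
rewrite -/k in k1 k2.
move: k1 k2; rewrite -/k ler_pdivlMr// ltr_pdivrMr// intrD => k1 k2.
rewrite mulrNz mulNr; move: k1 k2; set P := 2 * pi; set kr := k%:~R => k1 k2.
by apply/andP; split; lra.
Qed.

End ThetaAverage.

(** * Translating a classical symbol in the dual circle variable *)

Section FibreShift.
Context {R : realType} {n : nat}.
Local Notation M := (RnS1 R n).
Implicit Types (e d c : R) (g h q : M * M -> R).

Lemma powR_comparable (x y K k : R) : 0 < x -> 0 < y -> 1 <= K ->
  x <= K * y -> y <= K * x -> x `^ k <= K `^ `|k| * y `^ k.
Proof.
move=> x0 y0 K1 xKy yKx; have K0 : 0 <= K := le_trans ler01 K1.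
have [k0|k0] := leP 0 k.
  by rewrite ger0_norm// -powRM ?(ltW y0)//; apply: ge0_ler_powR;
    rewrite ?nnegrE ?mulr_ge0 ?(ltW x0) ?(ltW y0).
rewrite ltr0_norm//.
have H : y `^ (- k) <= K `^ (- k) * x `^ (- k).
  by rewrite -powRM ?(ltW x0)//; apply: ge0_ler_powR;
    rewrite ?nnegrE ?mulr_ge0 ?oppr_ge0 ?(ltW x0) ?(ltW y0) ?(ltW k0).
rewrite -[X in x `^ X]opprK -[X in y `^ X]opprK !(powRN _ (- k)).
by rewrite ler_pdivlMr ?powR_gt0// mulrC ler_pdivrMr ?powR_gt0.
Qed.

Lemma cts_compact_bounded (T : topologicalType) (f : T -> R) (A : set T) :
  compact A -> continuous f -> exists C, forall x, A x -> `|f x| <= C.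
Proof.
move=> cA cf; have := @continuous_compact _ _ f A _ cA.
move=> /(_ (continuous_subspaceT cf)) /compact_bounded[C [_ HC]].
exists (C + 1) => x Ax; apply: HC; first by rewrite ltrDl.
by exists x.
Qed.

Lemma rperiodic_rders q us : rperiodic q -> rperiodic (rders us q).
Proof.
move=> pq x t zeta.
pose k (p : M * M) : M * M := p + ((0, 2 * pi), 0).
have ak v a (h : R) : k (h *: v + a) = h *: v + k a by rewrite /k addrA.
have qk : q \o k = q.
  apply/funext => -[[x' t'] zeta'] /=.
  have -> : k ((x', t'), zeta') = ((x', t' + 2 * pi), zeta').
    by congr ((_, _), _) => /=; rewrite addr0.
  exact: pq.
have := rders_affine us q ak ((x, t), zeta); rewrite qk map_id => ->.
by congr (rders us q); congr ((_, _), _) => /=; rewrite addr0.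
Qed.

Lemma compact_unit_fibre : compact [set zeta : M | `|zeta| <= 1].
Proof.
have -> : [set zeta : M | `|zeta| <= 1] =
    [set x : 'rV[R]_n | `|x| <= 1] `*` `[-1, 1]%classic.
  apply/seteqP; split=> -[x s] /=; rewrite prod_normE ge_max/= in_itv/= -ler_norml.
    by case/andP.
  by case=> -> ->.
apply: compact_setX; last exact: segment_compact.
apply: bounded_closed_compact.
  by exists 1; split=> // r r1 x /= /le_trans; apply; exact: ltW.
rewrite (_ : [set _ | _] = (fun x : 'rV[R]_n => `|x|) @^-1` [set r : R | r <= 1])//.
by apply: preimage_closed; [move=> x _; exact: norm_continuous|exact: closed_le].
Qed.

(** Near the zero section the estimates come from compactness, so that the
    symbol bounds hold on the whole space after replacing the norm by
    one plus the norm. *)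
Lemma rclassical_global d q : rclassical d q -> forall vs ws : seq M,
  exists2 c, 0 <= c &
    forall p, `|rders (dirs vs ws) q p| <= c * (1 + `|p.2|) `^ (d - (size ws)%:R).
Proof.
move=> [sq pq [K cK Kq] [a [_ /(_ 0)]]].
rewrite subr0 => b0 vs ws; set us := dirs vs ws; set k := d - _.
have {}b0 : symbol_bound far d q.
  by move: b0; congr symbol_bound; apply/funext => p; rewrite big_ord0 subr0.
have [c Hc] := b0 vs ws.
pose A : set (M * M) := (K `*` `[0, 2 * pi]%classic) `*` [set zeta : M | `|zeta| <= 1].
have cA : compact A.
  apply: compact_setX; last exact: compact_unit_fibre.
  by apply: compact_setX => //; exact: segment_compact.
have crq : continuous (rders us q).
  by move=> p; apply: rsmooth_cts (rsmooth_rders us sq) I.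
have [C HC] := cts_compact_bounded cA crq.
have pos (p : M * M) : 0 < 1 + `|p.2| by rewrite ltr_pwDl.
have zero x t zeta : ~ K x -> rders us q ((x, t), zeta) = 0.
  move=> xK; have clK := compact_closed (@norm_hausdorff _ _) cK.
  have oK : @open ((M * M)%type : normedModType R) [set p | ~ K p.1.1].
    have := closed_openC clK => oK.
    rewrite (_ : [set p | _] = (fun p : M * M => p.1.1) @^-1` (~` K))//.
    apply: open_comp => // p _.
    by apply: (@continuous_comp _ _ _ fst fst); exact: cvg_fst.
  rewrite (@rders_eq _ _ _ q (fun=> 0) us oK _ ((x, t), zeta))//.
    by rewrite rders_cst; case: (us).
  by move=> [[y s] zeta'] /= yK; exact: Kq.
exists (`|c| * 2 `^ `|k| + `|C| * 2 `^ `|k|).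
  by rewrite addr_ge0// mulr_ge0// powR_ge0.
move=> [[x t] zeta]; rewrite mulrDl.
have two (u y : R) : 0 < u -> 1 <= y -> u <= y -> y <= 2 * u ->
    u `^ k <= 2 `^ `|k| * y `^ k.
  move=> u0 y1 uy yu; apply: powR_comparable => //; rewrite ?ler1n ?(lt_le_trans ltr01)//.
  by rewrite (le_trans uy)// ler_peMl// ?(le_trans ler01)// ler1n.
have [z1|z1] := leP 1 `|zeta|.
  apply: ler_wpDr; first by rewrite !mulr_ge0// powR_ge0.
  have H1 : `|rders us q ((x, t), zeta)| <= c * `|zeta| `^ k := Hc ((x, t), zeta) z1.
  apply: (le_trans H1); rewrite -mulrA.
  apply: le_trans (ler_wpM2r _ (ler_norm c)) _; first exact: powR_ge0.
  rewrite ler_wpM2l//; apply: two => /=; rewrite ?lerDl ?lerDr//.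
    exact: lt_le_trans z1.
  by rewrite mulr_natl mulr2n lerD2r.
apply: ler_wpDl; first by rewrite !mulr_ge0// powR_ge0.
have [t' t'2 E] := periodic_reduce (fun t => rperiodic_rders us pq x t zeta) t.
rewrite -E; have [xK|xK] := pselect (K x); last first.
  by rewrite zero// normr0 !mulr_ge0// powR_ge0.
have H1 : `|rders us q ((x, t'), zeta)| <= C.
  by apply: HC; split=> /=; [split=> //=; rewrite in_itv|exact: ltW].
apply: (le_trans H1); rewrite -mulrA (le_trans (ler_norm C))// -[leLHS]mulr1 ler_wpM2l//.
have := two 1 (1 + `|zeta|); rewrite powR1; apply; rewrite ?lerDl//.
by rewrite mulr1 mulr2n lerD2l ltW.
Qed.

Lemma symbol_bound_rders_s e g i : rsmooth off_zero g -> symbol_bound far e g ->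
  symbol_bound far (e - i%:R) (rders (nseq i e_s) g).
Proof.
move=> sg bg; elim: i => [|i IH]; first by rewrite subr0.
rewrite -natr1 opprD addrA.
exact: (symbol_bound_derive_zeta _ open_off_zero far_off_zero
  (rsmooth_rders (nseq i e_s) sg) IH).
Qed.

Lemma rhomogeneous_derive e g (w : M) : rsmooth off_zero g -> rhomogeneous e g ->
  rhomogeneous (e - 1) (fun p => 'D_(0, w) g p).
Proof.
move=> sg hg z zeta r z0 r0; have rn0 : r != 0 by rewrite gt_eqF.
pose k (p : M * M) : M * M := (p.1, r *: p.2).
have o0 : off_zero (z, zeta) by [].
have ork : off_zero (z, r *: zeta) by rewrite /off_zero/= scaler_eq0 negb_or rn0.
have ak (h : R) : k (h *: (0, w) + (z, zeta)) = h *: (r *: (0, w) + 0) + k (z, zeta).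
  by rewrite /k addr0; congr (_, _) => /=; rewrite ?scaler0// scalerDr !scalerA mulrC.
have [E _] := derive_affine g ak.
have := E; rewrite (derive_lin r (0, w) 0 open_off_zero sg ork) derive0 addr0.
move=> E1.
have E2 : 'D_(0, w) (g \o k) (z, zeta) = r `^ e * 'D_(0, w) g (z, zeta).
  rewrite -[RHS](deriveZ (r `^ e) (rsmooth_derivable sg o0)).
  apply: near_eq_derive; near=> p.
  have p0 : off_zero p by near: p; exact: (open_nbhs_nbhs (conj open_off_zero o0)).
  by have := hg p.1 p.2 r p0 r0; rewrite /k/= -surjective_pairing.
apply: (mulfI rn0); rewrite -E1 E2 mulrA; congr (_ * _).
by rewrite powRB ?rn0 ?implybT// powRr1 ?ltW// mulrC divfK.
Unshelve. all: by end_near. Qed.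

Lemma rhomogeneous_rders_s e g i : rsmooth off_zero g -> rhomogeneous e g ->
  rhomogeneous (e - i%:R) (rders (nseq i e_s) g).
Proof.
move=> sg hg; elim: i => [|i IH]; first by rewrite subr0.
rewrite -natr1 opprD addrA.
exact: (rhomogeneous_derive (0, 1) (rsmooth_rders (nseq i e_s) sg) IH).
Qed.

Lemma triangle_sum N (F : nat -> nat -> R) :
  \sum_(l < N) \sum_(i < l.+1) F i (l - i)%N = \sum_(i < N) \sum_(j < N - i) F i j.
Proof.
elim: N => [|N IH]; first by rewrite !big_ord0.
rewrite big_ord_recr/= IH [RHS]big_ord_recr/= subSnn big_ord1.
rewrite [X in _ + X = _]big_ord_recr/= subnn addrA; congr (_ + _).
rewrite -big_split/=; apply: eq_bigr => i _.
by rewrite subSn ?big_ord_recr//= ltnW.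
Qed.

Definition shift_s c (p : M * M) : M * M := p + c *: e_s.

Lemma shift_sE c z xi s : shift_s c (z, (xi, s)) = (z, (xi, s + c)).
Proof.
by rewrite /shift_s/e_s; congr (_, (_, _)) => /=; rewrite ?scaler0 ?addr0// [c *: 1]mulr1.
Qed.

Let shift_affine c v a (h : R) : shift_s c (h *: v + a) = h *: v + shift_s c a.
Proof. by rewrite /shift_s addrA. Qed.

Lemma continuous_shift_s c : continuous (shift_s c).
Proof. by move=> p; apply: cvgD; [exact: cvg_id|exact: cvg_cst]. Qed.

Lemma rsmooth_shift c q : rsmooth setT q -> rsmooth setT (q \o shift_s c).
Proof. by move=> sq; exact: (rsmooth_affine (shift_affine c) (@continuous_shift_s c) sq). Qed.

Lemma taylor_remainder_bound d q c N : rclassical d q ->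
  symbol_bound far (d - N%:R) (fun p => q (shift_s c p) -
    \sum_(i < N) c ^+ i / i`!%:R * rders (nseq i e_s) q p).
Proof.
move=> /[dup] cq [sq _ _ _] vs ws.
have [C C0 HC] := rclassical_global cq vs (ws ++ nseq N (0, 1)).
set k := d - _ in HC.
have Ek : k = d - N%:R - (size ws)%:R 
  by rewrite /k size_cat size_nseq natrD opprD addrA addrAC.
exists (`|c| ^+ N * (C * (2 + `|c|) `^ `|k|)) => p p1.
rewrite -Ek.
have s1 := rsmooth_shift c sq.
have s2 i : rsmooth setT (fun p => c ^+ i / i`!%:R * rders (nseq i e_s) q p).
  exact: (rsmoothZ _ openT (rsmooth_rders (nseq i e_s) sq)).
have -> : rders (dirs vs ws) (fun p => q (shift_s c p) -
      \sum_(i < N) c ^+ i / i`!%:R * rders (nseq i e_s) q p) p =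
    rders (dirs vs ws) q (p + c *: e_s) -
      \sum_(i < N) c ^+ i / i`!%:R * rders (nseq i e_s) (rders (dirs vs ws) q) p.
  have := rders_lin (dirs vs ws) (-1) openT (rsmooth_sum_ord N openT s2) s1 I.
  move=> /(_ p); rewrite (_ : (fun x => -1 * _ + _) = (fun p => q (shift_s c p) -
      \sum_(i < N) c ^+ i / i`!%:R * rders (nseq i e_s) q p)); last first.
    by apply/funext => x; rewrite mulN1r addrC.
  move=> ->; rewrite mulN1r addrC; congr (_ - _).
    by rewrite (rders_affine _ _ (shift_affine c)) map_id.
  rewrite (rders_sum _ _ openT (fun i : 'I_N => s2 i) I); apply: eq_bigr => i _.
  rewrite (rdersZ _ _ openT (rsmooth_rders (nseq i e_s) sq) I).
  by rewrite (rders_comm _ _ openT sq I).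
rewrite -mulrA; apply: taylor_line; first exact: (rsmooth_rders (dirs vs ws) sq).
move=> t tc.
have -> : rders (nseq N e_s) (rders (dirs vs ws) q) =
    rders (dirs vs (ws ++ nseq N (0, 1))) q.
  apply/funext => x; rewrite (rders_comm _ _ openT sq I) -rders_cat.
  by rewrite /dirs map_cat map_nseq catA.
apply: le_trans (HC _) _; rewrite -mulrA ler_wpM2l//.
have p10 : 0 < `|p.2| := lt_le_trans ltr01 p1.
have c0 : 0 <= `|c| by [].
have dist : `|t *: ((0, 1) : M)| <= `|c|.
  by rewrite normrZ prod_normE/= normr0 normr1 max_r// mulr1.
have up : `|(p + t *: e_s).2| <= `|p.2| + `|c|.
  by apply: le_trans (ler_normD _ _) _; rewrite lerD2l.
have lo : `|p.2| <= `|(p + t *: e_s).2| + `|c|.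
  by rewrite -lerBlDr; apply: le_trans (lerB_normD _ _); rewrite lerD2l lerN2.
have {}p1 : 1 <= `|p.2| := p1.
move: up lo; set X := `|(p + _).2|; move=> up lo.
have X0 : 0 <= X by rewrite /X.
apply: powR_comparable => //.
- by rewrite ltr_pwDl.
- by rewrite (le_trans (ler1n _ 2))// lerDl.
- by move: p1 up c0 {lo HC Ek p10 dist}; set P := `|p.2|; set k' := `|c|; nra.
- by move: p1 lo c0 X0 {up HC Ek p10 dist}; set P := `|p.2|; set k' := `|c|; nra.
Qed.

(** The term of index l of the new expansion collects the Taylor terms
    [c^i / i! d_s^i a_j] with [i + j = l], which share their degree. *)
Lemma rclassical_shift d q c : rclassical d q -> rclassical d (q \o shift_s c).
Proof.
move=> /[dup] cq [sq pq [K cK Kq] [a [aP aN]]].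
have sa j : rsmooth off_zero (a j) by have [] := aP j.
have soff : rsmooth off_zero q := rsmooth_sub (@subsetT _ _) sq.
pose F i j (p : M * M) := c ^+ i / i`!%:R * rders (nseq i e_s) (a j) p.
have sF i j : rsmooth off_zero (F i j).
  exact: (rsmoothZ _ open_off_zero (rsmooth_rders (nseq i e_s) (sa j))).
split.
- exact: rsmooth_shift.
- by move=> x t [xi s] /=; rewrite !shift_sE pq.
- by exists K => // x t [xi s] xK /=; rewrite shift_sE Kq.
exists (fun l p => \sum_(i < l.+1) F i (l - i)%N p); split=> [l|N].
  split.
  - exact: (@rsmooth_sum_ord _ _ l.+1 off_zero (fun i => F i (l - i)%N) open_off_zero).
  - move=> x t zeta; apply: eq_bigr => i _; congr (_ * _).
    by apply: rperiodic_rders; have [] := aP (l - i)%N.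
  - move=> z zeta r z0 r0; rewrite mulr_sumr; apply: eq_bigr => -[i il] _.
    have [_ _ ha] := aP (l - i)%N.
    rewrite /F (rhomogeneous_rders_s i (sa _) ha)// mulrCA; congr (_ `^ _ * _).
    by rewrite -addrA -opprD -natrD subnK.
pose A (p : M * M) := q (shift_s c p) - \sum_(i < N) c ^+ i / i`!%:R * rders (nseq i e_s) q p.
pose Rm i (p : M * M) := q p - \sum_(j < N - i) a j p.
have sRm i : rsmooth off_zero (Rm i).
  exact: (rsmoothB open_off_zero soff (rsmooth_sum_ord (N - i) open_off_zero sa)).
pose T i (p : M * M) := c ^+ i / i`!%:R * rders (nseq i e_s) (Rm i) p.
have sT i : rsmooth off_zero (T i).
  exact: (rsmoothZ _ open_off_zero (rsmooth_rders (nseq i e_s) (sRm i))).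
have sA : rsmooth off_zero A.
  apply: (rsmoothB open_off_zero (rsmooth_sub (@subsetT _ _) (rsmooth_shift c sq))).
  apply: (@rsmooth_sum_ord _ _ N off_zero (fun i p => c ^+ i / i`!%:R * rders (nseq i e_s) q p) open_off_zero) => i.
  exact: (rsmoothZ _ open_off_zero (rsmooth_rders (nseq i e_s) soff)).
apply: (@symbol_bound_eq _ _ off_zero far _ (fun p => A p + \sum_(i < N) T i p) _
  open_off_zero far_off_zero).
  move=> p p0; rewrite /A (triangle_sum N (fun i j => F i j p)) -addrA; congr (_ + _).
  rewrite addrC -sumrB -sumrN; apply: eq_bigr => i _; rewrite /T /F -mulrBr -mulr_sumr -mulrN.
  congr (_ * _); rewrite -(rders_sum _ _ open_off_zero (fun j : 'I_(N - i) => sa j) p0).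
  have := rders_lin (nseq i e_s) (-1) open_off_zero (rsmooth_sum_ord (N - i) open_off_zero sa) soff p0.
  rewrite (_ : (fun x => -1 * _ + _) = Rm i); last first.
    by apply/funext => x; rewrite mulN1r addrC.
  by move=> ->; rewrite mulN1r addrK.
apply: (symbol_boundD open_off_zero far_off_zero sA (rsmooth_sum_ord N open_off_zero sT)).
  exact: taylor_remainder_bound.
apply: (@symbol_bound_sum _ _ _ _ off_zero far _ (fun (i : 'I_N) p => T i p) open_off_zero far_off_zero).
  by move=> i; exact: sT.
move=> i; apply: (symbol_boundZ _ open_off_zero far_off_zero (rsmooth_rders (nseq i e_s) (sRm i))).
have := symbol_bound_rders_s i (sRm i) (aN (N - i)%N).
by rewrite -addrA -opprD -natrD subnK// ltnW.
Qed.

End FibreShift.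

(** * Dividing a symbol by the dual circle variable *)

Section FTC.
Context {R : realType}.

Lemma Rintegral_FTC (F f : R -> R) (a b : R) : a < b ->
  (forall t, a <= t <= b -> is_derive t (1 : R) F (f t)) ->
  (forall t, a <= t <= b -> {for t, continuous f}) ->
  \int[lebesgue_measure]_(t in `[a, b]) f t = F b - F a.
Proof.
move=> ab dF cf.
have cF t : a <= t <= b -> {for t, continuous F}.
  move=> tab; apply: differentiable_continuous; apply/derivable1_diffP.
  by have [] := dF t tab.
have incl t : t \in `]a, b[ -> a <= t <= b.
  by rewrite in_itv/= => /andP[/ltW-> /ltW->].
rewrite /Rintegral (@continuous_FTC2 _ f F a b ab)//.
- exact: cts_cts_in.
- split.
  + by move=> t /incl /dF [].
  + by apply: cvg_at_right_filter; apply: cF; rewrite lexx ltW.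
  + by apply: cvg_at_left_filter; apply: cF; rewrite lexx ltW.
- by move=> t /incl /dF [_ <-]; rewrite derive1E.
Qed.

End FTC.

Section FibreDivision.
Context {R : realType} {n : nat}.
Local Notation M := (RnS1 R n).
Local Notation P := ((M * M)%type : normedModType R).
Implicit Types (e d c : R) (g h q : M * M -> R).

Definition scale_s (t : R) (p : M * M) : M * M := (p.1, (p.2.1, t * p.2.2)).

Let Ns (v : M * M) : M * M := (v.1, (v.2.1, 0)).
Let Es (v : M * M) : M * M := (0, (0, v.2.2)).

Let aL t (h : R) v p : scale_s t (h *: v + p) = h *: (t *: Es v + Ns v) + scale_s t p.
Proof.
rewrite /scale_s /Es /Ns; congr (_, (_, _)) => /=.
- by rewrite scaler0 add0r.
- by rewrite scaler0 add0r.
- by rewrite addr0 mulrDr; congr (_ + _); exact: mulrCA.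
Qed.

Let cL (U : set (M * M)) (p : M * M) (t : R) : U p -> 0 <= t <= 1 ->
  {for (p, t), continuous (fun z : (M * M) * R => scale_s z.2 z.1)}.
Proof.
move=> _ _.
have c22 : {for (p, t), continuous (fun z : (M * M) * R => z.1.2.2)}.
  apply: (@continuous_comp _ _ _ (fun z : (M * M) * R => z.1.2) snd); last exact: cvg_snd.
  by apply: (@continuous_comp _ _ _ fst snd); [exact: cvg_fst|exact: cvg_snd].
apply: cts_pair; [|apply: cts_pair].
- by apply: (@continuous_comp _ _ _ fst fst); exact: cvg_fst.
- apply: (@continuous_comp _ _ _ (fun z : (M * M) * R => z.1.2) fst); last exact: cvg_fst.
  by apply: (@continuous_comp _ _ _ fst snd); [exact: cvg_fst|exact: cvg_snd].
- by apply: continuousM; [exact: cvg_snd|exact: c22].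
Qed.

Let cst1 : continuous ((fun=> 1) : R -> R). Proof. by move=> t; exact: cvg_cst. Qed.

(** The quotient by the fibre variable $s$, extended to $s = 0$ as for a
    function vanishing there. *)
Definition div_s g (p : M * M) : R :=
  if p.2.2 == 0 then 'D_e_s g p else g p / p.2.2.

(** Hadamard's formula: the quotient is the average of the derivative over a
    segment, hence smooth. *)
Lemma div_s_average (U : set (M * M)) g : @open P U ->
  (forall p t, U p -> 0 <= t <= 1 -> U (scale_s t p)) ->
  rsmooth U g -> (forall p, U p -> p.2.2 = 0 -> g p = 0) ->
  forall p, U p -> div_s g p = average 0 1 scale_s (fun=> 1) (fun x => 'D_e_s g x) p.
Proof.
move=> oU LU sg g0 p Up; rewrite /div_s /average.
have scale1 : scale_s 1 p = p by rewrite /scale_s mul1r -!surjective_pairing.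
case: ifPn => [/eqP s0|s0].
  transitivity (\int[lebesgue_measure]_(t in `[(0 : R), 1]) (fun=> 'D_e_s g p) t).
    by rewrite Rintegral_cst//= lebesgue_measure_itv/= lte_fin ltr01 sube0 mulr1.
  apply: eq_Rintegral => t _; rewrite mul1r; congr ('D__ g _).
  by rewrite -[LHS]scale1 /scale_s s0 !mulr0.
have cts t : 0 <= t <= 1 -> {for t, continuous (fun t => 'D_e_s g (scale_s t p))}.
  move=> t01.
  apply: (@continuous_comp _ _ _ (fun t => scale_s t p) (fun x => 'D_e_s g x)).
    apply: (@continuous_comp _ _ _ (fun t => (p, t)) (fun z : (M * M) * R => scale_s z.2 z.1)).
      by apply: cts_pair; [exact: cvg_cst|exact: cvg_id].
    exact: (@cL U).
  exact: (rsmooth_cts (rsmooth_derive e_s sg) (LU p t Up t01)).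
have -> : \int[lebesgue_measure]_(t in `[0, 1]) (1 * 'D_e_s g (scale_s t p)) =
    \int[lebesgue_measure]_(t in `[0, 1]) (p.2.2^-1 * (p.2.2 * 'D_e_s g (scale_s t p))).
  by apply: eq_Rintegral => t _; rewrite mul1r mulKf.
have ci : cts_in 0 1 (fun t => p.2.2 * 'D_e_s g (scale_s t p)).
  by apply: cts_inZ; exact: cts_cts_in.
rewrite RintegralZl//; last exact: cts_in_integrable.
have -> : \int[lebesgue_measure]_(t in `[0, 1]) (p.2.2 * 'D_e_s g (scale_s t p)) =
    g (scale_s 1 p) - g (scale_s 0 p).
  apply: (@Rintegral_FTC _ (fun t => g (scale_s t p)) _ _ _ ltr01) => t t01; last first.
    by apply: continuousM; [exact: cvg_cst|exact: cts].
  have Ut := LU p t Up t01.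
  have ak (h : R) : scale_s (h *: 1 + t) p = h *: (p.2.2 *: e_s + 0) + scale_s t p.
    rewrite /scale_s /e_s addr0; congr (_, (_, _)) => /=; rewrite ?scaler0 ?add0r//.
    by rewrite /GRing.scale/= !mulr1 mulrDl.
  have [E H] := @derive_affine _ _ _ _ g (fun t => scale_s t p) t 1 _ ak.
  apply: DeriveDef; first by apply: H; exact: (rsmooth_derivable sg Ut).
  by rewrite [LHS]E (derive_lin _ _ _ oU sg Ut) derive0 addr0.
rewrite scale1 (g0 (scale_s 0 p)) ?subr0 1?mulrC//.
  by apply: LU => //; rewrite lexx ler01.
by rewrite /= mul0r.
Qed.

Definition xi_neq0 : set (M * M) := [set p | p.2.1 != 0].

Lemma open_xi_neq0 : @open P xi_neq0.
Proof.
rewrite (_ : xi_neq0 = (fun p : M * M => `|p.2.1|) @^-1` [set s : R | s != 0]).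
  apply: open_comp; last exact: open_neq.
  move=> p _; apply: continuous_comp; last exact: norm_continuous.
  by apply: (@continuous_comp _ _ _ snd fst); [exact: cvg_snd|exact: cvg_fst].
by apply/seteqP; split=> p /=; rewrite /xi_neq0/= normr_eq0.
Qed.

Lemma xi_neq0_off_zero : xi_neq0 `<=` off_zero.
Proof. by move=> p; apply: contra => /eqP ->. Qed.

Lemma s_neq0_off_zero : [set p : M * M | p.2.2 != 0] `<=` off_zero.
Proof. by move=> p; apply: contra => /eqP ->. Qed.

Let xiL p t : xi_neq0 p -> 0 <= t <= 1 -> xi_neq0 (scale_s t p). Proof. by []. Qed.

Lemma div_s_smooth g : rsmooth off_zero g ->
  (forall p, off_zero p -> p.2.2 = 0 -> g p = 0) -> rsmooth off_zero (div_s g).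
Proof.
move=> sg g0.
have s1 : rsmooth xi_neq0 (div_s g).
  have sgx := rsmooth_sub xi_neq0_off_zero sg.
  apply: (rsmooth_eq open_xi_neq0 (fun p Up => esym
    (div_s_average open_xi_neq0 xiL sgx (fun p Up => g0 p (xi_neq0_off_zero Up)) Up))).
  exact: (rsmooth_average ler01 open_xi_neq0 open_xi_neq0 xiL (@cL xi_neq0) aL cst1
    (rsmooth_derive e_s sgx)).
have s2 : rsmooth [set p : M * M | p.2.2 != 0] (div_s g).
  have sgx := rsmooth_sub s_neq0_off_zero sg.
  apply: (@rsmooth_eq _ _ _ (fun p => g p * (s_var p)^-1) _ open_s_neq0).
    by move=> p /= s0; rewrite /div_s (negbTE s0).
  apply: (rsmoothM open_s_neq0 sgx).
  by apply: (rsmoothV open_s_neq0 (rsmooth_s_var open_s_neq0)).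
have -> : off_zero = \bigcup_b (if b then xi_neq0 else [set p : M * M | p.2.2 != 0]).
  apply/seteqP; split=> [[z [xi s]]|p [[] _ /=]].
  - rewrite /off_zero/= => p0; have [xi0|xi0] := eqVneq xi 0; last by exists true.
    exists false => //=; apply: contra p0 => /eqP ->; by rewrite xi0.
  - exact: xi_neq0_off_zero.
  - exact: s_neq0_off_zero.
by apply: rsmooth_union => -[].
Qed.

Lemma div_s_smoothT q : rsmooth setT q -> (forall p, p.2.2 = 0 -> q p = 0) ->
  rsmooth setT (div_s q).
Proof.
move=> sq q0.
apply: (rsmooth_eq openT (fun p Up => esym
    (@div_s_average setT q openT (fun _ _ _ _ => I) sq (fun p _ => q0 p) p Up))).
exact: (rsmooth_average ler01 openT openT (fun _ _ _ _ => I) (@cL setT) aL cst1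
    (rsmooth_derive e_s sq)).
Qed.

Lemma mul_div_s q p : (p.2.2 = 0 -> q p = 0) -> q p = p.2.2 * div_s q p.
Proof.
by rewrite /div_s; case: eqP => [-> ->|/eqP s0 _]; rewrite ?mul0r// mulrC divfK.
Qed.

(** Where $|s| \le |\xi|$ the segment in Hadamard's formula keeps the norm of the
    fibre variable; where $|s| \ge |\xi|$, dividing by $s$ gains one order. *)
Lemma symbol_bound_div_s e g : rsmooth off_zero g ->
  (forall p, off_zero p -> p.2.2 = 0 -> g p = 0) ->
  symbol_bound far e g -> symbol_bound far (e - 1) (div_s g).
Proof.
move=> sg g0 bg.
pose R1 : set (M * M) := far `&` [set p | `|p.2.2| <= `|p.2.1| ].
pose R2 : set (M * M) := far `&` [set p | `|p.2.1| <= `|p.2.2| ].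
have norm1 (p : M * M) : `|p.2.2| <= `|p.2.1| -> `|p.2| = `|p.2.1|.
  by rewrite prod_normE => /max_idPl.
have norm2 (p : M * M) : `|p.2.1| <= `|p.2.2| -> `|p.2| = `|p.2.2|.
  by rewrite prod_normE => /max_idPr.
have R1xi : R1 `<=` xi_neq0.
  move=> p [p1 /norm1 pE]; rewrite /xi_neq0/= -normr_gt0 -pE.
  exact: lt_le_trans ltr01 p1.
have R2s : R2 `<=` [set p : M * M | p.2.2 != 0].
  move=> p [p1 /norm2 pE]; rewrite /= -normr_gt0 -pE.
  exact: lt_le_trans ltr01 p1.
have b1 : symbol_bound R1 (e - 1) (div_s g).
  have sgx := rsmooth_sub xi_neq0_off_zero sg.
  apply: (symbol_bound_eq open_xi_neq0 R1xi (fun p Up => esym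
    (div_s_average open_xi_neq0 xiL sgx (fun p Up => g0 p (xi_neq0_off_zero Up)) Up))).
  have sD := rsmooth_derive e_s sgx.
  have bD := symbol_bound_derive_zeta (0, 1) open_off_zero far_off_zero sg bg.
  apply: (@symbol_bound_average _ _ 0 1 xi_neq0 xi_neq0 scale_s Ns Es R1 R1
    (fun=> 1) (e - 1) _ ler01 open_xi_neq0 open_xi_neq0 xiL (@cL xi_neq0) aL _ _
    R1xi R1xi _ cst1 sD).
  - by move=> v; exists v, 0; rewrite /Ns /Es.
  - by move=> v; exists (v.1, 0), (0, v.2); rewrite /Ns /Es.
  - move=> p t [p1 p2] /andP[t0 t1].
    have sE : `|(scale_s t p).2.2| <= `|(scale_s t p).2.1|.
      apply: le_trans p2; rewrite /= normrM ger0_norm//.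
      by rewrite ler_piMl.
    have nE : `|(scale_s t p).2| = `|p.2| by rewrite (norm1 _ sE) (norm1 _ p2).
    by split=> //; split=> //; rewrite /far/= nE.
  - by apply: symbol_bound_subset bD => p [].
have b2 : symbol_bound R2 (e - 1) (div_s g).
  have sgx := rsmooth_sub s_neq0_off_zero sg.
  have R2E p : R2 p -> `|p.2.2| = `|p.2| by move=> [_ /norm2].
  have bV := @symbol_bound_sV _ _ R2 1 R2s R2E.
  have sV : rsmooth [set p : M * M | p.2.2 != 0] (fun p => (s_var p)^-1 ^+ 1).
    exact: (rsmoothV open_s_neq0 (rsmooth_s_var open_s_neq0) (fun p => id)).
  have bg2 : symbol_bound R2 e g by apply: symbol_bound_subset bg => p [].
  have R2n p : R2 p -> p.2 != 0 by move=> [/far_off_zero].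
  have := symbol_boundM open_s_neq0 R2s R2n sgx sV bg2 bV.
  apply: (symbol_bound_eq open_s_neq0 R2s) => p s0.
  by rewrite /div_s (negbTE s0).
move=> vs ws; have [c1 H1] := b1 vs ws; have [c2 H2] := b2 vs ws.
exists (Num.max c1 c2) => p p1.
have [h|h] := leP `|p.2.2| `|p.2.1|.
  apply: le_trans (H1 p (conj p1 h)) _.
  by rewrite ler_wpM2r ?powR_ge0// le_max lexx.
apply: le_trans (H2 p (conj p1 (ltW h))) _.
by rewrite ler_wpM2r ?powR_ge0// le_max lexx orbT.
Qed.

End FibreDivision.

(** * Division by finitely many frequencies, and the modes of a symbol *)

Section SymbolDivision.
Context {R : realType} {n : nat}.
Local Notation M := (RnS1 R n).
Local Notation P := ((M * M)%type : normedModType R).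
Implicit Types (e d c : R) (g h : M * M -> R) (q : M * M -> R[i]).

Let div_sB g h p : rsmooth off_zero g -> rsmooth off_zero h -> off_zero p ->
  div_s (fun x => g x - h x) p = div_s g p - div_s h p.
Proof.
move=> sg sh p0; rewrite /div_s; case: ifP => _; last by rewrite mulrBl.
exact: (deriveB (rsmooth_derivable sg p0) (rsmooth_derivable sh p0)).
Qed.

Let div_s_sum N (a : nat -> M * M -> R) p : (forall j, rsmooth off_zero (a j)) -> off_zero p ->
  div_s (fun x => \sum_(j < N) a j x) p = \sum_(j < N) div_s (a j) p.
Proof.
move=> sa p0; rewrite /div_s; case: ifP => _; last by rewrite mulr_suml.
exact: (@rders_sum _ _ _ _ _ [:: e_s] (fun (j : 'I_N) x => a j x) p open_off_zero (fun j => sa j) p0).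
Qed.

Lemma rperiodic_div_s g : rperiodic g -> rperiodic (div_s g).
Proof.
move=> pg x t zeta; rewrite /div_s pg /=.
by have := rperiodic_rders [:: e_s] pg x t zeta => /= ->.
Qed.

Lemma rhomogeneous_div_s e g : rsmooth off_zero g -> rhomogeneous e g ->
  rhomogeneous (e - 1) (div_s g).
Proof.
move=> sg hg z [xi s] r z0 r0; have rn0 : r != 0 by rewrite gt_eqF.
rewrite /div_s /= mulf_eq0 (negbTE rn0) orFb; case: ifP => [_|s0].
  exact: (rhomogeneous_derive (0, 1) sg hg).
rewrite hg// powRB ?rn0 ?implybT// powRr1 ?ltW//.
by rewrite -[r *: s]/(r * s) invfM mulrACA -mulrA.
Qed.

(** The homogeneous terms inherit the vanishing on $s = 0$: along a ray in
    $s = 0$ the first non-zero term would dominate the remainder. *)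
Lemma expansion_vanish d (q : M * M -> R) a : rexpansion d q a ->
  (forall p, p.2.2 = 0 -> q p = 0) ->
  forall j p, off_zero p -> p.2.2 = 0 -> a j p = 0.
Proof.
move=> [aP aN] q0 j; elim/ltn_ind: j => N IH [z zeta] p0 /= s0.
have [_ _ ha] := aP N; have [c Hc] := symbol_bound0P (aN N.+1).
have z0 : 0 < `|zeta| by rewrite normr_gt0.
set A := a N (z, zeta).
have H r : 0 < r -> 1 <= r * `|zeta| -> `|A| * r <= c * `|zeta| `^ (d - N.+1%:R).
  move=> r0 r1.
  have /Hc : far (z, r *: zeta) by rewrite /far/= normrZ gtr0_norm.
  have rz : off_zero (z, r *: zeta).
    by rewrite /off_zero/= scaler_eq0 negb_or gt_eqF.
  have rs : (z, r *: zeta).2.2 = 0 by rewrite /= s0 [r *: _]mulr0.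
  rewrite q0// sub0r normrN big_ord_recr/= big1 ?add0r; last first.
    by move=> i _; apply: IH.
  have E1 : a N (z, r *: zeta) = r `^ (d - N%:R) * A := ha z zeta r p0 r0.
  have E2 : `|r *: zeta| = r * `|zeta| by rewrite normrZ gtr0_norm.
  rewrite E1 E2 normrM (ger0_norm (powR_ge0 _ _)) (powRM _ (ltW r0) (ltW z0)).
  have E3 : r `^ (d - N.+1%:R) = r `^ (d - N%:R) / r.
    rewrite -natr1 opprD addrA (@powRB _ r (d - N%:R) 1) ?(gt_eqF r0) ?implybT//.
    by rewrite powRr1 ?ltW.
  rewrite E3 -[X in c * X]mulrA [c * _]mulrCA ler_pM2l ?powR_gt0// mulrCA.
  by rewrite ler_pdivlMl// mulrC.
apply/eqP; rewrite -normr_le0; apply/ler_addgt0Pl => eps e0; rewrite addr0.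
set C := c * _ in H.
pose r := `|zeta|^-1 + `|C| / eps.
have r0 : 0 < r by rewrite ltr_wpDr ?divr_ge0 ?invr_gt0// ltW.
have r1 : 1 <= r * `|zeta|.
  by rewrite /r mulrDl mulVf ?(gt_eqF z0)// lerDl mulr_ge0// divr_ge0// ltW.
rewrite -(ler_pM2r r0); apply: le_trans (H r r0 r1) _; apply: le_trans (ler_norm C) _.
rewrite /r mulrDr mulrCA divff ?(gt_eqF e0)// mulr1 lerDr.
by rewrite mulr_ge0 ?invr_ge0// ltW.
Qed.

(** The homogeneous terms vanish on [s = 0] together with the symbol, so that
    the expansion may be divided term by term. *)
Lemma rclassical_div_s d (q : M * M -> R) : rclassical d q ->
  (forall p, p.2.2 = 0 -> q p = 0) -> rclassical (d - 1) (div_s q).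
Proof.
move=> [sq pq [K cK Kq] [a ea]] q0; have a0 := expansion_vanish ea q0.
have [aP aN] := ea.
have sa j : rsmooth off_zero (a j) by have [] := aP j.
have soff : rsmooth off_zero q := rsmooth_sub (@subsetT _ _) sq.
split.
- exact: div_s_smoothT.
- exact: rperiodic_div_s.
- exists K => // x t zeta xK; have clK := compact_closed (@norm_hausdorff _ _) cK.
  have oK : @open P [set p | ~ K p.1.1].
    rewrite (_ : [set p | _] = (fun p : M * M => p.1.1) @^-1` (~` K))//.
    apply: open_comp => [p _|]; last exact: closed_openC.
    by apply: (@continuous_comp _ _ _ fst fst); exact: cvg_fst.
  rewrite /div_s Kq// mul0r.
  have := @rders_eq _ _ _ q (fun=> 0) [:: e_s] oK _ ((x, t), zeta) xK.
  by move=> /= ->; [rewrite derive_cst if_same|move=> [[y s] zeta'] /= yK; exact: Kq].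
exists (fun j => div_s (a j)); split=> [j|N].
  have [_ pa ha] := aP j; split.
  - exact: (div_s_smooth (sa j) (a0 j)).
  - exact: rperiodic_div_s.
  - by rewrite addrAC; exact: rhomogeneous_div_s.
have sS := rsmooth_sum_ord N open_off_zero sa.
have sR := rsmoothB open_off_zero soff sS.
rewrite addrAC; apply: (symbol_bound_eq open_off_zero far_off_zero) (symbol_bound_div_s sR _ (aN N)).
  by move=> p p0; rewrite (div_sB soff sS p0) div_s_sum.
by move=> p p0 s0; rewrite q0// sub0r big1 ?oppr0// => j _; exact: a0.
Qed.

Definition theta_indep (T : Type) (f : M * M -> T) :=
  forall x t t' zeta, f ((x, t), zeta) = f ((x, t'), zeta).

Lemma theta_indep_div_s g : theta_indep g -> theta_indep (div_s g).
Proof.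
move=> ig x t t' zeta; rewrite /div_s (ig x t t') /=; congr (if _ then _ else _).
pose k (p : M * M) : M * M := p + ((0, t' - t), 0).
have ak v a (h : R) : k (h *: v + a) = h *: v + k a by rewrite /k addrA.
have gk : g \o k = g.
  apply/funext => -[[x' s] zeta'] /=.
  rewrite (_ : k _ = ((x', s + (t' - t)), zeta')); last by congr ((_, _), _) => /=; rewrite addr0.
  exact: ig.
have [] := @derive_affine _ _ _ _ g k ((x, t), zeta) e_s e_s (ak _ _).
rewrite gk => -> _; apply: (congr1 (fun p => 'D_e_s g p)).
by congr ((_, _), _) => /=; rewrite ?addr0// addrC subrK.
Qed.

(** Division by $s - c$ is division by $s$ conjugated by a fibre shift. *)
Lemma symbol_division d q c : classical_symbol d q -> theta_indep q ->
  (forall p, p.2.2 = c -> q p = 0) ->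
  exists r, [/\ classical_symbol (d - 1) r, theta_indep r &
    forall p, q p = (p.2.2 - c)%:C * r p].
Proof.
move=> /classical_symbolE[cR cI] iq q0.
pose D (g : M * M -> R) := div_s (g \o shift_s c) \o shift_s (- c).
have shK (p : M * M) : shift_s c (shift_s (- c) p) = p.
  by case: p => z [xi s]; rewrite !shift_sE subrK.
have v0 (g : M * M -> R) : (forall p, p.2.2 = c -> g p = 0) ->
    forall p, p.2.2 = 0 -> (g \o shift_s c) p = 0.
  by move=> g0 [z [xi s]] /= s0; rewrite shift_sE; apply: g0; rewrite /= s0 add0r.
have DE (g : M * M -> R) : (forall p, p.2.2 = c -> g p = 0) ->
    forall p, g p = (p.2.2 - c) * D g p.
  move=> g0 p; have := mul_div_s (v0 g g0 (shift_s (- c) p)).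
  have -> : (shift_s (- c) p).2.2 = p.2.2 - c by case: p => z [xi s]; rewrite shift_sE.
  by rewrite /comp shK.
have DC (g : M * M -> R) : (forall p, p.2.2 = c -> g p = 0) -> rclassical d g ->
    rclassical (d - 1) (D g).
  move=> g0 cg; apply: rclassical_shift; apply: rclassical_div_s (v0 g g0).
  exact: rclassical_shift.
have DI (g : M * M -> R) : theta_indep g -> theta_indep (D g).
  move=> ig x t t' [xi s]; rewrite /D /= !shift_sE; apply: theta_indep_div_s.
  by move=> y u u' [eta v]; rewrite /= !shift_sE; exact: ig.
have R0 p : p.2.2 = c -> complex.Re (q p) = 0 by move=> /q0 ->.
have I0 p : p.2.2 = c -> complex.Im (q p) = 0 by move=> /q0 ->.
exists (fun p => D (fun p => complex.Re (q p)) p +i* D (fun p => complex.Im (q p)) p).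
split.
- by apply/classical_symbolE; split; exact: DC.
- move=> x t t' zeta; congr (_ +i* _).
    by apply: DI => y u u' eta; rewrite (iq y u u').
  by apply: DI => y u u' eta; rewrite (iq y u u').
- by move=> p; apply/complex_eqP; rewrite ReZ ImZ/= -!DE.
Qed.

(** Distinct frequencies can be divided out one after the other, since a
    quotient by [s - c] still vanishes at the remaining ones. *)
Lemma symbol_division_seq (cs : seq R) d q : uniq cs -> classical_symbol d q ->
  theta_indep q -> (forall p, p.2.2 \in cs -> q p = 0) ->
  exists d' r, [/\ classical_symbol d' r, theta_indep r &
    forall p, q p = (\prod_(c <- cs) (p.2.2 - c))%:C * r p].
Proof.
elim: cs d q => [|c cs IH] d q.
  by move=> _ cq iq _; exists d, q; split=> // p; rewrite big_nil mul1r.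
move=> /= /andP[ccs ucs] cq iq q0.
have [|r [cr ir E]] := symbol_division (c := c) cq iq.
  by move=> p pc; apply: q0; rewrite pc mem_head.
have [|d' [r' [cr' ir' E']]] := IH _ _ ucs cr ir.
  move=> p pcs; have := E p; rewrite q0; last by rewrite inE pcs orbT.
  move=> /esym/eqP; rewrite mulf_eq0 => /orP[|/eqP//].
  rewrite -[0]/(0%:C) (inj_eq (@complexI R)) subr_eq0 => /eqP pc.
  by rewrite -pc pcs in ccs.
exists d', r'; split=> // p.
by rewrite big_cons E E' mulrA -rmorphM.
Qed.

Lemma symbol_shift d q c : classical_symbol d q -> classical_symbol d (q \o shift_s c).
Proof.
move=> /classical_symbolE[cR cI]; apply/classical_symbolE.
by split; [exact: (rclassical_shift c cR)|exact: (rclassical_shift c cI)].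
Qed.

Lemma continuous_cosM (k : R) : continuous (fun t : R => cos (k * t)).
Proof.
by move=> t; apply: continuous_comp; [exact: mulrl_continuous|exact: continuous_cos].
Qed.

Lemma continuous_sinM (k : R) : continuous (fun t : R => sin (k * t)).
Proof.
by move=> t; apply: continuous_comp; [exact: mulrl_continuous|exact: continuous_sin].
Qed.

Definition fibre_mode q (k : int) : M * M -> R[i] :=
  fun p => fourier_mode q k p.1.1 p.2.1 p.2.2.

Lemma theta_indep_fibre_mode q k : theta_indep (fibre_mode q k).
Proof. by []. Qed.

Lemma fibre_mode_classical d q k : classical_symbol d q ->
  classical_symbol d (fibre_mode q k).
Proof.
move=> /classical_symbolE[cR cI].
have [sR _ _ _] := cR; have [sI _ _ _] := cI.
pose C (t : R) := cos (- k%:~R * t); pose S (t : R) := sin (- k%:~R * t).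
have cC : continuous C := @continuous_cosM _.
have cS : continuous S := @continuous_sinM _.
have int (w : R -> R) g p : continuous w -> rsmooth setT g ->
    (@lebesgue_measure R).-integrable `[0, 2 * pi] (EFin \o (fun t => w t * g (set_theta t p))).
  by move=> cw sg; apply/cts_in_integrable/(theta_average_in (U := setT) _ cw sg I).
have RE p : complex.Re (fibre_mode q k p) = (2 * pi)^-1 *
    (-1 * theta_average S (fun p => complex.Im (q p)) p +
     theta_average C (fun p => complex.Re (q p)) p).
  rewrite /fibre_mode /fourier_mode ReZ; congr (_ * _); rewrite mulN1r addrC.
  rewrite /theta_average /average -RintegralB//; [|exact: (int _ _ p cC sR)|exact: (int _ _ p cS sI)].
  apply: eq_Rintegral => t _; rewrite /expi /C /S !mulNr.
  by case: p => [[x s] [xi u]]; rewrite /set_theta/=; case: (q _) => a b /=; ring.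
have IE p : complex.Im (fibre_mode q k p) = (2 * pi)^-1 *
    (1 * theta_average S (fun p => complex.Re (q p)) p +
     theta_average C (fun p => complex.Im (q p)) p).
  rewrite /fibre_mode /fourier_mode ImZ; congr (_ * _); rewrite mul1r.
  rewrite /theta_average /average -RintegralD//; [|exact: (int _ _ p cS sR)|exact: (int _ _ p cC sI)].
  apply: eq_Rintegral => t _; rewrite /expi /C /S !mulNr.
  by case: p => [[x s] [xi u]]; rewrite /set_theta/=; case: (q _) => a b /=; ring.
have scale g : rclassical d g -> rclassical d (fun p => (2 * pi)^-1 * g p).
  move=> cg; have := rclassical_lin ((2 * pi)^-1) cg (rclassical_lin (-1) cg cg).
  by under eq_fun do rewrite mulN1r addNr addr0.
apply/classical_symbolE; split.
  under eq_fun do rewrite RE; apply: scale.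
  by apply: rclassical_lin; apply: rclassical_theta_average.
under eq_fun do rewrite IE; apply: scale.
by apply: rclassical_lin; apply: rclassical_theta_average.
Qed.

End SymbolDivision.

(** * Complex absolute values and symmetric sums over the integers *)

Section ComplexBasics.
Context {R : realType}.
Local Notation C := R[i].
Local Notation normc := ComplexField.Normc.normc.
Implicit Types (z w : C) (t : R).

Lemma normc_ge0 z : 0 <= normc z.
Proof. by case: z => a b; exact: sqrtr_ge0. Qed.

Lemma normcD z w : normc (z + w) <= normc z + normc w.
Proof.
have E (u : C) : `|u| = (normc u)%:C by rewrite normc_def; case: u.
by have := ler_normD z w; rewrite !E -rmorphD lecR.
Qed.

Lemma normcM z w : normc (z * w) = normc z * normc w.
Proof. exact: ComplexField.Normc.normcM. Qed.

Lemma normc0 : normc (0 : C) = 0.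
Proof. exact: ComplexField.Normc.normc0. Qed.

Lemma normcN z : normc (- z) = normc z.
Proof. by case: z => a b /=; rewrite !sqrrN. Qed.

Lemma normcB z w : normc (z - w) = normc (w - z).
Proof. by rewrite -normcN opprB. Qed.

Lemma normc_eq0 z : normc z = 0 -> z = 0.
Proof. exact: ComplexField.Normc.eq0_normc. Qed.

Lemma normc_real (a : R) : normc a%:C = `|a|.
Proof. by rewrite /= expr0n/= addr0 sqrtr_sqr. Qed.

Lemma normc_sqr z : normc z ^+ 2 = complex.Re z ^+ 2 + complex.Im z ^+ 2.
Proof. by case: z => a b /=; rewrite sqr_sqrtr// addr_ge0// sqr_ge0. Qed.

Lemma normc_conj z : normc (conjc z) = normc z.
Proof. by case: z => a b /=; rewrite sqrrN. Qed.

Lemma mul_conjc z : z * conjc z = (normc z ^+ 2)%:C.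
Proof.
rewrite normc_sqr; case: z => a b; apply/complex_eqP => /=; split; ring.
Qed.

Lemma normc_sum (I : Type) (s : seq I) (F : I -> C) :
  normc (\sum_(i <- s) F i) <= \sum_(i <- s) normc (F i).
Proof.
elim/big_rec2 : _ => [|i x y _ IH]; first by rewrite normc0.
by apply: le_trans (normcD _ _) _; rewrite lerD2l.
Qed.

Lemma expiD s t : expi (s + t) = expi s * expi t :> C.
Proof.
by apply/complex_eqP; rewrite /expi/= cosD sinD; split=> //; rewrite addrC.
Qed.

Lemma expi0 : expi 0 = 1 :> C.
Proof. by rewrite /expi cos0 sin0. Qed.

Lemma expiN t : expi (- t) = conjc (expi t) :> C.
Proof. by rewrite /expi cosN sinN. Qed.

Lemma normc_expi t : normc (expi t) = 1.
Proof. by rewrite /expi /= cos2Dsin2 sqrtr1. Qed.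

Lemma expi_neq0 t : expi t != 0 :> C.
Proof. by apply/eqP => E; have := normc_expi t; rewrite E normc0 => /eqP; rewrite eq_sym oner_eq0. Qed.

Lemma expi_period (k : int) t : expi (k%:~R * (t + 2 * pi)) = expi (k%:~R * t) :> C.
Proof.
rewrite mulrDr expiD; suff -> : expi (k%:~R * (2 * pi)) = 1 :> C by rewrite mulr1.
have E (m : nat) : expi (m%:R * (2 * pi)) = 1 :> C.
  elim: m => [|m IH]; first by rewrite mul0r expi0.
  by rewrite -natr1 mulrDl mul1r expiD IH mul1r /expi mulr_natl cos2pi sin2pi.
case: k => m; first exact: E.
by rewrite NegzE mulrNz mulNr expiN E conjc1.
Qed.

End ComplexBasics.

Section SymmetricSums.
Context {R : realType}.
Local Notation C := R[i].
Local Notation normc := ComplexField.Normc.normc.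
Implicit Types (F G : int -> C) (N : nat) (K : R).

Definition psumZ F N : C := \sum_(i < N.*2.+1) F (i%:Z - N%:Z).

Lemma psumZ0 F : psumZ F 0 = F 0.
Proof. by rewrite /psumZ big_ord_recl big_ord0 addr0. Qed.

Lemma psumZS F N : psumZ F N.+1 = psumZ F N + F N.+1%:Z + F (- N.+1%:Z).
Proof.
rewrite /psumZ doubleS big_ord_recr big_ord_recl /= sub0r.
rewrite [X in X + _]addrC addrAC; congr (_ + _ + _).
  by apply: eq_bigr => i _; congr F; rewrite /bump/=; lia.
by congr F; rewrite -addnn; lia.
Qed.

(** The error of a symmetric partial sum is controlled by a telescoping sum. *)
Definition inv_sqr (m : int) : R := (1 + m%:~R ^+ 2)^-1.

Lemma inv_sqr_gt0 m : 0 < inv_sqr m.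
Proof. by rewrite invr_gt0 ltr_pwDl// sqr_ge0. Qed.

Lemma inv_sqr_le1 m : inv_sqr m <= 1.
Proof. by rewrite invf_le1 ?ltr_pwDl ?sqr_ge0// lerDl sqr_ge0. Qed.

Lemma inv_sqr_telescope N : inv_sqr N.+1%:Z <= 2 * (N.+1%:R^-1 - N.+2%:R^-1).
Proof.
have a0 : 0 < (N.+1%:R : R) by [].
have -> : (N.+2%:R : R) = N.+1%:R + 1 by rewrite natr1.
rewrite /inv_sqr -[N.+1%:Z%:~R]/(N.+1%:R); set a : R := N.+1%:R in a0 *.
have -> : 2 * (a^-1 - (a + 1)^-1) = 2 / (a * (a + 1)).
  by field; rewrite !gt_eqF// addr_gt0.
rewrite -[X in X <= _]mul1r ler_pdivrMr ?ltr_pwDl ?sqr_ge0// mulrAC ler_pdivlMr ?mulr_gt0 ?addr_gt0//.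
by nra.
Qed.

Lemma psumZ_diff F K N M : (forall m, normc (F m) <= K * inv_sqr m) -> (N <= M)%N ->
  normc (psumZ F M - psumZ F N) <= 4 * K * (N.+1%:R^-1 - M.+1%:R^-1).
Proof.
move=> FK; have K0 : 0 <= K.
  by have := le_trans (normc_ge0 _) (FK 0); rewrite pmulr_lge0// inv_sqr_gt0.
elim: M => [|M IH]; first by rewrite leqn0 => /eqP ->; rewrite !subrr normc0 mulr0.
rewrite leq_eqVlt => /orP[/eqP ->|]; first by rewrite !subrr normc0 mulr0.
rewrite ltnS => /IH {}IH; rewrite psumZS.
have -> : psumZ F M + F M.+1%:Z + F (- M.+1%:Z) - psumZ F N =
  (psumZ F M - psumZ F N) + (F M.+1%:Z + F (- M.+1%:Z)) by ring.
apply: le_trans (normcD _ _) _.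
apply: (@le_trans _ _ (4 * K * (N.+1%:R^-1 - M.+1%:R^-1) + 2 * (K * inv_sqr M.+1%:Z))).
  apply: lerD => //; apply: le_trans (normcD _ _) _; rewrite mulr_natl mulr2n.
  apply: lerD => //; apply: le_trans (FK _) _.
  by rewrite /inv_sqr mulrNz sqrrN.
have H := ler_wpM2l K0 (inv_sqr_telescope M).
move: IH H; set x := M.+1%:R^-1; set y := M.+2%:R^-1; set u := inv_sqr _; set v := N.+1%:R^-1.
by move=> _ H; lra.
Qed.

Lemma psumZ_tail F K N M : (forall m, normc (F m) <= K * inv_sqr m) -> (N <= M)%N ->
  normc (psumZ F M - psumZ F N) <= 4 * K / N.+1%:R.
Proof.
move=> FK NM; apply: le_trans (psumZ_diff FK NM) _.
have K0 : 0 <= K.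
  by have := le_trans (normc_ge0 _) (FK 0); rewrite pmulr_lge0// inv_sqr_gt0.
by rewrite ler_wpM2l// ?mulr_ge0// lerBlDr lerDl invr_ge0.
Qed.

Lemma cvg_inv_succ K : (fun N : nat => K / N.+1%:R) @ \oo --> (0 : R).
Proof.
rewrite -[X in _ --> X](mulr0 K); apply: cvgM; first exact: cvg_cst.
exact: cvg_harmonic.
Qed.

Lemma cvg_of_rate (x : nat -> R) (l K : R) : (forall N, `|x N - l| <= K / N.+1%:R) ->
  x @ \oo --> l.
Proof.
move=> H; apply/cvgrPdist_le => e e0.
have /cvgrPdist_le/(_ _ e0) := @cvg_inv_succ K.
apply: filterS => N; rewrite sub0r normrN distrC => HN.
by apply: le_trans (H N) _; apply: le_trans (ler_norm _) HN.
Qed.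

Lemma cauchy_rate (x : nat -> R) (K : R) :
  (forall N M, (N <= M)%N -> `|x M - x N| <= K / N.+1%:R) ->
  forall N, `|limn x - x N| <= K / N.+1%:R.
Proof.
move=> H; have cx : cvgn x.
  apply/cauchy_cvgP/cauchy_ballP => e e0.
  have /cvgrPdist_lt/(_ _ (divr_gt0 e0 (ltr0n _ 2)))[N0 _ HN] := @cvg_inv_succ K.
  exists ([set y | exists2 n, (N0 <= n)%N & y = x n], [set y | exists2 n, (N0 <= n)%N & y = x n]).
    by split; exists N0 => // n /= ?; exists n.
  move=> [_ _] [/= [n nN ->] [m mN ->]]; rewrite -ball_normE /=.
  have small k : (N0 <= k)%N -> `|x k - x N0| < e / 2.
    move=> k0; apply: le_lt_trans (H _ _ k0) _.
    by have := HN N0 (leqnn _); rewrite sub0r normrN; apply: le_lt_trans; exact: ler_norm.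
  rewrite (splitr e) -(subrK (x N0) (x n)) -addrA.
  by rewrite (le_lt_trans (ler_normD _ _))// ltrD ?small// distrC small.
move=> N; apply/ler_addgt0Pl => e e0.
have /cvgrPdist_lt/(_ _ e0)[M0 _ HM] := cx.
have := HM (maxn M0 N) (leq_maxl _ _) => /= H1.
rewrite -(subrK (x (maxn M0 N)) (limn x)) -addrA (le_trans (ler_normD _ _))//.
by rewrite lerD ?H ?leq_maxr// ltW.
Qed.

Lemma csumZ_limn F : csumZ F =
  limn (fun N => complex.Re (psumZ F N)) +i* limn (fun N => complex.Im (psumZ F N)).
Proof. by []. Qed.

Lemma csumZ_err F K N : (forall m, normc (F m) <= K * inv_sqr m) ->
  normc (csumZ F - psumZ F N) <= 8 * K / N.+1%:R.
Proof.
move=> FK.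
have HR := @cauchy_rate (fun N => complex.Re (psumZ F N)) (4 * K) _ N.
have HI := @cauchy_rate (fun N => complex.Im (psumZ F N)) (4 * K) _ N.
have -> : 8 * K / N.+1%:R = 4 * K / N.+1%:R + 4 * K / N.+1%:R by rewrite -mulrDl -mulrDl -natrD.
apply: le_trans (normc_le_ReIm _) _; rewrite ReB ImB csumZ_limn /=.
apply: lerD; [apply: HR|apply: HI] => a b ab.
  by rewrite -ReB; apply: le_trans (Re_le_normc _) (psumZ_tail FK ab).
by rewrite -ImB; apply: le_trans (Im_le_normc _) (psumZ_tail FK ab).
Qed.

Lemma csumZ_eq F (l : C) K : (forall N, normc (psumZ F N - l) <= K / N.+1%:R) -> csumZ F = l.
Proof.
move=> H; rewrite csumZ_limn; apply/complex_eqP => /=.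
split; apply: cvg_lim => //; apply: (@cvg_of_rate _ _ K) => N; apply: le_trans (H N).
  by rewrite -ReB; exact: Re_le_normc.
by rewrite -ImB; exact: Im_le_normc.
Qed.

Lemma csumZ_le F K : (forall m, normc (F m) <= K * inv_sqr m) -> normc (csumZ F) <= 9 * K.
Proof.
move=> FK; have := csumZ_err 0 FK; rewrite psumZ0 divr1 => H.
rewrite -(subrK (F 0) (csumZ F)); apply: le_trans (normcD _ _) _.
have := FK 0; rewrite /inv_sqr expr0n addr0 invr1 mulr1 => H0.
by apply: le_trans (lerD H H0) _; lra.
Qed.

Lemma psumZ_lin (a : C) F G N :
  psumZ (fun m => a * F m + G m) N = a * psumZ F N + psumZ G N.
Proof. by rewrite /psumZ big_split/= mulr_sumr. Qed.

Lemma csumZ_lin (a : C) F G K K' : (forall m, normc (F m) <= K * inv_sqr m) ->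
  (forall m, normc (G m) <= K' * inv_sqr m) ->
  csumZ (fun m => a * F m + G m) = a * csumZ F + csumZ G.
Proof.
move=> FK GK; apply: (@csumZ_eq _ _ (normc a * (8 * K) + 8 * K')) => N.
rewrite psumZ_lin opprD addrACA -mulrBr; apply: le_trans (normcD _ _) _.
rewrite normcM mulrDl; apply: lerD.
  by rewrite -[leRHS]mulrA ler_wpM2l ?normc_ge0// normcB csumZ_err.
by rewrite normcB csumZ_err.
Qed.

Lemma csumZM (a : C) F K : (forall m, normc (F m) <= K * inv_sqr m) ->
  csumZ (fun m => a * F m) = a * csumZ F.
Proof.
move=> FK; apply: (@csumZ_eq _ _ (normc a * (8 * K))) => N.
rewrite /psumZ -mulr_sumr -mulrBr normcM -[leRHS]mulrA ler_wpM2l ?normc_ge0//.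
by rewrite normcB csumZ_err.
Qed.

Lemma csumZ_single F j : (forall m, m != j -> F m = 0) -> csumZ F = F j.
Proof.
move=> F0; apply: (@csumZ_eq _ _ (normc (F j) * `|j|%N.+1%:R)) => N.
have nj m : m <> j -> F m = 0 by move=> /eqP; exact: F0.
have S M : psumZ F M = if (`|j| <= M)%N then F j else 0.
  elim: M => [|M IH].
    rewrite psumZ0; case: ifPn => [|jM]; first by rewrite leqn0 absz_eq0 => /eqP ->.
    by apply: F0; apply: contra jM => /eqP <-.
  rewrite psumZS IH.
  have [jM|Mj] := leqP `|j| M.
    rewrite (leq_trans jM)// (nj M.+1%:Z) 1?(nj (- M.+1%:Z)) ?addr0//; lia.
  rewrite add0r; have [jM|jM] := leqP `|j| M.+1.
    have [E|E] : j = M.+1%:Z \/ j = - M.+1%:Z by lia.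
      by rewrite -E (nj (- j)) ?addr0//; lia.
    by rewrite -E (nj M.+1%:Z) ?add0r//; lia.
  by rewrite (nj M.+1%:Z) 1?(nj (- M.+1%:Z)) ?addr0//; lia.
rewrite S; case: leqP => jN; first by rewrite subrr normc0 divr_ge0// mulr_ge0 ?normc_ge0.
rewrite sub0r normcN -mulrA ler_peMr ?normc_ge0// ler_pdivlMr// mul1r ler_nat.
by lia.
Qed.

Lemma csumZ_ext F G : (forall m, F m = G m) -> csumZ F = csumZ G.
Proof. by move=> FG; congr csumZ; apply/funext. Qed.

Lemma csumZ0 F : (forall m, F m = 0) -> csumZ F = 0.
Proof. by move=> F0; rewrite (@csumZ_single F 0). Qed.

Lemma inv_sqr_pred (m : int) : inv_sqr (m - 1) <= 3 * inv_sqr m.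
Proof.
rewrite /inv_sqr intrB; set x := m%:~R.
rewrite ler_pdivlMr ?ltr_pwDl ?sqr_ge0// mulrC ler_pdivrMr ?ltr_pwDl ?sqr_ge0//.
by have := sqr_ge0 (2 * x - 3 : R); rewrite !expr2; nra.
Qed.

Lemma csumZ_shift1 F K : (forall m, normc (F m) <= K * inv_sqr m) ->
  csumZ (fun m => F (m - 1)) = csumZ F.
Proof.
move=> FK; have K0 : 0 <= K.
  by have := le_trans (normc_ge0 _) (FK 0); rewrite pmulr_lge0// inv_sqr_gt0.
apply: (@csumZ_eq _ _ (8 * K + (2 * K + 2 * K))) => N.
have E : psumZ (fun m => F (m - 1)) N = psumZ F N + F (- N%:Z - 1) - F N%:Z.
  elim: N => [|N IH]; first by rewrite !psumZ0 oppr0; ring.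
  rewrite !psumZS IH.
  have -> : N.+1%:Z - 1 = N%:Z by lia.
  have -> : - N.+1%:Z = - N%:Z - 1 by lia.
  by ring.
rewrite E; have small (m : int) : (N <= `|m|)%N -> normc (F m) <= 2 * K / N.+1%:R.
  move=> Nm; apply: le_trans (FK m) _; rewrite -mulrA mulrCA ler_wpM2l//.
  have : (N%:R : R) <= `|m%:~R| by rewrite -intr_norm -[N%:R]/(N%:Z%:~R) ler_int; lia.
  rewrite /inv_sqr -natr1; set x := m%:~R; set a : R := N%:R => ax.
  have a0 : 0 <= a by rewrite /a.
  have a10 : 0 < a + 1 by lra.
  rewrite -[X in X <= _]mul1r ler_pdivrMr ?ltr_pwDl ?sqr_ge0// mulrAC ler_pdivlMr//.
  by rewrite -(real_normK (num_real x)); nra.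
have -> : psumZ F N + F (- N%:Z - 1) - F N%:Z - csumZ F =
  (psumZ F N - csumZ F) + (F (- N%:Z - 1) - F N%:Z) by ring.
apply: le_trans (normcD _ _) _; rewrite mulrDl; apply: lerD.
  by rewrite normcB csumZ_err.
by apply: le_trans (normcD _ _) _; rewrite normcN mulrDl lerD// small//; lia.
Qed.

Lemma csumZ_shift F K k : (forall m, normc (F m) <= K * inv_sqr m) ->
  csumZ (fun m => F (m - k%:Z)) = csumZ F.
Proof.
elim: k F K => [|k IH] F K FK; first by apply: csumZ_ext => m; rewrite subr0.
rewrite -(csumZ_shift1 FK) -(IH (fun m => F (m - 1)) (3 * K)).
  by apply: csumZ_ext => m; congr F; lia.
move=> m; apply: le_trans (FK _) _; rewrite [3 * K]mulrC -mulrA ler_wpM2l ?inv_sqr_pred//.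
by have := le_trans (normc_ge0 _) (FK 0); rewrite pmulr_lge0// inv_sqr_gt0.
Qed.

Lemma csumZ_shift_neg F K k : (forall m, normc (F m) <= K * inv_sqr m) ->
  csumZ (fun m => F (m + k%:Z)) = csumZ F.
Proof.
move=> FK.
have FK' m : normc (F (- m)) <= K * inv_sqr m.
  by apply: le_trans (FK _) _; rewrite /inv_sqr mulrNz sqrrN.
have sym G : csumZ (fun m => G (- m)) = csumZ G.
  have E N : psumZ (fun m => G (- m)) N = psumZ G N.
    by elim: N => [|N IH]; rewrite ?psumZ0 ?oppr0// !psumZS IH opprK addrAC.
  by rewrite !csumZ_limn (_ : psumZ (fun m => G (- m)) = psumZ G)//; apply/funext.
rewrite -(sym F) -(csumZ_shift k FK') -sym.
by apply: csumZ_ext => m; congr F; lia.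
Qed.

End SymmetricSums.

(** * Measurability of continuous functions and dominated Fubini theorem *)

Section Grid.
Context {R : realType}.

Lemma measurable_countable_comp (d : measure_display) (T : measurableType d)
    (I : countType) (h : T -> I) (g : I -> R) :
  (forall i, measurable (h @^-1` [set i])) -> measurable_fun setT (g \o h).
Proof.
move=> hm _ Y mY; rewrite setTI.
have -> : (g \o h) @^-1` Y = \bigcup_i (if `[< Y (g i) >] then h @^-1` [set i] else set0).
  apply/seteqP; split=> [x /= Yx|x [i _]].
    by exists (h x) => //; case: asboolP.
  by case: asboolP => // Yi /= ->.
apply: countable_bigcupT_measurable; first exact: countableP.
by move=> i; case: asboolP.
Qed.

(** A continuous function is the pointwise limit of its values at grid points,
    which take countably many values. *)
Lemma measurable_of_grid (d : measure_display) (T : measurableType d)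
    (V : normedModType R) (k : T -> V) (I : nat -> countType) (h : forall N, T -> I N)
    (r : forall N, I N -> V) (f : V -> R) :
  (forall N i, measurable (h N @^-1` [set i])) ->
  (forall N x, `|r N (h N x) - k x| <= N.+1%:R^-1) ->
  continuous f -> measurable_fun setT (f \o k).
Proof.
move=> hm hr cf; apply: (@measurable_realfun.measurable_fun_cvg _ _ _ _ (fun N => (f \o r N) \o h N)).
  by move=> N; exact: measurable_countable_comp.
move=> x _; apply: (@cvg_comp _ _ _ (fun N => r N (h N x)) f _ (nbhs (k x))); last exact: cf.
apply/cvgrPdist_le => e e0.
have /cvgrPdist_le/(_ _ e0) := @cvg_inv_succ R 1.
apply: filterS => N; rewrite sub0r normrN mul1r distrC => HN.
by apply: le_trans (hr N x) (le_trans (ler_norm _) HN).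
Qed.

Definition grid (N : nat) (x : R) : int := Num.floor (N.+1%:R * x).

Lemma grid_err N x : `|(grid N x)%:~R / N.+1%:R - x| <= N.+1%:R^-1.
Proof.
have a0 : 0 < (N.+1%:R : R) by [].
have /andP[] := floor_itv (N.+1%:R * x); rewrite -/(grid N x) intrD -[1%:~R]/(1 : R).
set g := (grid N x)%:~R; set a : R := N.+1%:R in a0 * => h1 h2.
have -> : g / a - x = (g - a * x) / a by field; rewrite gt_eqF.
rewrite normf_div (gtr0_norm a0) ler_pdivrMr// mulVf ?gt_eqF//.
by rewrite ler_norml; apply/andP; split; lra.
Qed.

Lemma measurable_grid (d : measure_display) (T : measurableType d) N (f : T -> R) (i : int) :
  measurable_fun setT f -> measurable [set x | grid N (f x) = i].
Proof.
move=> mf; have a0 : 0 < (N.+1%:R : R) by [].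
rewrite (_ : [set x | _] = setT `&` f @^-1` `[i%:~R / N.+1%:R, (i + 1)%:~R / N.+1%:R[%classic).
  exact: mf.
rewrite setTI; apply/seteqP; split=> x /=; rewrite in_itv/= ler_pdivrMr// ltr_pdivlMr// mulrC /grid.
  by move=> <-; exact: floor_itv.
by move=> H; exact: floor_def.
Qed.

Lemma measurable_cts_rV n (f : 'rV[R]_n -> R) : continuous f -> measurable_fun setT f.
Proof.
move=> cf; suff : measurable_fun setT (f \o id) by [].
apply: (measurable_of_grid (k := fun x : 'rV[R]_n => x) (I := fun=> 'rV[int]_n : countType)
  (h := fun N (x : 'rV[R]_n) => \row_i grid N (x ord0 i))
  (r := fun N k => \row_i ((k ord0 i)%:~R / N.+1%:R)) _ _ cf) => N.
  move=> k; rewrite (_ : _ @^-1` _ = \big[setI/setT]_(i < n) [set x : 'rV[R]_n | grid N (x ord0 i) = k ord0 i]).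
    apply: bigsetI_measurable => i _; apply: measurable_grid; exact: measurable_coord.
  apply/seteqP; split=> [x /= <-|x].
    by rewrite -bigcap_seq => i _ /=; rewrite mxE.
  rewrite -bigcap_seq => H /=; apply/rowP => i; rewrite mxE; apply: H => /=.
  exact: mem_index_enum.
move=> x; rewrite -[leLHS]/(mx_norm _) mx_normrE; apply/bigmax_leP; split; first by rewrite invr_ge0.
by move=> [i j] _ /=; rewrite !mxE !ord1 grid_err.
Qed.

Lemma measurable_cts_prod n (f : 'rV[R]_n * R -> R) : continuous f -> measurable_fun setT f.
Proof.
move=> cf; suff : measurable_fun setT (f \o id) by [].
apply: (measurable_of_grid (k := fun x : 'rV[R]_n * R => x)
  (I := fun=> ('rV[int]_n * int)%type : countType)
  (h := fun N (x : 'rV[R]_n * R) => (\row_i grid N (x.1 ord0 i), grid N x.2))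
  (r := fun N k => (\row_i ((k.1 ord0 i)%:~R / N.+1%:R), k.2%:~R / N.+1%:R)) _ _ cf) => N.
  move=> [k l]; rewrite (_ : _ @^-1` _ = [set x : 'rV[R]_n * R | grid N x.2 = l] `&`
      \big[setI/setT]_(i < n) [set x : 'rV[R]_n * R | grid N (x.1 ord0 i) = k ord0 i]).
    apply: measurableI; first by apply: measurable_grid; exact: measurable_snd.
    apply: bigsetI_measurable => i _; apply: measurable_grid.
    exact: (measurableT_comp (measurable_coord i) measurable_fst).
  apply/seteqP; split=> [x /= [<- <-]|x [/= H2]].
    by split=> //; rewrite -bigcap_seq => i _ /=; rewrite mxE.
  rewrite -bigcap_seq => H /=; congr (_, _) => //; apply/rowP => i; rewrite mxE; apply: H => /=.
  exact: mem_index_enum.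
move=> x; rewrite prod_normE/= ge_max grid_err andbT.
rewrite -[leLHS]/(mx_norm _) mx_normrE; apply/bigmax_leP; split; first by rewrite invr_ge0.
by move=> [i j] _ /=; rewrite !mxE !ord1 grid_err.
Qed.

End Grid.

Section FubiniDominated.
Context {R : realType} (d1 d2 : measure_display)
  (T1 : measurableType d1) (T2 : measurableType d2).
Variables (m1 : {sigma_finite_measure set T1 -> \bar R})
  (m2 : {sigma_finite_measure set T2 -> \bar R}) (D : set T2).
Hypothesis mD : measurable D.
Variables (f : T1 * T2 -> R) (u : T1 -> R) (v : T2 -> R).
Hypotheses (mf : measurable_fun setT f) (u0 : forall x, 0 <= u x) (v0 : forall y, 0 <= v y).
Hypotheses (iu : m1.-integrable setT (EFin \o u)) (iv : m2.-integrable D (EFin \o v)).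
Hypothesis fuv : forall x y, D y -> `|f (x, y)| <= u x * v y.

Let g : T1 * T2 -> R := f \_ (setT `*` D).
Let mX : measurable ((setT `*` D) : set (T1 * T2)%type).
Proof. exact: measurableX. Qed.

Let gE x y : g (x, y) = (fun y => f (x, y)) \_ D y.
Proof.
rewrite /g /patch; case: ifPn => xy; case: ifPn => Dy //.
  by move: Dy; rewrite notin_setE; case: (set_mem xy).
by move: xy; rewrite notin_setE; case; split=> //; exact: set_mem Dy.
Qed.

Let mg : @measurable_fun _ _ (T1 * T2)%type (measurableTypeR R) setT g.
Proof.
by apply: (measurable_restrictT f mX).1; exact: measurable_funTS.
Qed.

Lemma section_integrable2 x : m2.-integrable D (EFin \o (fun y => f (x, y))).
Proof.
apply: (@le_integrable _ _ _ _ _ mD _ (EFin \o (fun y => u x * v y))).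
- apply/measurable_EFinP; exact: measurable_funTS (measurableT_comp mf (pair1_measurable x)).
- by move=> y Dy; rewrite /= lee_fin [leRHS]ger0_norm ?mulr_ge0// fuv.
- exact: (integrableZl mD (u x) iv).
Qed.

Lemma section_integrable1 y : D y -> m1.-integrable setT (EFin \o (fun x => f (x, y))).
Proof.
move=> Dy; apply: (@le_integrable _ _ _ _ _ measurableT _ (EFin \o (fun x => v y * u x))).
- by apply/measurable_EFinP; apply: (measurableT_comp mf (pair2_measurable y)).
- by move=> x _; rewrite /= lee_fin [leRHS]ger0_norm ?mulr_ge0// mulrC fuv.
- exact: (integrableZl measurableT (v y) iu).
Qed.

Let gF x : (\int[m2]_y (g (x, y))%:E)%E = (\int[m2]_(y in D) f (x, y))%:E.
Proof.
rewrite /Rintegral fineK; last exact: (integrable_fin_num mD (section_integrable2 x)).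
by rewrite [RHS]integral_mkcond; apply: eq_integral => y _; rewrite gE /patch; case: ifP.
Qed.

Let ig : (m1 \x m2)%E.-integrable setT (EFin \o g).
Proof.
apply/integrable12ltyP; first exact/measurable_EFinP.
have iu2 : (\int[m1]_x (u x)%:E < +oo)%E.
  have /integrableP[_] := iu; congr (_ < _)%E; apply: eq_integral => x _.
  by rewrite /= ger0_norm.
have iv2 : ((\int[m2]_(y in D) (v y)%:E)%E \is a fin_num).
  exact: (integrable_fin_num mD iv).
apply: (@le_lt_trans _ _ (\int[m1]_x ((\int[m2]_(y in D) v y)%R%:E * (u x)%:E))%E); last first.
  rewrite ge0_integralZl//.
  - by apply: lte_mul_pinfty => //; rewrite lee_fin Rintegral_ge0.
  - by have /integrableP[] := iu.
  - by move=> x _; rewrite lee_fin.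
  - by rewrite lee_fin Rintegral_ge0.
apply: ge0_le_integral => //.
- by move=> x _; exact: integral_ge0.
- apply: (@measurable_fun_fubini_tonelli_F _ _ _ _ _ m2 (fun z => `|(g z)%:E|%E)) => //.
  apply: measurableT_comp => //; exact/measurable_EFinP.
- by apply: measurable_funeM; have /integrableP[] := iu.
move=> x _; rewrite muleC /Rintegral fineK// -ge0_integralZl//; last 3 first.
- by have /integrableP[] := iv.
- by move=> y _; rewrite lee_fin.
- by rewrite lee_fin.
rewrite [leRHS]integral_mkcond; apply: ge0_le_integral => //.
- by apply: measurableT_comp => //; apply/measurable_EFinP; exact: (measurableT_comp mg (pair1_measurable x)).
- apply/(measurable_restrictT _ mD).1; apply: measurable_funeM.
  by have /integrableP[] := iv.
- move=> y _; rewrite /= gE /patch; case: ifPn => Dy; last by rewrite normr0.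
  by rewrite -EFinM lee_fin fuv//; exact: set_mem.
Qed.

Lemma Fubini_integrable : (m1 \x m2)%E.-integrable (setT `*` D) (EFin \o f).
Proof.
by have := ig; rewrite -restrict_EFin => /(integrable_restrict _ mX measurableT); rewrite setTI.
Qed.

Let prodE : \int[(m1 \x m2)%E]_(z in setT `*` D) f z = fine (\int[(m1 \x m2)%E]_z (g z)%:E)%E.
Proof.
rewrite /Rintegral integral_mkcond; congr fine; apply: eq_integral => z _.
by rewrite /g /patch; case: ifP.
Qed.

Lemma Fubini12 :
  \int[(m1 \x m2)%E]_(z in setT `*` D) f z = \int[m1]_x \int[m2]_(y in D) f (x, y).
Proof.
rewrite prodE -(integral12_prod_meas1 ig) /Rintegral; congr fine.
by apply: eq_integral => x _; exact: gF.
Qed.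

Lemma Fubini21 :
  \int[(m1 \x m2)%E]_(z in setT `*` D) f z = \int[m2]_(y in D) \int[m1]_x f (x, y).
Proof.
rewrite prodE -(integral21_prod_meas1 ig) /Rintegral; congr fine.
rewrite [RHS]integral_mkcond; apply: eq_integral => y _; rewrite /fubini_G /patch.
case: ifPn => Dy.
  rewrite fineK; last exact: (integrable_fin_num measurableT (section_integrable1 (set_mem Dy))).
  by apply: eq_integral => x _; rewrite /= gE /patch Dy.
by apply: integral0_eq => x _; rewrite /= gE /patch (negbTE Dy).
Qed.

End FubiniDominated.

(** * Dominated integrals of complex functions *)

Section DominatedComplex.
Context {R : realType} (d : measure_display) (T : measurableType d).
Variables (mu : {measure set T -> \bar R}) (D : set T).
Local Notation C := R[i].
Local Notation normc := (@ComplexField.Normc.normc R).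
Implicit Types (f : T -> C) (g : T -> R).

Definition cmeas (A : set T) f :=
  measurable_fun A (fun x => complex.Re (f x)) /\ measurable_fun A (fun x => complex.Im (f x)).

Lemma cmeas_cst A (c : C) : cmeas A (fun=> c).
Proof. by split; exact: measurable_cst. Qed.

Lemma cmeasD A f f' : cmeas A f -> cmeas A f' -> cmeas A (fun x => f x + f' x).
Proof.
move=> [m1 m2] [m1' m2']; split.
  rewrite (_ : (fun x => _) = fun x => complex.Re (f x) + complex.Re (f' x)).
    exact: measurable_funD.
  by apply/funext => x; case: (f x) (f' x) => [a b] [a' b'].
rewrite (_ : (fun x => _) = fun x => complex.Im (f x) + complex.Im (f' x)).
  exact: measurable_funD.
by apply/funext => x; case: (f x) (f' x) => [a b] [a' b'].
Qed.

Lemma cmeasM A f f' : cmeas A f -> cmeas A f' -> cmeas A (fun x => f x * f' x).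
Proof.
move=> [m1 m2] [m1' m2']; split.
  rewrite (_ : (fun x => _) = fun x => complex.Re (f x) * complex.Re (f' x) - complex.Im (f x) * complex.Im (f' x)).
    by apply: measurable_funB; exact: measurable_funM.
  by apply/funext => x; case: (f x) (f' x) => [a b] [a' b'].
rewrite (_ : (fun x => _) = fun x => complex.Re (f x) * complex.Im (f' x) + complex.Im (f x) * complex.Re (f' x)).
  by apply: measurable_funD; exact: measurable_funM.
by apply/funext => x; case: (f x) (f' x) => [a b] [a' b'].
Qed.

Lemma cmeas_lin A (a : C) f f' : cmeas A f -> cmeas A f' -> cmeas A (fun x => a * f x + f' x).
Proof. by move=> m1 m2; apply: cmeasD => //; apply: cmeasM => //; exact: cmeas_cst. Qed.

Lemma cmeas_sum A (I : Type) (s : seq I) (F : I -> T -> C) :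
  (forall i, cmeas A (F i)) -> cmeas A (fun x => \sum_(i <- s) F i x).
Proof.
move=> mF; elim: s => [|i s IH].
  by rewrite (_ : (fun x => _) = fun=> 0); [exact: cmeas_cst|apply/funext => x; rewrite big_nil].
rewrite (_ : (fun x => _) = fun x => F i x + \sum_(j <- s) F j x).
  exact: cmeasD.
by apply/funext => x; rewrite big_cons.
Qed.

Lemma measurable_normc_sqr A f : cmeas A f -> measurable_fun A (fun x => normc (f x) ^+ 2).
Proof.
move=> [m1 m2]; under eq_fun do rewrite normc_sqr.
by apply: measurable_funD; apply: measurable_funX.
Qed.

(** Pointwise domination of a measurable function by an integrable one; keeping
    the dominating function explicit makes estimates compose. *)
Definition cdom f g :=
  [/\ cmeas D f, mu.-integrable D (EFin \o g) & forall x, D x -> normc (f x) <= g x].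

Hypothesis mD : measurable D.

Lemma cdom_Re f g : cdom f g -> mu.-integrable D (EFin \o (fun x => complex.Re (f x))).
Proof.
move=> [[m1 m2] ig H]; apply: le_integrable ig => //.
  exact/measurable_EFinP.
move=> x Dx; rewrite /= lee_fin; apply: le_trans (Re_le_normc _) _.
exact: le_trans (H _ Dx) (ler_norm _).
Qed.

Lemma cdom_Im f g : cdom f g -> mu.-integrable D (EFin \o (fun x => complex.Im (f x))).
Proof.
move=> [[m1 m2] ig H]; apply: le_integrable ig => //.
  exact/measurable_EFinP.
move=> x Dx; rewrite /= lee_fin; apply: le_trans (Im_le_normc _) _.
exact: le_trans (H _ Dx) (ler_norm _).
Qed.

Lemma integrable_lin (a : R) g g' : mu.-integrable D (EFin \o g) -> mu.-integrable D (EFin \o g') ->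
  mu.-integrable D (EFin \o (fun x => a * g x + g' x)).
Proof.
move=> ig ig'; have := integrableD mD (integrableZl mD a ig) ig'.
by apply: eq_integrable => // x _; rewrite /= EFinD EFinM.
Qed.

Lemma cintegral_lin (a : C) f f' g g' : cdom f g -> cdom f' g' ->
  cintegral mu D (fun x => a * f x + f' x) = a * cintegral mu D f + cintegral mu D f'.
Proof.
move=> F1 F2; have r1 := cdom_Re F1; have r2 := cdom_Re F2.
have j1 := cdom_Im F1; have j2 := cdom_Im F2.
have lin (u v w : T -> R) (b c : R) : mu.-integrable D (EFin \o u) -> mu.-integrable D (EFin \o v) ->
    mu.-integrable D (EFin \o w) ->
    \int[mu]_(x in D) (b * u x + (c * v x + w x)) =
    b * (\int[mu]_(x in D) u x) + (c * (\int[mu]_(x in D) v x) + \int[mu]_(x in D) w x).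
  move=> iu iv iw; rewrite RintegralD//; last exact: integrable_lin.
    rewrite RintegralZl// RintegralD// ?RintegralZl//.
    by have := integrableZl mD c iv; apply: eq_integrable => // x _; rewrite /= EFinM.
  by have := integrableZl mD b iu; apply: eq_integrable => // x _; rewrite /= EFinM.
case: a => a1 a2; apply/eqP; rewrite eq_complex /cintegral /=; apply/andP; split; apply/eqP.
  transitivity (\int[mu]_(x in D) (a1 * complex.Re (f x) + (- a2 * complex.Im (f x) + complex.Re (f' x)))).
    by apply: eq_Rintegral => x _; case: (f x) (f' x) => [? ?] [? ?] /=; ring.
  by rewrite lin//; ring.
transitivity (\int[mu]_(x in D) (a1 * complex.Im (f x) + (a2 * complex.Re (f x) + complex.Im (f' x)))).
  by apply: eq_Rintegral => x _; case: (f x) (f' x) => [? ?] [? ?] /=; ring.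
by rewrite lin//; ring.
Qed.

Lemma cintegral_ext f f' : (forall x, D x -> f x = f' x) -> cintegral mu D f = cintegral mu D f'.
Proof.
by move=> H; rewrite /cintegral; congr (_ +i* _); apply: eq_Rintegral => x /set_mem Dx; rewrite H.
Qed.

Lemma cintegral0 : cintegral mu D (fun=> 0) = 0.
Proof.
by rewrite /cintegral; congr (_ +i* _); apply: Rintegral_eq0.
Qed.

Lemma cdom0 g f : cdom f g -> cdom (fun=> 0) g.
Proof.
move=> [_ ig H]; split; [exact: cmeas_cst|exact: ig|].
by move=> x Dx; rewrite normc0; apply: le_trans (normc_ge0 _) (H _ Dx).
Qed.

Lemma cintegralM (a : C) f g : cdom f g -> cintegral mu D (fun x => a * f x) = a * cintegral mu D f.
Proof.
move=> F; have := (cintegral_lin a F (cdom0 F)).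
rewrite cintegral0 addr0 => <-; by apply: cintegral_ext => x _; rewrite addr0.
Qed.

Lemma cdomM (a : C) f g : cdom f g -> cdom (fun x => a * f x) (fun x => normc a * g x).
Proof.
move=> [m1 i1 H1]; split; first by apply: cmeasM => //; exact: cmeas_cst.
  by have := integrableZl mD (normc a) i1; apply: eq_integrable => // x _; rewrite /= EFinM.
by move=> x Dx; rewrite normcM; apply: ler_wpM2l; [exact: normc_ge0|exact: H1].
Qed.

Lemma cintegral_le f g : cdom f g -> normc (cintegral mu D f) <= 2 * \int[mu]_(x in D) g x.
Proof.
move=> F; have [m ig H] := F; have r1 := cdom_Re F; have r2 := cdom_Im F.
have aux (u : T -> R) : mu.-integrable D (EFin \o u) -> (forall x, D x -> `|u x| <= g x) ->
    `|\int[mu]_(x in D) u x| <= \int[mu]_(x in D) g x.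
  move=> iu Hu; apply: le_trans (le_normr_Rintegral mD iu) _; apply: le_Rintegral => //.
  have := integrable_abse iu; by apply: eq_integrable.
apply: le_trans (normc_le_ReIm _) _; rewrite mulr_natl mulr2n; apply: lerD; apply: aux => // x Dx.
  exact: le_trans (Re_le_normc _) (H _ Dx).
exact: le_trans (Im_le_normc _) (H _ Dx).
Qed.

Lemma cintegral_ae f f' : cmeas D f -> cmeas D f' -> f = f' %[ae mu in D] ->
  cintegral mu D f = cintegral mu D f'.
Proof.
move=> [m1 m2] [m1' m2'] ff'; rewrite /cintegral /Rintegral; congr (fine _ +i* fine _);
  apply: ae_eq_integral => //; try exact/measurable_EFinP; move: ff'; apply: filterS => x Hx Dx;
  by rewrite (Hx Dx).
Qed.

Lemma cdom_sum (I : Type) (s : seq I) (F : I -> T -> C) g :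
  mu.-integrable D (EFin \o g) -> (forall i, cdom (F i) g) ->
  cdom (fun x => \sum_(i <- s) F i x) (fun x => (size s)%:R * g x).
Proof.
move=> ig dF; split; first by apply: cmeas_sum => i; case: (dF i).
  by have := integrableZl mD (size s)%:R ig; apply: eq_integrable => // x _; rewrite /= EFinM.
move=> x Dx; apply: le_trans (normc_sum _ _) _; elim: s => [|i s IH].
  by rewrite big_nil mul0r.
by rewrite big_cons /= -addn1 natrD mulrDl mul1r addrC; apply: lerD => //; case: (dF i) => _ _ /(_ _ Dx).
Qed.

Lemma cintegral_sum (I : Type) (s : seq I) (F : I -> T -> C) g :
  mu.-integrable D (EFin \o g) -> (forall i, cdom (F i) g) ->
  cintegral mu D (fun x => \sum_(i <- s) F i x) = \sum_(i <- s) cintegral mu D (F i).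
Proof.
move=> ig dF; elim: s => [|i s IH].
  rewrite big_nil -[RHS]cintegral0; apply: cintegral_ext => x _.
  by rewrite big_nil.
rewrite big_cons -IH -[X in X + _]mul1r -(cintegral_lin 1 (dF i) (cdom_sum s ig dF)).
by apply: cintegral_ext => x _; rewrite big_cons mul1r.
Qed.

Section Series.
Variables (a : int -> T -> C) (g : T -> R).
Hypotheses (ma : forall m, cmeas D (a m)) (ig : mu.-integrable D (EFin \o g)).
Hypothesis H : forall m x, D x -> normc (a m x) <= g x * inv_sqr m.

Let g0 x : D x -> 0 <= g x.
Proof.
move=> Dx; have := H 0 Dx; rewrite /inv_sqr mulr0z expr0n addr0 invr1 mulr1.
exact: le_trans (normc_ge0 _).
Qed.

Lemma cmeas_csumZ : cmeas D (fun x => csumZ (fun m => a m x)).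
Proof.
have mS N : cmeas D (fun x => psumZ (fun m => a m x) N) by apply: cmeas_sum.
have E x N : D x -> normc (csumZ (fun m => a m x) - psumZ (fun m => a m x) N) <= 8 * g x / N.+1%:R.
  by move=> Dx; apply: csumZ_err => m; exact: H.
split.
  apply: (@measurable_fun_cvg _ _ _ _ (fun N x => complex.Re (psumZ (fun m => a m x) N))).
    by move=> N; have [] := mS N.
  move=> x Dx; apply: (@cvg_of_rate _ _ _ (8 * g x)) => N.
  by rewrite distrC -ReB; apply: le_trans (Re_le_normc _) (E _ _ Dx).
apply: (@measurable_fun_cvg _ _ _ _ (fun N x => complex.Im (psumZ (fun m => a m x) N))).
  by move=> N; have [] := mS N.
move=> x Dx; apply: (@cvg_of_rate _ _ _ (8 * g x)) => N.
by rewrite distrC -ImB; apply: le_trans (Im_le_normc _) (E _ _ Dx).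
Qed.

Lemma cdom_csumZ : cdom (fun x => csumZ (fun m => a m x)) (fun x => 9 * g x).
Proof.
split; first exact: cmeas_csumZ.
  by have := integrableZl mD 9 ig; apply: eq_integrable => // x _; rewrite /= EFinM.
by move=> x Dx; apply: csumZ_le => m; exact: H.
Qed.

Lemma cdom_term m : cdom (a m) g.
Proof.
split=> // x Dx; apply: le_trans (H m Dx) _; rewrite -[leRHS]mulr1.
by apply: ler_wpM2l; [exact: g0|exact: inv_sqr_le1].
Qed.

Lemma cintegral_csumZ :
  cintegral mu D (fun x => csumZ (fun m => a m x)) = csumZ (fun m => cintegral mu D (a m)).
Proof.
apply/esym/(@csumZ_eq _ _ _ (2 * \int[mu]_(x in D) (8 * g x))) => N.
have [dS <-] : cdom (fun x => psumZ (fun m => a m x) N) (fun x => (size (index_enum 'I_N.*2.+1))%:R * g x) /\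
    cintegral mu D (fun x => psumZ (fun m => a m x) N) = psumZ (fun m => cintegral mu D (a m)) N.
  by split; [exact: (cdom_sum _ ig (fun i => cdom_term _))|exact: (cintegral_sum _ ig (fun i => cdom_term _))].
have ig8 (c : R) : mu.-integrable D (EFin \o (fun x => c * g x)).
  by have := integrableZl mD c ig; apply: eq_integrable => // x _; rewrite /= EFinM.
have -> : 2 * \int[mu]_(x in D) (8 * g x) / N.+1%:R =
    2 * \int[mu]_(x in D) (N.+1%:R^-1 * (8 * g x)).
  by rewrite [in RHS]RintegralZl// [_^-1 * _]mulrC mulrA.
have <- : cintegral mu D (fun x => -1 * csumZ (fun m => a m x) + psumZ (fun m => a m x) N) =
    cintegral mu D (fun x => psumZ (fun m => a m x) N) - cintegral mu D (fun x => csumZ (fun m => a m x)).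
  by rewrite (cintegral_lin (-1) cdom_csumZ dS) mulN1r addrC.
apply: cintegral_le; split.
- by apply: cmeas_lin; [exact: cmeas_csumZ|case: dS].
- by have := integrableZl mD N.+1%:R^-1 (ig8 8); apply: eq_integrable => // x _; rewrite /= EFinM.
move=> x Dx; rewrite mulN1r addrC normcB mulrC; apply: csumZ_err => m; exact: H.
Qed.
End Series.

End DominatedComplex.

Section ParametricIntegral.
Context {R : realType} (V : normedModType R).
Local Notation C := R[i].
Local Notation normc := (@ComplexField.Normc.normc R).

Lemma cts_of_seq (f : V -> R) (p : V) :
  (forall u : nat -> V, (forall N, `|u N - p| <= N.+1%:R^-1) -> (fun N => f (u N)) @ \oo --> f p) ->
  {for p, continuous f}.
Proof.
move=> H; apply: contrapT => nc.
have [e e0 He] : exists2 e : R, 0 < e & forall N : nat, exists x : V, `|x - p| <= N.+1%:R^-1 /\ e < `|f p - f x|.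
  apply: contrapT => Hn; apply: nc; apply/cvgrPdist_le => e e0.
  apply: contrapT => nn; apply: Hn; exists e => // N; apply: contrapT => Hx; apply: nn.
  have N0 : 0 < (N.+1%:R^-1 : R) by rewrite invr_gt0.
  have : \forall x \near p, `|p - x| < N.+1%:R^-1 by apply: (@cvgr_dist_lt _ _ _ _ _ id p) => //; exact: cvg_id.
  apply: filterS => x px; rewrite leNgt; apply/negP => lx; apply: Hx; exists x; split=> //.
  by rewrite distrC ltW.
have [u Hu] := choice He.
have /cvgrPdist_le/(_ _ e0)[N _ HN] := H u (fun N => (Hu N).1).
by have := HN N (leqnn N) => /=; rewrite leNgt (Hu N).2.
Qed.

Definition ccts_at (f : V -> C) (p : V) :=
  {for p, continuous (fun x => complex.Re (f x))} /\ {for p, continuous (fun x => complex.Im (f x))}.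

Lemma ccts_at_dist (f : V -> C) p : (forall e : R, 0 < e -> \forall q \near p, normc (f q - f p) <= e) ->
  ccts_at f p.
Proof.
move=> H; split; apply/cvgrPdist_le => e e0; have := H _ e0; apply: filterS => q Hq; rewrite distrC.
  by rewrite -ReB; apply: le_trans (Re_le_normc _) Hq.
by rewrite -ImB; apply: le_trans (Im_le_normc _) Hq.
Qed.

Lemma ccts_dist (f : V -> C) p : ccts_at f p -> forall e : R, 0 < e -> \forall q \near p, normc (f q - f p) <= e.
Proof.
move=> [c1 c2] e e0; have e20 : 0 < e / 2 by rewrite divr_gt0.
have /cvgrPdist_le/(_ _ e20) c1' := c1; have /cvgrPdist_le/(_ _ e20) c2' := c2.
near=> q; apply: le_trans (normc_le_ReIm _) _; rewrite [leRHS]splitr ReB ImB.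
by apply: lerD; rewrite distrC; near: q.
Unshelve. all: by end_near. Qed.

Lemma ccts_lin (a : C) (f f' : V -> C) p : ccts_at f p -> ccts_at f' p -> ccts_at (fun x => a * f x + f' x) p.
Proof.
case: a => a b [c1 c2] [c1' c2']; split.
  rewrite (_ : (fun x => _) = (fun x => (a * complex.Re (f x) - b * complex.Im (f x)) + complex.Re (f' x))).
    by apply: cvgD => //; apply: cvgB; apply: cvgM => //; exact: cvg_cst.
  by apply/funext => x; case: (f x) (f' x) => [? ?] [? ?].
rewrite (_ : (fun x => _) = (fun x => (a * complex.Im (f x) + b * complex.Re (f x)) + complex.Im (f' x))).
  by apply: cvgD => //; apply: cvgD; apply: cvgM => //; exact: cvg_cst.
by apply/funext => x; case: (f x) (f' x) => [? ?] [? ?].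
Qed.

Lemma ccts_mul (f f' : V -> C) p : ccts_at f p -> ccts_at f' p -> ccts_at (fun x => f x * f' x) p.
Proof.
move=> [c1 c2] [c1' c2']; split.
  rewrite (_ : (fun x => _) = (fun x => complex.Re (f x) * complex.Re (f' x) - complex.Im (f x) * complex.Im (f' x))).
    by apply: cvgB; apply: cvgM.
  by apply/funext => x; case: (f x) (f' x) => [? ?] [? ?].
rewrite (_ : (fun x => _) = (fun x => complex.Re (f x) * complex.Im (f' x) + complex.Im (f x) * complex.Re (f' x))).
  by apply: cvgD; apply: cvgM.
by apply/funext => x; case: (f x) (f' x) => [? ?] [? ?].
Qed.

Lemma ccts_cst (c : C) p : ccts_at (fun=> c) p.
Proof. by split; exact: cvg_cst. Qed.

Lemma ccts_expi (h : V -> R) p : {for p, continuous h} -> ccts_at (fun x => expi (h x)) p.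
Proof.
move=> ch; split; first by apply: (@continuous_comp _ _ _ h cos); [exact: ch|exact: continuous_cos].
by apply: (@continuous_comp _ _ _ h sin); [exact: ch|exact: continuous_sin].
Qed.

Lemma ccts_sum (I : Type) (s : seq I) (F : I -> V -> C) p :
  (forall i, ccts_at (F i) p) -> ccts_at (fun x => \sum_(i <- s) F i x) p.
Proof.
move=> cF; elim: s => [|i s IH].
  by rewrite (_ : (fun x => _) = fun=> 0); [exact: ccts_cst|apply/funext => x; rewrite big_nil].
rewrite (_ : (fun x => _) = fun x => 1 * F i x + \sum_(j <- s) F j x); first exact: ccts_lin.
by apply/funext => x; rewrite big_cons mul1r.
Qed.

(** The symmetric partial sums converge uniformly. *)
Lemma ccts_csumZ (a : int -> V -> C) (K : R) p :
  (forall m x, normc (a m x) <= K * inv_sqr m) -> (forall m, ccts_at (a m) p) ->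
  ccts_at (fun x => csumZ (fun m => a m x)) p.
Proof.
move=> H ca; apply: ccts_at_dist => e e0.
have e30 : 0 < e / 3 by rewrite divr_gt0.
have /cvgrPdist_le/(_ _ e30)[N _ HN] := cvg_inv_succ (8 * K).
have {}HN := HN N (leqnn N).
have E x : normc (csumZ (fun m => a m x) - psumZ (fun m => a m x) N) <= e / 3.
  apply: le_trans (csumZ_err _ _) _; first by move=> m; exact: H.
  by apply: le_trans HN; rewrite sub0r normrN ler_norm.
have cS : ccts_at (fun x => psumZ (fun m => a m x) N) p by apply: ccts_sum.
have := ccts_dist cS e30; apply: filterS => q Hq.
rewrite (_ : csumZ (a^~ q) - csumZ (a^~ p) = (csumZ (fun m => a m q) - psumZ (fun m => a m q) N) +
  ((psumZ (fun m => a m q) N - psumZ (fun m => a m p) N) + (psumZ (fun m => a m p) N - csumZ (fun m => a m p)))).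
  apply: le_trans (normcD _ _) _; rewrite (_ : e = e / 3 + (e / 3 + e / 3)); last by field.
  apply: lerD; first exact: E.
  by apply: le_trans (normcD _ _) _; apply: lerD => //; rewrite normcB.
by ring.
Qed.

Lemma cts_Rintegral_dominated (d : measure_display) (T : measurableType d)
    (mu : {measure set T -> \bar R}) (D : set T) (F : V -> T -> R) (g : T -> R) (p : V) :
  measurable D -> (forall q, measurable_fun D (F q)) -> mu.-integrable D (EFin \o g) ->
  (forall q x, D x -> `|F q x| <= g x) -> (forall x, D x -> {for p, continuous (F ^~ x)}) ->
  {for p, continuous (fun q => \int[mu]_(x in D) F q x)}.
Proof.
move=> mD mF ig H cF; apply: cts_of_seq => u Hu.
have iF q : mu.-integrable D (EFin \o F q).
  apply: le_integrable ig => //; first exact/measurable_EFinP.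
  by move=> x Dx; rewrite /= lee_fin; apply: le_trans (H _ _ Dx) (ler_norm _).
have up : u @ \oo --> p.
  apply/cvgrPdist_le => e e0; have /cvgrPdist_le/(_ _ e0) := @cvg_inv_succ R 1.
  apply: filterS => N; rewrite sub0r normrN mul1r distrC => HN.
  by apply: le_trans (Hu N) (le_trans (ler_norm _) HN).
apply: fine_cvg; rewrite /Rintegral fineK; last exact: (integrable_fin_num mD (iF p)).
apply: (@dominated_cvg _ _ _ mu _ mD (fun N => EFin \o F (u N)) (EFin \o F p) (EFin \o g)).
- by move=> N; exact/measurable_EFinP.
- by move=> x Dx; apply: cvg_EFin; [exact: nearW|exact: (cvg_comp _ _ up (cF x Dx))].
- by [].
- exact: ig.
- by move=> N x Dx; rewrite lee_fin; exact: H.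
Qed.

Lemma ccts_cintegral (d : measure_display) (T : measurableType d)
    (mu : {measure set T -> \bar R}) (D : set T) (F : V -> T -> C) (g : T -> R) (p : V) :
  measurable D -> (forall q, cdom mu D (F q) g) -> (forall x, D x -> ccts_at (F ^~ x) p) ->
  ccts_at (fun q => cintegral mu D (F q)) p.
Proof.
move=> mD dF cF; split; apply: (@cts_Rintegral_dominated _ _ mu D _ g) => //.
- by move=> q; case: (dF q) => -[].
- by case: (dF p).
- by move=> q x Dx; case: (dF q) => _ _ /(_ _ Dx); exact: le_trans (Re_le_normc _).
- by move=> x Dx; case: (cF x Dx).
- by move=> q; case: (dF q) => -[].
- by case: (dF p).
- by move=> q x Dx; case: (dF q) => _ _ /(_ _ Dx); exact: le_trans (Im_le_normc _).
- by move=> x Dx; case: (cF x Dx).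
Qed.

End ParametricIntegral.

(** * An integrable weight on Euclidean space *)

Section IntegrationRn.
Context {R : realType}.
Local Notation C := R[i].
Local Notation normc := (@ComplexField.Normc.normc R).
Local Notation leb := (@lebesgue_measure R).

Lemma rV_cons0 n t (y : 'rV[R]_n) : rV_cons (t, y) ord0 ord0 = t.
Proof. by rewrite mxE unlift_none. Qed.

Lemma rV_consS n t (y : 'rV[R]_n) i : rV_cons (t, y) ord0 (lift ord0 i) = y ord0 i.
Proof. by rewrite mxE liftK. Qed.

Lemma rV_unconsK n (x : 'rV[R]_n.+1) : rV_cons (rV_uncons x) = x.
Proof.
apply/rowP => i; rewrite mxE; case: unliftP => [j ->|->] /=; last by [].
by rewrite mxE.
Qed.

Lemma lebesgue_rVS n : lebesgue_rV n.+1 = pushforward (leb \x lebesgue_rV n)%E (@rV_cons R n) :> (set 'rV[R]_n.+1 -> \bar R).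
Proof. by []. Qed.

Lemma integrable_rVS n (f : 'rV[R]_n.+1 -> R) (u : R -> R) (v : 'rV[R]_n -> R) :
  measurable_fun setT f -> (forall t, 0 <= u t) -> (forall y, 0 <= v y) ->
  leb.-integrable setT (EFin \o u) -> (lebesgue_rV n).-integrable setT (EFin \o v) ->
  (forall t y, `|f (rV_cons (t, y))| <= u t * v y) ->
  (lebesgue_rV n.+1).-integrable setT (EFin \o f).
Proof.
move=> mf u0 v0 iu iv fuv.
have := @integrable_pushforward _ _ (measurableTypeR R * 'rV[R]_n)%type 'rV[R]_n.+1 R (@rV_cons R n)
  (@measurable_rV_cons R n) (leb \x lebesgue_rV n)%E setT (EFin \o f).
apply; [exact/measurable_EFinP| |exact: measurableT].
rewrite preimage_setT -setXTT.
apply: (@Fubini_integrable _ _ _ _ _ leb (lebesgue_rV n) setT measurableT (f \o @rV_cons R n) u v) => //.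
  exact: measurableT_comp mf (@measurable_rV_cons R n).
by move=> t y _; exact: fuv.
Qed.

Lemma Rintegral_rVS n (f : 'rV[R]_n.+1 -> R) (u : R -> R) (v : 'rV[R]_n -> R) :
  measurable_fun setT f -> (forall t, 0 <= u t) -> (forall y, 0 <= v y) ->
  leb.-integrable setT (EFin \o u) -> (lebesgue_rV n).-integrable setT (EFin \o v) ->
  (forall t y, `|f (rV_cons (t, y))| <= u t * v y) ->
  \int[lebesgue_rV n.+1]_x f x = \int[(leb \x lebesgue_rV n)%E]_(p in setT `*` setT) f (rV_cons p).
Proof.
move=> mf u0 v0 iu iv fuv; have mfc := measurableT_comp mf (@measurable_rV_cons R n).
rewrite /Rintegral; congr fine.
have := @integral_pushforward _ _ (measurableTypeR R * 'rV[R]_n)%type 'rV[R]_n.+1 R (@rV_cons R n)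
  (@measurable_rV_cons R n) (leb \x lebesgue_rV n)%E setT (EFin \o f).
move=> -> //; [by rewrite preimage_setT setXTT|exact/measurable_EFinP|].
rewrite preimage_setT -setXTT.
exact: (@Fubini_integrable _ _ _ _ _ leb (lebesgue_rV n) setT measurableT (f \o @rV_cons R n) u v mfc u0 v0 iu iv (fun t y _ => fuv t y)).
Qed.

Lemma oneDsqrV_gt0 (t : R) : 0 < (1 + t ^+ 2)^-1.
Proof. by rewrite invr_gt0 ltr_pwDl// sqr_ge0. Qed.

Lemma integrable_oneDsqrV : leb.-integrable setT (EFin \o (fun t : R => (1 + t ^+ 2)^-1)).
Proof.
have c : continuous (fun t : R => (1 + t ^+ 2)^-1) by exact: continuous_oneDsqrV.
apply/integrableP; split; first by apply/measurable_EFinP; exact: continuous_measurable_fun.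
under eq_integral do rewrite /= ger0_norm ?(ltW (oneDsqrV_gt0 _))//.
rewrite ge0_symfun_integralT//=.
- rewrite (_ : [set x | _] = `[0, +oo[%classic); last first.
    by apply/seteqP; split => x/=; rewrite in_itv/= andbT.
  by have := @integral0y_oneDsqr R; rewrite /oneDsqr => ->; rewrite -EFinM ltry.
- by move=> t; rewrite ltW// oneDsqrV_gt0.
- by move=> t /=; rewrite sqrrN.
Qed.

(** An integrable weight on R^n that splits off one coordinate at a time. *)
Definition wt n (x : 'rV[R]_n) : R := \prod_(i < n) (1 + x ord0 i ^+ 2)^-1.

Lemma wt_gt0 n (x : 'rV[R]_n) : 0 < wt x.
Proof. by apply: prodr_gt0 => i _; exact: oneDsqrV_gt0. Qed.

Lemma wt_le1 n (x : 'rV[R]_n) : wt x <= 1.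
Proof.
apply: prodr_ile1 => i _; rewrite (ltW (oneDsqrV_gt0 _))/= invf_le1 ?ler_wpDr ?sqr_ge0//.
by rewrite ltr_pwDl// sqr_ge0.
Qed.

Lemma wt_cons n t (y : 'rV[R]_n) : wt (rV_cons (t, y)) = (1 + t ^+ 2)^-1 * wt y.
Proof.
rewrite /wt big_ord_recl rV_cons0; congr (_ * _).
by apply: eq_bigr => i _; rewrite rV_consS.
Qed.

Lemma wt_cts n : continuous (@wt n).
Proof.
move=> x; rewrite /wt; elim: (index_enum _) => [|i s IH].
  by rewrite (_ : (fun x => _) = fun=> 1); [exact: cst_continuous|apply/funext => y; rewrite big_nil].
rewrite (_ : (fun x => _) = fun y : 'rV[R]_n => (1 + y ord0 i ^+ 2)^-1 * \prod_(j <- s) (1 + y ord0 j ^+ 2)^-1).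
  rewrite /continuous_at; apply: cvgM; [exact: (nbhs_filter x)| |exact: IH].
  apply: (@continuous_comp _ _ _ (fun y : 'rV[R]_n => y ord0 i) (fun t : R => (1 + t ^+ 2)^-1)).
    exact: coord_continuous.
  exact: continuous_oneDsqrV.
by apply/funext => y; rewrite big_cons.
Qed.

Lemma measurable_wtE n : measurable_fun setT (EFin \o @wt n).
Proof. by apply/measurable_EFinP; apply: measurable_cts_rV; exact: wt_cts. Qed.

Lemma integrable_wt n : (lebesgue_rV n).-integrable setT (EFin \o @wt n).
Proof.
elim: n => [|n IH].
  apply/integrableP; split; first exact: measurable_wtE.
  rewrite (_ : lebesgue_rV 0 = \d_(0 : 'rV[R]_0))// integral_dirac//.
    by rewrite diracT mul1e ltry.
  by apply: measurableT_comp => //; exact: measurable_wtE.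
apply: (@integrable_rVS n (@wt n.+1) (fun t => (1 + t ^+ 2)^-1) (@wt n)) => //.
- by apply: measurable_cts_rV; exact: wt_cts.
- by move=> t; exact: ltW (oneDsqrV_gt0 _).
- by move=> y; exact: ltW (wt_gt0 _).
- exact: integrable_oneDsqrV.
- by move=> t y; rewrite wt_cons ger0_norm// mulr_ge0// ltW// ?oneDsqrV_gt0 ?wt_gt0.
Qed.

(** Boxes have positive measure, so that a continuous function is determined by
    its class modulo null sets. *)
Lemma ball_rV_gt0 n (x : 'rV[R]_n) (e : R) : 0 < e ->
  measurable [set y : 'rV[R]_n | forall i, `|y ord0 i - x ord0 i| <= e] /\
  (0 < lebesgue_rV n [set y : 'rV[R]_n | forall i, `|(y ord0 i - x ord0 i)%R| <= e]%R)%E.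
Proof.
move=> e0.
have itvE (a : R) : [set t | `|t - a| <= e] = `[a - e, a + e]%classic.
  by apply/seteqP; split=> t /=; rewrite in_itv/= ler_norml; move=> /andP[? ?]; apply/andP; split; lra.
have vol (a : R) : leb [set t | `|t - a| <= e] = (2 * e)%:E.
  rewrite itvE [LHS]lebesgue_measure_itv /= lte_fin ifT; last lra.
  by rewrite -EFinB; congr EFin; ring.
have mB m (z : 'rV[R]_m) : measurable [set y : 'rV[R]_m | forall i, `|y ord0 i - z ord0 i| <= e].
  rewrite (_ : [set y | _] = \big[setI/setT]_(i < m) [set y : 'rV[R]_m | `|y ord0 i - z ord0 i| <= e]).
    apply: bigsetI_measurable => i _.
    have := @measurable_coord R m i measurableT [set t | `|t - z ord0 i| <= e].
    by rewrite setTI; apply; rewrite itvE.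
  apply/seteqP; split=> [y Hy|y]; rewrite -bigcap_seq; first by move=> i _; exact: Hy.
  by move=> Hy i; apply: Hy; exact: mem_index_enum.
split; first exact: mB.
elim: n => [|n IH] in x *.
  by rewrite /= diracE mem_set ?lte_fin// => -[].
rewrite lebesgue_rVS /pushforward.
rewrite (_ : _ @^-1` _ = [set t | `|t - x ord0 ord0| <= e] `*`
    [set y : 'rV[R]_n | forall i, `|y ord0 i - (\row_j x ord0 (lift ord0 j)) ord0 i| <= e]).
  rewrite product_measure1E; [|by rewrite itvE|exact: mB].
  apply: mule_gt0; last exact: IH.
  by rewrite [X in (_ < X)%E]vol lte_fin mulr_gt0.
apply/seteqP; split=> [[t y] /= H|[t y] [/= H1 H2] i].
  split; first by have := H ord0; rewrite rV_cons0.
  by move=> i; have := H (lift ord0 i); rewrite rV_consS mxE.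
case: (unliftP ord0 i) => [j ->|->]; last by rewrite rV_cons0.
by have := H2 j; rewrite rV_consS mxE.
Qed.

End IntegrationRn.

Section ComplexFubini.
Context {R : realType} (d1 d2 : measure_display)
  (T1 : measurableType d1) (T2 : measurableType d2).
Variables (m1 : {sigma_finite_measure set T1 -> \bar R})
  (m2 : {sigma_finite_measure set T2 -> \bar R}) (D : set T2).
Hypothesis mD : measurable D.
Local Notation normc := (@ComplexField.Normc.normc R).
Variables (f : T1 * T2 -> R[i]) (u : T1 -> R) (v : T2 -> R).
Hypotheses (mf : cmeas setT f) (u0 : forall x, 0 <= u x) (v0 : forall y, 0 <= v y).
Hypotheses (iu : m1.-integrable setT (EFin \o u)) (iv : m2.-integrable D (EFin \o v)).
Hypothesis fuv : forall x y, D y -> normc (f (x, y)) <= u x * v y.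

Let fR x y : D y -> `|complex.Re (f (x, y))| <= u x * v y.
Proof. by move=> Dy; apply: le_trans (Re_le_normc _) (fuv x Dy). Qed.
Let fI x y : D y -> `|complex.Im (f (x, y))| <= u x * v y.
Proof. by move=> Dy; apply: le_trans (Im_le_normc _) (fuv x Dy). Qed.

Lemma cFubini12 : cintegral (m1 \x m2)%E (setT `*` D) f =
  cintegral m1 setT (fun x => cintegral m2 D (fun y => f (x, y))).
Proof.
case: mf => mR mI; rewrite /cintegral; congr (_ +i* _).
  exact: (Fubini12 mD (f := fun z => complex.Re (f z)) mR u0 v0 iu iv fR).
exact: (Fubini12 mD (f := fun z => complex.Im (f z)) mI u0 v0 iu iv fI).
Qed.

Lemma cFubini21 : cintegral (m1 \x m2)%E (setT `*` D) f =
  cintegral m2 D (fun y => cintegral m1 setT (fun x => f (x, y))).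
Proof.
case: mf => mR mI; rewrite /cintegral; congr (_ +i* _).
  exact: (Fubini21 mD (f := fun z => complex.Re (f z)) mR u0 v0 iu iv fR).
exact: (Fubini21 mD (f := fun z => complex.Im (f z)) mI u0 v0 iu iv fI).
Qed.

Lemma cFubini_swap : cintegral m1 setT (fun x => cintegral m2 D (fun y => f (x, y))) =
  cintegral m2 D (fun y => cintegral m1 setT (fun x => f (x, y))).
Proof. by rewrite -cFubini12 cFubini21. Qed.

Lemma cdom_section2 x : cdom m2 D (fun y => f (x, y)) (fun y => u x * v y).
Proof.
split; last by move=> y Dy; exact: fuv.
  case: mf => mR mI; split; apply: measurable_funTS.
    exact: (measurableT_comp mR (pair1_measurable x)).
  exact: (measurableT_comp mI (pair1_measurable x)).
by have := integrableZl mD (u x) iv; apply: eq_integrable => // y _; rewrite /= EFinM.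
Qed.

End ComplexFubini.

(** * Fourier coefficients on the circle *)

Section CircleSeries.
Context {R : realType}.
Local Notation C := R[i].
Local Notation normc := (@ComplexField.Normc.normc R).
Local Notation leb := (@lebesgue_measure R).
Local Notation S1 := (@dom_S1 R).

Lemma measurable_dom_S1 : measurable (S1 : set (measurableTypeR R)). Proof. exact: measurable_itv. Qed.

Lemma twopi_gt0 : 0 < 2 * pi :> R. Proof. by rewrite mulr_gt0// pi_gt0. Qed.

Lemma dom_S1_measure : (leb S1 = (2 * pi)%:E)%E.
Proof.
by rewrite [LHS]lebesgue_measure_itv /= lte_fin twopi_gt0 -EFinB subr0.
Qed.

Lemma integrable_dom_S1_cst (c : R) : leb.-integrable S1 (EFin \o (fun=> c)).
Proof.
apply: measurable_bounded_integrable; first exact: measurable_dom_S1.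
- by rewrite [X in (X < _)%E]dom_S1_measure ltry.
- exact: measurable_cst.
- by exists `|c|; split; [exact: num_real|move=> x cx y _ /=; exact: ltW].
Qed.

Lemma Rintegral_dom_S1_cst (c : R) : \int[leb]_(t in S1) c = c * (2 * pi).
Proof.
by rewrite [LHS]Rintegral_cst; [rewrite [X in fine X]dom_S1_measure|exact: measurable_dom_S1].
Qed.

Definition ccts (V : normedModType R) (f : V -> C) := forall p, ccts_at f p.

Lemma ccts_cmeas (f : R -> C) (A : set (measurableTypeR R)) : ccts f -> measurable A -> cmeas (T := measurableTypeR R) A f.
Proof.
by move=> cf mA; split; apply: measurable_funTS; apply: continuous_measurable_fun => p; case: (cf p).
Qed.

Lemma cdom_S1 (f : R -> C) (B : R) : ccts f -> (forall t, normc (f t) <= B) -> cdom leb S1 f (fun=> B).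
Proof.
move=> cf H; split; first exact: (ccts_cmeas cf measurable_dom_S1).
  exact: integrable_dom_S1_cst.
by move=> t _; exact: H.
Qed.

Definition cder (F F' : R -> C) := forall t,
  is_derive t (1 : R) (fun t : R => complex.Re (F t)) (complex.Re (F' t)) /\
  is_derive t (1 : R) (fun t : R => complex.Im (F t)) (complex.Im (F' t)).

Lemma cFTC (F F' : R -> C) : cder F F' -> ccts F' -> cintegral leb S1 F' = F (2 * pi) - F 0.
Proof.
move=> dF cF; apply/complex_eqP; rewrite ReB ImB /cintegral /=; split.
  apply: (@Rintegral_FTC R (fun t => complex.Re (F t)) (fun t => complex.Re (F' t))) => [|t _|t _]; first exact: twopi_gt0.
    by case: (dF t).
  by case: (cF t).
apply: (@Rintegral_FTC R (fun t => complex.Im (F t)) (fun t => complex.Im (F' t))) => [|t _|t _]; first exact: twopi_gt0.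
  by case: (dF t).
by case: (cF t).
Qed.

Lemma cder_expi (c : R) : cder (fun t => expi (c * t)) (fun t => (0 +i* c) * expi (c * t)).
Proof.
have dl (t : R) : is_derive t (1 : R) (fun t : R => c * t) c.
  by apply: (is_derive_eq (is_deriveZ c (is_derive_id t (1 : R)))); rewrite /GRing.scale /= mulr1.
move=> t; split=> /=.
  by apply: (is_derive_eq (is_derive1_comp (is_derive_cos (c * t)) (dl t))); rewrite /=; ring.
by apply: (is_derive_eq (is_derive1_comp (is_derive_sin (c * t)) (dl t))); rewrite /=; ring.
Qed.

Lemma cderM (F F' G G' : R -> C) : cder F F' -> cder G G' ->
  cder (fun t => F t * G t) (fun t => F' t * G t + F t * G' t).
Proof.
move=> dF dG t; have [f1 f2] := dF t; have [g1 g2] := dG t; split.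
  rewrite (_ : (fun t => _) = (fun t => complex.Re (F t) * complex.Re (G t) - complex.Im (F t) * complex.Im (G t))).
    apply: (is_derive_eq (is_deriveB (is_deriveM f1 g1) (is_deriveM f2 g2))).
    by rewrite /GRing.scale /=; case: (F t) (F' t) (G t) (G' t) => [? ?] [? ?] [? ?] [? ?] /=; ring.
  by apply/funext => s; case: (F s) (G s) => [? ?] [? ?].
rewrite (_ : (fun t => _) = (fun t => complex.Re (F t) * complex.Im (G t) + complex.Im (F t) * complex.Re (G t))).
  apply: (is_derive_eq (is_deriveD (is_deriveM f1 g2) (is_deriveM f2 g1))).
  by rewrite /GRing.scale /=; case: (F t) (F' t) (G t) (G' t) => [? ?] [? ?] [? ?] [? ?] /=; ring.
by apply/funext => s; case: (F s) (G s) => [? ?] [? ?].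
Qed.

Lemma cder_ccts (F F' : R -> C) : cder F F' -> ccts F.
Proof.
by move=> dF t; have [f1 f2] := dF t; split; apply/differentiable_continuous/derivable1_diffP; apply: ex_derive.
Qed.

Lemma ccts_expi_lin (c : R) : ccts (fun t : R => expi (c * t)).
Proof. exact: cder_ccts (cder_expi c). Qed.

Definition fcoef (g : R -> C) (k : int) : C :=
  ((2 * pi)^-1)%:C * cintegral leb S1 (fun t => g t * expi (- (k%:~R * t))).

Lemma ccts_fcoef (g : R -> C) (k : int) : ccts g -> ccts (fun t => g t * expi (- (k%:~R * t))).
Proof.
move=> cg t; apply: ccts_mul; first exact: cg.
by have := ccts_expi_lin (- k%:~R) t; under [X in ccts_at X _]eq_fun do rewrite mulNr.
Qed.

Lemma cdom_fcoef (g : R -> C) (k : int) (B : R) : ccts g -> (forall t, normc (g t) <= B) ->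
  cdom leb S1 (fun t => g t * expi (- (k%:~R * t))) (fun=> B).
Proof.
by move=> cg H; apply: cdom_S1 => [|t]; [exact: ccts_fcoef|rewrite normcM normc_expi mulr1].
Qed.

Lemma fcoef_le (g : R -> C) k (B : R) : ccts g -> (forall t, normc (g t) <= B) -> normc (fcoef g k) <= 2 * B.
Proof.
move=> cg H; rewrite normcM normc_real ger0_norm ?invr_ge0 ?(ltW twopi_gt0)//.
rewrite ler_pdivrMl ?twopi_gt0//.
have := cintegral_le measurable_dom_S1 (cdom_fcoef k cg H); rewrite Rintegral_dom_S1_cst.
by rewrite (_ : 2 * pi * (2 * B) = 2 * (B * (2 * pi))); last ring.
Qed.

Lemma fcoef_ext (g h : R -> C) k : (forall t, S1 t -> g t = h t) -> fcoef g k = fcoef h k.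
Proof. by move=> H; congr (_ * _); apply: cintegral_ext => t St; rewrite H. Qed.

Lemma fcoef_lin (a : C) (g h : R -> C) k (B B' : R) : ccts g -> ccts h -> (forall t, normc (g t) <= B) ->
  (forall t, normc (h t) <= B') -> fcoef (fun t => a * g t + h t) k = a * fcoef g k + fcoef h k.
Proof.
move=> cg ch Hg Hh; rewrite /fcoef mulrCA -mulrDr; congr (_ * _).
rewrite -(cintegral_lin measurable_dom_S1 a (cdom_fcoef k cg Hg) (cdom_fcoef k ch Hh)).
by apply: cintegral_ext => t _; ring.
Qed.

Lemma expi_twopi (k : int) : expi (k%:~R * (2 * pi)) = 1 :> C.
Proof. by have := @expi_period R k 0; rewrite add0r mulr0 expi0. Qed.

Lemma fcoef_expi (j k : int) : fcoef (fun t => expi (j%:~R * t)) k = (j == k)%:R.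
Proof.
rewrite /fcoef; have -> : (fun t : R => expi (j%:~R * t) * expi (- (k%:~R * t))) = (fun t => expi ((j - k)%:~R * t) : C).
  by apply/funext => t; rewrite -expiD intrB mulrBl.
rewrite -subr_eq0; case: eqP => [->|/eqP jk0].
  rewrite (_ : (fun t => _) = (fun=> 1 : C)); last by apply/funext => t; rewrite mul0r expi0.
  rewrite /cintegral /= Rintegral_dom_S1_cst (Rintegral_dom_S1_cst 0) mul1r mul0r.
  apply/complex_eqP; split=> /=; last by ring.
  by rewrite mulVf ?mul0r ?subr0// gt_eqF// twopi_gt0.
set c : R := (j - k)%:~R; have c0 : c != 0 by rewrite intr_eq0.
have -> : (fun t => expi (c * t) : C) = (fun t => (0 +i* c) * expi (c * t) * (0 +i* c)^-1).
  apply/funext => t; rewrite [RHS]mulrC mulrA mulVf ?mul1r//.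
  by rewrite eq_complex /= eqxx.
rewrite (_ : cintegral _ _ _ = 0) ?mulr0//.
have cc : ccts (fun t : R => (0 +i* c) * expi (c * t)) by move=> t; apply: ccts_mul; [exact: ccts_cst|exact: ccts_expi_lin].
have dc : cdom leb S1 (fun t : R => (0 +i* c) * expi (c * t)) (fun=> normc (0 +i* c)).
  by apply: cdom_S1 => // t; rewrite normcM normc_expi mulr1.
under cintegral_ext do rewrite mulrC.
rewrite (cintegralM measurable_dom_S1 _ dc) (cFTC (cder_expi c) cc) expi_twopi mulr0 expi0 subrr.
by rewrite mulr0.
Qed.

(** Integration by parts against an exponential has no boundary terms for a
    periodic function. *)
Lemma fcoef_der (g g' : R -> C) k (B : R) : cder g g' -> ccts g' -> g (2 * pi) = g 0 ->
  (forall t, normc (g t) <= B) -> (forall t, normc (g' t) <= B) ->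
  fcoef g' k = (0 +i* k%:~R) * fcoef g k.
Proof.
move=> dg cg' per Hg Hg'; have cg := cder_ccts dg.
pose e t : C := expi (- (k%:~R * t)).
have eE : e = fun t => expi (- k%:~R * t) by apply/funext => t; rewrite mulNr.
have de : cder e (fun t => (0 +i* (- k%:~R)) * e t) by rewrite eE; exact: cder_expi.
have c1 : ccts (fun t => g' t * e t) by exact: ccts_fcoef.
have c2 : ccts (fun t => g t * e t) by exact: ccts_fcoef.
have E : (fun t => g' t * e t + g t * ((0 +i* (- k%:~R)) * e t)) =
    (fun t => (0 +i* (- k%:~R)) * (g t * e t) + g' t * e t) by apply/funext => t; ring.
have := cderM dg de; rewrite E => /cFTC H.
have : ccts (fun t => (0 +i* (- k%:~R)) * (g t * e t) + g' t * e t) by move=> t; apply: ccts_lin.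
have e2 : e (2 * pi) = 1 by rewrite /e -mulNr -mulrNz expi_twopi.
have e0 : e 0 = 1 by rewrite /e mulr0 oppr0 expi0.
move=> /H; rewrite per e2 e0 subrr.
rewrite (cintegral_lin measurable_dom_S1 _ (cdom_fcoef k cg Hg) (cdom_fcoef k cg' Hg')).
move=> /eqP; rewrite addrC addr_eq0 => /eqP H2; rewrite /fcoef H2.
rewrite mulrCA; congr (_ * _); rewrite -mulNr; congr (_ * _).
by apply/complex_eqP; rewrite /= oppr0 opprK.
Qed.
End CircleSeries.

(** * Convergence of Fourier series *)

Section FourierSeries.
Context {R : realType}.
Local Notation C := R[i].
Local Notation normc := (@ComplexField.Normc.normc R).
Local Notation leb := (@lebesgue_measure R).
Local Notation S1 := (@dom_S1 R).

Lemma fcoef_decay (g g1 g2 : R -> C) (B : R) k : cder g g1 -> cder g1 g2 -> ccts g2 ->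
  (forall t, g (t + 2 * pi) = g t) -> (forall t, g1 (t + 2 * pi) = g1 t) ->
  (forall t, normc (g t) <= B) -> (forall t, normc (g1 t) <= B) -> (forall t, normc (g2 t) <= B) ->
  normc (fcoef g k) <= 4 * B * inv_sqr k.
Proof.
move=> d1 d2 c2 per per1 H0 H1 H2; have c1 := cder_ccts d2; have c0 := cder_ccts d1.
have p0 : g (2 * pi) = g 0 by rewrite -(per 0) add0r.
have p1 : g1 (2 * pi) = g1 0 by rewrite -(per1 0) add0r.
have E : ((1 + k%:~R ^+ 2 : R)%:C) * fcoef g k = fcoef g k - fcoef g2 k.
  rewrite (fcoef_der k d2 c2 p1 H1 H2) (fcoef_der k d1 c1 p0 H0 H1).
  case: (fcoef g k) => a b; apply/complex_eqP; split=> /=; ring.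
have pos : 0 < 1 + k%:~R ^+ 2 :> R by rewrite ltr_pwDl// sqr_ge0.
rewrite /inv_sqr ler_pdivlMr// mulrC -[X in X * _](gtr0_norm pos) -normc_real -normcM E.
apply: le_trans (normcD _ _) _; rewrite normcN (_ : 4 * B = 2 * B + 2 * B); last ring.
by apply: lerD; apply: fcoef_le.
Qed.

(** Where the cosine is at least 1/2 the tangent bound [u * cos u <= sin u]
    suffices; elsewhere the sine is at least 3/4. *)
Lemma sin_ge_div_pi (u : R) : 0 <= u <= pi / 2 -> u / pi <= sin u.
Proof.
move=> /andP[u0 u1]; have pi0 := pi_gt0 R; have pi2 := pi_ge2 R.
have s0 : 0 <= sin u by apply: sin_ge0_pi; apply/andP; split=> //; lra.
have cu0 : 0 <= cos u by apply: cos_ge0_pihalf; apply/andP; split; lra.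
have tanb : u * cos u <= sin u.
  case: (eqVneq u 0) => [->|un0]; first by rewrite mul0r sin0.
  have up : 0 < u by rewrite lt_neqAle eq_sym un0.
  have [c] := @MVT R sin cos 0 u up (fun x _ => is_derive_sin x) (continuous_subspaceT (@continuous_sin R)).
  rewrite in_itv /= sin0 !subr0 => /andP[c0 cu] ->; rewrite mulrC ler_wpM2r//.
  by rewrite ltW// ltr_cos ?in_itv//=; apply/andP; split; lra.
rewrite ler_pdivrMr//.
have [ch|ch] := lerP 2^-1 (cos u); first by nra.
have := cos2Dsin2 u; have : sin u <= 1 by have := sin_le1 u.
by nra.
Qed.

Lemma normc_expiB (s t : R) : normc (expi s - expi t) = 2 * `|sin ((s - t) / 2)|.
Proof.
have E : expi s - expi t = expi t * (expi (s - t) - 1) by rewrite mulrBr -expiD mulr1 addrCA subrr addr0.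
rewrite E normcM normc_expi mul1r; set u := s - t.
apply/eqP; rewrite -(@eqrXn2 _ 2) ?normc_ge0 ?mulr_ge0//.
rewrite normc_sqr exprMn real_normK ?num_real//=.
have -> : cos u = 1 - 2 * sin (u / 2) ^+ 2.
  by rewrite [in LHS](splitr u) cosD; have := cos2Dsin2 (u / 2); nra.
have -> : sin u = 2 * sin (u / 2) * cos (u / 2) by rewrite [in LHS](splitr u) sinD; ring.
apply/eqP; have H : cos (u / 2) ^+ 2 = 1 - sin (u / 2) ^+ 2 by have := cos2Dsin2 (u / 2); lra.
by rewrite subr0 !exprMn H; ring.
Qed.

Lemma mvt_dist (f f' : R -> R) (B s t : R) : (forall x : R, is_derive x (1 : R) f (f' x)) ->
  (forall x, `|f' x| <= B) -> `|f s - f t| <= B * `|s - t|.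
Proof.
move=> df H; wlog st : s t / t <= s.
  by move=> W; case/orP: (le_total t s) => [/W//|/W]; rewrite distrC [X in _ <= _ * X]distrC.
case: (eqVneq s t) => [->|snt]; first by rewrite !subrr normr0 mulr0.
have lt : t < s by rewrite lt_neqAle eq_sym snt.
have cf : {within `[t, s], continuous f}.
  by apply: continuous_subspaceT => x; apply/differentiable_continuous/derivable1_diffP; apply: ex_derive.
have [c _ ->] := @MVT R f f' t s lt (fun x _ => df x) cf.
by rewrite normrM ler_wpM2r.
Qed.

Lemma periodic_shift (g : R -> C) (j : int) t : (forall t, g (t + 2 * pi) = g t) -> g (t + j%:~R * (2 * pi)) = g t.
Proof.
move=> per; have E (m : nat) u : g (u + m%:R * (2 * pi)) = g u.
  by elim: m => [|m IH]; [rewrite mul0r addr0|rewrite -addn1 natrD mulrDl mul1r addrA per].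
case: j => m; first exact: E.
by rewrite -[LHS](E m.+1); congr g; rewrite NegzE mulrNz mulNr -pmulrn -addrA addNr addr0.
Qed.

Lemma periodic_lipschitz (g g1 : R -> C) (B : R) s t : cder g g1 ->
  (forall t, g (t + 2 * pi) = g t) -> (forall t, normc (g1 t) <= B) ->
  normc (g s - g t) <= 2 * pi * B * normc (expi s - expi t).
Proof.
move=> dg per H; have pi0 := pi_gt0 R; have B0 := le_trans (normc_ge0 _) (H 0).
pose j := Num.floor ((s - t + pi) / (2 * pi)); pose s' := s + (- j)%:~R * (2 * pi).
have -> : g s = g s' by rewrite /s' periodic_shift.
have -> : expi s = expi s' :> C.
  rewrite /s' (periodic_shift (g := @expi R))// => u.
  by have := @expi_period R 1 u; rewrite !mul1r.
have us : `|s' - t| <= pi.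
  have /andP[] := floor_itv ((s - t + pi) / (2 * pi)); rewrite -/j intrD -[1%:~R]/(1 : R).
  rewrite ler_pdivlMr ?ltr_pdivrMr ?mulr_gt0// /s' mulrNz ler_norml => h1 h2.
  by apply/andP; split; nra.
rewrite normc_expiB; apply: (@le_trans _ _ (2 * B * `|s' - t|)).
  apply: le_trans (normc_le_ReIm _) _; rewrite ReB ImB (_ : 2 * B * _ = B * `|s' - t| + B * `|s' - t|); last by ring.
  apply: lerD.
    apply: (@mvt_dist (fun x => complex.Re (g x)) (fun x => complex.Re (g1 x))); first by move=> x; case: (dg x).
    by move=> x; apply: le_trans (Re_le_normc _) (H x).
  apply: (@mvt_dist (fun x => complex.Im (g x)) (fun x => complex.Im (g1 x))); first by move=> x; case: (dg x).
  by move=> x; apply: le_trans (Im_le_normc _) (H x).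
suff : `|s' - t| <= 2 * pi * `|sin ((s' - t) / 2)|.
  by move=> HH; rewrite (_ : 2 * pi * B * _ = 2 * B * (2 * pi * `|sin ((s' - t) / 2)|)); [apply: ler_wpM2l => //; rewrite mulr_ge0|ring].
set u := s' - t in us *.
have -> : `|sin (u / 2)| = sin (`|u| / 2).
  have a0 : 0 <= sin (`|u| / 2).
    by apply: sin_ge0_pi; apply/andP; split; [rewrite divr_ge0|lra].
  rewrite -(ger0_norm a0); case: (ger0P u) => // _; by rewrite mulNr sinN normrN.
have : `|u| / 2 / pi <= sin (`|u| / 2).
  by apply: sin_ge_div_pi; apply/andP; split; [rewrite divr_ge0|rewrite ler_pM2r].
by rewrite ler_pdivrMr//; lra.
Qed.

Definition dirichlet N (u : R) : C := psumZ (fun k => expi (k%:~R * u)) N.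

Lemma dirichletE N u : (expi u - 1) * dirichlet N u = expi (N.+1%:R * u) - expi (- (N%:R * u)).
Proof.
elim: N => [|N IH].
  by rewrite /dirichlet psumZ0 mul0r mul1r oppr0 expi0 mulr1.
rewrite /dirichlet psumZS -/(dirichlet N u) 2!mulrDr IH.
have e1 : expi (N.+1%:R * u) * expi u = expi (N.+2%:R * u) :> C.
  by rewrite -expiD; congr expi; rewrite -[N.+2%:R]natr1; ring.
have e2 : expi (- (N.+1%:R * u)) * expi u = expi (- (N%:R * u)) :> C.
  by rewrite -expiD; congr expi; rewrite -[N.+1%:R]natr1; ring.
rewrite mulrNz mulNr [N.+1%:~R]/(N.+1%:R) -e1 -e2; ring.
Qed.

Lemma fejerE M u : (expi u - 1) ^+ 2 * \sum_(N < M.+1) dirichlet N u =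
  expi (M.+2%:R * u) - 2 * expi u + expi (- (M%:R * u)).
Proof.
elim: M => [|M IH].
  rewrite big_ord1 expr2 -mulrA dirichletE mul0r oppr0 expi0 mul1r.
  have -> : expi (2 * u) = expi u * expi u :> C by rewrite -expiD; congr expi; ring.
  ring.
rewrite big_ord_recr /= mulrDr IH expr2 -mulrA dirichletE.
have e1 : expi (M.+2%:R * u) * expi u = expi (M.+3%:R * u) :> C.
  by rewrite -expiD; congr expi; rewrite -[M.+3%:R]natr1; ring.
have e2 : expi (- (M.+1%:R * u)) * expi u = expi (- (M%:R * u)) :> C.
  by rewrite -expiD; congr expi; rewrite -[M.+1%:R]natr1; ring.
rewrite -e1 -e2; ring.
Qed.

Lemma cintegral_cvg0 (d : measure_display) (T : measurableType d) (mu : {measure set T -> \bar R})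
    (D : set T) (F : nat -> T -> C) (g : T -> R) :
  measurable D -> (forall N, cdom mu D (F N) g) ->
  (forall x, D x -> exists K, forall N, normc (F N x) <= K / N.+1%:R) ->
  (fun N => complex.Re (cintegral mu D (F N))) @ \oo --> (0 : R) /\
  (fun N => complex.Im (cintegral mu D (F N))) @ \oo --> (0 : R).
Proof.
move=> mD dF H.
have key (G : nat -> T -> R) : (forall N, mu.-integrable D (EFin \o G N)) ->
    (forall N x, D x -> `|G N x| <= normc (F N x)) -> (fun N => \int[mu]_(x in D) G N x) @ \oo --> (0 : R).
  move=> iG HG; have [_ ig _] := dF 0%N.
  apply: fine_cvg; rewrite /Rintegral.
  have -> : (0%:E = \int[mu]_(x in D) 0%:E)%E by rewrite integral0.
  apply: (@dominated_cvg _ _ _ mu _ mD (fun N => EFin \o G N) (fun=> 0%:E) (EFin \o g)).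
  - by move=> N; exact: measurable_int (iG N).
  - move=> x Dx; apply: cvg_EFin; first exact: nearW.
    have [K HK] := H x Dx; apply: (@cvg_of_rate _ _ _ K) => N; rewrite subr0.
    exact: le_trans (HG N x Dx) (HK N).
  - by [].
  - exact: ig.
  - move=> N x Dx; rewrite lee_fin; apply: le_trans (HG N x Dx) _.
    by case: (dF N) => _ _ /(_ _ Dx).
split; apply: key.
- by move=> N; exact: (cdom_Re mD (dF N)).
- by move=> N x _; exact: Re_le_normc.
- by move=> N; exact: (cdom_Im mD (dF N)).
- by move=> N x _; exact: Im_le_normc.
Qed.

(** Fejer's argument: averaged Dirichlet kernels times a Lipschitz function
    vanishing at [t0] stay bounded and tend to zero pointwise. *)
Lemma fourier_series_at_zero (g g1 g2 : R -> C) (B t0 : R) : cder g g1 -> cder g1 g2 -> ccts g2 ->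
  (forall t, g (t + 2 * pi) = g t) -> (forall t, g1 (t + 2 * pi) = g1 t) ->
  (forall t, normc (g t) <= B) -> (forall t, normc (g1 t) <= B) -> (forall t, normc (g2 t) <= B) ->
  g t0 = 0 -> csumZ (fun k => fcoef g k * expi (k%:~R * t0)) = 0.
Proof.
move=> d1 d2 c2 per per1 H0 H1 H2 g0; have cg := cder_ccts d1.
pose L := 2 * pi * B; pose S N := psumZ (fun k => fcoef g k * expi (k%:~R * t0)) N.
have B0 : 0 <= B := le_trans (normc_ge0 _) (H0 0).
have L0 : 0 <= L by rewrite !mulr_ge0 ?pi_ge0.
have Lip t : normc (g t) <= L * normc (expi (t0 - t) - 1).
  have := periodic_lipschitz t t0 d1 per H1; rewrite g0 subr0 -/L.
  suff -> : normc (expi t - expi t0) = normc (expi (t0 - t) - 1) by [].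
  rewrite normcB -[RHS](mul1r) -(normc_expi t) -normcM mulrBr mulr1 -expiD.
  by rewrite addrCA subrr addr0.
have cD N : ccts (fun t => dirichlet N (t0 - t)).
  move=> t; apply: ccts_sum => i; rewrite (_ : (fun x => _) = fun x => expi ((i%:Z - N%:Z)%:~R * t0) * expi (- (i%:Z - N%:Z)%:~R * x)).
    by apply: ccts_mul; [exact: ccts_cst|exact: ccts_expi_lin].
  by apply/funext => x; rewrite -expiD mulrBr mulNr.
pose K M t : C := (M.+1%:R^-1)%:C * \sum_(N < M.+1) dirichlet N (t0 - t).
have SE N : S N = ((2 * pi)^-1)%:C * cintegral leb S1 (fun t => g t * dirichlet N (t0 - t)).
  rewrite /S /psumZ.
  transitivity (((2 * pi)^-1)%:C * \sum_(i < N.*2.+1) cintegral leb S1 (fun t => expi ((i%:Z - N%:Z)%:~R * t0) * (g t * expi (- ((i%:Z - N%:Z)%:~R * t))))).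
    rewrite mulr_sumr; apply: eq_bigr => i _.
    by rewrite (cintegralM measurable_dom_S1 _ (cdom_fcoef _ cg H0)) /fcoef; ring.
  have dk (i : 'I_N.*2.+1) : cdom leb S1 (fun t => expi ((i%:Z - N%:Z)%:~R * t0) * (g t * expi (- ((i%:Z - N%:Z)%:~R * t)))) (fun=> B).
    apply: cdom_S1 => [t|t]; first by apply: ccts_mul; [exact: ccts_cst|exact: ccts_fcoef].
    by rewrite !normcM !normc_expi mul1r mulr1.
  congr (_ * _); rewrite -(cintegral_sum measurable_dom_S1 (index_enum _) (integrable_dom_S1_cst B) dk).
  apply: cintegral_ext => t _; rewrite /dirichlet /psumZ mulr_sumr; apply: eq_bigr => i _.
  by rewrite mulrCA -expiD mulrBr.
have bD N t : normc (g t * dirichlet N (t0 - t)) <= 2 * L.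
  rewrite normcM; apply: le_trans (ler_wpM2r (normc_ge0 _) (Lip t)) _.
  rewrite -mulrA -normcM dirichletE mulrC; apply: ler_wpM2r => //.
  by apply: le_trans (normcD _ _) _; rewrite normcN !normc_expi.
have dD N : cdom leb S1 (fun t => g t * dirichlet N (t0 - t)) (fun=> 2 * L).
  by apply: cdom_S1 => // t; apply: ccts_mul; [exact: cg|exact: cD].
have meanE M : (M.+1%:R^-1)%:C * \sum_(N < M.+1) S N = ((2 * pi)^-1)%:C * cintegral leb S1 (fun t => g t * K M t).
  transitivity ((M.+1%:R^-1)%:C * (((2 * pi)^-1)%:C * cintegral leb S1 (fun t => \sum_(N < M.+1) g t * dirichlet N (t0 - t)))).
    rewrite (cintegral_sum measurable_dom_S1 (index_enum _) (integrable_dom_S1_cst (2 * L)) (fun N : 'I_M.+1 => dD N)).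
    by congr (_ * _); rewrite mulr_sumr; apply: eq_bigr => N _; exact: SE.
  rewrite mulrCA; congr (_ * _).
  rewrite -(cintegralM measurable_dom_S1 _ (cdom_sum measurable_dom_S1 (index_enum 'I_M.+1) (integrable_dom_S1_cst (2 * L)) (fun N : 'I_M.+1 => dD N))).
  by apply: cintegral_ext => t _; rewrite /K mulrCA -mulr_sumr.
have dK M : cdom leb S1 (fun t => g t * K M t) (fun=> 2 * L).
  apply: cdom_S1 => t.
    by apply: ccts_mul; [exact: cg|apply: ccts_mul; [exact: ccts_cst|apply: ccts_sum => N; exact: cD]].
  rewrite /K mulrCA mulr_sumr normcM normc_real ger0_norm// ler_pdivrMl//.
  apply: le_trans (normc_sum _ _) _; apply: le_trans (ler_sum _ (fun (N : 'I_M.+1) _ => bD N t)) _.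
  by rewrite sumr_const card_ord -[X in X <= _]mulr_natl.
have pw t : S1 t -> exists K0 : R, forall M, normc (g t * K M t) <= K0 / M.+1%:R.
  move=> _; case: (eqVneq (expi (t0 - t) - 1 : C) 0) => [z1|z1].
    exists 0 => M; have := Lip t; rewrite z1 normc0 mulr0 => gt0.
    have -> : g t = 0 by apply: normc_eq0; apply/eqP; rewrite eq_le gt0 normc_ge0.
    by rewrite !mul0r normc0.
  exists (normc (g t) * (4 * (normc (expi (t0 - t) - 1) ^+ 2)^-1)) => M.
  rewrite /K mulrCA normcM normc_real ger0_norm// mulrC; apply: ler_wpM2r => //.
  rewrite normcM; apply: ler_wpM2l; first exact: normc_ge0.
  have zp : 0 < normc (expi (t0 - t) - 1).
    by rewrite lt_neqAle normc_ge0 andbT eq_sym; apply: contra z1 => /eqP/normc_eq0 ->.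
  rewrite ler_pdivlMr ?exprn_gt0// mulrC expr2 -!normcM -expr2 fejerE.
  apply: le_trans (normcD _ _) _; apply: le_trans (lerD (normcD _ _) (lexx _)) _.
  rewrite normcN normcM !normc_expi mulr1.
  have -> : normc (2 : C) = 2.
    have -> : (2 : C) = (2 : R)%:C by apply/complex_eqP; split=> //=; rewrite addr0.
    by rewrite normc_real ger0_norm.
  lra.
have [mR mI] := @cintegral_cvg0 _ _ leb S1 (fun M t => g t * K M t) (fun=> 2 * L) measurable_dom_S1 dK pw.
have F0 k : normc (fcoef g k * expi (k%:~R * t0)) <= 4 * B * inv_sqr k.
  by rewrite normcM normc_expi mulr1; exact: (fcoef_decay k d1 d2).
have E N := csumZ_err N F0.
have avg (u : nat -> R) : arithmetic_mean u = (fun M => M.+1%:R^-1 * \sum_(N < M.+1) u N).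
  by apply/funext => M; rewrite /arithmetic_mean /series /= big_mkord.
apply/complex_eqP; split.
  have cRe : (fun N => complex.Re (S N)) @ \oo --> complex.Re (csumZ (fun k => fcoef g k * expi (k%:~R * t0))).
    apply: (@cvg_of_rate _ _ _ (8 * (4 * B))) => N; rewrite distrC -ReB.
    exact: le_trans (Re_le_normc _) (E N).
  have := cesaro cRe; rewrite avg => H.
  rewrite -(cvg_lim (@Rhausdorff R) H); apply: cvg_lim => //.
  have -> : (fun M : nat => M.+1%:R^-1 * \sum_(N < M.+1) complex.Re (S N)) =
      (fun M => (2 * pi)^-1 * complex.Re (cintegral leb S1 (fun t => g t * K M t))).
    by apply/funext => M; rewrite -ReZ -meanE ReZ Re_sum.
  by rewrite -[X in _ --> X](mulr0 (2 * pi)^-1); apply: cvgMr.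
have cIm : (fun N => complex.Im (S N)) @ \oo --> complex.Im (csumZ (fun k => fcoef g k * expi (k%:~R * t0))).
  apply: (@cvg_of_rate _ _ _ (8 * (4 * B))) => N; rewrite distrC -ImB.
  exact: le_trans (Im_le_normc _) (E N).
have := cesaro cIm; rewrite avg => H.
rewrite -(cvg_lim (@Rhausdorff R) H); apply: cvg_lim => //.
have -> : (fun M : nat => M.+1%:R^-1 * \sum_(N < M.+1) complex.Im (S N)) =
    (fun M => (2 * pi)^-1 * complex.Im (cintegral leb S1 (fun t => g t * K M t))).
  by apply/funext => M; rewrite -ImZ -meanE ImZ Im_sum.
by rewrite -[X in _ --> X](mulr0 (2 * pi)^-1); apply: cvgMr.
Qed.

Lemma psumZ_single (c : C) N : psumZ (fun k : int => (k == 0)%:R * c) N = c.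
Proof. by elim: N => [|N IH]; rewrite ?psumZ0 ?mul1r// psumZS IH !mul0r !addr0. Qed.

Lemma fourier_series (g g1 g2 : R -> C) (B t0 : R) : cder g g1 -> cder g1 g2 -> ccts g2 ->
  (forall t, g (t + 2 * pi) = g t) -> (forall t, g1 (t + 2 * pi) = g1 t) ->
  (forall t, normc (g t) <= B) -> (forall t, normc (g1 t) <= B) -> (forall t, normc (g2 t) <= B) ->
  csumZ (fun k => fcoef g k * expi (k%:~R * t0)) = g t0.
Proof.
move=> d1 d2 c2 per per1 H0 H1 H2; have cg := cder_ccts d1.
have B0 : 0 <= B := le_trans (normc_ge0 _) (H0 0).
pose G t := g t - g t0.
have dG : cder G g1.
  move=> t; have [f1 f2] := d1 t; rewrite /G; split.
    rewrite (_ : (fun t => _) = (fun t => complex.Re (g t) - complex.Re (g t0))); last by apply/funext => x; rewrite ReB.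
    by apply: (is_derive_eq (is_deriveB f1 (is_derive_cst (complex.Re (g t0)) t (1 : R)))); rewrite subr0.
  rewrite (_ : (fun t => _) = (fun t => complex.Im (g t) - complex.Im (g t0))); last by apply/funext => x; rewrite ImB.
  by apply: (is_derive_eq (is_deriveB f2 (is_derive_cst (complex.Im (g t0)) t (1 : R)))); rewrite subr0.
have HG t : normc (G t) <= 2 * B.
  by apply: le_trans (normcD _ _) _; rewrite normcN mulr_natl mulr2n lerD.
have up : B <= 2 * B by lra.
have F0 k : normc (fcoef g k * expi (k%:~R * t0)) <= 4 * B * inv_sqr k.
  by rewrite normcM normc_expi mulr1; exact: (fcoef_decay k d1 d2).
have Z := @fourier_series_at_zero G g1 g2 (2 * B) t0 dG d2 c2 _ per1 HG _ _ (subrr _).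
have FG k : fcoef G k = fcoef g k - (k == 0)%:R * g t0.
  have -> : fcoef G k = fcoef (fun t => (- g t0) * expi (0%:~R * t) + g t) k.
    by apply: fcoef_ext => t _; rewrite mul0r expi0 mulr1 addrC.
  rewrite (fcoef_lin _ _ (ccts_expi_lin _) cg (B := 1) (B' := B))// => [|t]; last by rewrite normc_expi.
  by rewrite fcoef_expi eq_sym mulNr mulrC addrC.
apply/eqP; rewrite -subr_eq0; apply/eqP; rewrite -[RHS]Z.
- apply/esym/(@csumZ_eq _ _ _ (8 * (4 * B))) => N.
  rewrite normcB (_ : psumZ _ N = psumZ (fun k => fcoef g k * expi (k%:~R * t0)) N - g t0).
    by rewrite opprB addrA subrK; exact: csumZ_err.
  rewrite -[in RHS](psumZ_single (g t0) N) -[X in _ = _ + X]mulN1r addrC -psumZ_lin.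
  apply: eq_bigr => i _; rewrite FG mulrBl addrC mulN1r; congr (- _ + _).
  by case: eqP => [->|]; rewrite ?mul0r// expi0 mulr1.
- by move=> t; rewrite /G per.
- by move=> t; apply: le_trans (H1 t) up.
- by move=> t; apply: le_trans (H2 t) up.
Qed.

End FourierSeries.

(** * The projector on exponentials and on uniformly convergent series *)

Lemma sqr_le2 (R : realDomainType) (c a b : R) : 0 <= c -> c <= a + b -> c ^+ 2 <= 2 * a ^+ 2 + 2 * b ^+ 2.
Proof.
move=> c0 H; have : c ^+ 2 <= (a + b) ^+ 2 by rewrite ler_pXn2r// nnegrE// (le_trans c0 H).
by have := sqr_ge0 (a - b); rewrite sqrrB sqrrD => h1 h2; lra.
Qed.

Section SquareNorm.
Context {R : realType} (d : measure_display) (T : measurableType d).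
Variables (mu : {measure set T -> \bar R}) (D : set T).
Hypothesis mD : measurable D.
Local Notation C := R[i].
Local Notation normc := (@ComplexField.Normc.normc R).
Implicit Types (F G : T -> C).

Lemma measurable_sq F : cmeas D F -> measurable_fun D (fun x => (normc (F x) ^+ 2)%:E).
Proof. by move=> mF; apply/measurable_EFinP; exact: measurable_normc_sqr. Qed.

Lemma sqnorm2_ge0 F : (0 <= sqnorm2 mu D F)%E.
Proof. by apply: integral_ge0 => x _; rewrite lee_fin sqr_ge0. Qed.

Lemma sqnorm2_eq0 F : cmeas D F -> sqnorm2 mu D F = 0%E -> F = (fun=> 0) %[ae mu in D].
Proof.
move=> mF F0; have : ae_eq mu D (fun x => (normc (F x) ^+ 2)%:E) (cst 0%E).
  apply/(ae_eq_integral_abs mu mD (measurable_sq mF)); rewrite -[RHS]F0.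
  by apply: eq_integral => x _; rewrite gee0_abs// lee_fin sqr_ge0.
apply: filterS => x H Dx; apply: normc_eq0; apply/eqP; rewrite -sqrf_eq0; apply/eqP.
by have := H Dx; case.
Qed.

Lemma sqnorm2_le F (g : T -> R) : cmeas D F -> mu.-integrable D (EFin \o g) ->
  (forall x, D x -> normc (F x) ^+ 2 <= g x) -> (sqnorm2 mu D F <= (\int[mu]_(x in D) g x)%:E)%E.
Proof.
move=> mF ig H; rewrite /Rintegral fineK; last exact: (integrable_fin_num mD ig).
apply: ge0_le_integral => //.
- by move=> x _; rewrite lee_fin sqr_ge0.
- exact: measurable_sq.
- exact: measurable_int ig.
Qed.

Lemma sqnorm2_triangle F G : cmeas D F -> cmeas D G ->
  (sqnorm2 mu D (fun x => F x + G x)%R <= 2%:E * sqnorm2 mu D F + 2%:E * sqnorm2 mu D G)%E.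
Proof.
move=> mF mG; have sF := measurable_sq mF; have sG := measurable_sq mG.
rewrite /sqnorm2 -!ge0_integralZl//; try by move=> x _; rewrite lee_fin sqr_ge0.
rewrite -ge0_integralD//; try (by move=> x _; rewrite -EFinM lee_fin mulr_ge0// sqr_ge0);
  try exact: measurable_funeM.
apply: ge0_le_integral => //.
- by move=> x _; rewrite lee_fin sqr_ge0.
- by apply: measurable_sq; exact: cmeasD.
- by apply: emeasurable_funD; exact: measurable_funeM.
move=> x _; rewrite -!EFinM -EFinD lee_fin.
exact: sqr_le2 (normc_ge0 _) (normcD _ _).
Qed.

Lemma sqnorm2_ae F G : cmeas D F -> cmeas D G -> F = G %[ae mu in D] -> sqnorm2 mu D F = sqnorm2 mu D G.
Proof.
move=> mF mG FG; apply: ae_eq_integral => //; try exact: measurable_sq.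
by move: FG; apply: filterS => x H Dx; rewrite (H Dx).
Qed.

Lemma ereal_le_rate0 (x : \bar R) (K : R) : (0 <= x)%E -> (forall N, x <= (K / N.+1%:R)%:E)%E -> x = 0%E.
Proof.
case: x => [x| |] //.
- rewrite lee_fin => x0 H; congr EFin; apply/eqP; rewrite eq_le x0 andbT.
  have c0 : (fun N : nat => K / N.+1%:R) @ \oo --> (0 : R) := @cvg_inv_succ R K.
  rewrite leNgt; apply/negP => xp; have /cvgrPdist_lt/(_ _ xp)[N _ HN] := c0.
  have := HN N (leqnn N); rewrite sub0r normrN ltNge => /negP; apply.
  by apply: le_trans (ler_norm _); have := H N; rewrite lee_fin.
- by move=> _ /(_ 0%N); rewrite leye_eq.
Qed.

End SquareNorm.

Section SzegoCircle.
Context {R : realType}.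
Local Notation C := R[i].
Local Notation normc := (@ComplexField.Normc.normc R).
Local Notation leb := (@lebesgue_measure R).
Local Notation S1 := (@dom_S1 R).
Local Notation mS1 := (@measurable_dom_S1 R).

Definition cexp (j : int) (t : R) : C := expi (j%:~R * t).

Lemma ccts_cexp j : ccts (cexp j). Proof. exact: ccts_expi_lin. Qed.

Lemma cmeas_cexp j : cmeas (T := measurableTypeR R) S1 (cexp j).
Proof. exact: (ccts_cmeas (@ccts_cexp j) mS1). Qed.

Lemma normc_cexp j t : normc (cexp j t) = 1. Proof. exact: normc_expi. Qed.

Lemma L2_cexp (a : C) j : L2_S1 (fun t => a * cexp j t).
Proof.
split; first by move=> t; rewrite /cexp expi_period.
have m : cmeas (T := measurableTypeR R) S1 (fun t => a * cexp j t).
  by apply: cmeasM; [exact: cmeas_cst|exact: cmeas_cexp].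
split; [by case: m|by case: m|].
apply: le_lt_trans (sqnorm2_le mS1 m (integrable_dom_S1_cst (normc a ^+ 2)) _) _; last exact: ltry.
by move=> t _; rewrite normcM normc_cexp mulr1.
Qed.

Lemma cmeas_conj (d : measure_display) (T : measurableType d) (A : set T) (f : T -> C) :
  cmeas A f -> cmeas A (fun x => conjc (f x)).
Proof.
move=> [m1 m2]; split.
  by rewrite (_ : (fun x => _) = fun x => complex.Re (f x))//; apply/funext => x; case: (f x).
rewrite (_ : (fun x => _) = fun x => - complex.Im (f x)); last by apply/funext => x; case: (f x).
exact: measurable_funN.
Qed.

Lemma conjcM (z w : C) : conjc (z * w) = conjc z * conjc w.
Proof. by case: z w => [a b] [c d]; apply/complex_eqP; split=> /=; ring. Qed.

Lemma conjcB (z w : C) : conjc (z - w) = conjc z - conjc w.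
Proof. by case: z w => [a b] [c d]; apply/complex_eqP; split=> /=; ring. Qed.

Lemma conjc_sum (I : Type) (s : seq I) (F : I -> C) : conjc (\sum_(i <- s) F i) = \sum_(i <- s) conjc (F i).
Proof.
elim: s => [|i s IH]; first by rewrite !big_nil; apply/complex_eqP; rewrite /= oppr0.
by rewrite !big_cons -IH; case: (F i) (\sum_(j <- s) F j) => [a b] [c d]; apply/complex_eqP; split=> //=; ring.
Qed.

Section Orthogonal.
Variable u : R -> C.
Hypotheses (mu : cmeas (T := measurableTypeR R) S1 u)
  (iu : leb.-integrable S1 (EFin \o (fun t => normc (u t) ^+ 2))).

Lemma cdom_pair (h : R -> C) (B : R) : ccts h -> (forall t, normc (h t) <= B) ->
  cdom leb S1 (fun t => u t * conjc (h t)) (fun t => B * normc (u t) ^+ 2 + B).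
Proof.
move=> ch Hh; have B0 : 0 <= B := le_trans (normc_ge0 _) (Hh 0); split.
- by apply: cmeasM => //; apply: cmeas_conj; exact: (ccts_cmeas ch mS1).
- exact: (integrable_lin mS1 B iu (integrable_dom_S1_cst B)).
move=> t _; rewrite normcM normc_conj.
have := Hh t; have := normc_ge0 (u t); have := normc_ge0 (h t) => h0 u0 hB.
apply: (@le_trans _ _ (normc (u t) * B)); first exact: ler_wpM2l.
rewrite (_ : B * normc (u t) ^+ 2 + B = (normc (u t) ^+ 2 + 1) * B); last ring.
by apply: ler_wpM2r => //; have := sqr_ge0 (normc (u t) - 1); have := sqr_ge0 (normc (u t)); rewrite sqrrB1 => *; lra.
Qed.

Lemma sq_orthogonal (h : R -> C) (B : R) : ccts h -> (forall t, normc (h t) <= B) ->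
  inner_S1 u h = 0 -> (sqnorm2 leb S1 u <= sqnorm2 leb S1 (fun t => u t - h t)%R)%E.
Proof.
move=> ch Hh uh; have B0 : 0 <= B := le_trans (normc_ge0 _) (Hh 0).
have mh : cmeas (T := measurableTypeR R) S1 h := ccts_cmeas ch mS1.
have mB : cmeas (T := measurableTypeR R) S1 (fun t => u t - h t).
  have := cmeas_lin (-1) mh mu; rewrite (_ : (fun x => _) = fun t => u t - h t)//.
  by apply/funext => t; rewrite mulN1r addrC.
have iB : leb.-integrable S1 (EFin \o (fun t => normc (u t - h t) ^+ 2)).
  apply: le_integrable (integrable_lin mS1 2 iu (integrable_dom_S1_cst (2 * B ^+ 2))) => //; first exact: mS1.
    exact: measurable_sq.
  move=> t _; rewrite /= lee_fin [X in X <= _]ger0_norm ?sqr_ge0//; apply: le_trans (ler_norm _).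
  apply: le_trans (sqr_le2 (normc_ge0 _) (normcD _ _)) _; rewrite normcN lerD2l; apply: ler_wpM2l => //.
  by rewrite ler_pXn2r// nnegrE; exact: normc_ge0.
have dp := cdom_pair ch Hh; have ip := cdom_Re mS1 dp.
have -> : sqnorm2 leb S1 u = (\int[leb]_(t in S1) normc (u t) ^+ 2)%:E.
  by rewrite /Rintegral fineK//; exact: (integrable_fin_num mS1 iu).
have -> : sqnorm2 leb S1 (fun t => u t - h t) = (\int[leb]_(t in S1) normc (u t - h t) ^+ 2)%:E.
  by rewrite /Rintegral fineK//; exact: (integrable_fin_num mS1 iB).
have -> : \int[leb]_(t in S1) normc (u t - h t) ^+ 2 =
    \int[leb]_(t in S1) (2 * complex.Re (u t * conjc (h t)) + normc (u t - h t) ^+ 2).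
  rewrite RintegralD//; [|exact: mS1|]; last first.
    by have := integrableZl mS1 2 ip; apply: eq_integrable => //; exact: mS1.
  rewrite RintegralZl//; last exact: mS1.
  by have [+ _] := (complex_eqP _ _).1 uh => /= ->; rewrite mulr0 add0r.
rewrite lee_fin; apply: le_Rintegral => //; [exact: mS1|exact: (integrable_lin mS1 2 ip iB)|].
move=> t _; rewrite !normc_sqr; case: (u t) (h t) => [a b] [c d] /=.
have := sqr_ge0 c; have := sqr_ge0 d; lra.
Qed.
End Orthogonal.

Lemma inner_cexp j m : inner_S1 (cexp j) (cexp m) = (2 * pi)%:C * (j == m)%:R.
Proof.
rewrite -fcoef_expi /fcoef mulrA (_ : (2 * pi)%:C * _ = 1); last first.
  by apply/complex_eqP; split=> /=; rewrite ?mulfV ?gt_eqF ?twopi_gt0// !(mul0r, mulr0) ?subr0 ?addr0.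
rewrite mul1r.
by apply: cintegral_ext => t _; rewrite /cexp expiN.
Qed.

Lemma hardy_cexp (m : nat) : hardy_S1 (cexp m%:Z).
Proof.
split; first by have := L2_cexp 1 m%:Z; under eq_fun do rewrite mul1r.
move=> e e0; exists m.+1, (fun i => (i == m)%:R).
rewrite /sqnorm2 (eq_integral (fun=> 0%E)) ?integral0 ?lte_fin// => t _.
rewrite big_ord_recr /= eqxx mul1r big1 ?add0r ?subrr ?normc0 ?expr0n// => i _.
by rewrite ltn_eqF ?mul0r.
Qed.

Variable P1 : (R -> C) -> (R -> C).
Hypothesis hP1 : is_szego_S1 P1.

(** The difference of the expected value and the projection is orthogonal to
    all [cexp m], [m >= 0], and lies in their closed span. *)
Lemma szego_cexp j : P1 (cexp j) = (fun t => if (0 <= j)%R then cexp j t else 0) %[ae leb in S1].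
Proof.
have Lv : L2_S1 (cexp j) by have := L2_cexp (1 : R[i]) j; under eq_fun do rewrite mul1r.
have [[Lw apw] orth] := hP1 Lv; set w := P1 (cexp j) in Lw apw orth *.
pose b : C := (0 <= j)%R%:R; pose s t := b * cexp j t; pose u t := s t - w t.
have mw : cmeas (T := measurableTypeR R) S1 w by case: Lw => _ [].
have ms : cmeas (T := measurableTypeR R) S1 s by apply: cmeasM; [exact: cmeas_cst|exact: cmeas_cexp].
have mu : cmeas (T := measurableTypeR R) S1 u.
  have := cmeas_lin (-1) mw ms; rewrite (_ : (fun x => _) = u)//.
  by apply/funext => t; rewrite mulN1r addrC.
have isq f : cmeas (T := measurableTypeR R) S1 f -> (sqnorm2 leb S1 f < +oo)%E ->
    leb.-integrable S1 (EFin \o (fun t => normc (f t) ^+ 2)).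
  move=> mf lf; apply/integrableP; split; first exact: measurable_sq.
  by rewrite (eq_integral (fun t => (normc (f t) ^+ 2)%:E))// => t _; rewrite /= ger0_norm// sqr_ge0.
have iw := isq w mw ltac:(by case: Lw => _ []).
have iu : leb.-integrable S1 (EFin \o (fun t => normc (u t) ^+ 2)).
  apply: le_integrable (integrable_lin mS1 2 iw (integrable_dom_S1_cst (2 * normc b ^+ 2))) => //; first exact: mS1.
    exact: measurable_sq.
  move=> t _; rewrite /= lee_fin [X in X <= _]ger0_norm ?sqr_ge0//; apply: le_trans (ler_norm _).
  apply: le_trans (sqr_le2 (normc_ge0 _) (normcD _ _)) _; rewrite normcN addrC lerD2l.
  by rewrite /s normcM normc_cexp mulr1.
have bound1 m t : normc (cexp m t) <= 1 by rewrite normc_cexp.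
have ou (m : nat) : inner_S1 u (cexp m%:Z) = 0.
  have H := orth _ (hardy_cexp m).
  have iv : leb.-integrable S1 (EFin \o (fun t => normc (cexp j t) ^+ 2)).
    by apply: (isq _ (cmeas_cexp j)); case: Lv => _ [].
  have dv := cdom_pair (cmeas_cexp j) iv (@ccts_cexp m%:Z) (bound1 m%:Z).
  have dw := cdom_pair mw iw (@ccts_cexp m%:Z) (bound1 m%:Z).
  have E1 : inner_S1 (cexp j) (cexp m%:Z) = inner_S1 w (cexp m%:Z).
    apply/eqP; rewrite -subr_eq0 addrC -mulN1r; apply/eqP; rewrite -[RHS]H.
    rewrite /inner_S1 -(cintegral_lin mS1 (-1) dw dv); apply: cintegral_ext => t _; ring.
  transitivity (b * inner_S1 (cexp j) (cexp m%:Z) + (-1) * inner_S1 w (cexp m%:Z)).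
    rewrite -(cintegralM mS1 (-1) dw) -(cintegral_lin mS1 b dv (cdomM mS1 (-1) dw)).
    by apply: cintegral_ext => t _; rewrite /u /s; ring.
  rewrite -E1 inner_cexp /b; case: eqP => [->|_]; last by rewrite !mulr0 addr0.
  by rewrite mul1r mulN1r addrN.
have u0 : sqnorm2 leb S1 u = 0%E.
  apply: (@ereal_le_rate0 _ _ 1); first exact: sqnorm2_ge0.
  move=> N; have e0 : 0 < (1 / N.+1%:R : R) by rewrite divr_gt0.
  have [K [c Hc]] := apw _ e0; apply: ltW; apply: le_lt_trans Hc.
  pose h t := s t - \sum_(m < K) c m * cexp m%:Z t.
  have -> : sqnorm2 leb S1 (fun t => w t - \sum_(m < K) c m * expi (m%:R * t)) =
      sqnorm2 leb S1 (fun t => u t - h t).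
    apply: eq_integral => t _; congr (_ ^+ 2)%:E; rewrite /u /h opprB addrCA addrC normcB.
    by congr normc; rewrite /cexp; ring.
  have ch : ccts h.
    move=> t; rewrite (_ : h = fun t => (-1) * (\sum_(m < K) c m * cexp m%:Z t) + s t); last first.
      by apply/funext => x; rewrite mulN1r addrC.
    apply: ccts_lin; last by apply: ccts_mul; [exact: ccts_cst|exact: ccts_cexp].
    by apply: ccts_sum => m; apply: ccts_mul; [exact: ccts_cst|exact: ccts_cexp].
  apply: (@sq_orthogonal u mu iu h (normc b + \sum_(m < K) normc (c m)) ch).
    move=> t; apply: le_trans (normcD _ _) _; rewrite normcN; apply: lerD.
      by rewrite normcM normc_cexp mulr1.
    apply: le_trans (normc_sum _ _) _; apply: ler_sum => m _.
    by rewrite normcM normc_cexp mulr1.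
  have du m := cdom_pair mu iu (@ccts_cexp m) (bound1 m).
  pose B := \sum_(m < K) normc (c m).
  have ig : leb.-integrable S1 (EFin \o (fun t => B * (1 * normc (u t) ^+ 2 + 1))).
    have [_ i1 _] := du 0; have := integrableZl mS1 B i1.
    by apply: eq_integrable => //; exact: mS1.
  have ds (m : 'I_K) : cdom leb S1 (fun t => conjc (c m) * (u t * conjc (cexp m%:Z t)))
      (fun t => B * (1 * normc (u t) ^+ 2 + 1)).
    have [m1 _ l1] := cdomM mS1 (conjc (c m)) (du m%:Z); split=> // t St.
    apply: le_trans (l1 t St) _; rewrite normc_conj; apply: ler_wpM2r.
      by rewrite mul1r addr_ge0 ?sqr_ge0.
    by rewrite /B (bigD1 m)//= lerDl sumr_ge0// => k _; exact: normc_ge0.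
  transitivity ((-1) * (\sum_(m < K) conjc (c m) * inner_S1 u (cexp m%:Z)) + conjc b * inner_S1 u (cexp j)).
    rewrite -(cintegralM mS1 (conjc b) (du j)).
    rewrite (_ : \sum_(m < K) _ = cintegral leb S1 (fun t => \sum_(m < K) conjc (c m) * (u t * conjc (cexp m%:Z t)))).
      rewrite -(cintegral_lin mS1 (-1) (cdom_sum mS1 (index_enum _) ig ds) (cdomM mS1 (conjc b) (du j))).
      apply: cintegral_ext => t _; rewrite /h /s conjcB conjc_sum conjcM mulrBr mulN1r addrC mulrCA; congr (- _ + _).
      by rewrite mulr_sumr; apply: eq_bigr => m _; rewrite conjcM mulrCA.
    rewrite (cintegral_sum mS1 (index_enum _) ig ds); apply: eq_bigr => m _.
    by rewrite (cintegralM mS1 _ (du m%:Z)).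
  rewrite big1 ?mulr0 ?add0r => [|m _]; last by rewrite ou mulr0.
  case: (boolP (0 <= j)%R) => j0; first by rewrite -[in cexp j](gez0_abs j0) ou mulr0.
  by rewrite /b (negbTE j0) (_ : conjc (0 : C) = 0) ?mul0r//; apply/complex_eqP; rewrite /= oppr0.
have := sqnorm2_eq0 mS1 mu u0; apply: filterS => t H St.
move: (H St); rewrite /u /s /b => /eqP; rewrite subr_eq0 => /eqP <-.
by case: (0 <= j)%R; rewrite ?mul1r ?mul0r.
Qed.

End SzegoCircle.

Section SzegoRn.
Context {R : realType} {n : nat}.
Local Notation C := R[i].
Local Notation normc := (@ComplexField.Normc.normc R).
Local Notation leb := (@lebesgue_measure R).
Local Notation S1 := (@dom_S1 R).
Local Notation mS1 := (@measurable_dom_S1 R).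
Local Notation M := ('rV[R]_n * measurableTypeR R)%type.
Local Notation mu := (@mu_RnS1 R n).
Local Notation dom := (@dom_RnS1 R n).

#[local] Instance ae_RnS1_filter : Filter (nbhs (almost_everywhere mu)).
Proof. by rewrite /mu_RnS1; exact _. Qed.

Lemma measurable_dom : measurable (dom : set M).
Proof. by apply: measurableX => //; exact: mS1. Qed.

(** Measurable periodic functions that are dominated by the weight: closed under
    all operations below and contained in L^2. *)
Definition tame (F : M -> C) (K : R) :=
  [/\ cmeas (T := M) setT F, Defs.periodic F & forall z, normc (F z) <= K * wt z.1].

Lemma integrable_wt_dom : mu.-integrable dom (EFin \o (fun z : M => wt z.1)).
Proof.
apply: (@Fubini_integrable _ _ _ _ _ (lebesgue_rV n) leb S1 mS1 (fun z => wt z.1) (@wt R n) (fun=> 1)) => //.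
- exact: (measurableT_comp (measurable_cts_rV (@wt_cts R n)) measurable_fst).
- by move=> x; exact: ltW (wt_gt0 x).
- exact: integrable_wt.
- exact: integrable_dom_S1_cst.
- by move=> x t _ /=; rewrite mulr1 ger0_norm// ltW// wt_gt0.
Qed.

Definition wt_mass : R := \int[mu]_(z in dom) wt z.1.

Lemma wt_mass_ge0 : 0 <= wt_mass.
Proof. by apply: Rintegral_ge0 => z _; exact: ltW (wt_gt0 _). Qed.

Lemma tame_cmeas (F : M -> C) K : tame F K -> cmeas (T := M) dom F.
Proof. by case=> -[m1 m2] _ _; split; exact: measurable_funTS. Qed.

Lemma tame_sqnorm2 (F : M -> C) (K : R) : tame F K -> (sqnorm2 mu dom F <= (K ^+ 2 * wt_mass)%:E)%E.
Proof.
move=> tF; have [_ _ H] := tF; rewrite /wt_mass -RintegralZl; [|exact: measurable_dom|exact: integrable_wt_dom].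
apply: (sqnorm2_le measurable_dom (tame_cmeas tF)).
  by have := integrableZl measurable_dom (K ^+ 2) integrable_wt_dom; apply: eq_integrable => //; exact: measurable_dom.
move=> z _; apply: (@le_trans _ _ ((K * wt z.1) ^+ 2)).
  by rewrite ler_pXn2r ?nnegrE ?normc_ge0//; apply: le_trans (normc_ge0 _) (H z).
rewrite exprMn ler_wpM2l ?sqr_ge0// expr2 -[leRHS]mulr1 ler_wpM2l ?wt_le1//.
exact: ltW (wt_gt0 _).
Qed.

Lemma tame_L2 (F : M -> C) K : tame F K -> L2_RnS1 F.
Proof.
move=> tF; have [m1 m2] := tame_cmeas tF; split; first by case: tF.
by split=> //; apply: le_lt_trans (tame_sqnorm2 tF) _; exact: ltry.
Qed.

Lemma tame_lin (a : C) F G K K' : tame F K -> tame G K' -> tame (fun z => a * F z + G z) (normc a * K + K').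
Proof.
move=> [m1 p1 H1] [m2 p2 H2]; split; first exact: cmeas_lin.
  by move=> x t; rewrite p1 p2.
move=> z; apply: le_trans (normcD _ _) _; rewrite normcM mulrDl -mulrA.
by apply: lerD => //; apply: ler_wpM2l; [exact: normc_ge0|exact: H1].
Qed.

Lemma tame0 : tame (fun=> 0) 0.
Proof. by split=> [|//|z]; [exact: cmeas_cst|rewrite normc0 mul0r]. Qed.

Variables (P1 : (R -> C) -> (R -> C)) (P : (RnS1 R n -> C) -> (RnS1 R n -> C)).
Hypotheses (hP1 : is_szego_S1 P1) (hP : is_szego P1 P).

Lemma szego_lin (a : C) F G K K' : tame F K -> tame G K' ->
  eq_RnS1 (P (fun z => a * F z + G z)) (fun z => a * P F z + P G z).
Proof. by case: hP => _ H _ _ /tame_L2 LF /tame_L2 LG; exact: H. Qed.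

Lemma szego0 : eq_RnS1 (P (fun=> 0)) (fun=> 0).
Proof.
have := szego_lin (-1) tame0 tame0; rewrite (_ : (fun z => _) = (fun=> 0)); last by apply/funext => z; rewrite mulr0 addr0.
by apply: filterS => z H Dz; rewrite (H Dz) mulN1r addNr.
Qed.

Lemma szego_sum (I : Type) (s : seq I) (F G : I -> M -> C) (K : R) : (forall i, tame (F i) K) ->
  (forall i, eq_RnS1 (P (F i)) (G i)) ->
  tame (fun z => \sum_(i <- s) F i z) ((size s)%:R * K) /\
  eq_RnS1 (P (fun z => \sum_(i <- s) F i z)) (fun z => \sum_(i <- s) G i z).
Proof.
move=> tF PF; elim: s => [|i s [t1 IH]].
  have E (H : I -> M -> C) : (fun z => \sum_(i <- [::]) H i z) = (fun=> 0) by apply/funext => z; rewrite big_nil.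
  by rewrite !E /= mul0r; split; [exact: tame0|exact: szego0].
have E : (fun z => \sum_(j <- i :: s) F j z) = (fun z => 1 * F i z + \sum_(j <- s) F j z).
  by apply/funext => z; rewrite big_cons mul1r.
rewrite E; split.
  have := tame_lin 1 (tF i) t1; rewrite (_ : normc 1 * K + _ = (size (i :: s))%:R * K)//.
  by rewrite (_ : (1 : C) = 1%:C)// normc_real normr1 mul1r /= -[(size s).+1]addn1 natrD; ring.
have := szego_lin 1 (tF i) t1; apply: filterS3 IH (PF i) => z H1 H2 H3 Dz.
by rewrite (H3 Dz) (H2 Dz) (H1 Dz) big_cons mul1r.
Qed.

(** The series converges uniformly with respect to the weight, hence in L^2,
    where the projector is continuous. *)
Lemma szego_csumZ (a : int -> M -> C) (c : int -> bool) (K : R) :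
  (forall m, cmeas (T := M) setT (a m)) -> (forall m, Defs.periodic (a m)) ->
  (forall m z, normc (a m z) <= K * wt z.1 * inv_sqr m) ->
  (forall m, eq_RnS1 (P (a m)) (fun z => if c m then a m z else 0)) ->
  eq_RnS1 (P (fun z => csumZ (fun m => a m z))) (fun z => csumZ (fun m => if c m then a m z else 0)).
Proof.
move=> ma pa Ha Pa; have [L2P _ [B HB] _] := hP.
pose b m z := if c m then a m z else 0.
have K0 : 0 <= K.
  have := Ha 0 (0, 0); rewrite /inv_sqr mulr0z expr0n addr0 invr1 mulr1 => H.
  by have := le_trans (normc_ge0 _) H; rewrite pmulr_lge0// wt_gt0.
have Hb m z : normc (b m z) <= K * wt z.1 * inv_sqr m.
  rewrite /b; case: (c m) => //; rewrite normc0 !mulr_ge0//; [exact: ltW (wt_gt0 _)|exact: ltW (inv_sqr_gt0 _)].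
have mb m : cmeas (T := M) setT (b m) by rewrite /b; case: (c m) => //; exact: cmeas_cst.
have pb m : Defs.periodic (b m) by move=> x t; rewrite /b pa.
have le1 m (z : M) : K * wt z.1 * inv_sqr m <= K * wt z.1.
  by rewrite -[leRHS]mulr1 ler_wpM2l ?inv_sqr_le1// mulr_ge0// ltW// wt_gt0.
have tame_series (h : int -> M -> C) : (forall m, cmeas (T := M) setT (h m)) -> (forall m, Defs.periodic (h m)) ->
    (forall m z, normc (h m z) <= K * wt z.1 * inv_sqr m) ->
    (forall m, tame (h m) K) /\ tame (fun z => csumZ (fun m => h m z)) (9 * K) /\
    (forall N, tame (fun z => -1 * psumZ (fun m => h m z) N + csumZ (fun m => h m z)) (8 * K / N.+1%:R)).
  move=> mh ph Hh.
  have ms : cmeas (T := M) setT (fun z => csumZ (fun m => h m z)).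
    by apply: (@cmeas_csumZ _ _ M setT h (fun z => K * wt z.1)) => // m z _; exact: Hh.
  split; first by move=> m; split=> // z; apply: le_trans (Hh m z) (le1 m z).
  split; first by split=> // [x t|z]; [congr csumZ; apply/funext => m; exact: ph|rewrite -mulrA; apply: csumZ_le => m; exact: Hh].
  move=> N; split.
  - by apply: cmeas_lin => //; apply: cmeas_sum.
  - by move=> x t; congr (-1 * _ + csumZ _); [apply: eq_bigr => i _|apply/funext => m]; exact: ph.
  - move=> z; rewrite mulN1r addrC (_ : 8 * K / N.+1%:R * wt z.1 = 8 * (K * wt z.1) / N.+1%:R); last by ring.
    by apply: csumZ_err => m; exact: Hh.
have [ta [tF tFS]] := tame_series a ma pa Ha; have [tb [tG tGT]] := tame_series b mb pb Hb.
set F := fun z => csumZ (fun m => a m z) in tF tFS *.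
set G := fun z => csumZ (fun m => b m z) in tG tGT *.
have LPF := L2P _ (tame_L2 tF); have mPF : cmeas (T := M) dom (P F) by case: LPF => _ [].
have mG := tame_cmeas tG.
have mPG : cmeas (T := M) dom (fun z => P F z + (-1) * G z).
  by apply: cmeasD => //; apply: cmeasM => //; exact: cmeas_cst.
suff : sqnorm2 mu dom (fun z => P F z + (-1) * G z) = 0%E.
  move/(sqnorm2_eq0 measurable_dom mPG); apply: filterS => z H Dz.
  by have /eqP := H Dz; rewrite mulN1r subr_eq0 => /eqP.
pose W := 2 * (`|B| + 1) * ((8 * K) ^+ 2 * wt_mass).
apply: (@ereal_le_rate0 _ _ W); first exact: sqnorm2_ge0.
move=> N; pose S z := psumZ (fun m => a m z) N; pose T z := psumZ (fun m => b m z) N.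
have [tS PS] := @szego_sum _ (index_enum 'I_N.*2.+1) (fun i => a (i%:Z - N%:Z)) (fun i => b (i%:Z - N%:Z)) K
  (fun i => ta _) (fun i => Pa _).
have LPFS := L2P _ (tame_L2 (tFS N)).
have mPFS : cmeas (T := M) dom (P (fun z => -1 * S z + F z)) by case: LPFS => _ [].
have mTG : cmeas (T := M) dom (fun z => (-1) * (-1 * T z + G z)).
  by apply: cmeasM; [exact: cmeas_cst|exact: tame_cmeas (tGT N)].
have PE := szego_lin (-1) tS tF.
rewrite (_ : sqnorm2 mu dom _ = sqnorm2 mu dom (fun z => P (fun z => -1 * S z + F z) z + (-1) * (-1 * T z + G z))); last first.
  apply: (sqnorm2_ae measurable_dom mPG); first exact: cmeasD.
  apply: filterS2 PS PE => z H1 H2 Dz; rewrite (H2 Dz) (H1 Dz).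
  by transitivity (-1 * T z + P F z + -1 * (-1 * T z + G z)); [ring|].
apply: le_trans (@sqnorm2_triangle _ _ M (lebesgue_rV n \x leb)%E dom measurable_dom _ _ mPFS mTG) _.
have dK0 : 0 <= (8 * K / N.+1%:R) ^+ 2 * wt_mass by rewrite mulr_ge0 ?sqr_ge0 ?wt_mass_ge0.
have s1 : (sqnorm2 mu dom (P (fun z => -1 * S z + F z)%R) <= (`|B| * ((8 * K / N.+1%:R) ^+ 2 * wt_mass))%R%:E)%E.
  apply: le_trans (HB _ (tame_L2 (tFS N))) _.
  apply: (@le_trans _ _ (`|B|%:E * sqnorm2 mu dom (fun z => -1 * S z + F z)%R)%E).
    by apply: lee_wpmul2r; [exact: sqnorm2_ge0|rewrite lee_fin ler_norm].
  by rewrite EFinM; apply: lee_wpmul2l; [rewrite lee_fin|exact: tame_sqnorm2 (tFS N)].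
have s2 : (sqnorm2 mu dom (fun z => -1 * (-1 * T z + G z))%R <= ((8 * K / N.+1%:R) ^+ 2 * wt_mass)%R%:E)%E.
  rewrite (_ : sqnorm2 mu dom _ = sqnorm2 mu dom (fun z => -1 * T z + G z)%R); first exact: tame_sqnorm2 (tGT N).
  by apply: eq_integral => z _; rewrite mulN1r normcN.
apply: le_trans (leeD (lee_wpmul2l _ s1) (lee_wpmul2l _ s2)) _ => //.
rewrite -!EFinM -EFinD lee_fin.
rewrite (_ : _ + _ = W / N.+1%:R * N.+1%:R^-1); last by rewrite /W; ring.
rewrite -[leRHS]mulr1 ler_wpM2l ?invf_le1 ?ler1n// divr_ge0// /W !mulr_ge0 ?addr_ge0 ?wt_mass_ge0//.
Qed.

(** On the circle the projection fixes an exponential of nonnegative frequency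
    and kills the others; the factor in x rides along. *)
Lemma szego_product (A : 'rV[R]_n -> C) (K : R) j : cmeas setT A -> (forall x, normc (A x) <= K * wt x) ->
  eq_RnS1 (P (fun z => A z.1 * cexp j z.2)) (fun z => if (0 <= j)%R then A z.1 * cexp j z.2 else 0).
Proof.
move=> mA HA; have [_ _ _ Pprod] := hP.
have LA : L2 (lebesgue_rV n) setT A.
  have ig : (lebesgue_rV n).-integrable setT (EFin \o (fun x => K ^+ 2 * wt x)).
    by have := integrableZl measurableT (K ^+ 2) (@integrable_wt R n); apply: eq_integrable.
  split; [by case: mA|by case: mA|].
  apply: le_lt_trans (sqnorm2_le measurableT mA ig _) _; last exact: ltry.
  move=> x _; apply: (@le_trans _ _ ((K * wt x) ^+ 2)).
    by rewrite ler_pXn2r ?nnegrE ?normc_ge0//; apply: le_trans (normc_ge0 _) (HA x).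
  rewrite exprMn ler_wpM2l ?sqr_ge0// expr2 -[leRHS]mulr1 ler_wpM2l ?wt_le1//.
  exact: ltW (wt_gt0 _).
have Lv : L2_S1 (@cexp R j) by have := L2_cexp (1 : R[i]) j; under eq_fun do rewrite mul1r.
have H := Pprod A (cexp j) LA Lv.
have [N [mN N0 sN]] := szego_cexp hP1 j.
have null : \forall z \ae mu, ~ N z.2.
  exists (setT `*` N); split; first exact: measurableX.
    by rewrite [LHS]product_measure1E// [X in (_ * X)%E]N0 mule0.
  by move=> [x t] /= /contrapT.
apply: filterS2 H null => z Hz nN Dz; rewrite (Hz Dz).
have : ~ ~ (S1 z.2 -> P1 (cexp j) z.2 = if (0 <= j)%R then cexp j z.2 else 0).
  by move=> bad; apply: nN; exact: sN.
move=> /contrapT ->; last by case: Dz.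
by case: ifP => //; rewrite mulr0.
Qed.

End SzegoRn.

(** * Test functions *)

Section TestFunctions.
Context {R : realType} {n : nat}.
Local Notation C := R[i].
Local Notation normc := (@ComplexField.Normc.normc R).
Local Notation M := (RnS1 R n).
Implicit Types (f : M -> C).

Lemma rsmooth_trig (c a b : R) : rsmooth setT (fun t : R => a * cos (c * t) + b * sin (c * t)).
Proof.
apply: (@rsmooth_coind _ _ setT (fun g => exists a b : R, g = fun t : R => a * cos (c * t) + b * sin (c * t)) openT);
  last by exists a, b.
move=> g [{}a [{}b ->]].
have dl (t : R) : is_derive t (1 : R) (fun t : R => c * t) c.
  by apply: (is_derive_eq (is_deriveZ c (is_derive_id t (1 : R)))); rewrite /GRing.scale /= mulr1.
have D (t : R) : is_derive t (1 : R) (fun t : R => a * cos (c * t) + b * sin (c * t))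
    ((b * c) * cos (c * t) + (- (a * c)) * sin (c * t)).
  apply: (is_derive_eq (is_deriveD (is_deriveZ a (is_derive1_comp (is_derive_cos (c * t)) (dl t)))
    (is_deriveZ b (is_derive1_comp (is_derive_sin (c * t)) (dl t))))).
  by rewrite /GRing.scale /=; ring.
have df t : differentiable (fun t : R => a * cos (c * t) + b * sin (c * t)) t.
  by apply/derivable1_diffP; apply: ex_derive.
split=> [t _|v].
  split; first exact: differentiable_continuous (df t).
  by move=> v; exact: diff_derivable (df t).
exists (fun t : R => (v * (b * c)) * cos (c * t) + (v * (- (a * c))) * sin (c * t)); first by exists (v * (b * c)), (v * (- (a * c))).
move=> t _; rewrite deriveE; last exact: df.
have -> : v = v *: (1 : R) by rewrite /GRing.scale /= mulr1.
rewrite linearZ /= -deriveE; last exact: df.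
by case: (D t) => _ ->; rewrite /GRing.scale /= mulr1; ring.
Qed.

Definition csmooth (V : normedModType R) (f : V -> C) :=
  rsmooth setT (fun x => complex.Re (f x)) /\ rsmooth setT (fun x => complex.Im (f x)).

Lemma csmoothP (V : normedModType R) (f : V -> C) : smooth_on setT f <-> csmooth f.
Proof. exact: smooth_onE. Qed.

Lemma csmoothM (V : normedModType R) (f h : V -> C) : csmooth f -> csmooth h -> csmooth (fun x => f x * h x).
Proof.
move=> [f1 f2] [h1 h2]; have oT := @openT V; split.
  rewrite (_ : (fun x => _) = fun x => complex.Re (f x) * complex.Re (h x) + (-1) * (complex.Im (f x) * complex.Im (h x))).
    exact: (rsmoothD oT (rsmoothM oT f1 h1) (rsmoothZ (-1) oT (rsmoothM oT f2 h2))).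
  by apply/funext => x; case: (f x) (h x) => [? ?] [? ?] /=; ring.
rewrite (_ : (fun x => _) = fun x => complex.Re (f x) * complex.Im (h x) + complex.Im (f x) * complex.Re (h x)).
  exact: (rsmoothD oT (rsmoothM oT f1 h2) (rsmoothM oT f2 h1)).
by apply/funext => x; case: (f x) (h x) => [? ?] [? ?] /=; ring.
Qed.

Lemma csmooth_comp (V W : normedModType R) (k : V -> W) (L : V -> W) (f : W -> C) :
  (forall v a (h : R), k (h *: v + a) = h *: L v + k a) -> continuous k -> csmooth f -> csmooth (f \o k).
Proof.
by move=> kL ck [f1 f2]; split; [have := rsmooth_affine kL ck f1|have := rsmooth_affine kL ck f2]; rewrite preimage_setT.
Qed.

Lemma csmooth_cexp (m : int) : csmooth (fun z : M => cexp m z.2 : C).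
Proof.
have H : csmooth (@cexp R m).
  split; rewrite /cexp /=.
    by have := rsmooth_trig m%:~R 1 0; under eq_fun do rewrite mul1r mul0r addr0.
  by have := rsmooth_trig m%:~R 0 1; under eq_fun do rewrite mul0r mul1r add0r.
by apply: (@csmooth_comp M R (fun z => z.2) (fun z => z.2)) H => // z; exact: cvg_snd.
Qed.

Lemma csmooth_ccts (V : normedModType R) (f : V -> C) : csmooth f -> ccts f.
Proof. by move=> [f1 f2] p; split; [exact: (rsmooth_cts f1)|exact: (rsmooth_cts f2)]. Qed.

Lemma csmooth_cderive (V : normedModType R) (v : V) (f : V -> C) : csmooth f -> csmooth (cderive v f).
Proof. by move=> [f1 f2]; split; exact: rsmooth_derive. Qed.

Lemma test_csmooth f : test_function f -> csmooth f.
Proof. by case=> /csmoothP. Qed.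

Lemma test_cexpM m f : test_function f -> test_function (fun z => cexp m z.2 * f z).
Proof.
move=> [/csmoothP sf pf [K cK Kf]]; split.
- by apply/csmoothP; exact: (csmoothM (csmooth_cexp m) sf).
- by move=> x t; rewrite /= pf /cexp expi_period.
- by exists K => // x t nK; rewrite Kf ?mulr0.
Qed.

Lemma test_scale (a : C) f : test_function f -> test_function (fun z => a * f z).
Proof.
move=> [/csmoothP sf pf [K cK Kf]]; split.
- apply/csmoothP; apply: (@csmoothM M (fun=> a) f _ sf).
  by split; apply: rsmooth_cst; exact: openT.
- by move=> x t; rewrite /= pf.
- by exists K => // x t nK; rewrite Kf ?mulr0.
Qed.

Lemma test_cderive v f : test_function f -> test_function (cderive v f).
Proof.
move=> [/csmoothP sf pf [K cK Kf]]; split.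
- by apply/csmoothP; exact: csmooth_cderive.
- move=> x t; rewrite /cderive.
  have per (g : M -> R) : (forall x t, g (x, t + 2 * pi) = g (x, t)) -> 'D_v g (x, t + 2 * pi) = 'D_v g (x, t).
    move=> pg; pose k (z : M) : M := (z.1, z.2 + 2 * pi).
    have kE (h : R) : k (h *: v + (x, t)) = h *: v + k (x, t) by congr (_, _); rewrite /= addrA.
    have [<- _] := @derive_affine _ _ _ _ g k (x, t) v v kE.
    by congr ('D_v _ _); apply/funext => -[y s] /=; rewrite /k /= pg.
  by rewrite !per => // y s; rewrite pf.
- exists K => // x t nK.
  have oK : @open M [set z | ~ K z.1].
    apply: (@open_comp _ _ (fun z : M => z.1) (~` K)); first by move=> z _; exact: cvg_fst.
    by rewrite openC; apply: compact_closed => //; exact: norm_hausdorff.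
  have der0 (g : M -> R) : (forall z : M, ~ K z.1 -> g z = 0) -> 'D_v g (x, t) = 0.
    move=> g0; have := @rders_eq _ _ [set z : M | ~ K z.1] g (fun=> 0) [:: v] oK g0 (x, t) nK.
    by rewrite /= => ->; exact: (@derive_cst _ _ _ (0 : R)).
  by rewrite /cderive !der0 => [|[y s] /= nKy|[y s] /= nKy]; rewrite ?Kf.
Qed.

Lemma weight_compact (K : set 'rV[R]_n) : compact K -> exists2 c : R, 0 <= c & forall x, K x -> 1 <= c * wt x.
Proof.
move=> cK; have ci : continuous (fun x : 'rV[R]_n => (wt x)^-1).
  by move=> x; apply: (@cvgV _ _ (nbhs x) _ (@wt R n)); [rewrite gt_eqF// wt_gt0|exact: wt_cts].
have [c Hc] := cts_compact_bounded cK ci; exists `|c| => // x Kx.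
rewrite -ler_pdivrMr ?wt_gt0// mul1r; apply: le_trans (ler_norm _) _.
exact: le_trans (Hc x Kx) (ler_norm _).
Qed.

Lemma test_bound f : test_function f -> exists2 c : R, 0 <= c & forall z, normc (f z) <= c * wt z.1.
Proof.
move=> [/csmoothP sf pf [K cK Kf]]; have cf := csmooth_ccts sf.
have [w w0 Hw] := weight_compact cK.
have cKt : compact (K `*` `[0, 2 * pi]%classic : set M) by apply: compact_setX => //; exact: segment_compact.
have [a Ha] := cts_compact_bounded cKt (fun z => (cf z).1).
have [b Hb] := cts_compact_bounded cKt (fun z => (cf z).2).
exists ((`|a| + `|b|) * w); first by rewrite mulr_ge0// addr_ge0.
move=> [x t] /=; have [Kx|nKx] := pselect (K x); last first.
  by rewrite Kf// normc0 !mulr_ge0 ?addr_ge0// ltW// wt_gt0.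
have [t' t'I <-] := periodic_reduce (pf x) t.
have in_t' : (K `*` `[0, 2 * pi]%classic) (x, t') by split=> //=; rewrite in_itv.
apply: le_trans (normc_le_ReIm _) _; rewrite -mulrA -[leLHS]mulr1.
apply: ler_pM; [exact: addr_ge0|exact: ler01|by apply: lerD; [apply: le_trans (Ha _ in_t') (ler_norm _)|apply: le_trans (Hb _ in_t') (ler_norm _)]|exact: Hw].
Qed.

Lemma ccts_cmeas_M f : ccts f -> cmeas (T := ('rV[R]_n * measurableTypeR R)%type) setT f.
Proof. by move=> cf; split; apply: measurable_cts_prod => z; case: (cf z). Qed.

Lemma ccts_cmeas_rV (f : 'rV[R]_n -> C) : ccts f -> cmeas setT f.
Proof. by move=> cf; split; apply: measurable_cts_rV => z; case: (cf z). Qed.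

Lemma test_tame f : test_function f -> exists2 K : R, 0 <= K & tame f K.
Proof.
move=> tf; have [c c0 Hc] := test_bound tf; exists c => //; split=> //.
  exact: ccts_cmeas_M (csmooth_ccts (test_csmooth tf)).
by case: tf.
Qed.

Definition axis (j : 'I_n) : M := (delta_mx ord0 j, 0).
Definition circle_axis : M := (0, 1).

Lemma cder_circle f x : csmooth f -> cder (fun t => f (x, t)) (fun t => cderive circle_axis f (x, t)).
Proof.
move=> [f1 f2] t.
have D (g : M -> R) : rsmooth setT g -> is_derive t (1 : R) (fun t : R => g (x, t)) ('D_circle_axis g (x, t)).
  move=> sg; have [dE dd] := line_derive g (x, 0) circle_axis t.
  have E s : ((x, 0) : M) + s *: circle_axis = (x, s).
    by congr (_, _) => /=; rewrite ?scaler0 ?addr0// add0r /GRing.scale /= mulr1.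
  have Eg : (fun s : R => g ((x, 0) + s *: circle_axis)) = (fun s => g (x, s)) by apply/funext => s; rewrite E.
  rewrite Eg E in dE dd; rewrite -dE; apply: DeriveDef => //; apply: dd; have [_ dg] := sg [::] (x, t) Logic.I; exact: dg.
by split; exact: D.
Qed.

Definition circle_mode f (m : int) (x : 'rV[R]_n) : C := fcoef (fun t => f (x, t)) m.

Lemma csmooth_section f x : csmooth f -> ccts (fun t => f (x, t)).
Proof. by move=> sf; exact: cder_ccts (cder_circle x sf). Qed.

Lemma csmooth_circle_mode f m : csmooth f -> csmooth (fun z : M => circle_mode f m z.1).
Proof.
move=> [sR sI]; have sf : csmooth f by split.
pose C0 (t : R) := cos (- m%:~R * t); pose S0 (t : R) := sin (- m%:~R * t).
have cC : continuous C0 := @continuous_cosM _ _.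
have cS : continuous S0 := @continuous_sinM _ _.
pose lift (g : M -> R) (p : M * M) := g p.1.
have sl (g : M -> R) : rsmooth setT g -> @rsmooth _ ((M * M)%type : normedModType R) setT (lift g).
  move=> sg; have := @rsmooth_affine _ _ M setT g (fun p : M * M => p.1) (fun p => p.1) _ _ sg.
  by rewrite preimage_setT; apply=> // p; exact: cvg_fst.
have int (w : R -> R) (g : M -> R) x : continuous w -> rsmooth setT g ->
    (@lebesgue_measure R).-integrable `[0, 2 * pi] (EFin \o (fun t => w t * g (x, t))).
  move=> cw sg; apply/cts_in_integrable.
  exact: (theta_average_in (U := setT) (p := ((x, 0), 0)) (g := lift g) _ cw (sl g sg) Logic.I).
pose av (w : R -> R) (g : M -> R) (z : M) := theta_average w (lift g) (z, 0).
have sav w g : continuous w -> rsmooth setT g -> rsmooth setT (av w g).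
  move=> cw sg; have := @rsmooth_affine _ M ((M * M)%type : normedModType R) setT _ (fun z : M => (z, 0)) (fun z => (z, 0)) _ _ (theta_average_smooth cw (sl g sg)).
  rewrite preimage_setT; apply=> [v a h|z]; first by congr (_, _); rewrite /= scaler0 addr0.
  by apply: cts_pair; [exact: cvg_id|exact: cvg_cst].
have oT := @openT M; split.
  rewrite (_ : (fun z => _) = fun z : M => (2 * pi)^-1 * (av C0 (fun z => complex.Re (f z)) z + (-1) * av S0 (fun z => complex.Im (f z)) z)).
    apply: (rsmoothZ _ oT); apply: (rsmoothD oT); first exact: sav.
    by apply: (rsmoothZ _ oT); exact: sav.
  apply/funext => -[x t]; rewrite /circle_mode /fcoef ReZ; congr (_ * _); rewrite mulN1r.
  rewrite /av /theta_average /average -RintegralB//; [|exact: (int _ _ x cC sR)|exact: (int _ _ x cS sI)].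
  apply: eq_Rintegral => s _; rewrite /expi /C0 /S0 /lift !mulNr /=.
  by case: (f _) => a b /=; ring.
rewrite (_ : (fun z => _) = fun z : M => (2 * pi)^-1 * (av C0 (fun z => complex.Im (f z)) z + av S0 (fun z => complex.Re (f z)) z)).
  by apply: (rsmoothZ _ oT); apply: (rsmoothD oT); exact: sav.
apply/funext => -[x t]; rewrite /circle_mode /fcoef ImZ; congr (_ * _).
rewrite /av /theta_average /average -RintegralD//; [|exact: (int _ _ x cC sI)|exact: (int _ _ x cS sR)].
apply: eq_Rintegral => s _; rewrite /expi /C0 /S0 /lift !mulNr /=.
by case: (f _) => a b /=; ring.
Qed.

Lemma test_circle_mode f m : test_function f -> test_function (fun z => cexp m z.2 * circle_mode f m z.1).
Proof.
move=> tf; have sf := test_csmooth tf; have [_ pf [K cK Kf]] := tf; split.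
- by apply/csmoothP; apply: csmoothM; [exact: csmooth_cexp|exact: csmooth_circle_mode].
- by move=> x t; rewrite /cexp /= expi_period.
- exists K => // x t nK; have E0 : (fun t => f (x, t)) = (fun=> 0) by apply/funext => u; rewrite Kf.
  rewrite /circle_mode /= E0 /fcoef (_ : (fun t : R => 0 * _) = fun=> 0); last by apply/funext => u; rewrite mul0r.
  by rewrite cintegral0 ?mulr0//; exact: measurable_dom_S1.
Qed.

End TestFunctions.

(** * The Fourier transform on the product *)

Section FourierTransform.
Context {R : realType}.
Local Notation C := R[i].
Local Notation normc := (@ComplexField.Normc.normc R).
Local Notation leb := (@lebesgue_measure R).
Local Notation S1 := (@dom_S1 R).
Local Notation mS1 := (@measurable_dom_S1 R).

Lemma dotp_cts n (y : 'rV[R]_n) : continuous (fun x => dotp x y).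
Proof.
move=> x; rewrite /dotp; elim: (index_enum _) => [|i s IH].
  by rewrite (_ : (fun x => _) = fun=> 0); [exact: cst_continuous|apply/funext => z; rewrite big_nil].
rewrite (_ : (fun x => _) = fun z : 'rV[R]_n => z ord0 i * y ord0 i + \sum_(j <- s) z ord0 j * y ord0 j); last first.
  by apply/funext => z; rewrite big_cons.
rewrite /continuous_at; apply: cvgD; [exact: (nbhs_filter x)| |exact: IH].
apply: cvgM; [exact: (nbhs_filter x)|exact: coord_continuous|exact: cst_continuous].
Qed.

Lemma dotpC n (x y : 'rV[R]_n) : dotp x y = dotp y x.
Proof. by apply: eq_bigr => i _; rewrite mulrC. Qed.

Lemma cts_opp_at (V : normedModType R) (h : V -> R) p : {for p, continuous h} -> {for p, continuous (fun x => - h x)}.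
Proof. by move=> ch; apply: cvgN. Qed.

Lemma ccts_plane n (y : 'rV[R]_n) : ccts (fun x : 'rV[R]_n => expi (dotp x y) : C).
Proof. by move=> x; apply: ccts_expi; exact: dotp_cts. Qed.

Lemma ccts_planeN n (y : 'rV[R]_n) : ccts (fun x : 'rV[R]_n => expi (- dotp x y) : C).
Proof. by move=> x; apply: ccts_expi; apply: cts_opp_at; exact: dotp_cts. Qed.

Lemma cintegral_rVS n (f : 'rV[R]_n.+1 -> C) (u : R -> R) (v : 'rV[R]_n -> R) :
  cmeas setT f -> (forall t, 0 <= u t) -> (forall y, 0 <= v y) ->
  leb.-integrable setT (EFin \o u) -> (lebesgue_rV n).-integrable setT (EFin \o v) ->
  (forall t y, normc (f (rV_cons (t, y))) <= u t * v y) ->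
  cintegral (lebesgue_rV n.+1) setT f = cintegral leb setT (fun t => cintegral (lebesgue_rV n) setT (fun y => f (rV_cons (t, y)))) /\
  cintegral (lebesgue_rV n.+1) setT f = cintegral (lebesgue_rV n) setT (fun y => cintegral leb setT (fun t => f (rV_cons (t, y)))).
Proof.
move=> [mR mI] u0 v0 iu iv H.
have E : cintegral (lebesgue_rV n.+1) setT f = cintegral (leb \x lebesgue_rV n)%E (setT `*` setT) (f \o @rV_cons R n).
  rewrite /cintegral; congr (_ +i* _).
    apply: (@Rintegral_rVS R n (fun x => complex.Re (f x)) u v) => // t y.
    by apply: le_trans (Re_le_normc _) (H t y).
  apply: (@Rintegral_rVS R n (fun x => complex.Im (f x)) u v) => // t y.
  by apply: le_trans (Im_le_normc _) (H t y).
have mc : cmeas (T := (measurableTypeR R * 'rV[R]_n)%type) setT (f \o @rV_cons R n).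
  by split; [exact: (measurableT_comp mR (@measurable_rV_cons R n))|exact: (measurableT_comp mI (@measurable_rV_cons R n))].
by rewrite E; split; [exact: (cFubini12 measurableT mc u0 v0 iu iv (fun t y _ => H t y))|exact: (cFubini21 measurableT mc u0 v0 iu iv (fun t y _ => H t y))].
Qed.

Lemma cintegral_line0 (F F' : R -> C) (L : R) : cder F F' -> ccts F' -> 0 <= L ->
  (forall t, L < `|t| -> F t = 0 /\ F' t = 0) -> cintegral leb setT F' = 0.
Proof.
move=> dF cF L0 H.
have L1 : - (L + 1) < L + 1 by lra.
have out (t : R) : ~ (t \in `[- (L + 1), L + 1]) -> L < `|t|.
  by move=> nt; rewrite ltNge; apply/negP; rewrite ler_norml => /andP[? ?]; apply: nt; rewrite in_itv/=; apply/andP; split; lra.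
have z1 : F (L + 1) = 0 by apply: (H _ _).1; rewrite ger0_norm; lra.
have z2 : F (- (L + 1)) = 0 by apply: (H _ _).1; rewrite normrN ger0_norm; lra.
have key (G G' : R -> R) : (forall t, is_derive t (1 : R) G (G' t)) -> (forall t, {for t, continuous G'}) ->
    (forall t, L < `|t| -> G' t = 0) -> G (L + 1) = 0 -> G (- (L + 1)) = 0 -> \int[leb]_t G' t = 0.
  move=> dG cG G0 g1 g2; transitivity (\int[leb]_(t in `[- (L + 1), L + 1]) G' t).
    rewrite /Rintegral [in RHS]integral_mkcond; congr fine; apply: eq_integral => t _.
    rewrite /patch; case: ifPn => // nt; rewrite G0//; apply: out => ti.
    by move: nt; rewrite mem_set.
  by rewrite (@Rintegral_FTC R G G' _ _ L1 (fun t _ => dG t) (fun t _ => cG t)) g1 g2 subrr.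
rewrite /cintegral; congr (_ +i* _).
  apply: (key (fun t => complex.Re (F t))); rewrite ?z1 ?z2// => t; [by case: (dF t)|by case: (cF t)|].
  by move=> /H[_ ->].
apply: (key (fun t => complex.Im (F t))); rewrite ?z1 ?z2// => t; [by case: (dF t)|by case: (cF t)|].
by move=> /H[_ ->].
Qed.

Lemma rV_cons_cts n (t : R) : continuous (fun y : 'rV[R]_n => rV_cons (t, y)).
Proof.
move=> y A /nbhs_ballP[e e0 HA]; apply/nbhs_ballP; exists e => // z yz; apply: HA; split=> // i j.
by rewrite ord1 !mxE; case: (unliftP ord0 j) => [k _|_] /=; [exact: yz.2|exact: ballxx].
Qed.

Lemma rV_cons_ctsl n (y : 'rV[R]_n) : continuous (fun t : R => rV_cons (t, y)).
Proof.
move=> t; apply/cvgrPdist_le => e e0; near=> s.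
rewrite -[leLHS]/(mx_norm _) mx_normrE; apply/bigmax_leP; split; first exact: ltW.
move=> [i j] _; rewrite ord1 /= !mxE; case: (unliftP ord0 j) => [k _|_] /=; first by rewrite subrr normr0 ltW.
by near: s; apply: cvgr_dist_le => //; exact: cvg_id.
Unshelve. all: by end_near. Qed.

Lemma ccts_comp (V W : normedModType R) (k : V -> W) (f : W -> C) : continuous k -> ccts f -> ccts (f \o k).
Proof.
move=> ck cf x; have [c1 c2] := cf (k x); split.
  by apply: (@continuous_comp _ _ _ k (fun y => complex.Re (f y))); [exact: ck|exact: c1].
by apply: (@continuous_comp _ _ _ k (fun y => complex.Im (f y))); [exact: ck|exact: c2].
Qed.

Lemma cintegral_axis0 n (j : 'I_n) (g g' : 'rV[R]_n -> C) (L K : R) : 0 <= L ->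
  (forall x : 'rV[R]_n, cder (fun s => g (x + s *: delta_mx ord0 j)) (fun s => g' (x + s *: delta_mx ord0 j))) ->
  ccts g' -> (forall (x : 'rV[R]_n) i, L < `|x ord0 i| -> g x = 0 /\ g' x = 0) ->
  (forall x : 'rV[R]_n, normc (g' x) <= K * wt x) -> cintegral (lebesgue_rV n) setT g' = 0.
Proof.
move=> L0; elim: n j g g' K => [[]//|n IH] j g g' K dg cg' sg Hg.
have K0 : 0 <= K by have := le_trans (normc_ge0 _) (Hg 0); rewrite pmulr_lge0// wt_gt0.
have iu : leb.-integrable setT (EFin \o (fun t : R => K * (1 + t ^+ 2)^-1)).
  by have := integrableZl measurableT K (@integrable_oneDsqrV R); apply: eq_integrable.
have u0 (t : R) : 0 <= K * (1 + t ^+ 2)^-1 by rewrite mulr_ge0// ltW// oneDsqrV_gt0.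
have v0 (y : 'rV[R]_n) : 0 <= wt y := ltW (wt_gt0 y).
have H t (y : 'rV[R]_n) : normc (g' (rV_cons (t, y))) <= K * (1 + t ^+ 2)^-1 * wt y.
  by rewrite -mulrA -wt_cons.
have [E1 E2] := cintegral_rVS (ccts_cmeas_rV cg') u0 v0 iu (@integrable_wt R n) H.
case: (unliftP ord0 j) => [k jk|j0].
  rewrite E1 (_ : (fun t => _) = fun=> 0) ?cintegral0//; apply/funext => t.
  have lin (y : 'rV[R]_n) (s : R) : rV_cons (t, y) + s *: delta_mx ord0 j = rV_cons (t, y + s *: delta_mx ord0 k).
    apply/rowP => i; rewrite !mxE jk; case: (unliftP ord0 i) => [l ->|->] /=; rewrite ?mxE ?eqxx /=.
      by rewrite ?(inj_eq (@lift_inj _ _)).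
    by rewrite ?(negbTE (neq_lift _ _)) mulr0 addr0.
  apply: (IH k (fun y => g (rV_cons (t, y))) _ K).
  - move=> y; have := dg (rV_cons (t, y)); rewrite (_ : (fun s => g _) = fun s => g (rV_cons (t, y + s *: delta_mx ord0 k))).
      by rewrite (_ : (fun s => g' _) = fun s => g' (rV_cons (t, y + s *: delta_mx ord0 k)))//; apply/funext => s; rewrite lin.
    by apply/funext => s; rewrite lin.
  - exact: (ccts_comp (@rV_cons_cts n t) cg').
  - by move=> y i Hi; apply: (sg _ (lift ord0 i)); rewrite rV_consS.
  - move=> y; apply: le_trans (H t y) _; rewrite ler_wpM2r// -[leRHS]mulr1 ler_wpM2l//.
    by rewrite invf_le1 ?ler_wpDr ?sqr_ge0// ltr_pwDl// sqr_ge0.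
rewrite E2 (_ : (fun y => _) = fun=> 0) ?cintegral0//; apply/funext => y.
have lin (s : R) : rV_cons (0, y) + s *: delta_mx ord0 j = rV_cons (s, y).
  apply/rowP => i; rewrite !mxE j0; case: (unliftP ord0 i) => [l ->|->] /=; rewrite ?eqxx /=.
    by rewrite ?(eq_sym (lift _ _)) ?(negbTE (neq_lift _ _)) mulr0 addr0.
  by rewrite mulr1 add0r.
apply: (@cintegral_line0 (fun t => g (rV_cons (t, y))) _ L) => //.
- have := dg (rV_cons (0, y)); rewrite (_ : (fun s => g _) = fun s => g (rV_cons (s, y))).
    by rewrite (_ : (fun s => g' _) = fun s => g' (rV_cons (s, y)))//; apply/funext => s; rewrite lin.
  by apply/funext => s; rewrite lin.
- exact: (ccts_comp (@rV_cons_ctsl n y) cg').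
- by move=> t Ht; apply: (sg _ ord0); rewrite rV_cons0.
Qed.

Section OnProduct.
Variable n : nat.
Local Notation M := (RnS1 R n).
Local Notation mu := (@mu_RnS1 R n).
Local Notation dom := (@dom_RnS1 R n).
Implicit Types (f : M -> C) (xi : 'rV[R]_n) (m : int).

Definition wave xi m (z : M) : C := expi (- dotp z.1 xi - m%:~R * z.2).

Lemma waveE xi m (z : M) : wave xi m z = expi (- dotp z.1 xi) * expi (- (m%:~R * z.2)).
Proof. by rewrite /wave expiD. Qed.

Lemma ccts_wave xi m : ccts (wave xi m).
Proof.
move=> z; apply: ccts_expi; apply: cvgB.
  apply: cvgN; apply: (@continuous_comp _ _ _ (fun z : M => z.1) (fun x => dotp x xi)); first exact: cvg_fst.
  exact: dotp_cts.
by apply: cvgM; [exact: cvg_cst|exact: cvg_snd].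
Qed.

Lemma tame_dom f K : tame f K -> cdom mu dom f (fun z => K * wt z.1).
Proof.
move=> tf; split; [exact: tame_cmeas tf| |by move=> z _; case: tf].
by have := integrableZl (@measurable_dom R n) K (@integrable_wt_dom R n); apply: eq_integrable => //; exact: measurable_dom.
Qed.

Lemma tame_wave f K xi m : tame f K -> tame (fun z => wave xi m z * f z) K.
Proof.
move=> [mf pf Hf]; split.
- by apply: cmeasM => //; apply: ccts_cmeas_M; exact: ccts_wave.
- by move=> x t; rewrite pf !waveE /= -!mulNr -!mulrNz expi_period.
- by move=> z; rewrite normcM normc_expi mul1r.
Qed.

Lemma fourier_le f K xi m : tame f K ->
  normc (fourier f xi m) <= `|((2 * pi)^-1) ^+ n.+1| * (2 * (K * wt_mass (R := R) (n := n))).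
Proof.
move=> tf; rewrite normcM normc_real ler_wpM2l//.
apply: le_trans (@cintegral_le _ _ _ (lebesgue_rV n \x leb)%E dom (@measurable_dom R n) _ _ (tame_dom (tame_wave xi m tf))) _.
by rewrite RintegralZl//; [exact: measurable_dom|exact: integrable_wt_dom].
Qed.

Lemma ccts_circle_mode f m : csmooth f -> ccts (circle_mode f m).
Proof.
move=> sf; have := csmooth_ccts (csmooth_circle_mode m sf) => H.
have := @ccts_comp _ M (fun x : 'rV[R]_n => (x, 0 : R)) _ _ H; apply.
by move=> x; apply: (@cts_pair _ _ _ id (fun=> 0) x); [exact: cvg_id|exact: cst_continuous].
Qed.

Lemma circle_mode_le f K m x : csmooth f -> (forall z, normc (f z) <= K * wt z.1) ->
  normc (circle_mode f m x) <= 2 * K * wt x.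
Proof. by move=> sf H; rewrite -mulrA; apply: fcoef_le; [exact: csmooth_section|move=> t; exact: H]. Qed.

Lemma circle_mode_dom f K xi m : csmooth f -> (forall z, normc (f z) <= K * wt z.1) ->
  cdom (lebesgue_rV n) setT (fun x => expi (- dotp x xi) * circle_mode f m x) (fun x => 2 * K * wt x).
Proof.
move=> sf H; split.
- by apply: ccts_cmeas_rV => x; apply: ccts_mul; [exact: ccts_planeN|exact: ccts_circle_mode].
- by have := integrableZl measurableT (2 * K) (@integrable_wt R n); apply: eq_integrable.
- by move=> x _; rewrite normcM normc_expi mul1r; exact: circle_mode_le.
Qed.

Lemma fourierE f K xi m : tame f K ->
  fourier f xi m = (((2 * pi)^-1) ^+ n)%:C * cintegral (lebesgue_rV n) setT (fun x => expi (- dotp x xi) * circle_mode f m x).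
Proof.
move=> tf; have tw := tame_wave xi m tf; have [mw _ Hw] := tw.
have K0 : 0 <= K by have := le_trans (normc_ge0 _) (Hw (0, 0)); rewrite pmulr_lge0// wt_gt0.
have c0 : 0 <= (2 * pi)^-1 :> R by rewrite invr_ge0 ltW// twopi_gt0.
have u0 (x : 'rV[R]_n) : 0 <= K * wt x by rewrite mulr_ge0// ltW// wt_gt0.
have v0 (t : R) : 0 <= (2 * pi)^-1 :> R := c0.
have iu : (lebesgue_rV n).-integrable setT (EFin \o (fun x => K * wt x)).
  by have := integrableZl measurableT K (@integrable_wt R n); apply: eq_integrable.
have H x t : S1 t -> normc (((2 * pi)^-1)%:C * (wave xi m (x, t) * f (x, t))) <= K * wt x * (2 * pi)^-1.
  by move=> _; rewrite normcM normc_real (ger0_norm c0) mulrC ler_wpM2r//; exact: (Hw (x, t)).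
have mm : cmeas (T := ('rV[R]_n * measurableTypeR R)%type) setT (fun z => ((2 * pi)^-1)%:C * (wave xi m z * f z)).
  by apply: cmeasM => //; exact: cmeas_cst.
rewrite /fourier exprSr (_ : ((_ * _)%:C : C) = (((2 * pi)^-1) ^+ n)%:C * ((2 * pi)^-1)%:C); last first.
  by apply/complex_eqP; split=> /=; ring.
rewrite -mulrA -(@cintegralM _ _ _ (lebesgue_rV n \x leb)%E dom (@measurable_dom R n) _ _ _ (tame_dom tw)).
congr (_ * _); rewrite (cFubini12 mS1 mm u0 v0 iu (integrable_dom_S1_cst _) H).
apply: cintegral_ext => x _ /=; rewrite /circle_mode /fcoef.
have ds := cdom_section2 mS1 mm (u := fun x => K * wt x) (v := fun=> (2 * pi)^-1) (integrable_dom_S1_cst _) H x.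
have c1 : cdom leb S1 (fun t => f (x, t) * expi (- (m%:~R * t))) (fun=> K * wt x).
  have [mf _ Hf] := tf; split.
  - apply: cmeasM.
      case: mf => mR mI; split; apply: measurable_funTS.
        exact: (measurableT_comp mR (pair1_measurable x)).
      exact: (measurableT_comp mI (pair1_measurable x)).
    apply: (ccts_cmeas _ mS1) => t; by have := ccts_fcoef m (fun t => ccts_cst (1 : C) t) t; under [X in ccts_at X _]eq_fun do rewrite mul1r.
  - exact: integrable_dom_S1_cst.
  - by move=> t _; rewrite normcM normc_expi mulr1; exact: (Hf (x, t)).
rewrite -(cintegralM mS1 _ c1) -(cintegralM mS1 _ (cdomM mS1 _ c1)).
by apply: cintegral_ext => t _; rewrite waveE /=; ring.
Qed.

End OnProduct.
End FourierTransform.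

(** * Rapid decay of the transform *)

Section FourierDecay.
Context {R : realType} {n : nat}.
Local Notation C := R[i].
Local Notation normc := (@ComplexField.Normc.normc R).
Local Notation leb := (@lebesgue_measure R).
Local Notation S1 := (@dom_S1 R).
Local Notation mS1 := (@measurable_dom_S1 R).
Local Notation M := (RnS1 R n).
Local Notation mu := (@mu_RnS1 R n).
Local Notation dom := (@dom_RnS1 R n).
Implicit Types (f : M -> C) (xi : 'rV[R]_n) (m : int).

Lemma fourier_circle f xi m : test_function f ->
  fourier (cderive circle_axis f) xi m = (0 +i* m%:~R) * fourier f xi m.
Proof.
move=> tf; have sf := test_csmooth tf; have td := test_cderive circle_axis tf.
have [K K0 tK] := test_tame tf; have [K' K'0 tK'] := test_tame td.
have [_ pf _] := tf; have [_ _ HK] := tK; have [_ _ HK'] := tK'.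
rewrite (fourierE _ _ tK') (fourierE _ _ tK) mulrCA; congr (_ * _).
rewrite -(cintegralM measurableT _ (circle_mode_dom xi m sf HK)); apply: cintegral_ext => x _.
rewrite [RHS]mulrCA; congr (_ * _); rewrite /circle_mode.
apply: (@fcoef_der _ (fun t => f (x, t)) _ m (K + K')).
- exact: cder_circle.
- exact: csmooth_section (test_csmooth td).
- by rewrite -[2 * pi]add0r pf.
- by move=> t; apply: le_trans (HK (x, t)) _; have := wt_le1 x; have := wt_gt0 x => /= *; nra.
- by move=> t; apply: le_trans (HK' (x, t)) _; have := wt_le1 x; have := wt_gt0 x => /= *; nra.
Qed.

Lemma fourier_axis f xi m j : test_function f ->
  fourier (cderive (axis j) f) xi m = (0 +i* xi ord0 j) * fourier f xi m.
Proof.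
move=> tf; have sf := test_csmooth tf; have td := test_cderive (axis j) tf.
have [K K0 tK] := test_tame tf; have [K' K'0 tK'] := test_tame td.
have [_ _ [A cA Af]] := tf; have [_ _ HK] := tK; have [_ _ HK'] := tK'.
rewrite /fourier mulrCA; congr (_ * _).
have tw := tame_wave xi m tK; have tw' := tame_wave xi m tK'.
apply/eqP; rewrite -subr_eq0; apply/eqP.
have t2 : tame (fun z => - (0 +i* xi ord0 j) * (wave xi m z * f z) + wave xi m z * cderive (axis j) f z) (normc (- (0 +i* xi ord0 j)) * K + K').
  exact: tame_lin.
transitivity (cintegral mu dom (fun z => - (0 +i* xi ord0 j) * (wave xi m z * f z) + wave xi m z * cderive (axis j) f z)).
  rewrite (@cintegral_lin _ _ _ (lebesgue_rV n \x leb)%E dom (@measurable_dom R n) _ _ _ _ _ (tame_dom tw) (tame_dom tw')).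
  by rewrite mulNr addrC.
set N := normc _ * K + K' in t2; have [m2 _ H2] := t2.
have N0 : 0 <= N by have := le_trans (normc_ge0 _) (H2 (0, 0)); rewrite pmulr_lge0// wt_gt0.
have u0 (x : 'rV[R]_n) : 0 <= N * wt x by rewrite mulr_ge0// ltW// wt_gt0.
have iu : (lebesgue_rV n).-integrable setT (EFin \o (fun x => N * wt x)).
  by have := integrableZl measurableT N (@integrable_wt R n); apply: eq_integrable.
have v0 (t : R) : 0 <= 1 :> R by [].
have H3 x t : S1 t -> normc (- (0 +i* xi ord0 j) * (wave xi m (x, t) * f (x, t)) + wave xi m (x, t) * cderive (axis j) f (x, t)) <= N * wt x * 1.
  by move=> _; rewrite mulr1; exact: (H2 (x, t)).
rewrite (cFubini21 mS1 m2 u0 v0 iu (integrable_dom_S1_cst 1) H3).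
rewrite (_ : (fun t => _) = fun=> 0) ?cintegral0//; first exact: mS1.
apply/funext => t.
have [L L0 HL] : exists2 L : R, 0 <= L & forall (x : 'rV[R]_n) i, L < `|x ord0 i| -> ~ A x.
  have [L HL] := cts_compact_bounded cA (@norm_continuous _ 'rV[R]_n); exists `|L| => // x i Lx Ax.
  have := HL x Ax; rewrite normr_id => xL.
  have : `|x ord0 i| <= `|x|.
    rewrite -[leRHS]/(mx_norm _) mx_normrE.
    exact: (@le_bigmax _ _ _ 0 (fun ij : 'I_1 * 'I_n => `|x ij.1 ij.2|) (ord0, i)).
  by move=> xx; have := le_lt_trans (le_trans xx (le_trans xL (ler_norm L))) Lx; rewrite ltxx.
have [_ _ [A' cA' Af']] := td.
have cg' : ccts (fun x => - (0 +i* xi ord0 j) * (wave xi m (x, t) * f (x, t)) + wave xi m (x, t) * cderive (axis j) f (x, t)).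
  have cp : continuous (fun x : 'rV[R]_n => (x, t) : M).
    by move=> x; apply: (@cts_pair _ _ _ id (fun=> t) x); [exact: cvg_id|exact: cst_continuous].
  have c1 := ccts_comp cp (@ccts_wave R n xi m); have c2 := ccts_comp cp (csmooth_ccts sf).
  have c3 := ccts_comp cp (csmooth_ccts (test_csmooth td)).
  by move=> x; apply: ccts_lin; [exact: (ccts_mul (c1 x) (c2 x))|exact: (ccts_mul (c1 x) (c3 x))].
have der0 x : ~ A x -> cderive (axis j) f (x, t) = 0.
  move=> nA; have oK : @open M [set z | ~ A z.1].
    apply: (@open_comp _ _ (fun z : M => z.1) (~` A)); first by move=> z _; exact: cvg_fst.
    by rewrite openC; apply: compact_closed => //; exact: norm_hausdorff.
  have d0 (g : M -> R) : (forall z : M, ~ A z.1 -> g z = 0) -> 'D_(axis j) g (x, t) = 0.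
    move=> g0; have := @rders_eq _ _ [set z : M | ~ A z.1] g (fun=> 0) [:: axis j] oK g0 (x, t) nA.
    by rewrite /= => ->; exact: (@derive_cst _ _ _ (0 : R)).
  by rewrite /cderive !d0 => [|[y s] /= nAy|[y s] /= nAy]; rewrite ?Af.
apply: (@cintegral_axis0 _ _ j (fun x => wave xi m (x, t) * f (x, t)) _ L N L0) => //.
- move=> x.
  have dw : cder (fun s => wave xi m (x + s *: delta_mx ord0 j, t)) (fun s => (0 +i* - xi ord0 j) * wave xi m (x + s *: delta_mx ord0 j, t)).
    have E : (fun s => wave xi m (x + s *: delta_mx ord0 j, t)) = (fun s => wave xi m (x, t) * expi (- xi ord0 j * s)).
      apply/funext => s; rewrite /wave /= -expiD; congr expi.
      rewrite (_ : dotp (x + s *: delta_mx ord0 j) xi = dotp x xi + s * xi ord0 j); first by ring.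
      rewrite /dotp (bigD1 j)//= [in RHS](bigD1 j)//= !mxE !eqxx mulr1 mulrDl addrAC; congr (_ + _).
      by congr (_ + _); apply: eq_bigr => i ij; rewrite !mxE (negbTE ij) andbF mulr0 addr0.
    have dc : cder (fun=> wave xi m (x, t)) (fun=> 0) by move=> s; split; exact: is_derive_cst.
    have := cderM dc (cder_expi (- xi ord0 j)); rewrite -E.
    rewrite (_ : (fun s => _ + _) = (fun s => (0 +i* - xi ord0 j) * wave xi m (x + s *: delta_mx ord0 j, t)))//.
    by apply/funext => s; rewrite (congr1 (fun F => F s) E) /= mul0r add0r mulrCA.
  have df : cder (fun s => f (x + s *: delta_mx ord0 j, t)) (fun s => cderive (axis j) f (x + s *: delta_mx ord0 j, t)).
    move=> s; have [f1 f2] := sf.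
    have D (g : M -> R) : rsmooth setT g -> is_derive s (1 : R) (fun s : R => g (x + s *: delta_mx ord0 j, t)) ('D_(axis j) g (x + s *: delta_mx ord0 j, t)).
      move=> sg; have [dE dd] := line_derive g (x, t) (axis j) s.
      have E u : ((x, t) : M) + u *: axis j = (x + u *: delta_mx ord0 j, t) by congr (_, _); rewrite /= scaler0 addr0.
      have Eg : (fun u : R => g ((x, t) + u *: axis j)) = (fun u => g (x + u *: delta_mx ord0 j, t)) by apply/funext => u; rewrite E.
      by rewrite Eg E in dE dd; rewrite -dE; apply: DeriveDef => //; apply: dd; have [_ dg] := sg [::] (x + s *: delta_mx ord0 j, t) Logic.I; exact: dg.
    by split; exact: D.
  have := cderM dw df; rewrite (_ : (fun s => _ + _) = (fun s => - (0 +i* xi ord0 j) * (wave xi m (x + s *: delta_mx ord0 j, t) * f (x + s *: delta_mx ord0 j, t)) + wave xi m (x + s *: delta_mx ord0 j, t) * cderive (axis j) f (x + s *: delta_mx ord0 j, t)))//.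
  apply/funext => s; rewrite mulrA; congr (_ * _ * _ + _).
  by apply/complex_eqP; split=> //=; rewrite oppr0.
- move=> x i Lx; have nA := HL x i Lx.
  by rewrite (Af x t nA) (der0 x nA) !mulr0 addr0.
Qed.

(** Functions of the dual variable whose product with the Fourier transform of
    any test function is bounded; derivatives turn into multiplications. *)
Definition multiplier (w : 'rV[R]_n -> int -> R) := forall f, test_function f ->
  exists2 K : R, 0 <= K & forall xi m, `|w xi m| * normc (fourier f xi m) <= K.

Lemma multiplier1 : multiplier (fun _ _ => 1).
Proof.
move=> f tf; have [K K0 tK] := test_tame tf.
exists (`|((2 * pi)^-1) ^+ n.+1| * (2 * (K * wt_mass (R := R) (n := n)))).
  by rewrite !mulr_ge0 ?wt_mass_ge0.
by move=> xi m; rewrite normr1 mul1r; exact: fourier_le.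
Qed.

Lemma multiplier_axis w j : multiplier w -> multiplier (fun xi m => xi ord0 j * w xi m).
Proof.
move=> mw f tf; have [K K0 HK] := mw _ (test_cderive (axis j) tf); exists K => // xi m.
have := HK xi m; rewrite fourier_axis// normcM mulrA normrM [`|xi ord0 j| * _]mulrC.
rewrite (_ : normc (0 +i* xi ord0 j) = `|xi ord0 j|)//.
by rewrite /= expr0n add0r sqrtr_sqr.
Qed.

Lemma multiplier_circle w : multiplier w -> multiplier (fun xi m => m%:~R * w xi m).
Proof.
move=> mw f tf; have [K K0 HK] := mw _ (test_cderive circle_axis tf); exists K => // xi m.
have := HK xi m; rewrite fourier_circle// normcM mulrA normrM [`|m%:~R| * _]mulrC.
rewrite (_ : normc (0 +i* m%:~R) = `|m%:~R|)//.
by rewrite /= expr0n add0r sqrtr_sqr.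
Qed.

Lemma multiplierD w w' : multiplier w -> multiplier w' -> multiplier (fun xi m => w xi m + w' xi m).
Proof.
move=> mw mw' f tf; have [K K0 HK] := mw f tf; have [K' K'0 HK'] := mw' f tf.
exists (K + K'); first exact: addr_ge0.
move=> xi m; apply: (@le_trans _ _ (`|w xi m| * normc (fourier f xi m) + `|w' xi m| * normc (fourier f xi m))).
  by rewrite -mulrDl; apply: ler_wpM2r; [exact: normc_ge0|exact: ler_normD].
exact: lerD.
Qed.

Definition japanese_sqr xi m : R := 1 + m%:~R ^+ 2 + \sum_(i < n) xi ord0 i ^+ 2.

Lemma multiplier_prod (s : seq 'I_n) w : multiplier w ->
  multiplier (fun xi m => (\prod_(i <- s) (1 + xi ord0 i ^+ 2)) * w xi m).
Proof.
move=> mw; elim: s => [|i s IH].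
  by rewrite (_ : (fun xi m => _) = w)//; apply/funext => xi; apply/funext => m; rewrite big_nil mul1r.
rewrite (_ : (fun xi m => _) = (fun xi m => \prod_(j <- s) (1 + xi ord0 j ^+ 2) * w xi m + xi ord0 i * (xi ord0 i * (\prod_(j <- s) (1 + xi ord0 j ^+ 2) * w xi m)))).
  by apply: multiplierD => //; do 2 apply: multiplier_axis.
by apply/funext => xi; apply/funext => m; rewrite big_cons; ring.
Qed.

Lemma multiplier_japanese w N : multiplier w -> multiplier (fun xi m => japanese_sqr xi m ^+ N * w xi m).
Proof.
move=> mw; elim: N => [|N IH].
  by rewrite (_ : (fun xi m => _) = w)//; apply/funext => xi; apply/funext => m; rewrite expr0 mul1r.
pose h xi m := japanese_sqr xi m ^+ N * w xi m.
have sumh (s : seq 'I_n) : multiplier (fun xi m => (\sum_(i <- s) xi ord0 i ^+ 2) * h xi m + (h xi m + m%:~R * (m%:~R * h xi m))).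
  elim: s => [|i s IHs].
    rewrite (_ : (fun xi m => _) = (fun xi m => h xi m + m%:~R * (m%:~R * h xi m))).
      by apply: multiplierD => //; do 2 apply: multiplier_circle.
    by apply/funext => xi; apply/funext => m; rewrite big_nil mul0r add0r.
  rewrite (_ : (fun xi m => _) = (fun xi m => xi ord0 i * (xi ord0 i * h xi m) + ((\sum_(j <- s) xi ord0 j ^+ 2) * h xi m + (h xi m + m%:~R * (m%:~R * h xi m))))).
    by apply: multiplierD => //; do 2 apply: multiplier_axis.
  by apply/funext => xi; apply/funext => m; rewrite big_cons; ring.
rewrite (_ : (fun xi m => _) = (fun xi m => (\sum_(i < n) xi ord0 i ^+ 2) * h xi m + (h xi m + m%:~R * (m%:~R * h xi m)))); first exact: sumh.
by apply/funext => xi; apply/funext => m; rewrite /h exprS /japanese_sqr; ring.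
Qed.

Lemma dual_norm_le xi m : (1 + `|(xi, m%:~R : R)|) ^+ 2 <= 4 * japanese_sqr xi m.
Proof.
have S0 : 0 <= \sum_(i < n) xi ord0 i ^+ 2 by apply: sumr_ge0 => i _; exact: sqr_ge0.
have m0 := sqr_ge0 (m%:~R : R).
have H : `|(xi, m%:~R : R)| ^+ 2 <= m%:~R ^+ 2 + \sum_(i < n) xi ord0 i ^+ 2.
  rewrite prod_normE /=; case: (leP `|xi| `|m%:~R|) => _.
    by rewrite real_normK ?num_real// lerDl.
  have : `|xi| <= Num.sqrt (\sum_(i < n) xi ord0 i ^+ 2).
    rewrite -[`|xi|]/(mx_norm _) mx_normrE; apply/bigmax_leP; split; first exact: sqrtr_ge0.
    move=> [a i] _ /=; rewrite ord1 -sqrtr_sqr; apply: ler_wsqrtr.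
    by rewrite (bigD1 i)//= lerDl sumr_ge0// => l _; exact: sqr_ge0.
  move=> hx; apply: (@le_trans _ _ (\sum_(i < n) xi ord0 i ^+ 2)); last by rewrite lerDr.
  by rewrite -[leRHS](sqr_sqrtr S0) ler_pXn2r ?nnegrE ?sqrtr_ge0.
have := sqr_ge0 (1 - `|(xi, m%:~R : R)|); rewrite /japanese_sqr sqrrB sqrrD !expr1n !mul1r => *; lra.
Qed.

(** Rapid decay, in the form used to dominate the integrand of [Op]. *)
Lemma fourier_decay (d : R) f : test_function f -> exists2 K : R, 0 <= K &
  forall xi m, (1 + `|(xi, m%:~R : R)|) `^ d * normc (fourier f xi m) <= K * wt xi * inv_sqr m.
Proof.
move=> tf; pose N := Num.bound `|d|.
have mw : multiplier (fun xi m => japanese_sqr xi m ^+ N.+1 * (\prod_(i < n) (1 + xi ord0 i ^+ 2) * 1)).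
  by apply: multiplier_japanese; apply: multiplier_prod; exact: multiplier1.
have [K K0 HK] := mw f tf; exists (4 ^+ N * K); first by rewrite mulr_ge0// exprn_ge0.
move=> xi m; have J1 : 1 <= japanese_sqr xi m.
  by rewrite /japanese_sqr -addrA lerDl addr_ge0 ?sqr_ge0// sumr_ge0// => i _; exact: sqr_ge0.
have J0 : 0 <= japanese_sqr xi m := le_trans ler01 J1.
set P := \prod_(i < n) (1 + xi ord0 i ^+ 2) in HK *.
have P0 : 0 < \prod_(i < n) (1 + xi ord0 i ^+ 2) :> R by apply: prodr_gt0 => i _; rewrite ltr_pwDl// sqr_ge0.
have wE : wt xi = (\prod_(i < n) (1 + xi ord0 i ^+ 2))^-1 by rewrite /wt prodfV.
have m1 : 0 < 1 + m%:~R ^+ 2 :> R by rewrite ltr_pwDl// sqr_ge0.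
have r1 : 1 <= 1 + `|(xi, m%:~R : R)| by rewrite lerDl.
rewrite wE /inv_sqr ler_pdivlMr// ler_pdivlMr// -mulrA -mulrA.
have := HK xi m; rewrite mulr1 normrM (ger0_norm (exprn_ge0 _ J0)) (gtr0_norm P0) exprSr => HK'.
apply: (@le_trans _ _ ((4 ^+ N * japanese_sqr xi m ^+ N) * (normc (fourier f xi m) * (japanese_sqr xi m * \prod_(i < n) (1 + xi ord0 i ^+ 2))))).
  apply: ler_pM; rewrite ?powR_ge0 ?mulr_ge0 ?normc_ge0 ?(ltW P0) ?(ltW m1)//.
    apply: (@le_trans _ _ ((1 + `|(xi, m%:~R : R)|) `^ (N.*2)%:R)).
      apply: ler_powR => //; apply: (@le_trans _ _ (N%:R)); last by rewrite ler_nat -addnn leq_addr.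
      by apply: le_trans (ler_norm d) _; apply: ltW; apply: archi_boundP; exact: normr_ge0.
    rewrite powR_mulrn ?(le_trans ler01 r1)// -mul2n exprM -exprMn.
    by rewrite ler_pXn2r ?nnegrE ?sqr_ge0 ?mulr_ge0//; exact: dual_norm_le.
  apply: ler_wpM2l; first exact: normc_ge0.
  apply: ler_wpM2r; first exact: ltW.
  by rewrite /japanese_sqr lerDl sumr_ge0// => i _; exact: sqr_ge0.
rewrite -mulrA; apply: ler_wpM2l; first exact: exprn_ge0.
by apply: le_trans HK'; rewrite le_eqVlt; apply/orP; left; apply/eqP; ring.
Qed.

Lemma ccts_fourier f K m : tame f K -> ccts (fun xi => fourier f xi m).
Proof.
move=> tf xi; rewrite /fourier; apply: ccts_mul; first exact: ccts_cst.
have := @ccts_cintegral _ 'rV[R]_n _ _ (lebesgue_rV n \x leb)%E dom (fun xi z => wave xi m z * f z) _ xi (@measurable_dom R n) (fun eta => tame_dom (tame_wave eta m tf)).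
apply=> z _.
rewrite (_ : (fun eta => wave eta m z * f z) = fun eta => expi (- dotp eta z.1) * (expi (- (m%:~R * z.2)) * f z)); last first.
  by apply/funext => eta; rewrite waveE dotpC mulrA.
by apply: ccts_mul; [exact: ccts_planeN|exact: ccts_cst].
Qed.

End FourierDecay.

(** * Density of products of one-variable transforms *)

Section LineTransform.
Context {R : realType}.
Local Notation C := R[i].
Local Notation normc := (@ComplexField.Normc.normc R).
Local Notation leb := (@lebesgue_measure R).
Implicit Types (phi F G : R -> C).

Lemma mul_realV (a : R) : a != 0 -> a%:C * (a^-1)%:C = 1 :> C.
Proof. by move=> a0; apply/complex_eqP; split=> /=; rewrite ?mulfV// !mul0r ?mulr0 ?subr0 ?addr0. Qed.

Definition jap (t : R) : R := 1 + t ^+ 2.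

Lemma jap_gt0 t : 0 < jap t. Proof. by rewrite /jap ltr_pwDl// sqr_ge0. Qed.

Lemma jap_ge1 t : 1 <= jap t. Proof. by rewrite /jap lerDl sqr_ge0. Qed.

Lemma jap_cancel (A Q B z : R) N : A * (Q * jap z) ^+ N * (B * (jap z ^+ N.+1)^-1) = A * Q ^+ N * B * (jap z)^-1.
Proof.
have j0 : jap z != 0 by rewrite gt_eqF// jap_gt0.
have jN : jap z ^+ N != 0 by rewrite expf_neq0.
by rewrite exprMn [jap z ^+ N.+1]exprS invfM; field; rewrite j0 jN.
Qed.

Lemma cts_jap : continuous jap. Proof. exact: continuous_oneDsqr. Qed.

Lemma jap_shift (x y : R) : jap (x + y) <= 2 * jap x * jap y.
Proof.
rewrite /jap; have := sqr_ge0 (x - y); have := sqr_ge0 (x * y); rewrite sqrrB sqrrD exprMn => *.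
by rewrite (_ : 2 * (1 + x ^+ 2) * (1 + y ^+ 2) = 2 + 2 * x ^+ 2 + 2 * y ^+ 2 + 2 * (x ^+ 2 * y ^+ 2)); [lra|ring].
Qed.

Lemma integrable_japV (K : R) : leb.-integrable setT (EFin \o (fun t => K * (jap t)^-1)).
Proof. by have := integrableZl measurableT K (@integrable_oneDsqrV R); apply: eq_integrable. Qed.

Lemma cdom_line F (K : R) : ccts F -> (forall t, normc (F t) <= K * (jap t)^-1) -> cdom leb setT F (fun t => K * (jap t)^-1).
Proof. by move=> cF H; split; [exact: (ccts_cmeas cF measurableT)|exact: integrable_japV|move=> t _; exact: H]. Qed.

Lemma Rintegral_affine (g : R -> R) (a b K : R) : 0 < a -> continuous g ->
  (forall t, `|g t| <= K * (jap t)^-1) ->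
  \int[leb]_t g t = a * \int[leb]_t g (a * t + b).
Proof.
move=> a0 cg H.
have da (t : R) : is_derive t (1 : R) (fun t : R => a * t + b) a.
  apply: (is_derive_eq (is_deriveD (is_deriveZ a (is_derive_id t (1 : R))) (is_derive_cst b t (1 : R)))).
  by rewrite /GRing.scale /= mulr1 addr0.
have dE : derive1 (fun t : R => a * t + b) = fun=> a by apply/funext => t; rewrite derive1E; case: (da t).
have ca : continuous (fun t : R => a * t + b).
  by move=> t; apply/differentiable_continuous/derivable1_diffP; apply: ex_derive.
have ig (h : R -> R) : continuous h -> (forall t, `|h t| <= 2 * K * (jap t)^-1) -> leb.-integrable setT (EFin \o h).
  move=> ch Hh; apply: le_integrable (integrable_japV (2 * K)) => //.
    by apply/measurable_EFinP; exact: continuous_measurable_fun.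
  by move=> t _; rewrite /= lee_fin; apply: le_trans (Hh t) (ler_norm _).
have K0 : 0 <= K by have := le_trans (normr_ge0 _) (H 0); rewrite pmulr_lge0// invr_gt0 jap_gt0.
have w0 t : 0 <= K * (jap t)^-1 by rewrite mulr_ge0// invr_ge0 ltW// jap_gt0.
have cw : continuous (fun t => K * (jap t)^-1).
  by move=> t; apply: cvgM; [exact: cvg_cst|exact: continuous_oneDsqrV].
have nonneg (h : R -> R) : continuous h -> (forall t, 0 <= h t) -> leb.-integrable setT (EFin \o h) ->
    leb.-integrable setT (EFin \o (fun t => h (a * t + b))) /\ \int[leb]_t h t = a * \int[leb]_t h (a * t + b).
  move=> ch h0 ih.
  have E : (\int[leb]_t (h t)%:E = \int[leb]_t (h (a * t + b) * a)%:E)%E.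
    have := @increasing_ge0_integration_by_substitutionT R (fun t : R => a * t + b) h.
    rewrite dE; apply.
    - by move=> x y xy; rewrite ltrD2r ltr_pM2l.
    - by move=> t; exact: cst_continuous.
    - exact: is_cvg_cst.
    - exact: is_cvg_cst.
    - by move=> t; apply: ex_derive.
    - apply/cvgrNyPle => A; near=> x; rewrite -lerBrDr -ler_pdivlMl//; near: x; exact: nbhs_ninfty_le.
    - apply/cvgryPge => A; near=> x; rewrite -lerBlDr -ler_pdivrMl//; near: x; exact: nbhs_pinfty_ge.
    - exact: ch.
    - exact: h0.
  have iha : leb.-integrable setT (EFin \o (fun t => h (a * t + b) * a)).
    apply/integrableP; split.
      apply/measurable_EFinP; apply: continuous_measurable_fun => t; apply: cvgM; last exact: cvg_cst.
      by apply: (@continuous_comp _ _ _ (fun t : R => a * t + b) h); [exact: ca|exact: ch].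
    rewrite [X in (X < _)%E](_ : _ = (\int[leb]_t (h (a * t + b) * a)%:E)%E); last first.
      by apply: eq_integral => t _; rewrite /= ger0_norm// mulr_ge0// ltW.
    rewrite -E; have /integrableP[_] := ih; congr (_ < _)%E; apply: eq_integral => t _; by rewrite /= ger0_norm.
  have ih2 : leb.-integrable setT (EFin \o (fun t => h (a * t + b))).
    have := integrableZl measurableT a^-1 iha; apply: eq_integrable => // t _.
    by rewrite /= -EFinM mulrCA mulVf ?mulr1// gt_eqF.
  split=> //; rewrite -RintegralZl//; rewrite /Rintegral E; congr fine; apply: eq_integral => t _; by rewrite mulrC.
have cgw : continuous (fun t => g t + K * (jap t)^-1) by move=> t; apply: cvgD; [exact: cg|exact: cw].
have g0 t : 0 <= g t + K * (jap t)^-1 by have := H t; rewrite ler_norml => /andP[]; lra.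
have i1 := ig _ cgw (fun t => ltac:(apply: le_trans (ler_normD _ _) _; rewrite (ger0_norm (w0 t)); have := H t; lra)).
have i2 := ig _ cw (fun t => ltac:(rewrite (ger0_norm (w0 t)); have := w0 t; lra)).
have [j1 E1] := nonneg _ cgw g0 i1; have [j2 E2] := nonneg _ cw w0 i2.
transitivity (\int[leb]_t ((g t + K * (jap t)^-1) - K * (jap t)^-1)).
  by apply: eq_Rintegral => t _; rewrite addrK.
rewrite RintegralB// E1 E2 -mulrBr -RintegralB//; congr (_ * _); apply: eq_Rintegral => t _; by rewrite addrK.
Unshelve. all: by end_near. Qed.

Lemma cintegral_affine F (a b K : R) : 0 < a -> ccts F -> (forall t, normc (F t) <= K * (jap t)^-1) ->
  cintegral leb setT F = a%:C * cintegral leb setT (fun t => F (a * t + b)).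
Proof.
move=> a0 cF H; apply/complex_eqP; rewrite ReZ ImZ /cintegral /=; split.
  apply: (@Rintegral_affine (fun t => complex.Re (F t)) a b K a0) => [t|t]; first by case: (cF t).
  exact: le_trans (Re_le_normc _) (H t).
apply: (@Rintegral_affine (fun t => complex.Im (F t)) a b K a0) => [t|t]; first by case: (cF t).
exact: le_trans (Im_le_normc _) (H t).
Qed.

Definition cc phi := csmooth phi /\ exists2 L : R, 0 <= L & forall t, L < `|t| -> phi t = 0.

Definition ftr phi (t : R) : C := cintegral leb setT (fun x => expi (- t * x) * phi x).

Lemma cc_bound phi : cc phi -> exists2 K : R, 0 <= K & forall t, normc (phi t) <= K * (jap t)^-1.
Proof.
move=> [sphi [L L0 HL]]; have cphi := csmooth_ccts sphi.
have cI : compact `[- L, L]%classic by exact: segment_compact.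
have [a Ha] := cts_compact_bounded cI (fun t => (cphi t).1).
have [b Hb] := cts_compact_bounded cI (fun t => (cphi t).2).
exists ((`|a| + `|b|) * (1 + L ^+ 2)); first by rewrite mulr_ge0// addr_ge0// sqr_ge0.
move=> t; have [lt|tl] := ltP L `|t|.
  by rewrite HL// normc0 !mulr_ge0 ?addr_ge0 ?sqr_ge0// invr_ge0 ltW// jap_gt0.
have tI : `[- L, L]%classic t by rewrite /= in_itv/= -ler_norml.
rewrite ler_pdivlMr ?jap_gt0//; apply: ler_pM; rewrite ?normc_ge0 ?(ltW (jap_gt0 _))//.
  apply: le_trans (normc_le_ReIm _) _; apply: lerD.
    exact: le_trans (Ha t tI) (ler_norm _).
  exact: le_trans (Hb t tI) (ler_norm _).
by rewrite /jap lerD2l -(real_normK (num_real t)) ler_pXn2r// nnegrE.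
Qed.

Lemma ccts_wave1 (t : R) : ccts (fun x : R => expi (- t * x) : C).
Proof. exact: ccts_expi_lin. Qed.

Lemma cdom_ftr phi (K : R) t : ccts phi -> (forall t, normc (phi t) <= K * (jap t)^-1) ->
  cdom leb setT (fun x => expi (- t * x) * phi x) (fun x => K * (jap x)^-1).
Proof.
move=> cp H; apply: cdom_line => [x|x]; first by apply: ccts_mul; [exact: ccts_wave1|exact: cp].
by rewrite normcM normc_expi mul1r.
Qed.

Lemma cc_cder phi : cc phi -> exists2 phi', cc phi' & cder phi phi'.
Proof.
move=> [[s1 s2] [L L0 HL]].
have D (g : R -> R) : rsmooth setT g -> forall t, is_derive t (1 : R) g ('D_1 g t).
  by move=> sg t; apply: DeriveDef => //; have [_ dg] := sg [::] t Logic.I; exact: dg.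
exists (cderive (1 : R) phi); last by move=> t; split; exact: D.
split; first by apply: csmooth_cderive.
exists L => // t Lt.
have oU : @open R [set t | L < `|t|].
  apply: (@open_comp _ _ (fun t : R => `|t|) [set s | L < s]); last exact: open_gt.
  by move=> s _; exact: norm_continuous.
have d0 (g : R -> R) : (forall t, L < `|t| -> g t = 0) -> 'D_1 g t = 0.
  move=> g0; have := @rders_eq _ _ [set t : R | L < `|t|] g (fun=> 0) [:: 1] oU g0 t Lt.
  by rewrite /= => ->; exact: (@derive_cst _ _ _ (0 : R)).
by rewrite /cderive !d0 => [|s Ls|s Ls]; rewrite ?HL.
Qed.

Lemma ftr_der phi phi' t : cc phi -> cc phi' -> cder phi phi' -> ftr phi' t = (0 +i* t) * ftr phi t.
Proof.
move=> cp cp' d; have [K K0 HK] := cc_bound cp; have [K' K'0 HK'] := cc_bound cp'.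
have c1 := csmooth_ccts cp.1; have c2 := csmooth_ccts cp'.1.
have [_ [L L0 HL]] := cp; have [_ [L' L'0 HL']] := cp'.
have dd := cderM (cder_expi (- t)) d.
have E : (fun x => (0 +i* - t) * expi (- t * x) * phi x + expi (- t * x) * phi' x) =
    (fun x => (0 +i* - t) * (expi (- t * x) * phi x) + expi (- t * x) * phi' x).
  by apply/funext => x; rewrite mulrA.
rewrite E in dd.
have cd : ccts (fun x => (0 +i* - t) * (expi (- t * x) * phi x) + expi (- t * x) * phi' x).
  by move=> x; apply: ccts_lin; apply: ccts_mul; by [exact: ccts_wave1|exact: c1|exact: c2].
have := cintegral_line0 dd cd (addr_ge0 L0 L'0) _.
rewrite (cintegral_lin measurableT (0 +i* - t) (cdom_ftr t c1 HK) (cdom_ftr t c2 HK')) -/(ftr phi t) -/(ftr phi' t).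
move=> H; apply/eqP; rewrite -subr_eq0 -[X in _ - X]mul1r -mulNr addrC.
rewrite (_ : - 1 * _ + _ = (0 +i* - t) * ftr phi t + ftr phi' t); last first.
  congr (_ + _); rewrite mulN1r -mulNr; congr (_ * _); by apply/complex_eqP; split=> //=; rewrite oppr0.
apply/eqP; apply: H => x Lx.
have h1 : L < `|x| by apply: le_lt_trans Lx; rewrite lerDl.
have h2 : L' < `|x| by apply: le_lt_trans Lx; rewrite lerDr.
by rewrite HL// HL'// !mulr0 addr0.
Qed.

Lemma ftr_decay N phi : cc phi -> exists2 K : R, 0 <= K & forall t, normc (ftr phi t) <= K * ((jap t) ^+ N)^-1.
Proof.
elim: N phi => [|N IH] phi cp.
  have [K K0 HK] := cc_bound cp.
  exists (2 * \int[leb]_t (K * (jap t)^-1)).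
    by rewrite mulr_ge0//; apply: Rintegral_ge0 => t _; rewrite mulr_ge0// invr_ge0 ltW// jap_gt0.
  by move=> t; rewrite expr0 invr1 mulr1; exact: (cintegral_le measurableT (cdom_ftr t (csmooth_ccts cp.1) HK)).
have [p1 c1 d1] := cc_cder cp; have [p2 c2 d2] := cc_cder c1.
have [K K0 HK] := IH _ cp; have [K' K'0 HK'] := IH _ c2.
exists (K + K'); first exact: addr_ge0.
move=> t; rewrite exprS invfM mulrA ler_pdivlMr ?exprn_gt0 ?jap_gt0// ler_pdivlMr ?jap_gt0// -mulrA mulrC.
have E : (jap t)%:C * ftr phi t = ftr phi t - ftr p2 t.
  rewrite (ftr_der t c1 c2 d2) (ftr_der t cp c1 d1) /jap.
  by case: (ftr phi t) => x y; apply/complex_eqP; split=> /=; ring.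
have J0 : 0 < jap t ^+ N by rewrite exprn_gt0// jap_gt0.
rewrite -mulrA -[X in _ * (X * _)](gtr0_norm (jap_gt0 t)) -normc_real -normcM E mulrC.
apply: (@le_trans _ _ ((normc (ftr phi t) + normc (ftr p2 t)) * jap t ^+ N)).
  rewrite ler_wpM2r ?(ltW J0)//; apply: le_trans (normcD _ _) _; by rewrite normcN.
by rewrite mulrDl; apply: lerD; rewrite -ler_pdivlMr.
Qed.

Lemma ccts_ftr phi : cc phi -> ccts (ftr phi).
Proof.
move=> cp t; have [K K0 HK] := cc_bound cp; have c1 := csmooth_ccts cp.1.
apply: (@ccts_cintegral _ R _ _ leb setT (fun t x => expi (- t * x) * phi x) _ t measurableT (fun s => cdom_ftr s c1 HK)).
move=> x _; apply: ccts_mul; last exact: ccts_cst.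
have := @ccts_expi_lin R (- x) t; rewrite (_ : (fun x0 => expi (- x * x0)) = (fun s => expi (- s * x)))//.
by apply/funext => s; rewrite !mulNr mulrC.
Qed.

Lemma cc_affine phi (a b c : R) : 0 < a -> cc phi -> cc (fun x => expi (c * x) * phi (a * x + b)).
Proof.
move=> a0 [sp [L L0 HL]]; split.
  apply: csmoothM.
    split=> /=.
      by have := rsmooth_trig c 1 0; under eq_fun do rewrite mul1r mul0r addr0.
    by have := rsmooth_trig c 0 1; under eq_fun do rewrite mul0r mul1r add0r.
  apply: (@csmooth_comp R R R (fun x : R => a * x + b) (fun v : R => a * v) phi _ _ sp).
    by move=> v x h; rewrite /GRing.scale /=; ring.
  move=> x; apply: cvgD; last exact: cvg_cst.
  by apply: cvgM; [exact: cvg_cst|exact: cvg_id].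
exists ((L + `|b|) / a); first by rewrite divr_ge0 ?addr_ge0// ltW.
move=> x; rewrite ltr_pdivrMr// => Lx; rewrite HL ?mulr0//.
have := ler_normB (a * x + b) b; rewrite addrK normrM (gtr0_norm a0) mulrC; lra.
Qed.

(** Substitution turns an affine change of variable into a modulation and a
    dilation of the transform. *)
Lemma ftr_affine phi (a b c t : R) : 0 < a -> cc phi ->
  ftr (fun x => expi (c * x) * phi (a * x + b)) t = (a^-1)%:C * expi (b * ((t - c) / a)) * ftr phi ((t - c) / a).
Proof.
move=> a0 cp; have [K K0 HK] := cc_bound cp; have c1 := csmooth_ccts cp.1.
set s := (t - c) / a.
have cF : ccts (fun x => expi (- s * x) * phi x) by move=> x; apply: ccts_mul; [exact: ccts_wave1|exact: c1].
have HF x : normc (expi (- s * x) * phi x) <= K * (jap x)^-1 by rewrite normcM normc_expi mul1r.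
have ca := cc_affine b c a0 cp; have [K' K'0 HK'] := cc_bound ca; have c2 := csmooth_ccts ca.1.
have an : a != 0 by rewrite gt_eqF.
rewrite [in RHS]/ftr (cintegral_affine b a0 cF HF).
have -> : cintegral leb setT (fun x => expi (- s * (a * x + b)) * phi (a * x + b)) =
    expi (- (b * s)) * ftr (fun x => expi (c * x) * phi (a * x + b)) t.
  rewrite /ftr -(cintegralM measurableT _ (cdom_ftr t c2 HK')); apply: cintegral_ext => x _.
  rewrite !mulrA -!expiD; congr (expi _ * _); rewrite /s; field.
  exact: an.
set X := ftr _ t; rewrite -!mulrA [a%:C * _]mulrCA [expi (b * s) * (_ * _)]mulrA -expiD subrr expi0 mul1r mulrA.
by rewrite [_ * a%:C]mulrC mul_realV ?mul1r.
Qed.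

Definition annihilated G := forall phi, cc phi -> cintegral leb setT (fun t => G t * ftr phi t) = 0.

Section Annihilated.
Variables (G : R -> C) (A : R) (N : nat).
Hypotheses (cG : ccts G) (HG : forall t, normc (G t) <= A * jap t ^+ N) (aG : annihilated G).

Let A0 : 0 <= A.
Proof. by have := le_trans (normc_ge0 _) (HG 0); rewrite pmulr_lge0// exprn_gt0// jap_gt0. Qed.

Lemma annihilated_bound phi : cc phi -> exists2 K : R, 0 <= K & forall t, normc (G t * ftr phi t) <= K * (jap t)^-1.
Proof.
move=> cp; have [K K0 HK] := ftr_decay N.+1 cp; exists (A * K); first exact: mulr_ge0.
move=> t; rewrite normcM; have J0 := exprn_gt0 N (jap_gt0 t).
apply: (@le_trans _ _ ((A * jap t ^+ N) * (K * (jap t ^+ N.+1)^-1))).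
  by apply: ler_pM; rewrite ?normc_ge0.
by rewrite exprS invfM le_eqVlt; apply/orP; left; apply/eqP; field; rewrite ?gt_eqF// jap_gt0.
Qed.

(** Integrating the translates of [phi] against [chi] inserts the factor
    [ftr chi (- t)]. *)
Lemma annihilated_mul phi chi : cc phi -> cc chi ->
  cintegral leb setT (fun t => G t * ftr phi t * ftr chi (- t)) = 0.
Proof.
move=> cp cx; have [K K0 HK] := annihilated_bound cp; have [K' K'0 HK'] := cc_bound cx.
have c1 := ccts_ftr cp; have c2 := csmooth_ccts cx.1.
pose f (z : measurableTypeR R * measurableTypeR R) : C := G z.1 * ftr phi z.1 * (expi (z.1 * z.2) * chi z.2).
have cm (F : R -> C) : ccts F -> cmeas (T := measurableTypeR R) setT F by move=> cF; exact: (ccts_cmeas cF measurableT).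
have fst_m (F : R -> C) : ccts F -> cmeas (T := (measurableTypeR R * measurableTypeR R)%type) setT (fun z => F z.1).
  move=> /cm[m1 m2]; split; [exact: (measurableT_comp m1 measurable_fst)|exact: (measurableT_comp m2 measurable_fst)].
have snd_m (F : R -> C) : ccts F -> cmeas (T := (measurableTypeR R * measurableTypeR R)%type) setT (fun z => F z.2).
  move=> /cm[m1 m2]; split; [exact: (measurableT_comp m1 measurable_snd)|exact: (measurableT_comp m2 measurable_snd)].
have mf : cmeas setT f.
  apply: cmeasM; first by apply: cmeasM; exact: fst_m.
  apply: cmeasM; last exact: snd_m.
  have mp : measurable_fun setT (fun z : measurableTypeR R * measurableTypeR R => z.1 * z.2 : measurableTypeR R).
    by apply: measurable_funM; [exact: measurable_fst|exact: measurable_snd].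
  split; [apply: (measurableT_comp (f := @cos R) _ mp)|apply: (measurableT_comp (f := @sin R) _ mp)]; apply: continuous_measurable_fun.
    exact: continuous_cos.
  exact: continuous_sin.
have u0 (t : R) : 0 <= K * (jap t)^-1 by rewrite mulr_ge0// invr_ge0 ltW// jap_gt0.
have v0 (t : R) : 0 <= K' * (jap t)^-1 by rewrite mulr_ge0// invr_ge0 ltW// jap_gt0.
have H x y : setT y -> normc (f (x, y)) <= K * (jap x)^-1 * (K' * (jap y)^-1).
  by move=> _; rewrite /f normcM; apply: ler_pM; rewrite ?normc_ge0//= normcM normc_expi mul1r.
have := cFubini_swap measurableT mf u0 v0 (integrable_japV K) (integrable_japV K') H.
rewrite (_ : (fun y => cintegral leb setT (fun x => f (x, y))) = fun=> 0); last first.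
  apply/funext => y; rewrite /f /=.
  have c0 := cc_affine y 0 ltr01 cp; have [K2 K20 HK2] := annihilated_bound c0.
  have c3 := ccts_ftr c0.
  have d3 : cdom leb setT (fun t => G t * ftr (fun x => expi (0 * x) * phi (1 * x + y)) t) (fun t => K2 * (jap t)^-1).
    by apply: cdom_line => // t; apply: ccts_mul; [exact: cG|exact: c3].
  rewrite -(mulr0 (chi y)) -(aG c0) -(cintegralM measurableT (chi y) d3); apply: cintegral_ext => t _.
  rewrite (ftr_affine y 0 t ltr01 cp) subr0 divr1 invr1 [y * t]mulrC.
  by rewrite (_ : (1%:C : C) = 1)// mul1r; ring.
rewrite cintegral0// => <-; apply: cintegral_ext => t _; rewrite /f /=.
rewrite -[LHS]/(G t * ftr phi t * cintegral leb setT (fun x => expi (- - t * x) * chi x)).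
rewrite -(cintegralM measurableT _ (cdom_ftr (- t) c2 HK')).
by apply: cintegral_ext => y _; rewrite opprK.
Qed.
End Annihilated.

Lemma Rintegral_gt0 (g : R -> R) : continuous g -> (forall t, 0 <= g t) -> leb.-integrable setT (EFin \o g) ->
  0 < g 0 -> 0 < \int[leb]_t g t.
Proof.
move=> cg g0 ig gp; have g2 : 0 < g 0 / 2 by rewrite divr_gt0.
have /cvgrPdist_le/(_ _ g2) := cg 0 => /nbhs_ballP[e /= e0 He].
have e2 : 0 < e / 2 by rewrite divr_gt0.
have lo t : t \in `[0, e / 2] -> g 0 / 2 <= g t.
  rewrite in_itv /= => /andP[t0 te]; have : `|g 0 - g t| <= g 0 / 2.
    by apply: He; rewrite /ball /= sub0r normrN ger0_norm//; lra.
  by rewrite ler_norml => /andP[]; lra.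
have mI : measurable (`[0, e / 2]%classic : set (measurableTypeR R)) by exact: measurable_itv.
rewrite -lte_fin /Rintegral fineK; last exact: (integrable_fin_num measurableT ig).
have s1 : (0 < \int[leb]_(t in `[0%R, (e / 2)%R]) (g 0 / 2)%R%:E)%E.
  rewrite integral_cst// [X in (_ * X)%E]lebesgue_measure_itv /= lte_fin e2 -EFinB subr0 -EFinM lte_fin.
  exact: mulr_gt0.
have s2 : (\int[leb]_(t in `[0%R, (e / 2)%R]) (g 0 / 2)%R%:E <= \int[leb]_(t in `[0%R, (e / 2)%R]) (g t)%:E)%E.
  apply: ge0_le_integral => //.
  - by move=> t _; rewrite lee_fin ltW.
  - by apply/measurable_EFinP; apply: measurable_funTS; exact: continuous_measurable_fun.
apply: (lt_le_trans s1); apply: (le_trans s2).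
apply: ge0_subset_integral => //; first by apply/measurable_EFinP; exact: continuous_measurable_fun.
by move=> t _; rewrite lee_fin.
Qed.

Lemma csmooth_conj phi : csmooth phi -> csmooth (fun x => conjc (phi x)).
Proof.
move=> [s1 s2]; split.
  by rewrite (_ : (fun x => _) = fun x => complex.Re (phi x))//; apply/funext => x; case: (phi x).
rewrite (_ : (fun x => _) = fun x => (-1) * complex.Im (phi x)); last by apply/funext => x; case: (phi x) => a b /=; rewrite mulN1r.
by apply: rsmoothZ => //; exact: openT.
Qed.

(** Take for [phi] the translates, modulations and dilations of [|b|^2]: the
    hypothesis becomes [int G (s z + eta) W z dz = 0] for [s > 0], where W, the
    squared modulus of the transform of [|b|^2], has positive mass. Letting s
    tend to 0 gives [G eta = 0]. The dilation is written [s = sin a], which is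
    bounded in a, so that one dominating function serves for all of them. *)
Lemma annihilated_eq0 (G : R -> C) (A : R) (N : nat) (b : R -> C) : ccts G ->
  (forall t, normc (G t) <= A * jap t ^+ N) -> cc b -> b 0 != 0 -> annihilated G -> forall t, G t = 0.
Proof.
move=> cG HG cb b0 aG eta.
have A0 : 0 <= A by have := le_trans (normc_ge0 _) (HG 0); rewrite pmulr_lge0// exprn_gt0// jap_gt0.
pose psi x := b x * conjc (b x).
have psiE x : psi x = (normc (b x) ^+ 2)%:C by exact: mul_conjc.
have cpsi : cc psi.
  have [sb [L L0 HL]] := cb; split; first by apply: csmoothM => //; exact: csmooth_conj.
  by exists L => // t Lt; rewrite /psi HL// mul0r.
have [K0 K00 HK0] := cc_bound cpsi; have cps := csmooth_ccts cpsi.1.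
have [K K00' HK] := ftr_decay N.+1 cpsi; have cft := ccts_ftr cpsi.
pose W t := ftr psi t * ftr psi (- t).
have negc : continuous (fun t : R => - t) by move=> t; apply: cvgN; exact: cvg_id.
have cW : ccts W by move=> t; apply: ccts_mul; [exact: cft|exact: (ccts_comp negc cft t)].
have japN t : jap (- t) = jap t by rewrite /jap sqrrN.
have J1 t m : 1 <= jap t ^+ m by rewrite exprn_ege1// jap_ge1.
have ftr_le t : normc (ftr psi t) <= K.
  by apply: le_trans (HK t) _; rewrite -[leRHS]mulr1 ler_wpM2l// invf_le1 ?J1// exprn_gt0// jap_gt0.
have HW t : normc (W t) <= K * K * (jap t ^+ N.+1)^-1.
  rewrite /W normcM mulrAC; apply: ler_pM; rewrite ?normc_ge0//.
(* the product is the squared modulus, since psi is real *)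
have W_re t : complex.Re (W t) = complex.Re (ftr psi t) ^+ 2 + complex.Im (ftr psi t) ^+ 2 /\ complex.Im (W t) = 0.
  have eR : complex.Re (ftr psi (- t)) = complex.Re (ftr psi t).
    rewrite /ftr /cintegral /=; apply: eq_Rintegral => x _.
    by rewrite psiE opprK mulNr /= !mulr0 !subr0 cosN.
  have eI : complex.Im (ftr psi (- t)) = - complex.Im (ftr psi t).
    rewrite -[RHS]mulN1r /ftr /cintegral /= -RintegralZl//; last exact: (cdom_Im measurableT (cdom_ftr t cps HK0)).
    apply: eq_Rintegral => x _.
    by rewrite psiE opprK [- t * x]mulNr /= !mulr0 !add0r sinN; ring.
  rewrite /W; move: eR eI; case: (ftr psi t) (ftr psi (- t)) => [x y] [x' y'] /= -> ->; split; ring.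
have dW : cdom leb setT W (fun t => K * K * (jap t)^-1).
  apply: cdom_line => // t; apply: le_trans (HW t) _; rewrite ler_wpM2l ?mulr_ge0//.
  rewrite lef_pV2 ?posrE ?exprn_gt0 ?jap_gt0// exprS -[leLHS]mulr1 ler_wpM2l ?J1//.
  exact: ltW (jap_gt0 t).
have IW : cintegral leb setT W != 0.
  suff : 0 < \int[leb]_t complex.Re (W t).
    by move=> H; apply/eqP => /complex_eqP[/= E _]; move: H; rewrite E ltxx.
  apply: Rintegral_gt0; first by move=> t; case: (cW t).
  - by move=> t; rewrite (W_re t).1 addr_ge0// sqr_ge0.
  - exact: (cdom_Re measurableT dW).
  rewrite (W_re 0).1; apply: ltr_pwDl; last exact: sqr_ge0.
  rewrite exprn_even_gt0//= gt_eqF// /ftr /cintegral /=.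
  rewrite (_ : \int[leb]_x _ = \int[leb]_x normc (b x) ^+ 2); last first.
    by apply: eq_Rintegral => x _; rewrite psiE oppr0 mul0r /= cos0 sin0 mul1r mul0r subr0.
  have pc : continuous (fun x => normc (b x) ^+ 2).
    by move=> x; have := (cps x).1; rewrite (_ : (fun x => _) = (fun x => normc (b x) ^+ 2))//; apply/funext => y; rewrite psiE.
  apply: Rintegral_gt0 => //; first by move=> x; exact: sqr_ge0.
    have := cdom_Re measurableT (cdom_line cps HK0); apply: eq_integrable => // x _; by rewrite /= psiE.
  by rewrite exprn_even_gt0//=; apply: contra b0 => /eqP/normc_eq0 ->.
pose I0 (a : R) := cintegral leb setT (fun z => G (sin a * z + eta) * W z).
have Isin a : 0 < sin a -> I0 a = 0.
  move=> s0; set s := sin a in s0; rewrite /I0 -/s.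
  have cp1 := cc_affine 0 eta s0 cpsi; have cp2 := cc_affine 0 (- eta) s0 cpsi.
  have := annihilated_mul cG HG aG cp1 cp2.
  have cF : ccts (fun t => G t * ftr (fun x => expi (eta * x) * psi (s * x + 0)) t * ftr (fun x => expi (- eta * x) * psi (s * x + 0)) (- t)).
    move=> t; apply: ccts_mul; last exact: (ccts_comp negc (ccts_ftr cp2) t).
    by apply: ccts_mul; [exact: cG|exact: ccts_ftr].
  have [B B0 HB] := annihilated_bound HG cp1.
  have [K3 K30 HK3] := ftr_decay 0 cp2.
  have HF t : normc (G t * ftr (fun x => expi (eta * x) * psi (s * x + 0)) t * ftr (fun x => expi (- eta * x) * psi (s * x + 0)) (- t)) <= B * K3 * (jap t)^-1.
    rewrite normcM mulrAC; apply: ler_pM; rewrite ?normc_ge0//.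
    by have := HK3 (- t); rewrite expr0 invr1 mulr1.
  rewrite (cintegral_affine eta s0 cF HF).
  have sn : s != 0 by rewrite gt_eqF.
  have bW : exists2 B', 0 <= B' & forall z, normc (G (s * z + eta) * W z) <= B' * (jap z)^-1.
    exists (A * (2 * jap eta * (1 + s ^+ 2)) ^+ N * (K * K)); first by rewrite !mulr_ge0// exprn_ge0// !mulr_ge0 ?addr_ge0 ?sqr_ge0// ltW// jap_gt0.
    move=> z; rewrite normcM.
    have hj : jap (s * z + eta) <= 2 * jap eta * (1 + s ^+ 2) * jap z.
      apply: le_trans (jap_shift _ _) _; rewrite [leLHS]mulrAC -[leRHS]mulrA ler_wpM2l ?mulr_ge0 ?(ltW (jap_gt0 _))//.
      by rewrite /jap exprMn; have := sqr_ge0 s; have := sqr_ge0 z => *; nra.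
    apply: (@le_trans _ _ ((A * (2 * jap eta * (1 + s ^+ 2) * jap z) ^+ N) * (K * K * (jap z ^+ N.+1)^-1))).
      apply: ler_pM; rewrite ?normc_ge0//; apply: le_trans (HG _) _; rewrite ler_wpM2l//.
      by rewrite lerXn2r// nnegrE ?(ltW (jap_gt0 _))// (le_trans _ hj)// ltW// jap_gt0.
    by rewrite jap_cancel.
  have [B' B'0 HB'] := bW.
  have dGW : cdom leb setT (fun z => G (s * z + eta) * W z) (fun z => B' * (jap z)^-1).
    apply: cdom_line => // z; apply: ccts_mul; last exact: cW.
    apply: (ccts_comp (k := fun z : R => s * z + eta) _ cG z) => y; apply: cvgD; last exact: cvg_cst.
    by apply: cvgM; [exact: cvg_cst|exact: cvg_id].
  rewrite (_ : (fun t => _) = fun z => ((s^-1)%:C * (s^-1)%:C) * (G (s * z + eta) * W z)); last first.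
    apply/funext => z; rewrite !(ftr_affine _ _ _ s0 cpsi) !mul0r expi0 !mulr1 /W.
    have -> : (s * z + eta - eta) / s = z by field.
    have -> : (- (s * z + eta) - - eta) / s = - z by field.
    by ring.
  rewrite (cintegralM measurableT _ dGW) => /eqP; rewrite !mulf_eq0.
  have sc : s%:C != 0 :> C by rewrite eq_complex /= eqxx andbT.
  have sc' : (s^-1)%:C != 0 :> C by rewrite eq_complex /= eqxx andbT invr_neq0.
  by rewrite (negbTE sc) (negbTE sc') /= => /eqP.
have cI : ccts_at I0 0.
  pose B := A * (4 * jap eta) ^+ N * (K * K).
  have HB a z : normc (G (sin a * z + eta) * W z) <= B * (jap z)^-1.
    rewrite normcM.
    have hj : jap (sin a * z + eta) <= 4 * jap eta * jap z.
      apply: le_trans (jap_shift _ _) _; rewrite [leLHS]mulrAC.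
      have s1 : sin a ^+ 2 <= 1 by have := cos2Dsin2 a; have := sqr_ge0 (cos a); lra.
      have : jap (sin a * z) <= 2 * jap z by rewrite /jap exprMn; have := sqr_ge0 z; nra.
      have := jap_gt0 eta; nra.
    apply: (@le_trans _ _ ((A * (4 * jap eta * jap z) ^+ N) * (K * K * (jap z ^+ N.+1)^-1))).
      apply: ler_pM; rewrite ?normc_ge0//; apply: le_trans (HG _) _; rewrite ler_wpM2l//.
      by rewrite lerXn2r// nnegrE ?(ltW (jap_gt0 _))// (le_trans _ hj)// ltW// jap_gt0.
    by rewrite jap_cancel.
  apply: (@ccts_cintegral _ R _ _ leb setT _ (fun z => B * (jap z)^-1) 0 measurableT).
    move=> a; apply: cdom_line => // z; apply: ccts_mul; last exact: cW.
    apply: (ccts_comp (k := fun z : R => sin a * z + eta) _ cG z) => y; apply: cvgD; last exact: cvg_cst.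
    by apply: cvgM; [exact: cvg_cst|exact: cvg_id].
  move=> z _; apply: ccts_mul; last exact: ccts_cst.
  apply: (ccts_comp (k := fun a : R => sin a * z + eta) _ cG 0) => y; apply: cvgD; last exact: cvg_cst.
  by apply: cvgM; [exact: continuous_sin|exact: cvg_cst].
have I00 : I0 0 = 0.
  apply/eqP; apply: contrapT => /negP n0.
  have p0 : 0 < normc (I0 0) by rewrite lt_neqAle normc_ge0 andbT eq_sym; apply: contra n0 => /eqP/normc_eq0 ->.
  have e0 : 0 < normc (I0 0) / 2 by rewrite divr_gt0.
  have /nbhs_ballP[r /= r0 Hr] := ccts_dist cI e0.
  pose a := Num.min (r / 2) 1; have a0 : 0 < a by rewrite lt_min divr_gt0//= ltr01.
  have ar : ball 0 r a by rewrite /ball /= sub0r normrN gtr0_norm// /a gt_min; apply/orP; left; lra.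
  have : normc (I0 a - I0 0) <= normc (I0 0) / 2 := Hr a ar.
  rewrite Isin; last first.
    by apply: sin_gt0_pi; rewrite a0 /a gt_min /=; apply/orP; right; have := pi_ge2 R; lra.
  by rewrite sub0r normcN; lra.
move: I00; rewrite /I0 (_ : (fun z => _) = fun z => G eta * W z); last by apply/funext => z; rewrite sin0 mul0r add0r.
rewrite (cintegralM measurableT _ dW) => /eqP; rewrite mulf_eq0 (negbTE IW) orbF => /eqP; exact.
Qed.

Lemma cintegral_rV0 (f : 'rV[R]_0 -> C) : cintegral (lebesgue_rV 0) setT f = f 0.
Proof.
have mf (g : 'rV[R]_0 -> R) : measurable_fun setT g.
  rewrite (_ : g = fun=> g 0); first exact: measurable_cst.
  by apply/funext => x; congr g; apply/rowP => -[].
have E (g : 'rV[R]_0 -> R) : \int[lebesgue_rV 0]_x g x = g 0.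
  rewrite /Rintegral (_ : lebesgue_rV 0 = \d_(0 : 'rV[R]_0))// integral_dirac//; last by apply/measurable_EFinP.
  by rewrite diracT mul1e.
by rewrite /cintegral !E; case: (f 0).
Qed.

(** Products of transforms in the single variables already separate continuous
    functions of polynomial growth. *)
Lemma annihilated_rV_eq0 n (G : 'rV[R]_n -> C) (A : R) (N : nat) (b : R -> C) : ccts G ->
  (forall xi, normc (G xi) <= A * \prod_(i < n) jap (xi ord0 i) ^+ N) -> cc b -> b 0 != 0 ->
  (forall phi : 'I_n -> R -> C, (forall i, cc (phi i)) ->
     cintegral (lebesgue_rV n) setT (fun xi => G xi * \prod_(i < n) ftr (phi i) (xi ord0 i)) = 0) ->
  forall xi, G xi = 0.
Proof.
move=> cG HG cb b0; elim: n G A cG HG => [|n IH] G A cG HG aG xi.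
  have := aG (fun=> b) (fun=> cb); rewrite cintegral_rV0 big_ord0 mulr1.
  by rewrite (_ : xi = 0)//; apply/rowP => -[].
have A0 : 0 <= A.
  have := le_trans (normc_ge0 _) (HG 0); rewrite pmulr_lge0// prodr_gt0// => i _.
  by rewrite exprn_gt0// jap_gt0.
rewrite -(rV_unconsK xi); case: (rV_uncons xi) => t0 y0.
apply: (IH (fun y => G (rV_cons (t0, y))) (A * jap t0 ^+ N)).
- exact: (ccts_comp (@rV_cons_cts _ n t0) cG).
- move=> y; apply: le_trans (HG _) _; rewrite big_ord_recl rV_cons0 mulrA.
  by rewrite (eq_bigr (fun i : 'I_n => jap (y ord0 i) ^+ N))// => i _; rewrite rV_consS.
move=> phi cphi.
have [K HK] := choice (fun i => ltac:(have [k k0 Hk] := ftr_decay N.+1 (cphi i); exists k; exact: (conj k0 Hk)) : exists k : R, 0 <= k /\ forall t, normc (ftr (phi i) t) <= k * (jap t ^+ N.+1)^-1).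
pose B := \prod_(i < n) K i.
have B0 : 0 <= B by apply: prodr_ge0 => i _; case: (HK i).
pose Q (y : 'rV[R]_n) := \prod_(i < n) ftr (phi i) (y ord0 i).
have normc_prod (F : 'I_n -> C) : normc (\prod_i F i) = \prod_i normc (F i).
  elim: (index_enum _) => [|i s IHs]; first by rewrite !big_nil (_ : (1 : C) = 1%:C)// normc_real normr1.
  by rewrite !big_cons normcM IHs.
have HGQ t (y : 'rV[R]_n) : normc (G (rV_cons (t, y)) * Q y) <= A * jap t ^+ N * (B * wt y).
  rewrite normcM /Q normc_prod.
  apply: (@le_trans _ _ ((A * jap t ^+ N * \prod_(i < n) jap (y ord0 i) ^+ N) * \prod_(i < n) (K i * (jap (y ord0 i) ^+ N.+1)^-1))).
    apply: ler_pM; rewrite ?normc_ge0//.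
    - by apply: prodr_ge0 => i _; exact: normc_ge0.
    - apply: le_trans (HG _) _; rewrite big_ord_recl rV_cons0 mulrA.
      by rewrite (eq_bigr (fun i : 'I_n => jap (y ord0 i) ^+ N))// => i _; rewrite rV_consS.
    - by apply: ler_prod => i _; rewrite normc_ge0; case: (HK i) => _ ->.
  rewrite -mulrA -big_split /= /B /wt -big_split /= le_eqVlt; apply/orP; left; apply/eqP; congr (_ * _).
  apply: eq_bigr => i _; rewrite exprS invfM -/(jap _); field.
  by rewrite ?expf_neq0 ?gt_eqF ?jap_gt0.
have cQ : ccts Q.
  move=> y; rewrite /Q; elim: (index_enum _) => [|i s IHs].
    by rewrite (_ : (fun x => _) = fun=> 1); [exact: ccts_cst|apply/funext => x; rewrite big_nil].
  rewrite (_ : (fun x => _) = fun x : 'rV[R]_n => ftr (phi i) (x ord0 i) * \prod_(j <- s) ftr (phi j) (x ord0 j)); last by apply/funext => x; rewrite big_cons.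
  apply: ccts_mul => //; apply: (@ccts_comp _ 'rV[R]_n R (fun x : 'rV[R]_n => x ord0 i) (ftr (phi i)) _ (ccts_ftr (cphi i))).
  exact: coord_continuous.
have dGQ t : cdom (lebesgue_rV n) setT (fun y => G (rV_cons (t, y)) * Q y) (fun y => A * jap t ^+ N * (B * wt y)).
  split; first by apply: ccts_cmeas_rV => y; apply: ccts_mul; [exact: (ccts_comp (@rV_cons_cts _ n t) cG y)|exact: cQ].
    have := integrableZl measurableT (A * jap t ^+ N * B) (@integrable_wt R n); apply: eq_integrable => // y _.
    by rewrite /= -EFinM mulrA.
  by move=> y _.
pose H t := cintegral (lebesgue_rV n) setT (fun y => G (rV_cons (t, y)) * Q y).
suff : forall t, H t = 0 by move=> /(_ t0).
pose w := \int[lebesgue_rV n]_y (B * wt y).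
have Jp t : 0 < jap t ^+ N by rewrite exprn_gt0// jap_gt0.
have iBw : (lebesgue_rV n).-integrable setT (EFin \o (fun y => B * wt y)).
  by have := integrableZl measurableT B (@integrable_wt R n); apply: eq_integrable.
apply: (@annihilated_eq0 H (2 * A * w) N b) => //.
- move=> t.
  have -> : H = fun s => (jap s ^+ N)%:C * cintegral (lebesgue_rV n) setT (fun y => ((jap s ^+ N)^-1)%:C * (G (rV_cons (s, y)) * Q y)).
    apply/funext => s; rewrite (cintegralM measurableT _ (dGQ s)) mulrA mul_realV ?mul1r//.
    by rewrite gt_eqF.
  have cj : {for t, continuous (fun s => jap s ^+ N)} by apply: (@continuous_comp _ _ _ jap (fun x => x ^+ N)); [exact: cts_jap|exact: exprn_continuous].
  apply: ccts_mul; first by split; [exact: cj|exact: cvg_cst].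
  apply: (@ccts_cintegral _ R _ _ (lebesgue_rV n) setT _ (fun y => A * (B * wt y)) t measurableT).
    move=> s; have [m1 _ H1] := cdomM measurableT ((jap s ^+ N)^-1)%:C (dGQ s); split=> //.
      by have := integrableZl measurableT A iBw; apply: eq_integrable.
    move=> y Sy; apply: le_trans (H1 y Sy) _; rewrite normc_real ger0_norm ?invr_ge0 ?(ltW (Jp _))//.
    by rewrite le_eqVlt; apply/orP; left; apply/eqP; field; rewrite expf_neq0// gt_eqF// jap_gt0.
  move=> y _; apply: ccts_mul.
    by split; [apply: cvgV => //; rewrite gt_eqF|exact: cvg_cst].
  by apply: ccts_mul; [exact: (ccts_comp (@rV_cons_ctsl _ n y) cG t)|exact: ccts_cst].
- move=> t; apply: le_trans (cintegral_le measurableT (dGQ t)) _.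
  by rewrite RintegralZl// le_eqVlt; apply/orP; left; apply/eqP; rewrite /w; ring.
- move=> p cp; have [k k0 Hk] := ftr_decay N.+1 cp.
  pose Phi (i : 'I_n.+1) := oapp phi p (unlift ord0 i).
  have cPhi i : cc (Phi i) by rewrite /Phi; case: (unliftP ord0 i) => [j _|_] /=.
  have := aG Phi cPhi.
  have PhiE t (y : 'rV[R]_n) : \prod_(i < n.+1) ftr (Phi i) (rV_cons (t, y) ord0 i) = ftr p t * Q y.
    rewrite big_ord_recl rV_cons0 /Phi unlift_none /=; congr (_ * _).
    by apply: eq_bigr => i _; rewrite rV_consS liftK.
  have cPhi2 : ccts (fun xi : 'rV[R]_n.+1 => \prod_(i < n.+1) ftr (Phi i) (xi ord0 i)).
    move=> y; elim: (index_enum _) => [|i s IHs].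
      by rewrite (_ : (fun x => _) = fun=> 1); [exact: ccts_cst|apply/funext => x; rewrite big_nil].
    rewrite (_ : (fun x => _) = fun x : 'rV[R]_n.+1 => ftr (Phi i) (x ord0 i) * \prod_(j <- s) ftr (Phi j) (x ord0 j)); last by apply/funext => x; rewrite big_cons.
    apply: ccts_mul => //; apply: (@ccts_comp _ 'rV[R]_n.+1 R (fun x : 'rV[R]_n.+1 => x ord0 i) (ftr (Phi i)) _ (ccts_ftr (cPhi i))).
    exact: coord_continuous.
  have u0 (t : R) : 0 <= A * k * (jap t)^-1 by rewrite !mulr_ge0// invr_ge0 ltW// jap_gt0.
  have v0 (y : 'rV[R]_n) : 0 <= B * wt y by rewrite mulr_ge0// ltW// wt_gt0.
  have Hb t (y : 'rV[R]_n) : normc (G (rV_cons (t, y)) * \prod_(i < n.+1) ftr (Phi i) (rV_cons (t, y) ord0 i)) <= A * k * (jap t)^-1 * (B * wt y).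
    rewrite PhiE mulrCA normcM mulrC.
    apply: (@le_trans _ _ ((A * jap t ^+ N * (B * wt y)) * (k * (jap t ^+ N.+1)^-1))).
      by apply: ler_pM; rewrite ?normc_ge0.
    rewrite exprS invfM le_eqVlt; apply/orP; left; apply/eqP; field.
    by rewrite ?expf_neq0 ?gt_eqF ?jap_gt0.
  have mm : cmeas setT (fun xi : 'rV[R]_n.+1 => G xi * \prod_(i < n.+1) ftr (Phi i) (xi ord0 i)).
    by apply: ccts_cmeas_rV => x; apply: ccts_mul; [exact: cG|exact: cPhi2].
  rewrite (cintegral_rVS mm u0 v0 (integrable_japV _) iBw Hb).1 => E; rewrite -[RHS]E.
  apply: cintegral_ext => t _; rewrite /H mulrC -(cintegralM measurableT _ (dGQ t)).
  by apply: cintegral_ext => y _; rewrite PhiE; ring.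
Qed.

End LineTransform.

(** * Expansion of an operator over the frequencies *)

Section OperatorExpansion.
Context {R : realType} {n : nat}.
Local Notation C := R[i].
Local Notation normc := (@ComplexField.Normc.normc R).
Local Notation leb := (@lebesgue_measure R).
Local Notation S1 := (@dom_S1 R).
Local Notation M := (RnS1 R n).
Local Notation P := ((M * M)%type : normedModType R).
Local Notation mu := (@mu_RnS1 R n).
Local Notation dom := (@dom_RnS1 R n).
Implicit Types (f : M -> C) (q : M * M -> C) (xi x : 'rV[R]_n) (m k : int).

Definition theta_dir : M * M := (circle_axis, 0).

Lemma classical_csmooth d q : classical_symbol d q -> @csmooth R P q.
Proof. by case=> /(@csmoothP R P). Qed.

Lemma classical_theta_bound d q (N : nat) : classical_symbol d q -> exists2 c : R, 0 <= c &
  forall p, normc (cderives (nseq N theta_dir) q p) <= c * wt p.1.1 * (1 + `|p.2|) `^ d.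
Proof.
move=> cq; have [/classical_symbolE[cR cI]] := (cq, cq) => _.
have [_ _ [K cK Kq] _] := cq; have [w w0 Hw] := weight_compact cK.
have [a a0 Ha] := rclassical_global cR (nseq N circle_axis) [::].
have [b b0 Hb] := rclassical_global cI (nseq N circle_axis) [::].
have dE : dirs (nseq N circle_axis) [::] = nseq N theta_dir.
  by rewrite /dirs /= cats0 map_nseq.
rewrite dE subr0 in Ha Hb; exists ((a + b) * w); first by rewrite mulr_ge0// addr_ge0.
move=> p; have B0 : 0 <= (1 + `|p.2|) `^ d by exact: powR_ge0.
have R1 := congr1 (fun F => F p) (@Re_cderives R P (nseq N theta_dir) q).
have I1 := congr1 (fun F => F p) (@Im_cderives R P (nseq N theta_dir) q).
apply: le_trans (normc_le_ReIm _) _; rewrite R1 I1.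
have [Kp|nKp] := pselect (K p.1.1).
  apply: (@le_trans _ _ ((a + b) * (1 + `|p.2|) `^ d)); first by rewrite mulrDl lerD.
  rewrite ler_wpM2r// -mulrA -[leLHS]mulr1 ler_wpM2l ?addr_ge0//; exact: Hw.
have oU : @open P [set p : M * M | ~ K p.1.1].
  apply: (@open_comp _ _ (fun p : M * M => p.1.1) (~` K)).
    by move=> z _; apply: (@continuous_comp _ _ _ (fun p : M * M => p.1) (fun z : M => z.1)); [exact: cvg_fst|exact: cvg_fst].
  by rewrite openC; apply: compact_closed => //; exact: norm_hausdorff.
have z0 (g : M * M -> R) : (forall p : M * M, ~ K p.1.1 -> g p = 0) -> rders (V := P) (nseq N theta_dir) g p = 0.
  move=> g0; rewrite (@rders_eq R P _ g (fun=> 0) (nseq N theta_dir) oU g0 p nKp) rders_cst.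
  by case: (nseq _ _).
rewrite !z0 => [|[[y s] z] /= nKy|[[y s] z] /= nKy]; rewrite ?Kq// normr0 addr0.
by rewrite !mulr_ge0 ?addr_ge0// ltW// wt_gt0.
Qed.

Lemma cder_theta q x zeta : @csmooth R P q ->
  cder (fun t => q ((x, t), zeta)) (fun t => cderive (V := P) theta_dir q ((x, t), zeta)).
Proof.
move=> [f1 f2] t.
have D (g : M * M -> R) : @rsmooth R P setT g -> is_derive t (1 : R) (fun t : R => g ((x, t), zeta)) (derive (V := P) g ((x, t), zeta) theta_dir).
  move=> sg; have [dE dd] := @line_derive R P g ((x, 0), zeta) theta_dir t.
  have E (s : R) : ((((x, 0), zeta) : P) + s *: (theta_dir : P)) = ((x, s), zeta) :> P.
    by congr (_, _); rewrite /= ?scaler0 ?addr0//; congr (_, _); rewrite /= ?scaler0 ?addr0// add0r /GRing.scale /= mulr1.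
  have Eg : (fun s : R => g ((((x, 0), zeta) : P) + s *: (theta_dir : P))) = (fun s => g ((x, s), zeta)) by apply/funext => s; rewrite E.
  by rewrite Eg E in dE dd; rewrite -dE; apply: DeriveDef => //; apply: dd; have [_ dg] := sg [::] ((x, t), zeta) Logic.I; exact: dg.
by split; exact: D.
Qed.

(** The Fourier series of a symbol in the circle variable converges rapidly,
    uniformly with respect to its order. *)
Lemma classical_modes d q : classical_symbol d q -> exists2 c : R, 0 <= c &
  [/\ forall p, normc (q p) <= c * wt p.1.1 * (1 + `|p.2|) `^ d,
      forall k p, normc (fibre_mode q k p) <= c * wt p.1.1 * (1 + `|p.2|) `^ d * inv_sqr k &
      forall p, q p = csumZ (fun k => cexp k p.1.2 * fibre_mode q k p)].
Proof.
move=> cq; have sq := classical_csmooth cq; have [_ pq _ _] := cq.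
have [c0 c00 H0] := classical_theta_bound 0 cq.
have [c1 c10 H1] := classical_theta_bound 1 cq.
have [c2 c20 H2] := classical_theta_bound 2 cq.
pose c := c0 + c1 + c2; have c_ge0 : 0 <= c by rewrite !addr_ge0.
have sq1 : @csmooth R P (cderive (V := P) theta_dir q) := @csmooth_cderive R P theta_dir q sq.
have sq2 : @csmooth R P (cderive (V := P) theta_dir (cderive (V := P) theta_dir q)) := @csmooth_cderive R P theta_dir _ sq1.
have w0 (p : M * M) : 0 <= wt p.1.1 * (1 + `|p.2|) `^ d by rewrite mulr_ge0 ?powR_ge0// ltW// wt_gt0.
have up (a : R) (p : M * M) : a <= c -> a * wt p.1.1 * (1 + `|p.2|) `^ d <= c * wt p.1.1 * (1 + `|p.2|) `^ d.
  by move=> ac; rewrite -!mulrA ler_wpM2r.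
have B0 p : normc (q p) <= c * wt p.1.1 * (1 + `|p.2|) `^ d.
  by apply: le_trans (H0 p) (up _ _ _); rewrite /c; lra.
have B1 p : normc (cderive (V := P) theta_dir q p) <= c * wt p.1.1 * (1 + `|p.2|) `^ d.
  by apply: le_trans (H1 p) (up _ _ _); rewrite /c; lra.
have B2 p : normc (cderive (V := P) theta_dir (cderive (V := P) theta_dir q) p) <= c * wt p.1.1 * (1 + `|p.2|) `^ d.
  by apply: le_trans (H2 p) (up _ _ _); rewrite /c; lra.
have per1 (x : 'rV[R]_n) t (zeta : M) : cderive (V := P) theta_dir q ((x, t + 2 * pi), zeta) = cderive (V := P) theta_dir q ((x, t), zeta).
  have key (g : M * M -> R) : rperiodic g -> derive (V := P) g ((x, t + 2 * pi), zeta) theta_dir = derive (V := P) g ((x, t), zeta) theta_dir.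
    by move=> pg; exact: (@rperiodic_rders R n g [:: theta_dir] pg x t zeta).
  by rewrite /cderive !key// => y s z; rewrite pq.
exists (4 * c); first by rewrite mulr_ge0.
split.
- move=> p; apply: le_trans (B0 p) _; rewrite -(mulrA c) -(mulrA (4 * c)); apply: ler_wpM2r; [exact: w0|lra].
- move=> k [[x t] [xi0 s0]]; pose zeta : M := (xi0, s0).
  rewrite [leRHS](_ : _ = 4 * (c * wt x * (1 + `|zeta|) `^ d) * inv_sqr k); last by rewrite /=; ring.
  apply: (@fcoef_decay R (fun s => q ((x, s), zeta)) _ _ (c * wt x * (1 + `|zeta|) `^ d) k (cder_theta x zeta sq) (cder_theta x zeta sq1)).
  + exact: cder_ccts (cder_theta x zeta sq2).
  + by move=> s; rewrite pq.
  + by move=> s; exact: per1.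
  + by move=> s; exact: (B0 ((x, s), zeta)).
  + by move=> s; exact: (B1 ((x, s), zeta)).
  + by move=> s; exact: (B2 ((x, s), zeta)).
- move=> [[x t] [xi0 s0]]; apply/esym; pose zeta : M := (xi0, s0).
  have := @fourier_series R (fun s => q ((x, s), zeta)) _ _ (c * wt x * (1 + `|zeta|) `^ d) t (cder_theta x zeta sq) (cder_theta x zeta sq1).
  rewrite -[q _]/(q ((x, t), zeta)) => <-.
  + by apply: csumZ_ext => k; rewrite [LHS]mulrC.
  + exact: cder_ccts (cder_theta x zeta sq2).
  + by move=> s; rewrite pq.
  + by move=> s; exact: per1.
  + by move=> s; exact: (B0 ((x, s), zeta)).
  + by move=> s; exact: (B1 ((x, s), zeta)).
  + by move=> s; exact: (B2 ((x, s), zeta)).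
Qed.

Definition Op_integrand q f m (z : M) xi : C :=
  q (z, (xi, m%:~R)) * expi (dotp z.1 xi) * fourier f xi m.

Definition Op_term q f m (z : M) : C := cintegral (lebesgue_rV n) setT (Op_integrand q f m z).

Lemma OpE q f z : Op q f z = csumZ (fun m => cexp m z.2 * Op_term q f m z).
Proof. by []. Qed.

Lemma ccts_slice q z m : @csmooth R P q -> ccts (fun xi : 'rV[R]_n => q (z, (xi, m%:~R))).
Proof.
move=> sq; apply: (@ccts_comp R 'rV[R]_n P (fun xi : 'rV[R]_n => (z, (xi, m%:~R))) q _ (csmooth_ccts sq)).
move=> xi; apply: (@cts_pair _ _ _ (fun=> z) (fun xi : 'rV[R]_n => (xi, m%:~R : R)) xi); first exact: cst_continuous.
by apply: (@cts_pair _ _ _ id (fun=> m%:~R : R) xi); [exact: cvg_id|exact: cst_continuous].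
Qed.

Lemma ccts_base q zeta : @csmooth R P q -> ccts (fun z : M => q (z, zeta)).
Proof.
move=> sq; apply: (@ccts_comp R M P (fun z : M => (z, zeta)) q _ (csmooth_ccts sq)).
by move=> z; apply: (@cts_pair _ _ _ id (fun=> zeta) z); [exact: cvg_id|exact: cst_continuous].
Qed.

(** Domination of the integrand of [Op] by the decay of the transform. *)
Lemma Op_integrand_dom d q f (c : R) : classical_symbol d q -> test_function f -> 0 <= c ->
  (forall p, normc (q p) <= c * wt p.1.1 * (1 + `|p.2|) `^ d) ->
  exists2 K : R, 0 <= K & forall (e : R) (r : M * M -> C), 0 <= e -> @csmooth R P r ->
    (forall p, normc (r p) <= e * wt p.1.1 * (1 + `|p.2|) `^ d) ->
    forall m z, cdom (lebesgue_rV n) setT (Op_integrand r f m z) (fun xi => e * K * wt z.1 * inv_sqr m * wt xi).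
Proof.
move=> cq tf c0 Hq; have [K K0 HK] := fourier_decay d tf; exists K => // e r e0 sr Hr m z.
have [K' _ tK] := test_tame tf; split.
- apply: ccts_cmeas_rV => xi; apply: ccts_mul; last exact: (ccts_fourier m tK).
  apply: ccts_mul; first exact: (ccts_slice z m sr).
  by have := ccts_plane z.1 xi; under [X in ccts_at X _]eq_fun do rewrite dotpC.
- by have := integrableZl measurableT (e * K * wt z.1 * inv_sqr m) (@integrable_wt R n); apply: eq_integrable.
- move=> xi _; rewrite /Op_integrand normcM normcM normc_expi mulr1.
  apply: (@le_trans _ _ (e * wt z.1 * (1 + `|(xi, m%:~R : R)|) `^ d * normc (fourier f xi m))).
    by rewrite ler_wpM2r ?normc_ge0//; exact: (Hr (z, (xi, m%:~R))).
  rewrite -mulrA (_ : e * K * wt z.1 * inv_sqr m * wt xi = e * wt z.1 * (K * wt xi * inv_sqr m)); last by ring.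
  by rewrite ler_wpM2l// mulr_ge0// ltW// wt_gt0.
Qed.

End OperatorExpansion.

(** * Expansion of an operator over the modes of its symbol *)

Section Modes.
Context {R : realType} {n : nat}.
Local Notation C := R[i].
Local Notation normc := (@ComplexField.Normc.normc R).
Local Notation leb := (@lebesgue_measure R).
Local Notation S1 := (@dom_S1 R).
Local Notation mS1 := (@measurable_dom_S1 R).
Local Notation M := (RnS1 R n).
Local Notation P := ((M * M)%type : normedModType R).
Local Notation mu := (@mu_RnS1 R n).
Local Notation dom := (@dom_RnS1 R n).
Implicit Types (f : M -> C) (q : M * M -> C) (xi x : 'rV[R]_n) (m k : int).
#[local] Existing Instance ae_RnS1_filter.

Lemma ccts_Op_term q f m (D : R) : @csmooth R P q -> 0 <= D ->
  (forall z, cdom (lebesgue_rV n) setT (Op_integrand q f m z) (fun xi => D * wt z.1 * wt xi)) ->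
  ccts (Op_term q f m) /\
  forall z, normc (Op_term q f m z) <= 2 * (D * \int[lebesgue_rV n]_xi wt xi) * wt z.1.
Proof.
move=> sq D0 dD; split=> z.
  apply: (@ccts_cintegral R M _ _ (lebesgue_rV n) setT _ (fun xi => D * wt xi) z measurableT).
    move=> y; have [m1 _ H1] := dD y; split=> //.
      by have := integrableZl measurableT D (@integrable_wt R n); apply: eq_integrable.
    move=> xi Sx; apply: le_trans (H1 xi Sx) _; rewrite ler_wpM2r ?(ltW (wt_gt0 _))//.
    by rewrite -[leRHS]mulr1 ler_wpM2l// wt_le1.
  move=> xi _; apply: ccts_mul; last exact: ccts_cst.
  apply: ccts_mul; first exact: (ccts_base (xi, m%:~R) sq z).
  apply: (@ccts_comp R M 'rV[R]_n (fun z : M => z.1) (fun x => expi (dotp x xi)) _ (ccts_plane xi) z).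
  by move=> y; exact: cvg_fst.
apply: le_trans (cintegral_le measurableT (dD z)) _.
rewrite RintegralZl//; last exact: integrable_wt.
by rewrite le_eqVlt; apply/orP; left; apply/eqP; ring.
Qed.

(** The expansion of [Op q f] into modes, with bounds that make all the series
    below converge absolutely. *)
Lemma Op_expansion d q f : classical_symbol d q -> test_function f -> exists2 D : R, 0 <= D &
  [/\ forall m, ccts (Op_term q f m),
      forall m z, normc (Op_term q f m z) <= D * wt z.1 * inv_sqr m,
      forall k m, ccts (Op_term (fibre_mode q k) f m),
      forall k m z, normc (Op_term (fibre_mode q k) f m z) <= D * wt z.1 * inv_sqr k * inv_sqr m &
      forall m z, Op_term q f m z = csumZ (fun k => cexp k z.2 * Op_term (fibre_mode q k) f m z)].
Proof.
move=> cq tf; have [c c0 [H0 Hk Hs]] := classical_modes cq.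
have [K K0 HK] := Op_integrand_dom cq tf c0 H0.
pose W : R := \int[lebesgue_rV n]_xi wt xi.
have W0 : 0 <= W by apply: Rintegral_ge0 => x _; exact: ltW (wt_gt0 _).
have i0 m : 0 <= inv_sqr m :> R := ltW (inv_sqr_gt0 m).
have sq := classical_csmooth cq; have sk k := classical_csmooth (fibre_mode_classical k cq).
have dq m z := HK c q c0 sq H0 m z.
have Hk' k (p : M * M) : normc (fibre_mode q k p) <= c * inv_sqr k * wt p.1.1 * (1 + `|p.2|) `^ d.
  apply: le_trans (Hk k p) _; rewrite (_ : c * inv_sqr k * wt p.1.1 * (1 + `|p.2|) `^ d = c * wt p.1.1 * (1 + `|p.2|) `^ d * inv_sqr k)//.
  by ring.
have dk k m z := HK (c * inv_sqr k) (fibre_mode q k) (mulr_ge0 c0 (i0 k)) (sk k) (Hk' k) m z.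
have A1 m : ccts (Op_term q f m) /\ forall z, normc (Op_term q f m z) <= 2 * (c * K * inv_sqr m * W) * wt z.1.
  apply: (@ccts_Op_term q f m (c * K * inv_sqr m) sq); first by rewrite !mulr_ge0.
  move=> z; have := dq m z; rewrite (_ : (fun xi => c * K * wt z.1 * inv_sqr m * wt xi) = (fun xi => c * K * inv_sqr m * wt z.1 * wt xi))//.
  by apply/funext => xi; ring.
have A2 k m : ccts (Op_term (fibre_mode q k) f m) /\
    forall z, normc (Op_term (fibre_mode q k) f m z) <= 2 * (c * inv_sqr k * K * inv_sqr m * W) * wt z.1.
  apply: (@ccts_Op_term (fibre_mode q k) f m (c * inv_sqr k * K * inv_sqr m) (sk k)); first by rewrite !mulr_ge0.
  move=> z; have := dk k m z; rewrite (_ : (fun xi => c * inv_sqr k * K * wt z.1 * inv_sqr m * wt xi) = (fun xi => c * inv_sqr k * K * inv_sqr m * wt z.1 * wt xi))//.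
  by apply/funext => xi; ring.
exists (2 * (c * K * W)); first by rewrite !mulr_ge0.
split.
- by move=> m; case: (A1 m).
- by move=> m z; apply: le_trans ((A1 m).2 z) _; rewrite le_eqVlt; apply/orP; left; apply/eqP; ring.
- by move=> k m; case: (A2 k m).
- by move=> k m z; apply: le_trans ((A2 k m).2 z) _; rewrite le_eqVlt; apply/orP; left; apply/eqP; ring.
- move=> m z.
  pose a k xi := cexp k z.2 * Op_integrand (fibre_mode q k) f m z xi.
  have ma k : cmeas setT (a k) by apply: cmeasM; [exact: cmeas_cst|case: (dk k m z)].
  have ig : (lebesgue_rV n).-integrable setT (EFin \o (fun xi => c * K * wt z.1 * inv_sqr m * wt xi)) by case: (dq m z).
  have Ha k xi : setT xi -> normc (a k xi) <= c * K * wt z.1 * inv_sqr m * wt xi * inv_sqr k.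
    move=> Sx; rewrite /a normcM normc_cexp mul1r; have [_ _ H] := dk k m z; apply: le_trans (H xi Sx) _.
    by rewrite le_eqVlt; apply/orP; left; apply/eqP; ring.
  transitivity (cintegral (lebesgue_rV n) setT (fun xi => csumZ (fun k => a k xi))).
    apply: cintegral_ext => xi _; rewrite /Op_integrand Hs -mulrA mulrC -(@csumZM R _ _ (c * wt z.1 * (1 + `|(xi, m%:~R : R)|) `^ d)).
      by apply: csumZ_ext => k; rewrite /a /Op_integrand /=; ring.
    by move=> k; rewrite normcM normc_cexp mul1r; exact: Hk.
  rewrite (cintegral_csumZ measurableT ma ig Ha); apply: csumZ_ext => k.
  by rewrite /a (cintegralM measurableT _ (dk k m z)).
Qed.

Lemma circle_mode_decay f : test_function f -> exists2 D : R, 0 <= D &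
  (forall m x, normc (circle_mode f m x) <= D * wt x * inv_sqr m) /\
  (forall z, f z = csumZ (fun m => cexp m z.2 * circle_mode f m z.1)).
Proof.
move=> tf; have t1 := test_cderive circle_axis tf; have t2 := test_cderive circle_axis t1.
have s0 := test_csmooth tf; have s1 := test_csmooth t1; have s2 := test_csmooth t2.
have [c0 c00 H0] := test_bound tf; have [c1 c10 H1] := test_bound t1; have [c2 c20 H2] := test_bound t2.
pose c := c0 + c1 + c2; have c_ge0 : 0 <= c by rewrite !addr_ge0.
have up (a : R) x : a <= c -> a * wt x <= c * wt x by move=> ac; rewrite ler_wpM2r// ltW// wt_gt0.
have B0 x t : normc (f (x, t)) <= c * wt x by apply: le_trans (H0 (x, t)) (up _ _ _); rewrite /c; lra.
have B1 x t : normc (cderive circle_axis f (x, t)) <= c * wt x by apply: le_trans (H1 (x, t)) (up _ _ _); rewrite /c; lra.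
have B2 x t : normc (cderive circle_axis (cderive circle_axis f) (x, t)) <= c * wt x by apply: le_trans (H2 (x, t)) (up _ _ _); rewrite /c; lra.
have [_ p0 _] := tf; have [_ p1 _] := t1.
exists (4 * c); first by rewrite mulr_ge0.
split.
- move=> m x; rewrite -(mulrA 4).
  by apply: (@fcoef_decay R (fun t => f (x, t)) _ _ (c * wt x) m (cder_circle x s0) (cder_circle x s1)) => // t; exact: (csmooth_section x s2).
- move=> [x t] /=; apply/esym; rewrite -(@fourier_series R (fun t => f (x, t)) _ _ (c * wt x) t (cder_circle x s0) (cder_circle x s1))//.
    by apply: csumZ_ext => m; rewrite mulrC.
  by move=> s; exact: (csmooth_section x s2).
Qed.

Variables (P1 : (R -> C) -> (R -> C)) (Pi : (M -> C) -> (M -> C)).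
Hypotheses (hP1 : is_szego_S1 P1) (hPi : is_szego P1 Pi).

Lemma cexpD j k t : cexp (j + k) t = cexp j t * cexp k t :> C.
Proof. by rewrite /cexp intrD mulrDl expiD. Qed.

Lemma cexp_meas m (A : 'rV[R]_n -> C) : cmeas setT A ->
  cmeas (T := ('rV[R]_n * measurableTypeR R)%type) setT (fun z => A z.1 * cexp m z.2).
Proof.
move=> [mR mI]; apply: cmeasM.
  by split; [exact: (measurableT_comp mR measurable_fst)|exact: (measurableT_comp mI measurable_fst)].
have [m1 m2] := ccts_cmeas (@ccts_cexp R m) measurableT.
by split; [exact: (measurableT_comp m1 measurable_snd)|exact: (measurableT_comp m2 measurable_snd)].
Qed.

Lemma szego_modes (A : int -> 'rV[R]_n -> C) (D : R) (r : int) : (forall k, cmeas setT (A k)) ->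
  (forall k x, normc (A k x) <= D * wt x * inv_sqr k) ->
  eq_RnS1 (Pi (fun z => csumZ (fun k => A k z.1 * cexp (r + k) z.2)))
          (fun z => csumZ (fun k => if (0 <= r + k)%R then A k z.1 * cexp (r + k) z.2 else 0)).
Proof.
move=> mA HA; apply: (@szego_csumZ R n P1 Pi hPi (fun k z => A k z.1 * cexp (r + k) z.2) (fun k => (0 <= r + k)%R) D).
- by move=> k; exact: cexp_meas.
- by move=> k x t; rewrite /= /cexp expi_period.
- by move=> k z; rewrite normcM normc_cexp mulr1.
- move=> k; apply: (szego_product hP1 hPi (K := D) (r + k) (mA k)) => x.
  by apply: le_trans (HA k x) _; rewrite -[leRHS]mulr1 ler_wpM2l ?inv_sqr_le1//; have := le_trans (normc_ge0 _) (HA k x); rewrite pmulr_lge0 ?inv_sqr_gt0.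
Qed.

Lemma szego_Op_term d q f m : classical_symbol d q -> test_function f ->
  eq_RnS1 (Pi (fun z => cexp m z.2 * Op_term q f m z))
    (fun z => csumZ (fun k => if (0 <= m + k)%R then Op_term (fibre_mode q k) f m (z.1, 0) * cexp (m + k) z.2 else 0)).
Proof.
move=> cq tf; have [D D0 [_ _ c2 B2 E]] := Op_expansion cq tf.
have cp : continuous (fun x : 'rV[R]_n => (x, 0) : M).
  by move=> x; apply: (@cts_pair _ _ _ id (fun=> 0) x); [exact: cvg_id|exact: cst_continuous].
have mA k : cmeas setT (fun x => Op_term (fibre_mode q k) f m (x, 0)) by apply: ccts_cmeas_rV; exact: (ccts_comp cp (c2 k m)).
have HA k x : normc (Op_term (fibre_mode q k) f m (x, 0)) <= D * wt x * inv_sqr k.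
  apply: le_trans (B2 k m (x, 0)) _; rewrite -[leRHS]mulr1 ler_wpM2l ?inv_sqr_le1//.
  by rewrite !mulr_ge0// ?ltW ?wt_gt0 ?inv_sqr_gt0.
have := szego_modes m mA HA; rewrite (_ : (fun z => csumZ (fun k => _ * cexp (m + k) z.2)) = (fun z => cexp m z.2 * Op_term q f m z))//.
apply/funext => z; rewrite E -(@csumZM R _ _ (D * wt z.1)).
  by apply: csumZ_ext => k; rewrite cexpD -[Op_term _ _ _ (z.1, 0)]/(Op_term (fibre_mode q k) f m z); ring.
move=> k; rewrite normcM normc_cexp mul1r; exact: (HA k z.1).
Qed.

Lemma tame_Op d q f : classical_symbol d q -> test_function f -> forall c : int -> bool,
  (forall m, eq_RnS1 (Pi (fun z => cexp m z.2 * Op_term q f m z)) (fun z => if c m then cexp m z.2 * Op_term q f m z else 0)) ->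
  eq_RnS1 (Pi (Op q f)) (fun z => csumZ (fun m => if c m then cexp m z.2 * Op_term q f m z else 0)).
Proof.
move=> cq tf c H; have [D D0 [c1 B1 _ _ E]] := Op_expansion cq tf; have [_ pq _ _] := cq.
apply: (@szego_csumZ R n P1 Pi hPi (fun m z => cexp m z.2 * Op_term q f m z) c D) => //.
- move=> m; apply: ccts_cmeas_M => z; apply: ccts_mul; last exact: c1.
  apply: (@ccts_comp R M R (fun z : M => z.2) (cexp m) _ (@ccts_cexp R m) z) => y; exact: cvg_snd.
- move=> m x t; rewrite /= /cexp expi_period; congr (_ * _).
  by apply: cintegral_ext => xi _; rewrite /Op_integrand /= pq.
- by move=> m z; rewrite normcM normc_cexp mul1r.
Qed.

(** The Fourier series of f in theta converges fast enough to be projected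
    termwise, and the Fourier coefficients only see the result almost
    everywhere. *)
Lemma fourier_szego f xi m : test_function f ->
  fourier (Pi f) xi m = if (0 <= m)%R then fourier f xi m else 0.
Proof.
move=> tf; have [D D0 [HD Ef]] := circle_mode_decay tf; have sf := test_csmooth tf.
have [K K0 tK] := test_tame tf.
have mA k : cmeas setT (circle_mode f k) by apply: ccts_cmeas_rV; exact: ccts_circle_mode.
have HA k x : normc (circle_mode f k x) <= D * wt x * inv_sqr k by exact: HD.
have H := szego_modes 0 mA HA.
rewrite (_ : (fun z => csumZ (fun k => _ * cexp (0 + k) z.2)) = f) in H; last first.
  by apply/funext => z; rewrite [RHS]Ef; apply: csumZ_ext => k; rewrite add0r mulrC.
pose a k (z : M) : C := if (0 <= k)%R then circle_mode f k z.1 * cexp k z.2 else 0.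
pose fp (z : M) := csumZ (fun k => a k z).
have Ha k z : normc (a k z) <= D * wt z.1 * inv_sqr k.
  rewrite /a; case: ifP => _; first by rewrite normcM normc_cexp mulr1.
  by rewrite normc0 !mulr_ge0// ?ltW ?wt_gt0 ?inv_sqr_gt0.
have ma k : cmeas (T := ('rV[R]_n * measurableTypeR R)%type) setT (a k).
  by rewrite /a; case: (0 <= k)%R; [exact: cexp_meas|exact: cmeas_cst].
have tfp : tame fp (9 * D).
  split.
  - by apply: (@cmeas_csumZ _ _ _ setT a (fun z => D * wt z.1)) => // k z _; exact: Ha.
  - by move=> x t; congr csumZ; apply/funext => k; rewrite /a /= /cexp expi_period.
  - by move=> z; rewrite -mulrA; apply: csumZ_le => k; exact: Ha.
have mPf : cmeas (T := ('rV[R]_n * measurableTypeR R)%type) dom (Pi f).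
  by have [L _ _ _] := hPi; have [_ []] := L _ (tame_L2 tK).
have Efp : fourier (Pi f) xi m = fourier fp xi m.
  congr (_ * _); have mw : cmeas (T := ('rV[R]_n * measurableTypeR R)%type) dom (wave xi m).
    by have [w1 w2] := ccts_cmeas_M (@ccts_wave R n xi m); split; exact: measurable_funTS.
  apply: (@cintegral_ae _ _ _ (lebesgue_rV n \x leb)%E dom (@measurable_dom R n) (fun z => wave xi m z * Pi f z) (fun z => wave xi m z * fp z)).
  - exact: cmeasM.
  - by apply: cmeasM => //; exact: tame_cmeas tfp.
  - apply: filterS H => z Hz Dz; rewrite (Hz Dz); congr (_ * _).
    by apply: csumZ_ext => k; rewrite /a add0r.
have key x : circle_mode fp m x = if (0 <= m)%R then circle_mode f m x else 0.
  rewrite /circle_mode /fcoef.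
  pose b k t := a k (x, t) * expi (- (m%:~R * t)).
  have cb k : ccts (b k).
    rewrite /b /a /=; case: (0 <= k)%R; last by move=> t; under [X in ccts_at X _]eq_fun do rewrite mul0r; exact: ccts_cst.
    by apply: ccts_fcoef => t; apply: ccts_mul; [exact: ccts_cst|exact: ccts_cexp].
  have mb k : cmeas (T := measurableTypeR R) S1 (b k) := ccts_cmeas (cb k) mS1.
  have Hb k t : S1 t -> normc (b k t) <= D * wt x * inv_sqr k by move=> _; rewrite /b normcM normc_expi mulr1; exact: (Ha k (x, t)).
  rewrite (_ : cintegral leb S1 _ = cintegral leb S1 (fun t => csumZ (fun k => b k t))); last first.
    apply: cintegral_ext => t _; rewrite /fp mulrC -(@csumZM R _ _ (D * wt x)); last by move=> k; exact: (Ha k (x, t)).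
    by apply: csumZ_ext => k; rewrite /b mulrC.
  rewrite (cintegral_csumZ mS1 mb (integrable_dom_S1_cst (D * wt x)) Hb).
  have term k : ((2 * pi)^-1)%:C * cintegral leb S1 (b k) = if (0 <= k)%R then (k == m)%:R * circle_mode f k x else 0.
    rewrite /b /a /=; case: ifP => _.
      rewrite -(fcoef_expi k m) /fcoef -mulrA; congr (_ * _); rewrite mulrC.
      have b1 t : normc (@cexp R k t) <= 1 by rewrite normc_cexp.
      rewrite -(cintegralM mS1 _ (cdom_fcoef m (@ccts_cexp R k) b1)).
      by apply: cintegral_ext => t _; rewrite mulrA.
    rewrite (_ : (fun t => 0 * _) = fun=> 0) ?cintegral0 ?mulr0//; first exact: mS1.
    by apply/funext => t; rewrite mul0r.
  have := @csumZM R ((2 * pi)^-1)%:C (fun k => cintegral leb S1 (b k)) (2 * (D * wt x * (2 * pi))) _.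
  move=> <-.
    rewrite (@csumZ_single R _ m) => [|k km]; last by rewrite term (negbTE km) mul0r if_same.
    by rewrite term eqxx mul1r.
  move=> k; have Hb' t : normc (b k t) <= D * wt x * inv_sqr k by rewrite /b normcM normc_expi mulr1; exact: (Ha k (x, t)).
  apply: le_trans (cintegral_le mS1 (cdom_S1 (cb k) Hb')) _.
  by rewrite Rintegral_dom_S1_cst le_eqVlt; apply/orP; left; apply/eqP; ring.
rewrite Efp (fourierE xi m tfp) (fourierE xi m tK); case: ifP => m0.
  have E : circle_mode fp m = circle_mode f m by apply/funext => x; rewrite key m0.
  by rewrite E.
rewrite (_ : (fun x => _) = fun=> 0) ?cintegral0 ?mulr0//.
by apply/funext => x; rewrite key m0 mulr0.
Qed.

End Modes.

(** * Raising, lowering and the mismatched modes *)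

Section Commutation.
Context {R : realType} {n : nat}.
Local Notation C := R[i].
Local Notation normc := (@ComplexField.Normc.normc R).
Local Notation leb := (@lebesgue_measure R).
Local Notation S1 := (@dom_S1 R).
Local Notation mS1 := (@measurable_dom_S1 R).
Local Notation M := (RnS1 R n).
Local Notation P := ((M * M)%type : normedModType R).
Local Notation mu := (@mu_RnS1 R n).
Local Notation dom := (@dom_RnS1 R n).
Implicit Types (f : M -> C) (q : M * M -> C) (xi x : 'rV[R]_n) (m k : int).
#[local] Existing Instance ae_RnS1_filter.

Lemma test_mul_expi m f : test_function f -> test_function (mul_expi m f).
Proof. exact: test_cexpM. Qed.

Lemma test_Dtheta f : test_function f -> test_function (Dtheta f).
Proof. by move=> tf; apply: test_scale; exact: test_cderive. Qed.

Lemma fourier_scale (a : C) f xi m : test_function f -> fourier (fun z => a * f z) xi m = a * fourier f xi m.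
Proof.
move=> tf; have [K _ tK] := test_tame tf; rewrite /fourier mulrCA; congr (_ * _).
rewrite -(@cintegralM _ _ _ (lebesgue_rV n \x leb)%E dom (@measurable_dom R n) _ _ _ (tame_dom (tame_wave xi m tK))).
by apply: cintegral_ext => z _; rewrite /wave mulrCA.
Qed.

Lemma fourier_Dtheta f xi m : test_function f -> fourier (Dtheta f) xi m = (m%:~R : R)%:C * fourier f xi m.
Proof.
move=> tf; rewrite /Dtheta fourier_scale; last exact: test_cderive.
rewrite fourier_circle// mulrA; congr (_ * _).
have -> : (0 +i* m%:~R : C) = (0 +i* 1) * (m%:~R : R)%:C by apply/complex_eqP; split=> /=; ring.
by rewrite mulrA mulVf ?mul1r// eq_complex /= oner_eq0 andbF.
Qed.

Lemma fourier_mul_expi j f xi m : fourier (mul_expi j f) xi m = fourier f xi (m - j).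
Proof.
congr (_ * _); apply: cintegral_ext => z _; rewrite /mul_expi mulrA -expiD; congr (expi _ * _).
by rewrite intrB; ring.
Qed.

Lemma iter_raise (k : nat) f : test_function f -> test_function (iter k (Dtheta \o mul_expi 1) f) /\
  forall xi m, fourier (iter k (Dtheta \o mul_expi 1) f) xi m =
    (\prod_(i < k) (m%:~R - i%:R : R))%:C * fourier f xi (m - k%:Z).
Proof.
move=> tf; elim: k => [|k [tk IH]]; first by split=> // xi m; rewrite big_ord0 subr0 mul1r.
rewrite iterS /=; have te := test_mul_expi 1 tk; split; first exact: test_Dtheta.
move=> xi m; rewrite fourier_Dtheta// fourier_mul_expi IH mulrA big_ord_recl subr0.
rewrite (_ : m - 1 - k%:Z = m - k.+1%:Z); last by rewrite -addrA -opprD addrC -intS.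
congr (_ * _); rewrite (eq_bigr (fun i : 'I_k => m%:~R - (lift ord0 i)%:R : R)).
  by apply/complex_eqP; split=> /=; ring.
by move=> i _; rewrite intrB /= /bump /= add1n -natr1; ring.
Qed.

Lemma iter_lower (k : nat) f : test_function f -> test_function (iter k (mul_expi (-1) \o Dtheta) f) /\
  forall xi m, fourier (iter k (mul_expi (-1) \o Dtheta) f) xi m =
    (\prod_(i < k) (m%:~R + i.+1%:R : R))%:C * fourier f xi (m + k%:Z).
Proof.
move=> tf; elim: k => [|k [tk IH]]; first by split=> // xi m; rewrite big_ord0 addr0 mul1r.
rewrite iterS /=; have td := test_Dtheta tk; split; first exact: test_mul_expi.
move=> xi m; rewrite fourier_mul_expi opprK fourier_Dtheta// IH mulrA big_ord_recl.
rewrite (_ : m + 1 + k%:Z = m + k.+1%:Z); last by rewrite -addrA -intS.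
congr (_ * _); rewrite (eq_bigr (fun i : 'I_k => m%:~R + (lift ord0 i).+1%:R : R)).
  by apply/complex_eqP; split=> /=; rewrite ?intrD; ring.
by move=> i _; rewrite intrD /= /bump /= add1n -[i.+2%:R]natr1; ring.
Qed.

Lemma Op_mode d q k f z : classical_symbol d q -> test_function f ->
  Op (mode_symbol q k) f z = csumZ (fun m => cexp m z.2 * (cexp k z.2 * Op_term (fibre_mode q k) f m z)).
Proof.
move=> cq tf; have [c c0 [H0 Hk Hs]] := classical_modes cq.
have [K K0 HK] := Op_integrand_dom cq tf c0 H0; have i0 : 0 <= inv_sqr k :> R := ltW (inv_sqr_gt0 k).
apply: csumZ_ext => m; congr (_ * _).
have Hk' (p : M * M) : normc (fibre_mode q k p) <= c * inv_sqr k * wt p.1.1 * (1 + `|p.2|) `^ d.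
  apply: le_trans (Hk k p) _; rewrite (_ : c * inv_sqr k * wt p.1.1 * (1 + `|p.2|) `^ d = c * wt p.1.1 * (1 + `|p.2|) `^ d * inv_sqr k)//.
  by ring.
have dk := HK (c * inv_sqr k) (fibre_mode q k) (mulr_ge0 c0 i0) (classical_csmooth (fibre_mode_classical k cq)) Hk' m z.
rewrite -(cintegralM measurableT _ dk); apply: cintegral_ext => xi _.
by rewrite /Op_integrand /mode_symbol /fibre_mode /cexp /=; ring.
Qed.

Lemma circle_mode_cexp (A : 'rV[R]_n -> C) j m x : circle_mode (fun z : M => cexp j z.2 * A z.1) m x = (j == m)%:R * A x.
Proof.
rewrite -fcoef_expi /circle_mode /fcoef -mulrA; congr (_ * _); rewrite mulrC.
have b1 t : normc (@cexp R j t) <= 1 by rewrite normc_cexp.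
rewrite -(cintegralM mS1 _ (cdom_fcoef m (@ccts_cexp R j) b1)).
  by apply: cintegral_ext => t _ /=; ring.
Qed.

Lemma fourier_test_mode f m xi j : test_function f ->
  fourier (fun z => cexp m z.2 * circle_mode f m z.1) xi j = (m == j)%:R * fourier f xi m.
Proof.
move=> tf; have [K _ tK] := test_tame tf; have [K' _ tK'] := test_tame (test_circle_mode m tf).
rewrite (fourierE _ _ tK') (fourierE _ _ tK) mulrCA; congr (_ * _); case: eqP => [<-|mj].
  by rewrite mul1r; apply: cintegral_ext => x _; rewrite circle_mode_cexp eqxx mul1r.
rewrite mul0r (_ : (fun x => _) = fun=> 0) ?cintegral0//; apply/funext => x.
by rewrite circle_mode_cexp; case: eqP => [//|_]; rewrite mul0r mulr0.
Qed.

Lemma Op_fourier0 q f z : (forall xi m, fourier f xi m = 0) -> Op q f z = 0.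
Proof.
move=> f0; apply: csumZ0 => m; rewrite (_ : (fun xi => _) = fun=> 0) ?cintegral0 ?mulr0//.
by apply/funext => xi; rewrite f0 mulr0.
Qed.

(** If the mode [Op (mode_symbol q k)] factors through an operator whose
    transform vanishes on the m-th mode, the m-th term vanishes. *)
Lemma factor_vanish d q k (T : (M -> C) -> M -> C) (Qk : (M -> C) -> M -> C) f m z :
  classical_symbol d q -> is_psido Qk -> test_function f ->
  (forall f, test_function f -> test_function (T f)) ->
  (forall xi j, fourier (T (fun z => cexp m z.2 * circle_mode f m z.1)) xi j = 0) ->
  (forall f, test_function f -> Op (mode_symbol q k) f = Qk (T f)) ->
  Op_term (fibre_mode q k) f m z = 0.
Proof.
move=> cq [r _ Hr] tf tT F0 E; have th := test_circle_mode m tf.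
have := congr1 (fun F => F z) (E _ th); rewrite (Hr _ (tT _ th)) (Op_fourier0 _ _ F0) (Op_mode k z cq th).
have Z j : Op_term (fibre_mode q k) (fun z => cexp m z.2 * circle_mode f m z.1) j z = (m == j)%:R * Op_term (fibre_mode q k) f m z.
  case: eqP => [<-|mj].
    by rewrite mul1r; apply: cintegral_ext => xi _; rewrite /Op_integrand fourier_test_mode// eqxx mul1r.
  rewrite mul0r /Op_term (_ : Op_integrand _ _ _ _ = fun=> 0) ?cintegral0//; apply/funext => xi.
  by rewrite /Op_integrand fourier_test_mode//; case: eqP => [//|_]; rewrite mul0r mulr0.
rewrite (@csumZ_single R _ m) => [|j jm]; last by rewrite Z eq_sym (negbTE jm) mul0r !mulr0.
rewrite Z eqxx mul1r => /eqP; rewrite !mulf_eq0 => /orP[|/orP[|/eqP//]];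
  by rewrite (negbTE (expi_neq0 _)).
Qed.

Variables (P1 : (R -> C) -> (R -> C)) (Pi : (M -> C) -> (M -> C)).
Hypotheses (hP1 : is_szego_S1 P1) (hPi : is_szego P1 Pi).

Lemma Op_szego q f z : test_function f ->
  Op q (Pi f) z = csumZ (fun m => if (0 <= m)%R then cexp m z.2 * Op_term q f m z else 0).
Proof.
move=> tf; apply: csumZ_ext => m; case: ifP => m0.
  apply: (congr1 (fun c => cexp m z.2 * c)); apply: cintegral_ext => xi _.
  by rewrite (fourier_szego hP1 hPi xi m tf) m0.
rewrite (_ : (fun xi => _) = fun=> 0) ?cintegral0 ?mulr0//; apply/funext => xi.
by rewrite (fourier_szego hP1 hPi)// m0 mulr0.
Qed.

Definition mismatch k m := (0 <= m + k)%R != (0 <= m)%R.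

(** Once the mismatched terms are gone, the projector keeps or kills the m-th
    term of [Op q f] as a whole, by the sign of m; applied to f first, it does
    the same to the m-th Fourier coefficient. *)
Lemma commute_of_vanish d q f : classical_symbol d q -> test_function f ->
  (forall k m z, mismatch k m -> Op_term (fibre_mode q k) f m z = 0) ->
  eq_RnS1 (Op q (Pi f)) (Pi (Op q f)).
Proof.
move=> cq tf V; have [D D0 [_ _ c2 B2 E]] := Op_expansion cq tf.
have H m : eq_RnS1 (Pi (fun z => cexp m z.2 * Op_term q f m z)) (fun z => if (0 <= m)%R then cexp m z.2 * Op_term q f m z else 0).
  have := szego_Op_term hP1 hPi m cq tf; apply: filterS => z Hz Dz; rewrite (Hz Dz).
  case: (boolP (0 <= m)%R) => m0.
    rewrite E -(@csumZM R _ _ (D * wt z.1 * inv_sqr m)).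
      apply: csumZ_ext => k; rewrite cexpD; case: ifP => mk; first by rewrite -[Op_term _ _ _ (z.1, 0)]/(Op_term (fibre_mode q k) f m z); ring.
      by rewrite V ?mulr0// /mismatch mk m0.
    by move=> k; rewrite normcM normc_cexp mul1r mulrAC; exact: B2.
  apply: csumZ0 => k; case: ifP => // mk.
  by rewrite V ?mul0r// /mismatch mk (negbTE m0).
have := tame_Op hPi cq tf H; apply: filterS => z Hz Dz.
by rewrite (Hz Dz) Op_szego.
Qed.

End Commutation.

(** * Invariant factors of the modes *)

Section Factorization.
Context {R : realType} {n : nat}.
Local Notation C := R[i].
Local Notation normc := (@ComplexField.Normc.normc R).
Local Notation leb := (@lebesgue_measure R).
Local Notation S1 := (@dom_S1 R).
Local Notation mS1 := (@measurable_dom_S1 R).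
Local Notation M := (RnS1 R n).
Implicit Types (f : M -> C) (q : M * M -> C) (xi x : 'rV[R]_n) (m : int).

Lemma raise_vanish d q (k : nat) (Qk : (M -> C) -> M -> C) f m z : classical_symbol d q -> is_psido Qk -> test_function f ->
  mismatch k%:Z m -> (forall f, test_function f -> Op (mode_symbol q k%:Z) f = Qk (iter k (Dtheta \o mul_expi 1) f)) ->
  Op_term (fibre_mode q k%:Z) f m z = 0.
Proof.
move=> cq pQ tf mk E; apply: (factor_vanish (T := fun g => iter k (Dtheta \o mul_expi 1) g) z cq pQ tf _ _ E).
  by move=> g tg; case: (iter_raise k tg).
move=> xi j; have [_ ->] := iter_raise k (test_circle_mode m tf); rewrite fourier_test_mode//.
case: eqP => [mj|_]; last by rewrite mul0r mulr0.
(* j runs over 0, .., k - 1, where the product has a zero factor *)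
have j0 : (0 <= j) && (j < k%:Z).
  by move: mk; rewrite /mismatch mj; case: (lerP 0 (j - k%:Z + k%:Z)); case: (lerP 0 (j - k%:Z)) => //=; lia.
have [i ij] : exists i : 'I_k, j%:~R - (i : nat)%:R = 0 :> R.
  case: j j0 {mj} => [j'|j'] j0; last by move: j0; lia.
  have jk : (j' < k)%N by move: j0; lia.
  by exists (Ordinal jk); rewrite -pmulrn subrr.
by rewrite (bigD1 i)//= ij mul0r; exact: mul0r.
Qed.

Lemma lower_vanish d q (k : nat) (Qk : (M -> C) -> M -> C) f m z : classical_symbol d q -> is_psido Qk -> test_function f ->
  mismatch (- k%:Z) m -> (forall f, test_function f -> Op (mode_symbol q (- k%:Z)) f = Qk (iter k (mul_expi (-1) \o Dtheta) f)) ->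
  Op_term (fibre_mode q (- k%:Z)) f m z = 0.
Proof.
move=> cq pQ tf mk E; apply: (factor_vanish (T := fun g => iter k (mul_expi (-1) \o Dtheta) g) z cq pQ tf _ _ E).
  by move=> g tg; case: (iter_lower k tg).
move=> xi j; have [_ ->] := iter_lower k (test_circle_mode m tf); rewrite fourier_test_mode//.
case: eqP => [mj|_]; last by rewrite mul0r mulr0.
have j0 : (j < 0) && (- k%:Z <= j).
  by move: mk; rewrite /mismatch mj; case: (lerP 0 (j + k%:Z - k%:Z)); case: (lerP 0 (j + k%:Z)) => //=; lia.
have [i ij] : exists i : 'I_k, j%:~R + (i : nat).+1%:R = 0 :> R.
  case: j j0 {mj} => [j'|j'] j0; first by move: j0; lia.
  have jk : (j' < k)%N by move: j0; lia.
  by exists (Ordinal jk); rewrite NegzE intrN -pmulrn addNr.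
by rewrite (bigD1 i)//= ij mul0r; exact: mul0r.
Qed.

Lemma fcoef_csumZ (b : int -> C) (D : R) m : (forall k, normc (b k) <= D * inv_sqr k) ->
  fcoef (fun t => csumZ (fun k => cexp k t * b k)) m = b m.
Proof.
move=> Hb; pose a k t := cexp k t * b k * expi (- (m%:~R * t)).
have ca k : ccts (fun t => cexp k t * b k) by move=> t; apply: ccts_mul; [exact: ccts_cexp|exact: ccts_cst].
have cb k : ccts (a k) by exact: ccts_fcoef (ca k).
have mb k : cmeas (T := measurableTypeR R) S1 (a k) := ccts_cmeas (cb k) mS1.
have Ha k t : normc (a k t) <= D * inv_sqr k by rewrite /a !normcM normc_expi mulr1 normc_cexp mul1r.
have Ha' k t : S1 t -> normc (a k t) <= D * inv_sqr k by move=> _.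
rewrite /fcoef (_ : cintegral leb S1 _ = cintegral leb S1 (fun t => csumZ (fun k => a k t))); last first.
  apply: cintegral_ext => t _; rewrite mulrC -(@csumZM R _ _ D); last by move=> k; rewrite normcM normc_cexp mul1r.
  by apply: csumZ_ext => k; rewrite /a mulrC.
rewrite (cintegral_csumZ mS1 mb (integrable_dom_S1_cst D) Ha').
have term k : ((2 * pi)^-1)%:C * cintegral leb S1 (a k) = (k == m)%:R * b k.
  rewrite -(fcoef_expi k m) /fcoef -mulrA; congr (_ * _); rewrite mulrC.
  have b1 t : normc (@cexp R k t) <= 1 by rewrite normc_cexp.
  rewrite -(cintegralM mS1 _ (cdom_fcoef m (@ccts_cexp R k) b1)).
  by apply: cintegral_ext => t _; rewrite /a; ring.
rewrite -(@csumZM R _ _ (2 * (D * (2 * pi)))).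
  rewrite (@csumZ_single R _ m) => [|k km]; last by rewrite term (negbTE km) mul0r.
  by rewrite term eqxx mul1r.
move=> k; apply: le_trans (cintegral_le mS1 (cdom_S1 (cb k) (Ha k))) _.
by rewrite Rintegral_dom_S1_cst le_eqVlt; apply/orP; left; apply/eqP; ring.
Qed.

Lemma rotate_test (a : R) f : test_function f -> test_function (rotate a f).
Proof.
move=> [sf pf [K cK K0]]; split; last by exists K => // x t Kx; exact: K0.
  apply/csmoothP; apply: (@csmooth_comp R M M (fun z : M => (z.1, z.2 + a)) id f).
  - by move=> v z h; rewrite /= -addrA.
  - move=> z; apply: (@cts_pair _ _ _ (fun z : M => z.1) (fun z : M => z.2 + a) z); first exact: cvg_fst.
    by apply: cvgD; [exact: cvg_snd|exact: cvg_cst].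
  - exact/csmoothP.
by move=> x t; rewrite /rotate /= addrAC pf.
Qed.

Lemma circle_mode_rotate f m x (a : R) : test_function f -> circle_mode (rotate a f) m x = cexp m a * circle_mode f m x.
Proof.
move=> tf; have [D D0 [HD Ef]] := circle_mode_decay tf.
rewrite {1}/circle_mode (_ : (fun t => rotate a f (x, t)) = (fun t => csumZ (fun k => cexp k t * (cexp k a * circle_mode f k x)))).
  by rewrite (@fcoef_csumZ _ (D * wt x))// => k; rewrite normcM normc_cexp mul1r; exact: HD.
by apply/funext => t; rewrite /rotate /= Ef /=; apply: csumZ_ext => k; rewrite /cexp mulrDr expiD mulrA.
Qed.

Lemma fourier_rotate f xi m (a : R) : test_function f -> fourier (rotate a f) xi m = cexp m a * fourier f xi m.
Proof.
move=> tf; have [K _ tK] := test_tame tf; have [K' _ tK'] := test_tame (rotate_test a tf).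
have [_ _ HK] := tK.
rewrite (fourierE _ _ tK') (fourierE _ _ tK) mulrCA; congr (_ * _).
rewrite -(cintegralM measurableT _ (circle_mode_dom xi m (test_csmooth tf) HK)).
by apply: cintegral_ext => x _; rewrite circle_mode_rotate// mulrCA.
Qed.

(** A rotation multiplies each Fourier coefficient by the phase that it
    produces in the exponential of that frequency. *)
Lemma Op_theta_indep d (r : M * M -> C) : classical_symbol d r -> theta_indep r -> @S1_invariant R n (Op r).
Proof.
move=> cr tr a f tf; apply/funext => -[x t]; have [c c0 [H0 _ _]] := classical_modes cr.
have [K K0 HK] := Op_integrand_dom cr tf c0 H0; have sr := classical_csmooth cr.
rewrite [RHS]/rotate !OpE; apply: csumZ_ext => m.
have -> : Op_term r (rotate a f) m (x, t) = cexp m a * Op_term r f m (x, t + a).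
  rewrite /Op_term -(cintegralM measurableT _ (HK c r c0 sr H0 m (x, t + a))); apply: cintegral_ext => xi _.
  by rewrite /Op_integrand fourier_rotate// (tr x (t + a) t) /=; ring.
by rewrite mulrA /cexp /= mulrDr expiD.
Qed.

Lemma csumZ_shiftz (F : int -> C) (K : R) (j : int) : (forall m, normc (F m) <= K * inv_sqr m) ->
  csumZ (fun m => F (m - j)) = csumZ F.
Proof.
case: j => j HF; first exact: csumZ_shift HF.
rewrite -(csumZ_shift_neg j.+1 HF); apply: csumZ_ext => m.
by rewrite NegzE opprK.
Qed.

(** When the j-th mode of the symbol vanishes at the integer frequencies
    [c i], dividing it by the product of the [s - c i] and translating s by j
    gives the symbol of the invariant factor. *)
Lemma mode_factor d q (j : int) (k : nat) (T : (M -> C) -> M -> C) (c : 'I_k -> int) :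
  injective c -> classical_symbol d q ->
  (forall f, test_function f -> test_function (T f) /\ forall xi m, fourier (T f) xi m =
     (\prod_(i < k) ((m - j - c i)%:~R : R))%:C * fourier f xi (m - j)) ->
  (forall i z xi, fibre_mode q j (z, (xi, (c i)%:~R)) = 0) ->
  exists Q : (M -> C) -> M -> C, [/\ is_psido Q, S1_invariant Q &
    forall f, test_function f -> Op (mode_symbol q j) f = Q (T f)].
Proof.
move=> ic cq HT V; have cf := fibre_mode_classical j cq.
pose cs := [seq ((c i)%:~R : R) | i <- index_enum 'I_k].
have ucs : uniq cs by rewrite map_inj_uniq ?index_enum_uniq// => i i' /intr_inj /ic.
have vcs (p : M * M) : p.2.2 \in cs -> fibre_mode q j p = 0.
  by case: p => z [xi s] /= /mapP[i _ ->]; exact: V.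
have [d' [r [cr tr Er]]] := symbol_division_seq ucs cf (@theta_indep_fibre_mode _ _ q j) vcs.
pose r' := r \o shift_s (- (j%:~R)).
have cr' : classical_symbol d' r' by exact: symbol_shift.
have r'E z xi s : r' (z, (xi, s)) = r (z, (xi, s - j%:~R)) by rewrite /r' /= shift_sE.
exists (Op r'); split.
- by exists r' => //; exists d'.
- by apply: (Op_theta_indep cr') => x t t' [xi s]; rewrite !r'E; exact: tr.
move=> f tf; apply/funext => z; have [tT FT] := HT f tf.
have [D D0 [_ _ _ B2 _]] := Op_expansion cq tf.
rewrite (Op_mode j z cq tf) [RHS]OpE.
pose H m := cexp m z.2 * (cexp j z.2 * Op_term (fibre_mode q j) f m z).
have HB m : normc (H m) <= D * wt z.1 * inv_sqr j * inv_sqr m by rewrite /H !normcM !normc_cexp !mul1r; exact: B2.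
rewrite -[LHS]/(csumZ H) -(csumZ_shiftz j HB).
apply: csumZ_ext => m; rewrite /H mulrA -cexpD subrK.
apply: (congr1 (fun c => cexp m z.2 * c)).
apply: cintegral_ext => xi _; rewrite /Op_integrand FT r'E Er /= big_map.
have -> : \prod_(i <- index_enum 'I_k) ((m - j)%:~R - (c i)%:~R : R) = \prod_(i < k) ((m - j - c i)%:~R : R).
  by apply: eq_bigr => i _; rewrite [RHS]intrB.
by rewrite -intrB; ring.
Qed.

End Factorization.

(** * Commutation forces the mismatched modes to vanish *)

Section Injectivity.
Context {R : realType}.
Local Notation C := R[i].
Local Notation normc := (@ComplexField.Normc.normc R).
Local Notation leb := (@lebesgue_measure R).

Lemma csmooth_prod (V : normedModType R) (I : Type) (s : seq I) (F : I -> V -> C) :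
  (forall i, csmooth (F i)) -> csmooth (fun x => \prod_(i <- s) F i x).
Proof.
move=> sF; elim: s => [|i s IH].
  rewrite (_ : (fun x => _) = fun=> 1); last by apply/funext => x; rewrite big_nil.
  by split; apply: rsmooth_cst; exact: openT.
rewrite (_ : (fun x => _) = fun x => F i x * \prod_(j <- s) F j x); last by apply/funext => x; rewrite big_cons.
exact: csmoothM.
Qed.

Lemma box_compact n (L : 'I_n -> R) : compact [set x : 'rV[R]_n | forall i, `|x ord0 i| <= L i].
Proof.
have := @rV_compact R n (fun i => [set t | `|t| <= L i]).
apply => i; rewrite (_ : [set t | _] = `[- L i, L i]%classic); first exact: segment_compact.
by apply/seteqP; split=> t /=; rewrite in_itv /= ler_norml.
Qed.

Lemma test_product n (phi : 'I_n -> R -> C) m : (forall i, cc (phi i)) ->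
  test_function (fun z : RnS1 R n => cexp m z.2 * \prod_(i < n) phi i (z.1 ord0 i)).
Proof.
move=> cp; apply: (@test_cexpM R n m (fun z => \prod_(i < n) phi i (z.1 ord0 i))).
have [L HL] := choice (fun i => ltac:(have [_ [l l0 Hl]] := cp i; exists l; exact: (conj l0 Hl)) : exists l : R, 0 <= l /\ forall t, l < `|t| -> phi i t = 0).
split.
- apply/csmoothP; apply: csmooth_prod => i.
  apply: (@csmooth_comp R (RnS1 R n) R (fun z : RnS1 R n => z.1 ord0 i) (fun z : RnS1 R n => z.1 ord0 i) (phi i)).
  + by move=> v z h; rewrite /= !mxE.
  + move=> z; apply: (@continuous_comp _ _ _ (fun z : RnS1 R n => z.1) (fun x : 'rV[R]_n => x ord0 i)); [exact: cvg_fst|exact: coord_continuous].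
  + by case: (cp i).
- by [].
- exists [set x | forall i, `|x ord0 i| <= L i]; first exact: box_compact.
  move=> x t nK; have [i Hi] : exists i, L i < `|x ord0 i|.
    by apply: contrapT => H; apply: nK => i; rewrite leNgt; apply/negP => Li; apply: H; exists i.
  by rewrite (bigD1 i)//= (HL i).2// mul0r.
Qed.

Lemma normc_prod (I : Type) (s : seq I) (F : I -> C) : normc (\prod_(i <- s) F i) = \prod_(i <- s) normc (F i).
Proof.
elim: s => [|i s IH]; first by rewrite !big_nil (_ : (1 : C) = 1%:C)// normc_real normr1.
by rewrite !big_cons normcM IH.
Qed.

Lemma ccts_product n (g : 'I_n -> R -> C) : (forall i, ccts (g i)) ->
  ccts (fun x : 'rV[R]_n => \prod_(i < n) g i (x ord0 i)).
Proof.
move=> cg y; elim: (index_enum _) => [|i s IHs].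
  by rewrite (_ : (fun x => _) = fun=> 1); [exact: ccts_cst|apply/funext => x; rewrite big_nil].
rewrite (_ : (fun x => _) = fun x : 'rV[R]_n => g i (x ord0 i) * \prod_(j <- s) g j (x ord0 j)); last by apply/funext => x; rewrite big_cons.
apply: ccts_mul => //; apply: (@ccts_comp _ 'rV[R]_n R (fun x : 'rV[R]_n => x ord0 i) (g i) _ (cg i)).
exact: coord_continuous.
Qed.

Lemma cdom_product n (g : 'I_n -> R -> C) (K : 'I_n -> R) : (forall i, ccts (g i)) ->
  (forall i t, normc (g i t) <= K i * (jap t)^-1) ->
  cdom (lebesgue_rV n) setT (fun x => \prod_(i < n) g i (x ord0 i)) (fun x => (\prod_(i < n) K i) * wt x).
Proof.
move=> cg Hg; split; first by apply: ccts_cmeas_rV; exact: ccts_product.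
  by have := integrableZl measurableT (\prod_(i < n) K i) (@integrable_wt R n); apply: eq_integrable.
move=> x _; rewrite normc_prod /wt -big_split /=; apply: ler_prod => i _.
by rewrite normc_ge0; exact: Hg.
Qed.

Lemma cintegral_product n (g : 'I_n -> R -> C) (K : 'I_n -> R) : (forall i, ccts (g i)) ->
  (forall i t, normc (g i t) <= K i * (jap t)^-1) ->
  cintegral (lebesgue_rV n) setT (fun x => \prod_(i < n) g i (x ord0 i)) = \prod_(i < n) cintegral leb setT (g i).
Proof.
elim: n => [|n IH] in g K *; first by rewrite cintegral_rV0 !big_ord0.
move=> cg Hg; pose K' i := K (lift ord0 i); pose g' i := g (lift ord0 i).
have K0 i : 0 <= K i by have := le_trans (normc_ge0 _) (Hg i 0); rewrite pmulr_lge0// invr_gt0 jap_gt0.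
have E t (y : 'rV[R]_n) : \prod_(i < n.+1) g i (rV_cons (t, y) ord0 i) = g ord0 t * \prod_(i < n) g' i (y ord0 i).
  by rewrite big_ord_recl rV_cons0; congr (_ * _); apply: eq_bigr => i _; rewrite rV_consS.
have dX := cdom_product (fun i => cg (lift ord0 i)) (fun i => Hg (lift ord0 i)).
have u0 (t : R) : 0 <= K ord0 * (jap t)^-1 by rewrite mulr_ge0// invr_ge0 ltW// jap_gt0.
have v0 (y : 'rV[R]_n) : 0 <= (\prod_(i < n) K' i) * wt y.
  by rewrite mulr_ge0 ?(ltW (wt_gt0 _))//; apply: prodr_ge0 => i _; exact: K0.
have iv : (lebesgue_rV n).-integrable setT (EFin \o (fun y : 'rV[R]_n => (\prod_(i < n) K' i) * wt y)) by case: dX.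
have Hb t (y : 'rV[R]_n) : normc (\prod_(i < n.+1) g i (rV_cons (t, y) ord0 i)) <= K ord0 * (jap t)^-1 * ((\prod_(i < n) K' i) * wt y).
  rewrite E normcM; apply: ler_pM; rewrite ?normc_ge0 ?Hg//.
  by case: dX => _ _ H; exact: H.
have [-> _] := cintegral_rVS (ccts_cmeas_rV (ccts_product cg)) u0 v0 (integrable_japV (K ord0)) iv Hb.
rewrite big_ord_recl -(IH g' K' (fun i => cg (lift ord0 i)) (fun i => Hg (lift ord0 i))) mulrC.
rewrite -(cintegralM measurableT _ (cdom_line (cg ord0) (Hg ord0))); apply: cintegral_ext => t _.
rewrite mulrC -(cintegralM measurableT _ dX); apply: cintegral_ext => y _; exact: E.
Qed.

Lemma expi_dotp n (x xi : 'rV[R]_n) : expi (- dotp x xi) = \prod_(i < n) expi (- xi ord0 i * x ord0 i) :> C.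
Proof.
rewrite /dotp -sumrN (big_morph _ (@expiD R) (@expi0 R)); apply: eq_bigr => i _.
by congr expi; ring.
Qed.

Lemma fourier_product n (phi : 'I_n -> R -> C) m j xi : (forall i, cc (phi i)) ->
  fourier (fun z : RnS1 R n => cexp m z.2 * \prod_(i < n) phi i (z.1 ord0 i)) xi j =
  (m == j)%:R * ((((2 * pi)^-1) ^+ n)%:C * \prod_(i < n) ftr (phi i) (xi ord0 i)).
Proof.
move=> cp; have [K _ tK] := test_tame (test_product m cp).
rewrite (fourierE _ _ tK) [RHS]mulrCA; congr (_ * _).
pose g i t := expi (- xi ord0 i * t) * phi i t.
have [L HL] := choice (fun i => ltac:(have [l l0 Hl] := cc_bound (cp i); exists l; exact: Hl) : exists l : R, forall t, normc (phi i t) <= l * (jap t)^-1).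
have cg i : ccts (g i) by move=> t; apply: ccts_mul; [exact: ccts_wave1|exact: csmooth_ccts (cp i).1 t].
have Hg i t : normc (g i t) <= L i * (jap t)^-1 by rewrite /g normcM normc_expi mul1r.
rewrite -[X in _ * X]/(\prod_(i < n) cintegral leb setT (g i)) -(cintegral_product cg Hg).
rewrite -(cintegralM measurableT _ (cdom_product cg Hg)); apply: cintegral_ext => x _.
rewrite (@circle_mode_cexp R n (fun x => \prod_(i < n) phi i (x ord0 i)) m j x) mulrCA; congr (_ * _).
by rewrite expi_dotp -big_split.
Qed.

Section Vanishing.
Variable n : nat.
Local Notation M := (RnS1 R n).
Local Notation P := ((M * M)%type : normedModType R).
Local Notation mu := (@mu_RnS1 R n).
Local Notation dom := (@dom_RnS1 R n).
Local Notation S1 := (@dom_S1 R).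
Implicit Types (f : M -> C) (q : M * M -> C) (xi x : 'rV[R]_n) (m k : int).
#[local] Existing Instance ae_RnS1_filter.

(** At the ends of the fundamental domain only half of a small interval in theta
    is available, which is still of positive length. *)
Lemma ae_continuous_eq0 (h : M -> C) : ccts h -> eq_RnS1 h (fun=> 0) -> forall z, dom z -> h z = 0.
Proof.
move=> ch ah [x t] [_ /=]; rewrite /dom_S1 /= in_itv /= => /andP[t0 t1].
apply/eqP; apply: contrapT => /negP n0.
have p0 : 0 < normc (h (x, t)) by rewrite lt_neqAle normc_ge0 andbT eq_sym; apply: contra n0 => /eqP/normc_eq0 ->.
have e0 : 0 < normc (h (x, t)) / 2 by rewrite divr_gt0.
have /nbhs_ballP[r /= r0 Hr] := ccts_dist (ch (x, t)) e0.
have nz z : ball (x, t) r z -> h z != 0.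
  by move=> /Hr H; apply/eqP => h0; move: H; rewrite /= h0 sub0r normcN; lra.
have r2 : 0 < r / 2 by rewrite divr_gt0.
pose B := [set y : 'rV[R]_n | forall i, `|y ord0 i - x ord0 i| <= r / 2].
pose lo := Num.max (t - r / 2) 0; pose hi := Num.min (t + r / 2) (2 * pi).
have lohi : lo < hi.
  by have pp := @twopi_gt0 R; rewrite /lo /hi gt_max !lt_min; apply/andP; split; apply/andP; split; lra.
have [N [mN N0 sN]] := ah.
have sub : B `*` `[lo, hi]%classic `<=` N.
  move=> [y s] [/= By]; rewrite in_itv /= /lo /hi ge_max le_min => /andP[/andP[s1 s2] /andP[s3 s4]].
  apply: sN => /= H; have : h (y, s) != 0.
    apply: nz; split=> /=; last by rewrite /ball /= ltr_norml; apply/andP; split; lra.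
    by split=> // a i; rewrite ord1 /ball /= distrC; apply: le_lt_trans (By i) _; lra.
  by rewrite H ?eqxx//; split=> //=; rewrite /dom_S1 /= in_itv /=; apply/andP.
have [mB B0] := ball_rV_gt0 x r2.
have mI : measurable (`[lo, hi]%classic : set (measurableTypeR R)) by exact: measurable_itv.
have : (mu (B `*` `[lo, hi]%classic) <= mu N)%E.
  by apply: le_measure; rewrite ?inE//; exact: measurableX.
rewrite N0 /mu_RnS1 product_measure1E// [X in (_ * X)%E]lebesgue_measure_itv /= lte_fin lohi -EFinB.
by rewrite leNgt => /negP; apply; rewrite mule_gt0// lte_fin subr_gt0.
Qed.

Variables (P1 : (R -> C) -> (R -> C)) (Pi : (M -> C) -> (M -> C)).
Hypotheses (hP1 : is_szego_S1 P1) (hPi : is_szego P1 Pi).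

(** On a function with the single frequency m the two sides of the commutation
    relation keep different modes exactly when the k-th one is mismatched;
    Fourier series in theta then separate the modes. *)
Lemma commuting_modes_vanish d q m k f : classical_symbol d q -> test_function f ->
  (forall xi j, j != m -> fourier f xi j = 0) ->
  eq_RnS1 (Op q (Pi f)) (Pi (Op q f)) -> mismatch k m ->
  forall x, Op_term (fibre_mode q k) f m (x, 0) = 0.
Proof.
move=> cq tf f0 cm mk x; have [D D0 [c1 B1 c2 B2 E]] := Op_expansion cq tf.
have T0 j z : j != m -> Op_term q f j z = 0.
  move=> jm; rewrite /Op_term (_ : Op_integrand _ _ _ _ = fun=> 0) ?cintegral0//; apply/funext => xi.
  by rewrite /Op_integrand f0// mulr0.
have bT : true%:R = 1 :> C by []. have bF : false%:R = 0 :> C by [].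
pose c : C := (0 <= m)%R%:R.
pose e (k : int) : C := (0 <= m + k)%R%:R - c.
pose b k z := cexp k z.2 * (e k * Op_term (fibre_mode q k) f m z).
have n1 : normc (1 : C) = 1 by rewrite (_ : (1 : C) = 1%:C)// normc_real normr1.
have p1 (B : bool) : normc (B%:R : C) <= 1 by case: B; rewrite ?bT ?bF ?n1 ?normc0.
have e1 j : normc (e j) <= 1.
  by rewrite /e /c; case: (0 <= m + j)%R; case: (0 <= m)%R; rewrite ?bT ?bF ?subrr ?subr0 ?sub0r ?normcN ?normc0 ?n1.
have bd (a : C) j z : normc a <= 1 -> normc (a * Op_term (fibre_mode q j) f m z) <= D * wt z.1 * inv_sqr j.
  move=> a1; rewrite normcM -[leRHS]mul1r; apply: ler_pM; rewrite ?normc_ge0//.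
  apply: le_trans (B2 j m z) _; rewrite -[leRHS]mulr1 ler_wpM2l ?inv_sqr_le1//.
  by rewrite !mulr_ge0// ?ltW ?wt_gt0 ?inv_sqr_gt0.
have Bb j z : normc (b j z) <= D * wt z.1 * inv_sqr j.
  by rewrite /b normcM normc_cexp mul1r; exact: bd.
pose h z := csumZ (fun j => b j z).
have ch : ccts h.
  move=> z; apply: (@ccts_csumZ R M b D z) => [j y|j].
    apply: le_trans (Bb j y) _; rewrite ler_wpM2r ?(ltW (inv_sqr_gt0 _))//.
    by rewrite -[leRHS]mulr1 ler_wpM2l// wt_le1.
  apply: ccts_mul; last by apply: ccts_mul; [exact: ccts_cst|exact: c2].
  by apply: (@ccts_comp R M R (fun z : M => z.2) (cexp j) _ (@ccts_cexp R j) z) => y; exact: cvg_snd.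
have ah : eq_RnS1 h (fun=> 0).
  have EO : Op q f = (fun z => cexp m z.2 * Op_term q f m z).
    by apply/funext => z; rewrite OpE (@csumZ_single R _ m)// => j jm; rewrite T0// mulr0.
  have H1 := szego_Op_term hP1 hPi m cq tf; rewrite -EO in H1.
  apply: filterS2 cm H1 => z Hc H1 Dz; have := Hc Dz; rewrite (H1 Dz) (Op_szego hP1 hPi)//.
  rewrite (@csumZ_single R _ m) => [|j jm]; last by rewrite T0// mulr0 if_same.
  pose Q j := cexp j z.2 * Op_term (fibre_mode q j) f m z.
  pose S j : C := (0 <= m + j)%R%:R * Q j.
  have QB j : normc (Q j) <= D * wt z.1 * inv_sqr j.
    by rewrite /Q normcM normc_cexp mul1r; have := bd 1 j z; rewrite n1 mul1r; exact.
  have SB j : normc (S j) <= D * wt z.1 * inv_sqr j.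
    by rewrite /S /Q mulrCA normcM normc_cexp mul1r; exact: bd.
  have -> : csumZ (fun j => if (0 <= m + j)%R then Op_term (fibre_mode q j) f m (z.1, 0) * cexp (m + j) z.2 else 0) = cexp m z.2 * csumZ S.
    rewrite -(csumZM _ SB); apply: csumZ_ext => j; rewrite /S /Q cexpD; case: ifP => _.
      by rewrite -[Op_term _ _ _ (z.1, 0)]/(Op_term (fibre_mode q j) f m z) bT; ring.
    by rewrite bF mul0r mulr0.
  have -> : (if (0 <= m)%R then cexp m z.2 * Op_term q f m z else 0) = cexp m z.2 * (c * csumZ Q).
    by rewrite E /c; case: (0 <= m)%R; rewrite ?bT ?mul1r// bF mul0r mulr0.
  move=> /(mulfI (expi_neq0 _)) HQ.
  rewrite /h (_ : (fun j => b j z) = fun j => - c * Q j + S j); last by apply/funext => j; rewrite /b /e /S /Q; ring.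
  by rewrite (csumZ_lin _ QB SB) -HQ mulNr addNr.
have h0 t : S1 t -> h (x, t) = 0 by move=> St; apply: (ae_continuous_eq0 ch ah); split.
have := @fcoef_csumZ R (fun j => e j * Op_term (fibre_mode q j) f m (x, 0)) (D * wt x) k (fun j => bd _ j (x, 0) (e1 j)).
rewrite (fcoef_ext (h := fun=> 0) k h0) /fcoef (_ : (fun t => 0 * _) = fun=> 0); last by apply/funext => t; rewrite mul0r.
rewrite cintegral0 ?mulr0; last exact: measurable_dom_S1.
move=> /esym/eqP; rewrite mulf_eq0 => /orP[|/eqP//].
move: mk; rewrite /mismatch /e /c; case: (0 <= m + k)%R; case: (0 <= m)%R => //= _.
  by rewrite bT bF subr0 oner_eq0.
by rewrite bT bF sub0r oppr_eq0 oner_eq0.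
Qed.

Lemma sum_sqr_le_prod (s : seq 'I_n) xi : 1 + \sum_(i <- s) xi ord0 i ^+ 2 <= \prod_(i <- s) jap (xi ord0 i).
Proof.
elim: s => [|i s IH]; first by rewrite !big_nil addr0.
rewrite !big_cons; have S0 : 0 <= \sum_(i <- s) xi ord0 i ^+ 2 by apply: sumr_ge0 => j _; exact: sqr_ge0.
apply: le_trans (ler_wpM2l (ltW (jap_gt0 _)) IH); rewrite /jap.
have := mulr_ge0 (sqr_ge0 (xi ord0 i)) S0; lra.
Qed.

(** The vanishing terms are the pairings of [q_k e^{i x.xi}] with transforms of
    test functions; those of products of bumps already separate. *)
Lemma commuting_symbol_vanish d q k m : (0 < n)%N -> classical_symbol d q ->
  (forall f, test_function f -> eq_RnS1 (Op q (Pi f)) (Pi (Op q f))) -> mismatch k m ->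
  forall z xi, fibre_mode q k (z, (xi, m%:~R)) = 0.
Proof.
move=> n0 cq cm mk [x t] xi; rewrite (@theta_indep_fibre_mode _ _ q k x t 0).
apply/eqP; apply: contrapT => /negP nz.
pose i0 := Ordinal n0; pose dl : 'rV[R]_n := delta_mx ord0 i0.
have cf := fibre_mode_classical k cq; have sf := classical_csmooth cf.
(* the symbol itself, along a line in the base, is the bump that the density
   argument needs *)
pose b (s : R) := fibre_mode q k ((x + s *: dl, 0), (xi, m%:~R)).
have b0 : b 0 != 0 by rewrite /b scale0r addr0.
have cb : cc b.
  split.
    apply: (@csmooth_comp R R P (fun s : R => (((x + s *: dl, 0), (xi, m%:~R)) : M * M)) (fun v : R => (((v *: dl, 0), (0, 0)) : M * M)) _ _ _ sf).
    - move=> v a h; rewrite -[RHS]/(((h *: (v *: dl) + (x + a *: dl), h *: 0 + 0), (h *: 0 + xi, h *: 0 + m%:~R)) : M * M).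
      by rewrite !scaler0 !add0r scalerA scalerDl addrCA.
    - move=> s; apply: (@cts_pair _ _ _ (fun s : R => (x + s *: dl, 0) : M) (fun=> (xi, m%:~R) : M) s); last exact: cvg_cst.
      apply: (@cts_pair _ _ _ (fun s : R => x + s *: dl) (fun=> 0 : R) s); last exact: cvg_cst.
      by apply: cvgD; [exact: cvg_cst|apply: cvgZl; exact: cvg_id].
  have [_ _ [K cK HK] _] := cf; have [w w0 Hw] := weight_compact cK.
  exists (`|x ord0 i0| + w); first by rewrite addr_ge0.
  move=> s Ls; apply: HK => Ks; have := Hw _ Ks.
  rewrite /wt (bigD1 i0)//= => H.
  have : (w : R) * (1 + (x ord0 i0 + s) ^+ 2)^-1 < 1.
    rewrite ltr_pdivrMr ?ltr_pwDl ?sqr_ge0// mul1r.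
    have : w < `|x ord0 i0 + s|.
      have := ler_normB (x ord0 i0 + s) (x ord0 i0); rewrite addrAC subrr add0r; lra.
    by rewrite -(real_normK (num_real (x ord0 i0 + s))) => ws; nra.
  apply/negP; rewrite -leNgt; apply: le_trans H _; rewrite ler_wpM2l//.
  have -> : (x + s *: dl) ord0 i0 = x ord0 i0 + s by rewrite /dl !mxE !eqxx /= mulr1.
  rewrite -[leRHS]mulr1 ler_wpM2l ?invr_ge0 ?addr_ge0 ?sqr_ge0//.
  by apply: prodr_ile1 => i _; rewrite (ltW (oneDsqrV_gt0 _)) invf_le1 ?ler_wpDr ?sqr_ge0// ltr_pwDl// sqr_ge0.
pose G eta := fibre_mode q k ((x, 0), (eta, m%:~R)) * expi (dotp x eta).
have cG : ccts G.
  move=> eta; apply: ccts_mul; first exact: (ccts_slice (x, 0) m sf).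
  by have := @ccts_plane R n x eta; under eq_fun do rewrite dotpC.
have [c c0 [_ Hk _]] := classical_modes cq.
pose N := Num.bound `|d|.
pose A : R := c * (4 * (1 + m%:~R ^+ 2)) ^+ N.
have m1 : 0 <= 1 + m%:~R ^+ 2 :> R by rewrite addr_ge0// sqr_ge0.
have HG eta : normc (G eta) <= A * \prod_(i < n) jap (eta ord0 i) ^+ N.
  rewrite /G normcM normc_expi mulr1; apply: le_trans (Hk k _) _ => /=.
  have r1 : 1 <= 1 + `|(eta, m%:~R : R)| by rewrite lerDl.
  set X := 1 + _ in r1 *.
  have X0 : 0 <= X `^ d by exact: powR_ge0.
  apply: (@le_trans _ _ (c * X `^ d)).
    rewrite -[leRHS]mulr1 ler_pM ?mulr_ge0 ?(ltW (wt_gt0 _)) ?(ltW (inv_sqr_gt0 _)) ?inv_sqr_le1//.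
    by rewrite ler_wpM2r// -[leRHS]mulr1 ler_wpM2l// wt_le1.
  rewrite /A -mulrA ler_wpM2l// prodrXl -exprMn.
  apply: (@le_trans _ _ (X `^ (N.*2)%:R)).
    apply: ler_powR => //; apply: (@le_trans _ _ (N%:R)); last by rewrite ler_nat -addnn leq_addr.
    by apply: le_trans (ler_norm d) _; apply: ltW; apply: archi_boundP; exact: normr_ge0.
  rewrite powR_mulrn ?(le_trans ler01 r1)// -mul2n exprM.
  have J : 1 + m%:~R ^+ 2 + \sum_(i < n) eta ord0 i ^+ 2 <= (1 + m%:~R ^+ 2) * \prod_(i < n) jap (eta ord0 i).
    apply: le_trans (ler_wpM2l m1 (sum_sqr_le_prod _ eta)).
    have S0 : 0 <= \sum_(i < n) eta ord0 i ^+ 2 by apply: sumr_ge0 => j _; exact: sqr_ge0.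
    by have := mulr_ge0 (sqr_ge0 (m%:~R : R)) S0; lra.
  have X2 : X ^+ 2 <= 4 * (1 + m%:~R ^+ 2) * \prod_(i < n) jap (eta ord0 i).
    apply: le_trans (dual_norm_le eta m) _; rewrite -mulrA ler_wpM2l//.
  by apply: lerXn2r => //; rewrite nnegrE ?sqr_ge0//; apply: le_trans X2; exact: sqr_ge0.
have : G xi = 0.
  apply: (annihilated_rV_eq0 cG HG cb b0) => phi cphi.
  pose f (z : M) := cexp m z.2 * \prod_(i < n) phi i (z.1 ord0 i).
  have tf : test_function f by exact: test_product.
  have f0 eta j : j != m -> fourier f eta j = 0.
    by move=> jm; rewrite fourier_product// eq_sym (negbTE jm) mul0r.
  have V := commuting_modes_vanish cq tf f0 (cm f tf) mk x.
  have [ck ck0 [Hk0 _ _]] := classical_modes cf.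
  have [K K0 HK] := Op_integrand_dom cf tf ck0 Hk0.
  have dk := HK ck _ ck0 sf Hk0 m (x, 0).
  pose a : R := ((2 * pi)^-1) ^+ n.
  have a0 : a != 0 by rewrite expf_neq0// invr_neq0// gt_eqF// twopi_gt0.
  rewrite (_ : (fun eta => _) = fun eta => (a^-1)%:C * Op_integrand (fibre_mode q k) f m (x, 0) eta).
    by rewrite (cintegralM measurableT _ dk) -[cintegral _ _ _]/(Op_term (fibre_mode q k) f m (x, 0)) V mulr0.
  apply/funext => eta; rewrite /Op_integrand fourier_product// eqxx mul1r -/a /G.
  set Y := \prod_(i < n) _; set F := fibre_mode _ _ _; set W := expi _.
  transitivity (a%:C * (a^-1)%:C * (F * W * Y)); first by rewrite mul_realV ?mul1r.
  by rewrite /=; ring.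
move=> /eqP; rewrite mulf_eq0 => /orP[]; first exact/negP.
by rewrite (negbTE (expi_neq0 _)).
Qed.

End Vanishing.
End Injectivity.

(** * Commutation with the projector *)

Theorem theorem3p4 (R : realType) (n : nat) (hn : (1 <= n)%N)
  (Pi1 : (R -> R[i]) -> (R -> R[i])) (hPi1 : is_szego_S1 Pi1)
  (Pi : (RnS1 R n -> R[i]) -> (RnS1 R n -> R[i])) (hPi : is_szego Pi1 Pi)
  (q : RnS1 R n * RnS1 R n -> R[i]) (hq : polyhomogeneous q) :
  (forall f, test_function f -> eq_RnS1 (Op q (Pi f)) (Pi (Op q f)))
  <->
  (forall k : nat, (0 < k)%N ->
     exists Qk Qmk : (RnS1 R n -> R[i]) -> (RnS1 R n -> R[i]),
       [/\ is_psido Qk /\ S1_invariant Qk,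
           is_psido Qmk /\ S1_invariant Qmk,
           forall f, test_function f ->
             Op (mode_symbol q k%:Z) f =
             Qk (iter k (Dtheta \o mul_expi 1) f) &
           forall f, test_function f ->
             Op (mode_symbol q (- k%:Z)) f =
             Qmk (iter k (mul_expi (-1) \o Dtheta) f)]).
Proof.
have [d cq] := hq; split=> [cm k k0|H f tf]; last first.
  apply: (commute_of_vanish hPi1 hPi cq tf) => k m z mk.
  case: k mk => [[|k]|k] mk; first by move: mk; rewrite /mismatch addr0 eqxx.
    have [Qk [_ [[pk _] _ Ek _]]] := H k.+1 isT; exact: (raise_vanish z cq pk tf mk Ek).
  have [_ [Qk [_ [pk _] _ Ek]]] := H k.+1 isT; move: mk; rewrite NegzE => mk.
  exact: (lower_vanish z cq pk tf mk Ek).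
have V j m (mk : mismatch j m) := commuting_symbol_vanish hPi1 hPi hn cq cm mk.
(* the mismatched frequencies of the modes k and -k, listed in the order of the
   factors of the raising and lowering products *)
pose c1 (i : 'I_k) : int := (i : nat)%:Z - k%:Z.
pose c2 (i : 'I_k) : int := k%:Z - (i : nat).+1%:Z.
have ic1 : injective c1 by move=> i i' /addIr [] /ord_inj.
have ic2 : injective c2 by move=> i i' /addrI /oppr_inj [] /ord_inj.
have V1 i z xi : fibre_mode q k%:Z (z, (xi, (c1 i)%:~R)) = 0.
  apply: V; rewrite /mismatch /c1; have := ltn_ord i.
  by case: (lerP 0 ((i : nat)%:Z - k%:Z + k%:Z)); case: (lerP 0 ((i : nat)%:Z - k%:Z)) => //=; lia.
have V2 i z xi : fibre_mode q (- k%:Z) (z, (xi, (c2 i)%:~R)) = 0.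
  apply: V; rewrite /mismatch /c2; have := ltn_ord i.
  by case: (lerP 0 (k%:Z - (i : nat).+1%:Z - k%:Z)); case: (lerP 0 (k%:Z - (i : nat).+1%:Z)) => //=; lia.
have F1 (f : RnS1 R n -> R[i]) : test_function f -> test_function (iter k (Dtheta \o mul_expi 1) f) /\
    forall xi m, fourier (iter k (Dtheta \o mul_expi 1) f) xi m =
      (\prod_(i < k) ((m - k%:Z - c1 i)%:~R : R))%:C * fourier f xi (m - k%:Z).
  move=> tf; have [tT FT] := iter_raise k tf; split=> // xi m; rewrite FT.
  congr ((_)%:C * _); apply: eq_bigr => i _; rewrite /c1 !intrB -!pmulrn; ring.
have F2 (f : RnS1 R n -> R[i]) : test_function f -> test_function (iter k (mul_expi (-1) \o Dtheta) f) /\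
    forall xi m, fourier (iter k (mul_expi (-1) \o Dtheta) f) xi m =
      (\prod_(i < k) ((m - - k%:Z - c2 i)%:~R : R))%:C * fourier f xi (m - - k%:Z).
  move=> tf; have [tT FT] := iter_lower k tf; split=> // xi m; rewrite FT opprK.
  congr ((_)%:C * _); apply: eq_bigr => i _; rewrite /c2 !intrB intrD -!pmulrn; ring.
have [Q1 [p1 s1 E1]] := mode_factor (j := k%:Z) (T := fun f => iter k (Dtheta \o mul_expi 1) f) ic1 cq F1 V1.
have [Q2 [p2 s2 E2]] := mode_factor (j := - k%:Z) (T := fun f => iter k (mul_expi (-1) \o Dtheta) f) ic2 cq F2 V2.
by exists Q1, Q2.
Qed.
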